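(* Consider the time-homogeneous optimal stopping problem with finite horizon and the standing assumptions described in the context, including Assumption (A). Then, for any $T_1\in[0,T)$, the optimal boundary $t\mapsto b(t)$ is Lipschitz on $[0,T_1]$.
   Context: **Problem.** Let $(\Omega,\mathcal F,\mathsf P)$ be a complete probability space carrying a standard one-dimensional Brownian motion $(B_t)_{t\ge 0}$, let $T\in(0,\infty)$ and let $\mathcal I\subseteq\mathbb R$ be an open, possibly unbounded interval. Given $\mu:\mathcal I\to\mathbb R$ and $\sigma:\mathcal I\to(0,\infty)$, for every $(t,x)\in[0,T]\times\mathcal I$ the process $X=X^{t,x}$ is the (assumed) unique strong solution of $$X_s=x+\int_t^s\mu(X_u)\,du+\int_t^s\sigma(X_u)\,dB_u,\quad s\in[t,T];$$ the behaviour of $X$ at the endpoints of $\mathcal I$ is not specified. Write $\mathsf E_{t,x}[\cdot]=\mathsf E[\cdot\,|X_t=x]$. Let $g:\mathbb R\to\mathbb R$ and $r:\mathbb R\to[0,\infty)$ be continuous and $$v(t,x)=\sup_{0\le\tau\le T-t}\mathsf E_{t,x}\Big[e^{-\int_0^\tau r(X_{t+s})ds}g(X_{t+\tau})\Big],$$ the supremum being over stopping times of the filtration of $(X_{t+s})_{s\in[0,T-t]}$. The problem is assumed well posed with $v$ continuous, and there is a continuous function $b:[0,T]\to\mathcal I$ such that $\tau_*^{t,x}=\inf\{s\in[0,T-t):X^{t,x}_{t+s}\le b(t+s)\}\wedge(T-t)$ is optimal and the continuation set is $\mathcal C:=\{(t,x)\in[0,T)\times\mathcal I:v(t,x)>g(x)\}=\{(t,x)\in[0,T)\times\mathcal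 I:x>b(t)\}$. **Notation.** $\mathcal L\varphi=\tfrac12\sigma^2\varphi_{xx}+\mu\varphi_x$; closures of subsets of $[0,T)\times\mathcal I$ are relative to $[0,T]\times\mathcal I$; functions of $x$ alone are regarded as functions of $(t,x)$. **Assumption (A).** For each $t_0\in[0,T)$ there is a rectangle $\mathcal R=\mathcal R(t_0)$, open relative to $[0,T)\times\mathcal I$, with $\overline{\mathcal R}\subset[0,T)\times\mathcal I$ and $(t_0,b(t_0))\in\mathcal R$, such that: (i) $v$ is continuously differentiable in time and space in $\overline{\mathcal R}$ (also across the boundary $b$); (ii) $g$ is twice continuously differentiable in $x$ on $\overline{\mathcal R}$ and $h(x):=(\mathcal Lg)(x)-r(x)g(x)<0$ for $(t,x)\in\overline{\mathcal R}$; (iii) in $\overline{\mathcal R}$ the functions $\mu$ and $r$ are continuously differentiable with $\alpha$-Hölder continuous derivatives for some $\alpha\in(0,1)$; (iv) in $\overline{\mathcal R}$ the function $\sigma$ is continuously differentiable with $\sigma_x$ Lipschitz continuous, and $\sigma(x)\ge c_{\mathcal R}>0$ for $(t,x)\in\overline{\mathcal R}$. *)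

(* Defs.v *)
From HB Require Import structures.
From mathcomp Require Import all_boot all_order all_algebra.
From mathcomp Require Import all_classical all_reals all_analysis.
Set Implicit Arguments.
Unset Strict Implicit.
Unset Printing Implicit Defensive.
Import Order.TTheory GRing.Theory Num.Theory.
Import numFieldNormedType.Exports.
Local Open Scope classical_set_scope.
Local Open Scope ring_scope.

(* A process is a function Y : R -> Omega -> R (time first); only its values on
   the time interval under consideration matter. *)

Section Processes.
Context (d : measure_display) (Omega : measurableType d) (R : realType).
Variable P : probability Omega R.

(* sigma(Y_u : t <= u <= s), augmented by the P-null sets *)
Definition filtration (Y : R -> Omega -> R) (t s : R) : set (set Omega) :=
  <<s [set A | P.-negligible A \/
       exists u D, [/\ t <= u <= s, measurable D & A = Y u @^-1` D] ] >>.

Definition measurable_wrt (F : set (set Omega)) (Z : Omega -> R) : Prop :=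
  forall D : set R, measurable D -> F (Z @^-1` D).

Definition cvg_in_prob (Z : nat -> Omega -> \bar R) : Prop :=
  forall e : R, 0 < e ->
    P [set w | (e%:E < `|Z n w|)%E] @[n --> \oo] --> 0%E.

Definition brownian_motion (B : R -> Omega -> R) : Prop :=
  [/\ forall t : R, 0 <= t -> measurable_fun setT (B t),
      {ae P, forall w, B 0 w = 0},
      (* B t - B s ~ N(0, t - s); the second argument of normal_prob is the
         standard deviation *)
      forall s t : R, 0 <= s < t -> forall D : set R, measurable D ->
        P [set w | D (B t w - B s w)%R] = normal_prob 0 (Num.sqrt (t - s)) D,
      forall s t : R, 0 <= s < t ->
        forall A (D : set R), filtration B 0 s A -> measurable D ->
        P (A `&` [set w | D (B t w - B s w)%R]) =
          (P A * P [set w | D (B t w - B s w)%R])%E &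
      {ae P, forall w, {within [set t | 0 <= t], continuous (B ^~ w)}}].

(* The simple integrand sum_(i < n) xi_i 1_(s_i, s_(i+1)] *)
Record simple_process := SimpleProcess {
  sp_size : nat;
  sp_time : nat -> R;
  sp_coef : nat -> Omega -> R }.

Definition sp_wf (B : R -> Omega -> R) (t T : R) (H : simple_process) : Prop :=
  [/\ sp_time H 0 = t, sp_time H (sp_size H) = T,
      forall i, (i < sp_size H)%N -> sp_time H i <= sp_time H i.+1,
      forall i, (i < sp_size H)%N ->
        measurable_wrt (filtration B 0 (sp_time H i)) (sp_coef H i) &
      exists K, forall i w, (i < sp_size H)%N -> `|sp_coef H i w| <= K].

Definition sp_val (H : simple_process) (u : R) (w : Omega) : R :=
  \sum_(i < sp_size H)
    sp_coef H i w * \1_(`]sp_time H i, sp_time H i.+1]%classic) u.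

Definition sp_integral (B : R -> Omega -> R) (H : simple_process)
    (s : R) (w : Omega) : R :=
  \sum_(i < sp_size H)
    sp_coef H i w * (B (Num.min (sp_time H i.+1) s) w -
                     B (Num.min (sp_time H i) s) w).

(* M_s = int_t^s H_u dB_u for s in [t, T]: H is measurable, adapted and a.s.
   square integrable, and M is the continuous limit in probability of the
   integrals of simple processes approximating H. *)
Definition ito_integral (B : R -> Omega -> R) (t T : R)
    (H M : R -> Omega -> R) : Prop :=
  [/\ measurable_fun (`[t, T] `*` [set: Omega])
        (fun p : R * Omega => H p.1 p.2),
      forall s, t <= s <= T -> measurable_wrt (filtration B 0 s) (H s),
      {ae P, forall w,
        (\int[lebesgue_measure]_(u in `[t, T]) ((H u w) ^+ 2)%:E < +oo)%E},
      {ae P, forall w, {within `[t, T], continuous (M ^~ w)}} &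
      exists Hn : nat -> simple_process,
        [/\ forall n, sp_wf B t T (Hn n),
            cvg_in_prob (fun n w => \int[lebesgue_measure]_(u in `[t, T])
              ((sp_val (Hn n) u w - H u w) ^+ 2)%:E)%E &
            forall s, t <= s <= T ->
              cvg_in_prob (fun n w => (sp_integral B (Hn n) s w - M s w)%:E)]].

(* Strong solution on [t, T] of dX = mu(X) ds + sigma(X) dB, X_t = x.
   The state space is the closure of I (in R); the coefficients are total
   functions, so their values at the finite endpoints of I are arbitrary: an
   endpoint may be inaccessible, absorbing, instantaneously left, etc. *)
Definition strong_solution (B : R -> Omega -> R) (I : set R)
    (mu sigma : R -> R) (T t x : R) (X : R -> Omega -> R) : Prop :=
  [/\ forall w, {within `[t, T], continuous (X ^~ w)},
      forall s w, t <= s <= T -> closure I (X s w),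
      forall s, t <= s <= T -> measurable_wrt (filtration B 0 s) (X s),
      {ae P, forall w, X t w = x} &
      {ae P, forall w, lebesgue_measure.-integrable `[t, T]
                         (fun u => (mu (X u w))%:E)} /\
      exists M : R -> Omega -> R,
        ito_integral B t T (fun u w => sigma (X u w)) M /\
        {ae P, forall w, forall s, t <= s <= T ->
          X s w = x + \int[lebesgue_measure]_(u in `[t, s]) mu (X u w)
                    + M s w}].

Definition unique_strong_solution (B : R -> Omega -> R) (I : set R)
    (mu sigma : R -> R) (T t x : R) (X : R -> Omega -> R) : Prop :=
  strong_solution B I mu sigma T t x X /\
  forall Y, strong_solution B I mu sigma T t x Y ->
    {ae P, forall w, forall s, t <= s <= T -> X s w = Y s w}.

(* Below X stands for X^{t,x}. *)

Definition stopping_time (X : R -> Omega -> R) (T t : R)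
    (tau : Omega -> R) : Prop :=
  (forall w, 0 <= tau w <= T - t) /\
  forall s : R, 0 <= s <= T - t -> filtration X t (t + s) [set w | tau w <= s].

Definition payoff (g r : R -> R) (X : R -> Omega -> R) (t : R)
    (tau : Omega -> R) (w : Omega) : R :=
  expR (- \int[lebesgue_measure]_(s in `[0, tau w]) r (X (t + s) w))
    * g (X (t + tau w) w).

Definition value (g r : R -> R) (T t : R) (X : R -> Omega -> R) : \bar R :=
  ereal_sup [set ('E_P[payoff g r X t tau])%E | tau in stopping_time X T t].

(* Adjoining T - t to the set both takes the minimum with T - t and gives the
   empty hitting set the convention inf = +oo. *)
Definition tau_star (b : R -> R) (X : R -> Omega -> R) (T t : R)
    (w : Omega) : R :=
  inf ([set s | 0 <= s < T - t /\ X (t + s) w <= b (t + s)] `|` [set T - t]).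

Definition optimal (g r : R -> R) (T t : R) (X : R -> Omega -> R)
    (tau : Omega -> R) : Prop :=
  stopping_time X T t tau /\ ('E_P[payoff g r X t tau])%E = value g r T t X.

End Processes.

Section Regularity.
Variable R : realType.

(* derivative relative to S; one-sided at the endpoints of an interval *)
Definition derivative_within (S : set R) (f : R -> R) (x l : R) : Prop :=
  (f y - f x) / (y - x) @[y --> within S x^'] --> l.

(* f is C^1 on S with derivative f1 *)
Definition C1_on (S : set R) (f f1 : R -> R) : Prop :=
  (forall x, S x -> derivative_within S f x (f1 x)) /\
  {within S, continuous f1}.

(* v(t, x) is C^1 in time and space on S *)
Definition C1_on2 (S : set (R * R)) (v : R -> R -> R) : Prop :=
  exists vt vx : R -> R -> R,
    [/\ forall t x, S (t, x) ->
          derivative_within [set s | S (s, x)] (v ^~ x) t (vt t x),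
        forall t x, S (t, x) ->
          derivative_within [set y | S (t, y)] (v t) x (vx t x),
        {within S, continuous (fun p : R * R => vt p.1 p.2)} &
        {within S, continuous (fun p : R * R => vx p.1 p.2)}].

Definition holder_on (S : set R) (a : R) (f : R -> R) : Prop :=
  exists K : R, forall x y, S x -> S y -> `|f x - f y| <= K * `|x - y| `^ a.

Definition state_domain (T : R) (I : set R) : set (R * R) := `[0, T[ `*` I.

Definition open_rectangle (T : R) (I : set R) (Q : set (R * R)) : Prop :=
  (exists A D : set R, [/\ is_interval A, is_interval D & Q = A `*` D]) /\
  exists2 O : set (R * R), open O & Q = O `&` state_domain T I.

(* closure relative to [0, T] x I *)
Definition rel_closure (T : R) (I : set R) (Q : set (R * R)) : set (R * R) :=
  closure Q `&` (`[0, T] `*` I).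

(* L f, where f1 and f2 are the first and second derivatives of f *)
Definition generator (mu sigma f1 f2 : R -> R) (x : R) : R :=
  2^-1 * sigma x ^+ 2 * f2 x + mu x * f1 x.

(* Functions of x alone are regular "on rel_closure Q" when they are so on its
   projection S to the space variable. *)
Definition assumption_A (T : R) (I : set R) (mu sigma g r b : R -> R)
    (v : R -> R -> R) : Prop :=
  forall t0 : R, 0 <= t0 < T ->
  exists Q : set (R * R),
    let Qbar := rel_closure T I Q in
    let S := [set x | exists t, Qbar (t, x)] in
    [/\ [/\ open_rectangle T I Q, Qbar `<=` state_domain T I & Q (t0, b t0)],
        C1_on2 Qbar v,
        exists g1 g2 : R -> R, [/\ C1_on S g g1, C1_on S g1 g2 &
          forall x, S x -> generator mu sigma g1 g2 x - r x * g x < 0],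
        exists (mu1 r1 : R -> R) (a : R), [/\ C1_on S mu mu1, C1_on S r r1, 0 < a < 1,
          holder_on S a mu1 & holder_on S a r1] &
        exists (sigma1 : R -> R) (c : R), [/\ C1_on S sigma sigma1,
          [lipschitz sigma1 x | x in S], 0 < c &
          forall x, S x -> c <= sigma x]].

End Regularity.

(* Main.v *)
(* The coefficients are Borel: mu and sigma are measurable along a continuous path
   of the solution, and composing with its hitting times recovers them on its range.
   The joint law of the past and of the future Brownian increments is a product;
   this gives the Markov property and the time-homogeneity of the value, so v is
   nonincreasing in t and b is nondecreasing. Short-time moment estimates turn
   the dynamic programming principle into viscosity inequalities: v is a
   supersolution, and a subsolution in the continuation set.
   Near a boundary point, h < 0, the smooth fit and the subsolution property force,
   through a one-dimensional maximum principle,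
     c/2 (x - b t)^2 <= v t x - g x     for x > b t,
   while comparing v with its time shift by means of the barrier
   A ((x - b t) - B (x - b t)^2) + N (u - t) yields
     v t x - v (t + s) x <= s A (x - b t).
   At x = b (t + s), where v (t + s) x = g x, the two combine into
   b (t + s) - b t <= 2 A s / c. Compactness of [0, T1] makes this bound global. *)

(* No Ito formula is used. The stochastic integral is only a limit in probability, so moments are
   computed for simple integrals with clipped coefficients and carried over on the event that the
   path stays in a small ball. The probability of leaving the ball within time D must be o(D);
   second moments would only give O(D), which is why fourth moments appear throughout. A solution is
   only an adapted process: for the Markov property it is rewritten as a functional of the past and
   of the later Brownian increments, the past is frozen, and uniqueness identifies the slice with
   the solution started afresh. Since frozen paths must be continuous and adapted, regular versions
   are built first. As [v] is only C^1, comparing [v] with its time shift would normally call for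
   doubling of variables. This is avoided: the supersolution property gives, at each point, an upper
   parabola whose curvature is read off from the equation, and this parabola enters the test
   function for the other copy of [v]. *)
Require Import Defs.
From HB Require Import structures.
From mathcomp Require Import all_boot all_order all_algebra.
From mathcomp Require Import all_classical all_reals all_analysis.
From mathcomp Require Import measurable_realfun ring lra.
Set Implicit Arguments.
Unset Strict Implicit.
Unset Printing Implicit Defensive.
Import Order.TTheory GRing.Theory Num.Theory.
Import numFieldNormedType.Exports.
Local Open Scope classical_set_scope.
Local Open Scope ring_scope.

(* [lra] reifies every inequality in the context; in a large context it is much
   faster on a few selected hypotheses. *)
Definition masked (A : Prop) := A.
Ltac mask_context := repeat match goal with H : is_true ?a |- _ => change (masked (is_true a)) in H end.
Tactic Notation "lra_only" hyp_list(hs) := revert hs; mask_context; intros; lra.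

Ltac pos := repeat first [assumption | exact: sqr_ge0 | exact: exprn_even_ge0
  | exact: normr_ge0 | exact: normal_pdf_ge0 | exact: ler0n | exact: ltW
  | apply: mulr_ge0 | apply: addr_ge0 | apply: exprn_ge0 | by []].

(** * Second and fourth moments of centred normal laws *)

Section gaussian_moments.
Context {R : realType}.
Local Notation lam := (@lebesgue_measure R).

(** Change of variables holds with the Radon-Nikodym derivative of [normal_prob], which agrees
    almost everywhere with [normal_pdf] because both have the same integral over every measurable
    set. *)
Lemma ge0_integral_normal (s : R) (f : R -> \bar R) :
  measurable_fun [set: R] f -> (forall x, (0 <= f x)%E) ->
  (\int[normal_prob 0 s]_x f x = \int[lam]_x (f x * (normal_pdf 0 s x)%:E))%E.
Proof.
move=> mf f0.
rewrite -(Radon_Nikodym_SigmaFinite.change_of_variables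
  (normal_prob_dominates 0 s) f0 measurableT mf).
have dom := normal_prob_dominates (0:R) s.
apply: ae_eq_integral => //.
- apply: emeasurable_funM => //.
  exact: measurable_int (Radon_Nikodym_SigmaFinite.f_integrable dom).
- apply: emeasurable_funM => //.
  by apply/measurable_EFinP; exact: measurable_normal_pdf.
- apply: ae_eqe_mul2l; apply: integral_ae_eq => //.
  + exact: Radon_Nikodym_SigmaFinite.f_integrable.
  + by apply/measurable_EFinP; exact: measurable_normal_pdf.
  + move=> E _ mE.
    by rewrite -Radon_Nikodym_SigmaFinite.f_integral.
Qed.

(** Lebesgue measure is invariant under reflection and the density is even. This later cancels odd
    powers while all integrands remain nonnegative. *)
Lemma ge0_integral_normalN (s : R) (f : R -> R) : s != 0 ->
  measurable_fun [set: R] f -> (forall x, 0 <= f x) ->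
  (\int[normal_prob 0 s]_x (f (- x))%:E = \int[normal_prob 0 s]_x (f x)%:E)%E.
Proof.
move=> s0 mf f0.
have mN : measurable_fun [set: R] (fun x => f (- x)).
  by apply: measurableT_comp => //; exact: oppr_measurable.
have mE : measurable_fun [set: R] (fun x => (f x)%:E).
  by apply/measurable_EFinP.
have mNE : measurable_fun [set: R] (fun x => (f (- x))%:E).
  by apply/measurable_EFinP.
rewrite !ge0_integral_normal// => [|x]; last by rewrite lee_fin.
pose h x := ((f x)%:E * (normal_pdf 0 s x)%:E)%E.
have mh : measurable_fun [set: R] h.
  apply: emeasurable_funM => //.
  by apply/measurable_EFinP; exact: measurable_normal_pdf.
pose hN (x : R) := h (- x).
transitivity (\int[lam]_x hN x)%E.
  apply: eq_integral => x _; rewrite /hN /h; congr (_ * _%:E)%E.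
  by rewrite !normal_pdfE// /normal_fun !subr0 sqrrN.
have -> : (\int[lam]_x hN x =
    \int[pushforward lam (-%R : R -> measurableTypeR R)]_x h x)%E.
  rewrite ge0_integral_pushforward//.
  by move=> x _; rewrite /h mule_ge0// lee_fin// normal_pdf_ge0.
by apply: eq_measure_integral => //= A mA AS; exact: lebesgue_measureN.
Qed.

Lemma is_derive_normal_pdf (s x : R) : s != 0 ->
  is_derive x 1 (normal_pdf 0 s) (- x / s ^+ 2 * normal_pdf 0 s x).
Proof.
move=> s0; rewrite normal_pdfE//.
pose c := - (s ^+ 2 *+ 2)^-1.
have d2 : is_derive x 1 (fun y : R => c * (y * y)) (c * (x + x)).
  have := @is_deriveZ R _ _ (id * id : R -> R) c x 1 (x + x).
  apply; have := @is_deriveM R _ (id : R -> R) (id : R -> R) x 1 1 1 _ _.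
  rewrite /GRing.scale /= !mulr1; apply; exact: is_derive_id.
have d3 : is_derive x 1 (expR \o (fun y : R => c * (y * y)))
   (c * (x + x) * expR (c * (x * x))).
  rewrite mulrC; exact: (is_derive1_comp (is_derive_expR _) d2).
have := @is_deriveZ R _ _ _ (normal_peak s) _ _ _ d3.
have eqf : (normal_peak s \*: (expR \o (fun y : R => c * (y * y)))) =
   (fun x : R => normal_peak s * normal_fun 0 s x).
  apply/funext => y; rewrite /normal_fun subr0 /= /GRing.scale /= /c.
  by congr (_ * expR _); rewrite -expr2 mulNr mulNr mulrC.
rewrite eqf => H; apply: (@is_derive_eq _ _ _ _ _ _ _ _ H).
rewrite /normal_fun subr0 /GRing.scale /= -expr2.
have -> : c * x ^+ 2 = - x ^+ 2 / (s ^+ 2 *+ 2) by rewrite /c; ring.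
by rewrite /c; field.
Qed.

(** This is the boundary term of the second-moment recursion. The bound [1 + y <= expR y] makes the
    density O(1/n^2), so that a multiple of the harmonic sequence is a majorant. *)
Lemma cvg_normal_pdf_mul (s : R) : s != 0 ->
  n.+1%:R * normal_pdf 0 s n.+1%:R @[n --> \oo] --> (0 : R).
Proof.
move=> s0.
have pk : 0 < normal_peak s by apply: normal_peak_gt0.
have s2 : 0 < s ^+ 2 *+ 2 by rewrite mulrn_wgt0// exprn_even_gt0.
pose K := normal_peak s * (s ^+ 2 *+ 2).
apply: (@squeeze_cvgr _ _ _ _ (fun=> 0) (fun n => K * harmonic n)).
- apply: nearW => n; apply/andP; split; first by rewrite mulr_ge0// normal_pdf_ge0.
  have n0 : (0 : R) < n.+1%:R by [].
  rewrite normal_pdfE// /normal_fun subr0 /K.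
  have := expR_ge1Dx (n.+1%:R ^+ 2 / (s ^+ 2 *+ 2)).
  rewrite mulNr expRN => h.
  have h2 : (expR (n.+1%:R ^+ 2 / (s ^+ 2 *+ 2)))^-1 <= (n.+1%:R ^+ 2 / (s ^+ 2 *+ 2))^-1.
    rewrite lef_pV2 ?posrE ?expR_gt0//; last by rewrite divr_gt0// ?exprn_gt0.
    by rewrite (le_trans _ h)// lerDr.
  rewrite mulrCA -mulrA ler_pM2l//.
  apply: (le_trans (ler_wpM2l (ltW n0) h2)).
  by rewrite /harmonic/= invf_div mulrCA expr2 invfM [n.+1%:R * _]mulrA divff ?gt_eqF// mul1r.
- exact: cvg_cst.
- by rewrite -[X in _ --> X](mulr0 K); apply: cvgMr; exact: cvg_harmonic.
Qed.

(** Integration by parts: the density p satisfies p' = - x / s^2 p, so the integrand is the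
    derivative of - s^2 x^(m+1) p(x). *)
Lemma normal_FTC (s a : R) (m : nat) : s != 0 -> 0 < a ->
  (\int[lam]_(x in `[(- a)%R, a])
      (x ^+ m.+2 * normal_pdf 0 s x - m.+1%:R * s ^+ 2 * x ^+ m * normal_pdf 0 s x)%:E =
   (- s ^+ 2 * (a ^+ m.+1 - (- a) ^+ m.+1) * normal_pdf 0 s a)%:E)%E.
Proof.
move=> s0 a0.
pose F (x : R) := - s ^+ 2 * (x ^+ m.+1 * normal_pdf 0 s x).
pose f (x : R) := x ^+ m.+2 * normal_pdf 0 s x - m.+1%:R * s ^+ 2 * x ^+ m * normal_pdf 0 s x.
have dX n (x : R) : is_derive x 1 (fun y : R => y ^+ n.+1) (n.+1%:R * x ^+ n).
  have := @is_deriveX _ _ id n.+1 x 1 1 (is_derive_id _ _).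
  rewrite /GRing.scale /= mulr1; congr is_derive.
  by apply/funext => y; elim: n.+1 => [|k IH]; rewrite ?expr0// !exprS /= -IH.
have dF (x : R) : is_derive x 1 F (f x).
  have dp := is_derive_normal_pdf x s0.
  have := @is_deriveZ R _ _ _ (- s ^+ 2) _ _ _ (is_deriveM (dX m x) dp).
  move=> H; apply: (@is_derive_eq _ _ _ _ _ _ _ _ H).
  rewrite /f /GRing.scale /= !exprS.
  by field.
have cont (g g' : R -> R) : (forall x : R, is_derive x (1 : R) g (g' x)) -> continuous g.
  move=> dg x; apply: differentiable_continuous; apply/derivable1_diffP.
  by case: (dg x).
have cF := cont _ _ dF.
have cX n : continuous (fun x : R => x ^+ n) by exact: exprn_continuous.
rewrite (@continuous_FTC2 R f F) ?gtrN//.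
- rewrite -EFinB /F; congr (_%:E).
  have -> : normal_pdf 0 s (- a) = normal_pdf 0 s a.
    by rewrite !normal_pdfE// /normal_fun !subr0 sqrrN.
  ring.
- apply: continuous_subspaceT => x; rewrite /f.
  have cp := @continuous_normal_pdf R 0 s s0.
  apply: cvgB; apply: cvgM; [exact: cX| exact: cp| |exact: cp].
  by apply: cvgM; [exact: cvg_cst|exact: cX].
- split; first by move=> x _; case: (dF x).
  + by apply: cvg_at_right_filter; exact: cF.
  + by apply: cvg_at_left_filter; exact: cF.
- by move=> x _; rewrite derive1E; case: (dF x).
Qed.

(** For even m the two boundary values have opposite signs in [normal_FTC] and add up to the
    subtracted term. *)
Lemma normal_moment_itv (s a : R) (m : nat) : s != 0 -> 0 < a -> ~~ odd m ->
  (\int[lam]_(x in `[(- a)%R, a]) (x ^+ m.+2 * normal_pdf 0 s x)%:E =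
   (m.+1%:R * s ^+ 2)%:E * \int[lam]_(x in `[(- a)%R, a]) (x ^+ m * normal_pdf 0 s x)%:E
     - (2 * s ^+ 2 * a ^+ m.+1 * normal_pdf 0 s a)%:E)%E.
Proof.
move=> s0 a0 em.
have cp := @continuous_normal_pdf R 0 s s0.
have mI n : lam.-integrable `[(- a), a] (fun x => (x ^+ n * normal_pdf 0 s x)%:E).
  apply: continuous_compact_integrable; first exact: segment_compact.
  by apply: continuous_subspaceT => x; apply: cvgM; [exact: exprn_continuous|exact: cp].
have := normal_FTC m s0 a0.
have e1 n : (\int[lam]_(x in `[(- a)%R, a]) (x ^+ n * normal_pdf 0 s x)%:E)%E
    \is a fin_num by exact: integrable_fin_num.
rewrite (eq_integral (fun x : measurableTypeR R => ((x ^+ m.+2 * normal_pdf 0 s x)%:E -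
  (m.+1%:R * s ^+ 2)%:E * (x ^+ m * normal_pdf 0 s x)%:E)%E)); last first.
  by move=> x _; rewrite -EFinM -EFinB !mulrA.
rewrite integralB//=; last by apply: integrableZl => //; exact: mI.
rewrite integralZl//.
rewrite exprNn -signr_odd /= em expr1 mulN1r opprK.
rewrite -(fineK (e1 m)) -(fineK (e1 m.+2)) -EFinM -EFinB => -[h].
by rewrite -EFinB; congr (_%:E); lra.
Qed.

Lemma normal_moment_cvg (s : R) (m : nat) : s != 0 -> ~~ odd m ->
  (\int[lam]_(x in `[(- n.+1%:R)%R, n.+1%:R%R]) (x ^+ m * normal_pdf 0 s x)%:E)%E
    @[n --> \oo] --> (\int[normal_prob 0 s]_x (x ^+ m)%:E)%E /\
  forall n, (\int[lam]_(x in `[(- n.+1%:R)%R, n.+1%:R%R]) (x ^+ m * normal_pdf 0 s x)%:E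
     <= \int[normal_prob 0 s]_x (x ^+ m)%:E)%E.
Proof.
move=> s0 em.
have X0 (x : R) : 0 <= x ^+ m by rewrite exprn_even_ge0.
rewrite ge0_integral_normal//; last first.
  by apply/measurable_EFinP; apply: measurable_funX.
have mf : measurable_fun [set: R] (fun x : R => (x ^+ m * normal_pdf 0 s x)%:E).
  apply/measurable_EFinP; apply: measurable_funM; last exact: measurable_normal_pdf.
  exact: measurable_funX.
have U : \bigcup_n (`[(- n.+1%:R)%R, n.+1%:R%R]%classic : set R) = setT.
  apply/seteqP; split => // x _; exists (Num.truncn `|x|) => //=.
  by rewrite in_itv/= -ler_norml ltW// truncnS_gt.
under [X in _ --> X /\ _]eq_integral do rewrite -EFinM.
split.
  rewrite -U; apply: (@ge0_nondecreasing_set_cvg_integral _ _ R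
   (fun n => `[(- n.+1%:R)%R, n.+1%:R%R]%classic : set (measurableTypeR R))
   (fun x => (x ^+ m * normal_pdf 0 s x)%:E) lam).
  + move=> n k nk; apply/subsetPset => x /=; rewrite !in_itv/= => /andP[h1 h2].
    have : n.+1%:R <= k.+1%:R :> R by rewrite ler_nat.
    by move=> h3; apply/andP; split; lra.
  + by move=> i; exact: measurable_itv.
  + by move=> i; exact: measurable_funTS.
  + by move=> i x _; rewrite lee_fin mulr_ge0// normal_pdf_ge0.
move=> n; apply: ge0_subset_integral => //=.
by move=> x _; rewrite lee_fin mulr_ge0// normal_pdf_ge0.
Qed.

Lemma normal_moment2 (s : R) : s != 0 ->
  (\int[normal_prob 0 s]_x (x ^+ 2)%:E = (s ^+ 2)%:E)%E.
Proof.
move=> s0; have [c2 _] := normal_moment_cvg s0 (isT : ~~ odd 2).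
have [c0 _] := normal_moment_cvg s0 (isT : ~~ odd 0).
move/cvg_lim : c2 => <- //.
have p1 : (\int[normal_prob 0 s]_x (x ^+ 0)%:E = 1)%E.
  under eq_integral do rewrite expr0.
  by rewrite integral_cst// mul1e; exact: probability_setT.
rewrite p1 in c0.
under eq_fun do rewrite normal_moment_itv//.
apply/cvg_lim => //.
have -> : ((s ^+ 2)%:E = (1%:R * s ^+ 2)%:E * 1 - (2 * s ^+ 2 * 0)%:E)%E.
  by rewrite mule1 mulr0 sube0 mul1r.
apply: cvgeB => //.
- by apply: cvgeZl.
- apply: cvg_EFin; first by apply: nearW.
  rewrite (_ : _ \o _ = (fun n => 2 * s ^+ 2 * (n.+1%:R * normal_pdf 0 s n.+1%:R))); last first.
    by apply/funext => n /=; rewrite expr1 !mulrA.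
  by apply: cvgMr; exact: cvg_normal_pdf_mul.
Qed.

(** Dropping the nonnegative boundary term of the recursion leaves an upper bound, which suffices
    below. *)
Lemma normal_moment4 (s : R) : s != 0 ->
  (\int[normal_prob 0 s]_x (x ^+ 4)%:E <= (3 * s ^+ 4)%:E)%E.
Proof.
move=> s0; have [c4 _] := normal_moment_cvg s0 (isT : ~~ odd 4).
have [_ c2] := normal_moment_cvg s0 (isT : ~~ odd 2).
rewrite normal_moment2// in c2.
rewrite -(cvg_lim _ c4)//; apply: lime_le; first by apply/cvg_ex; eexists; exact: c4.
apply: nearW => n.
rewrite normal_moment_itv//.
apply: (@le_trans _ _ ((3%:R * s ^+ 2)%:E * (\int[lam]_(x in `[(- n.+1%:R)%R, n.+1%:R%R])
   (x ^+ 2 * normal_pdf 0 s x)%:E))%E).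
  by rewrite geeDl// oppe_le0 lee_fin; pos.
have -> : ((3 * s ^+ 4)%:E = (3%:R * s ^+ 2)%:E * (s ^+ 2)%:E)%E.
  by rewrite -EFinM -mulrA -exprD.
by apply: lee_wpmul2l => //; rewrite lee_fin mulr_ge0// sqr_ge0.
Qed.

(** Adding the integrals of f(x) and f(-x), which are equal, removes the linear term without
    integrating a function of varying sign. *)
Lemma normal_square (s a b : R) : s != 0 ->
  (\int[normal_prob 0 s]_x ((a + b * x) ^+ 2)%:E = (a ^+ 2 + b ^+ 2 * s ^+ 2)%:E)%E.
Proof.
move=> s0.
pose f (x : R) := (a + b * x) ^+ 2.
have f0 x : 0 <= f x by exact: sqr_ge0.
have mf : measurable_fun [set: R] f.
  by apply: measurable_funX; apply: measurable_funD => //; apply: measurable_funM.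
have mfE : measurable_fun [set: R] (EFin \o f) by apply/measurable_EFinP.
have mN : measurable_fun [set: R] (fun x => (f (- x))%:E).
  by apply: measurableT_comp mfE _; exact: oppr_measurable.
have h : (\int[normal_prob 0 s]_x (f x)%:E + \int[normal_prob 0 s]_x (f x)%:E =
    (2 * a ^+ 2 + 2 * b ^+ 2 * s ^+ 2)%:E)%E.
  rewrite -{1}ge0_integral_normalN// -ge0_integralD//; last 2 first.
  - by move=> x _; rewrite lee_fin.
  - by move=> x _; rewrite lee_fin.
  under eq_integral => x _.
    have -> : ((f (- x))%:E + (f x)%:E)%E = ((2 * a ^+ 2)%:E + (2 * b ^+ 2)%:E * (x ^+ 2)%:E)%E.
      by rewrite -EFinM -!EFinD /f; congr (_%:E); ring.
    over.
  have p2 (x : R) : 0 <= x ^+ 2 by exact: sqr_ge0.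
  have q n : measurable_fun [set: R] (fun x : R => (x ^+ n)%:E).
    by apply/measurable_EFinP; apply: measurable_funX.
  rewrite ge0_integralD; [|by []|by move=> x _; rewrite lee_fin; pos|by []
   |by move=> x _; rewrite -EFinM lee_fin; pos|].
    rewrite ge0_integralZl; [|by []|exact: q|by move=> x _; rewrite lee_fin|by rewrite lee_fin; pos].
    by rewrite integral_cst// [X in (_ * X)%E]probability_setT mule1 normal_moment2.
  by apply: emeasurable_funM => //; exact: q.
move: h; rewrite /f; case: (\int[normal_prob 0 s]_x ((a + b * x) ^+ 2)%:E)%E => //= r.
by rewrite -EFinD => -[h]; congr (_%:E); lra.
Qed.

(** Same symmetrization as for the square. The lower bound is the submartingale property of fourth
    powers; the upper one feeds the recursion for fourth moments of simple integrals. *)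
Lemma normal_power4 (s a b : R) : s != 0 ->
  ((a ^+ 4)%:E <= \int[normal_prob 0 s]_x ((a + b * x) ^+ 4)%:E <=
    (a ^+ 4 + 6 * a ^+ 2 * b ^+ 2 * s ^+ 2 + 3 * b ^+ 4 * s ^+ 4)%:E)%E.
Proof.
move=> s0.
pose f (x : R) := (a + b * x) ^+ 4.
have f0 x : 0 <= f x by exact: exprn_even_ge0.
have mf : measurable_fun [set: R] f.
  by apply: measurable_funX; apply: measurable_funD => //; apply: measurable_funM.
have mfE : measurable_fun [set: R] (EFin \o f) by apply/measurable_EFinP.
have mN : measurable_fun [set: R] (fun x => (f (- x))%:E).
  by apply: measurableT_comp mfE _; exact: oppr_measurable.
pose m4 := (\int[normal_prob 0 s]_x (x ^+ 4)%:E)%E.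
have m40 : (0 <= m4)%E by apply: integral_ge0 => x _; rewrite lee_fin exprn_even_ge0.
have h : (\int[normal_prob 0 s]_x (f x)%:E + \int[normal_prob 0 s]_x (f x)%:E =
    (2 * a ^+ 4 + 12 * a ^+ 2 * b ^+ 2 * s ^+ 2)%:E + (2 * b ^+ 4)%:E * m4)%E.
  rewrite -{1}ge0_integral_normalN// -ge0_integralD//; last 2 first.
  - by move=> x _; rewrite lee_fin.
  - by move=> x _; rewrite lee_fin.
  under eq_integral => x _.
    have -> : ((f (- x))%:E + (f x)%:E)%E = (((2 * a ^+ 4)%:E + (12 * a ^+ 2 * b ^+ 2)%:E * (x ^+ 2)%:E)
       + (2 * b ^+ 4)%:E * (x ^+ 4)%:E)%E.
      by rewrite -!EFinM -!EFinD /f; congr (_%:E); ring.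
    over.
  have p2 (x : R) : 0 <= x ^+ 2 by exact: sqr_ge0.
  have p4 (x : R) : 0 <= x ^+ 4 by exact: exprn_even_ge0.
  have q n : measurable_fun [set: R] (fun x : R => (x ^+ n)%:E).
    by apply/measurable_EFinP; apply: measurable_funX.
  have mq (c : R) n : measurable_fun [set: R] (fun x : R => (c%:E * (x ^+ n)%:E)%E).
    by apply: emeasurable_funM => //; exact: q.
  have c2 : 0 <= 12 * a ^+ 2 * b ^+ 2 by pos.
  have c4 : 0 <= 2 * b ^+ 4 by pos.
  have z2 (x : R) : (0 <= (12 * a ^+ 2 * b ^+ 2)%:E * (x ^+ 2)%:E)%E by rewrite -EFinM lee_fin; pos.
  have z4 (x : R) : (0 <= (2 * b ^+ 4)%:E * (x ^+ 4)%:E)%E by rewrite -EFinM lee_fin; pos.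
  have za : (0 <= (2 * a ^+ 4)%:E)%E by rewrite lee_fin; pos.
  have m2 : measurable_fun [set: R] (fun x : R => ((2 * a ^+ 4)%:E + (12 * a ^+ 2 * b ^+ 2)%:E * (x ^+ 2)%:E)%E).
    by apply: emeasurable_funD => //; exact: mq.
  rewrite ge0_integralD; [|by []|by move=> x _; apply: adde_ge0; [exact: za|exact: z2]
    |exact: m2|by move=> x _; exact: z4|exact: mq].
  rewrite ge0_integralD; [|by []|by move=> x _; exact: za|by []|by move=> x _; exact: z2|exact: mq].
  rewrite ge0_integralZl; [|by []|exact: q|by move=> x _; rewrite lee_fin|by rewrite lee_fin].
  rewrite ge0_integralZl; [|by []|exact: q|by move=> x _; rewrite lee_fin|by rewrite lee_fin].
  by rewrite integral_cst// [X in (_ * X)%E]probability_setT mule1 normal_moment2// -EFinM -EFinD.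
have := normal_moment4 s0; rewrite -/m4 => hm.
move: h m40 hm; rewrite /f; case: (m4) => [m| |]//.
case: (\int[normal_prob 0 s]_x ((a + b * x) ^+ 4)%:E)%E => //= r.
rewrite -EFinM -!EFinD !lee_fin => -[h] m0 ms.
have b4 : 0 <= b ^+ 4 by exact: exprn_even_ge0.
have ab : 0 <= a ^+ 2 * b ^+ 2 * s ^+ 2 by pos.
have h1 : 0 <= b ^+ 4 * m by pos.
have h2 : b ^+ 4 * m <= b ^+ 4 * (3 * s ^+ 4) by rewrite ler_wpM2l.
by apply/andP; split; lra.
Qed.
End gaussian_moments.

(** * Restriction to a sub-sigma-algebra and independence as iterated integration *)

Section sub_sigma_algebra.
Context d (Omega : measurableType d) (R : realType) (P : probability Omega R).
Variable G : set (set Omega).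
Hypothesis Gm : G `<=` measurable.
Local Notation OG := (g_sigma_algebraType G).

Lemma sub_sigma_measurable (A : set Omega) : <<s G >> A -> measurable A.
Proof. by apply: smallest_sub => //; exact: sigma_algebra_measurable. Qed.

Lemma measurable_to_sub : measurable_fun [set: Omega] (id : Omega -> OG).
Proof. by move=> _ A mA; rewrite setTI; exact: sub_sigma_measurable. Qed.

Let idm : {mfun Omega >-> OG} := HB.pack (id : Omega -> OG)
  (isMeasurableFun.Build _ _ _ _ (id : Omega -> OG) measurable_to_sub).

(** The restriction of [P] to the sub-sigma-algebra, encoded as the law of the identity map, so that
    integrals against it are integrals against an image measure. *)
Definition sub_prob : probability OG R := distribution P idm.

Lemma measurable_from_sub d' (E : measurableType d') (f : OG -> E) :
  measurable_fun [set: OG] f -> measurable_fun [set: Omega] (f : Omega -> E).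
Proof. by move=> mf; exact: measurableT_comp mf measurable_to_sub. Qed.

Lemma ge0_integral_sub_prob (f : OG -> \bar R) :
  measurable_fun [set: OG] f -> (forall w, (0 <= f w)%E) ->
  (\int[sub_prob]_w f w = \int[P]_w f (w : Omega))%E.
Proof. by move=> mf f0; exact: (ge0_integral_distribution idm). Qed.

(* The joint law of (w, Z w), with w seen through the sub-sigma-algebra only,
   is a product: expectations become iterated integrals. *)
Lemma indep_integral d' (E : measurableType d') (Z : Omega -> E) (Q : probability E R)
  (h : OG * E -> \bar R) :
  measurable_fun [set: Omega] Z ->
  (forall A D, <<s G >> A -> measurable D -> P (A `&` Z @^-1` D) = (P A * Q D)%E) ->
  measurable_fun [set: OG * E] h -> (forall p, (0 <= h p)%E) ->
  (\int[P]_w h ((w : OG), Z w) = \int[P]_w \int[Q]_z h ((w : OG), z))%E.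
Proof.
move=> mZ ind mh h0.
pose j (w : Omega) : OG * E := (w : OG, Z w).
have mj : measurable_fun [set: Omega] j.
  by apply/measurable_fun_pairP; split; [exact: measurable_to_sub|exact: mZ].
pose jm : {mfun Omega >-> (OG * E)%type} := HB.pack j (isMeasurableFun.Build _ _ _ _ j mj).
pose m' : probability (OG * E)%type R := distribution P jm.
have mE X : measurable X -> (sub_prob \x Q)%E X = m' X.
  by apply: product_measure_unique => A D mA mD; exact: ind.
transitivity (\int[m']_p h p)%E; first by rewrite (ge0_integral_distribution jm).
transitivity (\int[(sub_prob \x Q)%E]_p h p)%E.
  by apply: eq_measure_integral => A mA _; exact: (esym (mE A mA)).
rewrite fubini_tonelli1//.
rewrite (@ge0_integral_sub_prob (fubini_F Q h))//.
  exact: measurable_fun_fubini_tonelli_F.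
by move=> w; apply: integral_ge0 => z _.
Qed.

End sub_sigma_algebra.

(** * The augmented filtration as a family of measurable types *)

Section filtration_lemmas.
Context d (Omega : measurableType d) (R : realType) (P : probability Omega R).
Hypothesis Pc : measure_is_complete P.
Implicit Type Y : R -> Omega -> R.

(** The generating family inside [filtration], named so that [g_sigma_algebraType] can turn the
    sigma-algebra into a measurable type; adaptedness then becomes [measurable_fun] on that type. *)
Definition filtration_gen Y (t s : R) : set (set Omega) :=
  [set A | P.-negligible A \/
       exists u D, [/\ t <= u <= s, measurable D & A = Y u @^-1` D] ].

Lemma filtration_gen_measurable Y t s :
  (forall u, t <= u <= s -> measurable_fun [set: Omega] (Y u)) ->
  filtration_gen Y t s `<=` measurable.
Proof.
move=> mY A [/Pc//|[u [D [us mD ->]]]].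
by rewrite -[_ @^-1` _]setTI; exact: mY.
Qed.

Lemma filtrationE Y t s : filtration P Y t s = <<s filtration_gen Y t s >>.
Proof. by []. Qed.

Lemma filtration_le Y t s s' : s <= s' -> filtration P Y t s `<=` filtration P Y t s'.
Proof.
move=> ss'; apply: smallest_sub; first exact: smallest_sigma_algebra.
move=> A [nA|[u [D [/andP[tu us] mD ->]]]]; apply: sub_sigma_algebra; first by left.
by right; exists u, D; split => //; rewrite tu (le_trans us).
Qed.

Lemma filtration_negligible Y t s A : P.-negligible A -> filtration P Y t s A.
Proof. by move=> nA; apply: sub_sigma_algebra; left. Qed.

Lemma filtration_coord Y t s u : t <= u <= s -> measurable_wrt (filtration P Y t s) (Y u).
Proof. by move=> us D mD; apply: sub_sigma_algebra; right; exists u, D. Qed.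

Lemma measurable_wrtP Y t s (Z : Omega -> R) :
  measurable_wrt (filtration P Y t s) Z <->
  measurable_fun [set: g_sigma_algebraType (filtration_gen Y t s)] Z.
Proof.
split=> [h _ D mD|h D mD]; first by rewrite setTI; exact: h.
by have := h measurableT D mD; rewrite setTI.
Qed.

End filtration_lemmas.

Lemma integral_prob_cst d (T : measurableType d) (R : realType) (P : probability T R) (c : R) :
  (\int[P]_w c%:E = c%:E)%E.
Proof. by rewrite integral_cst// [X in (_ * X)%E]probability_setT mule1. Qed.

Lemma sqr_le_norm (R : realDomainType) (x C : R) : `|x| <= C -> x ^+ 2 <= C ^+ 2.
Proof.
move=> xC; rewrite -(ger0_norm (sqr_ge0 x)) normrX.
by rewrite ler_pXn2r// nnegrE// (le_trans _ xC).
Qed.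

Lemma markov_subset d (T : measurableType d) (R : realType) (P : probability T R)
  (A : set T) (f : T -> R) (c : R) : measurable A -> measurable_fun [set: T] f ->
  (forall w, 0 <= f w) -> 0 <= c -> (forall w, A w -> c <= f w) ->
  (c%:E * P A <= \int[P]_w (f w)%:E)%E.
Proof.
move=> mA mf f0 c0 cf; rewrite -integral_cst//.
have mfE : measurable_fun [set: T] (EFin \o f) by apply/measurable_EFinP.
apply: (@le_trans _ _ (\int[P]_(w in A) (f w)%:E)%E).
  apply: ge0_le_integral => //=; try (by move=> w Aw; rewrite lee_fin ?cf//).
  exact: measurable_funTS.
by apply: ge0_subset_integral => //= w _; rewrite lee_fin.
Qed.

(** * Moments of discrete stochastic integrals *)

Section brownian_steps.
Context d (Omega : measurableType d) (R : realType) (P : probability Omega R).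
Variable B : R -> Omega -> R.
Hypothesis Pc : measure_is_complete P.
Hypothesis BM : brownian_motion P B.
Local Notation OF s := (g_sigma_algebraType (filtration_gen P B 0 s)).
Local Notation Fs := (filtration P B 0).

Lemma brownian_measurable t : 0 <= t -> measurable_fun [set: Omega] (B t).
Proof. by case: BM => + _ _ _ _; exact. Qed.

Lemma brownian_gen_measurable s : filtration_gen P B 0 s `<=` measurable.
Proof.
apply: (@filtration_gen_measurable _ _ _ _ Pc) => u /andP[u0 _].
exact: brownian_measurable.
Qed.

Lemma filtration_measurable s A : Fs s A -> measurable A.
Proof. by apply: sub_sigma_measurable; exact: brownian_gen_measurable. Qed.

Lemma adapted_measurable s d' (E : measurableType d') (Z : Omega -> E) :
  measurable_fun [set: OF s] Z -> measurable_fun [set: Omega] Z.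
Proof. by apply: measurable_from_sub; exact: brownian_gen_measurable. Qed.

Lemma adapted_le s s' d' (E : measurableType d') (Z : Omega -> E) : s <= s' ->
  measurable_fun [set: OF s] Z -> measurable_fun [set: OF s'] Z.
Proof. by move=> ss' mZ _ D mD; exact: (filtration_le ss' (mZ measurableT D mD)). Qed.

Lemma adapted_brownian s u : 0 <= u <= s -> measurable_fun [set: OF s] (B u).
Proof. by move=> us; apply/measurable_wrtP; exact: filtration_coord. Qed.

Lemma brownian_indep s t A D : 0 <= s < t -> Fs s A -> measurable D ->
  P (A `&` (fun w => B t w - B s w) @^-1` D) =
  (P A * normal_prob 0 (Num.sqrt (t - s)) D)%E.
Proof.
case: BM => _ _ Bn Bi _ st FA mD.
by rewrite -(Bn s t st D mD); exact: Bi.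
Qed.

Lemma brownian_incr_integral s t (h : OF s * measurableTypeR R -> \bar R) : 0 <= s < t ->
  measurable_fun [set: OF s * measurableTypeR R] h -> (forall p, (0 <= h p)%E) ->
  (\int[P]_w h ((w : OF s), (B t w - B s w)%R) =
   \int[P]_w \int[normal_prob 0 (Num.sqrt (t - s))]_z h ((w : OF s), z))%E.
Proof.
move=> st mh h0; have /andP[s0 s_t] := st.
have mZ : measurable_fun [set: Omega] ((fun w => B t w - B s w) : Omega -> measurableTypeR R).
  by apply: measurable_funB; apply: brownian_measurable; lra.
have ind A (D : set (measurableTypeR R)) : Fs s A -> measurable D ->
  P (A `&` (fun w => B t w - B s w) @^-1` D) =
  (P A * normal_prob 0 (Num.sqrt (t - s)) D)%E by exact: brownian_indep.
exact: (@indep_integral _ _ _ P _ (@brownian_gen_measurable s) _ (measurableTypeR R) _ _ h mZ ind mh h0).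
Qed.

Section one_step.
Variables (s t : R) (G S xi : Omega -> R).
Hypothesis st : 0 <= s <= t.
Hypothesis mG : measurable_fun [set: OF s] G.
Hypothesis mS : measurable_fun [set: OF s] S.
Hypothesis mxi : measurable_fun [set: OF s] xi.
Hypothesis G0 : forall w, 0 <= G w.

Let mh k : measurable_fun [set: OF s * measurableTypeR R]
  (fun p : OF s * measurableTypeR R => (G p.1 * (S p.1 + xi p.1 * p.2) ^+ k)%:E).
Proof.
apply/measurable_EFinP; apply: measurable_funM.
  exact: measurableT_comp mG measurable_fst.
apply: measurable_funX; apply: measurable_funD.
  exact: measurableT_comp mS measurable_fst.
by apply: measurable_funM; [exact: measurableT_comp mxi measurable_fst|exact: measurable_snd].
Qed.

Let mz (a b : R) k : measurable_fun [set: R] (fun x : R => ((a + b * x) ^+ k)%:E).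
Proof.
by apply/measurable_EFinP; apply: measurable_funX; apply: measurable_funD => //; apply: measurable_funM.
Qed.

Let sqrt_neq0 : s < t -> Num.sqrt (t - s) != 0.
Proof. by move=> lt; rewrite sqrtr_eq0 -ltNge subr_gt0. Qed.

(** Independence freezes [G], [S] and [xi], and leaves a second moment of N(0, t - s). The case
    [s = t] is separate because the normal moments are stated for a nonzero deviation. *)
Lemma one_step_square :
  (\int[P]_w (G w * (S w + xi w * (B t w - B s w)) ^+ 2)%:E =
   \int[P]_w (G w * (S w ^+ 2 + xi w ^+ 2 * (t - s)))%:E)%E.
Proof.
have /andP[s0] := st; rewrite le_eqVlt => /predU1P[<-|lt].
  by apply: eq_integral => w _; rewrite !subrr !mulr0 !addr0.
have := brownian_incr_integral _ (mh 2) _ => /(_ t) /= ->; last 2 first.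
- by rewrite s0.
- by move=> p; rewrite lee_fin mulr_ge0// sqr_ge0.
apply: eq_integral => w _; under eq_integral do rewrite EFinM.
rewrite ge0_integralZl//; [|exact: mz|by move=> x _; rewrite lee_fin sqr_ge0|by rewrite lee_fin].
by rewrite normal_square ?sqrt_neq0// sqr_sqrtr ?subr_ge0 ?ltW// -EFinM.
Qed.

Lemma one_step_power4 :
  (\int[P]_w (G w * S w ^+ 4)%:E <=
   \int[P]_w (G w * (S w + xi w * (B t w - B s w)) ^+ 4)%:E <=
   \int[P]_w (G w * (S w ^+ 4 + 6 * S w ^+ 2 * xi w ^+ 2 * (t - s)
      + 3 * xi w ^+ 4 * (t - s) ^+ 2))%:E)%E.
Proof.
have /andP[s0] := st; rewrite le_eqVlt => /predU1P[<-|lt].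
  under [X in (_ <= X <= _)%E]eq_integral do rewrite subrr mulr0 addr0.
  under [X in (_ <= _ <= X)%E]eq_integral do rewrite subrr expr0n !mulr0 !addr0.
  by rewrite lexx.
have := brownian_incr_integral _ (mh 4) _ => /(_ t) /= ->; last 2 first.
- by rewrite s0.
- by move=> p; rewrite lee_fin; pos.
have key w : ((G w * S w ^+ 4)%:E <=
    \int[normal_prob 0 (Num.sqrt (t - s))]_z (G w * (S w + xi w * z) ^+ 4)%:E <=
    (G w * (S w ^+ 4 + 6 * S w ^+ 2 * xi w ^+ 2 * (t - s)
      + 3 * xi w ^+ 4 * (t - s) ^+ 2))%:E)%E.
  under eq_integral do rewrite EFinM.
  rewrite ge0_integralZl//; [|exact: mz|by move=> x _; rewrite lee_fin; pos|by rewrite lee_fin].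
  have /andP[h1 h2] := normal_power4 (S w) (xi w) (sqrt_neq0 lt).
  have e2 : Num.sqrt (t - s) ^+ 2 = t - s by rewrite sqr_sqrtr ?subr_ge0 ?ltW.
  have e4 : Num.sqrt (t - s) ^+ 4 = (t - s) ^+ 2 by rewrite -[in RHS]e2 -exprM.
  rewrite e2 e4 in h2.
  by apply/andP; split; rewrite EFinM; apply: lee_wpmul2l => //; rewrite lee_fin.
have mF : measurable_fun [set: Omega] (fun w =>
   \int[normal_prob 0 (Num.sqrt (t - s))]_z (G w * (S w + xi w * z) ^+ 4)%:E)%E.
  apply: (@adapted_measurable s).
  have hp (p : OF s * measurableTypeR R) : (0 <= (G p.1 * (S p.1 + xi p.1 * p.2) ^+ 4)%:E)%E.
    by rewrite lee_fin; pos.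
  have := @measurable_fun_fubini_tonelli_F _ _ _ (measurableTypeR R) R (normal_prob 0 (Num.sqrt (t - s))) _ (mh 4) hp.
  by apply: eq_measurable_fun => w _.
apply/andP; split; apply: ge0_le_integral => //=.
- by move=> w _; rewrite lee_fin; pos.
- by apply/measurable_EFinP; apply: (@adapted_measurable s); repeat first [apply: measurable_funM|apply: measurable_funD|apply: measurable_funX|exact: mG|exact: mS|exact: mxi|exact: measurable_cst].
- by move=> w _; have /andP[] := key w.
- by move=> w _; apply: integral_ge0 => z _; rewrite lee_fin; pos.
- by apply/measurable_EFinP; apply: (@adapted_measurable s); repeat first [apply: measurable_funM|apply: measurable_funD|apply: measurable_funX|exact: mG|exact: mS|exact: mxi|exact: measurable_cst].
- by move=> w _; have /andP[] := key w.
Qed.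
End one_step.

Section steps.
Variables (u : nat -> R) (N : nat) (xi : nat -> Omega -> R).
Hypothesis u0 : 0 <= u 0.
Hypothesis ui : forall i, (i < N)%N -> u i <= u i.+1.
Hypothesis mxi : forall i, (i < N)%N -> measurable_fun [set: OF (u i)] (xi i).

Definition step_sum k w := \sum_(i < k) xi i w * (B (u i.+1) w - B (u i) w).
(** The predictable quadratic variation of [step_sum]. *)
Definition step_qv k w := \sum_(i < k) xi i w ^+ 2 * (u i.+1 - u i).

Lemma step_time_le i j : (i <= j <= N)%N -> u i <= u j.
Proof.
elim: j => [|j IH] /andP[ij jN]; first by move: ij; rewrite leqn0 => /eqP ->.
move: ij; rewrite leq_eqVlt => /predU1P[->//|]; rewrite ltnS => ij.
by apply: le_trans (ui jN); apply: IH; rewrite ij ltnW.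
Qed.

Lemma step_time_ge0 i : (i <= N)%N -> 0 <= u i.
Proof. by move=> iN; apply: le_trans u0 _; exact: step_time_le. Qed.

Lemma adapted_step_sum k : (k <= N)%N -> measurable_fun [set: OF (u k)] (step_sum k).
Proof.
elim: k => [_|k IH kN].
  by rewrite (_ : step_sum 0 = cst 0)//; apply/funext => w; rewrite /step_sum big_ord0.
rewrite (_ : step_sum _ = fun w => step_sum k w + xi k w * (B (u k.+1) w - B (u k) w)); last first.
  by apply/funext => w; rewrite /step_sum big_ord_recr.
have ge0 := step_time_ge0 (ltnW kN).
apply: measurable_funD; first exact: adapted_le (ui kN) (IH (ltnW kN)).
apply: measurable_funM; first exact: adapted_le (ui kN) (mxi kN).
by apply: measurable_funB; apply: adapted_brownian; rewrite ?lexx ?ui ?ge0 ?step_time_ge0.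
Qed.

Lemma step_qv_ge0 k w : (k <= N)%N -> 0 <= step_qv k w.
Proof.
move=> kN; apply: sumr_ge0 => i _; rewrite mulr_ge0 ?sqr_ge0// subr_ge0 ui//.
by rewrite (leq_trans _ kN).
Qed.

Lemma adapted_step_qv k : (k <= N)%N -> measurable_fun [set: OF (u k)] (step_qv k).
Proof.
elim: k => [_|k IH kN].
  by rewrite (_ : step_qv 0 = cst 0)//; apply/funext => w; rewrite /step_qv big_ord0.
rewrite (_ : step_qv _ = fun w => step_qv k w + xi k w ^+ 2 * (u k.+1 - u k)); last first.
  by apply/funext => w; rewrite /step_qv big_ord_recr.
apply: measurable_funD; first exact: adapted_le (ui kN) (IH (ltnW kN)).
apply: measurable_funM => //; apply: measurable_funX.
exact: adapted_le (ui kN) (mxi kN).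
Qed.

Section weighted.
Variables (G S : Omega -> R).
Hypothesis mG : measurable_fun [set: OF (u 0)] G.
Hypothesis mS : measurable_fun [set: OF (u 0)] S.
Hypothesis G0 : forall w, 0 <= G w.

(** Discrete Ito isometry. The weight [G] expresses conditioning on time [u 0], and [S] is a
    starting value; the choice [S = 1] is what later yields the mean of a simple integral. *)
Lemma step_square k : (k <= N)%N ->
  (\int[P]_w (G w * (S w + step_sum k w) ^+ 2)%:E =
   \int[P]_w (G w * (S w ^+ 2 + step_qv k w))%:E)%E.
Proof.
elim: k => [_|k IH kN].
  by apply: eq_integral => w _; rewrite /step_sum /step_qv !big_ord0 !addr0.
have k0 := step_time_ge0 (ltnW kN).
have u0k : u 0%N <= u k by apply: step_time_le; rewrite leq0n ltnW.
have mGk := adapted_le u0k mG; have mSk := adapted_le u0k mS.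
have mSs := adapted_step_sum (ltnW kN).
have mqk := adapted_step_qv (ltnW kN).
have mm (f : Omega -> R) : measurable_fun [set: OF (u k)] f ->
    measurable_fun [set: Omega] (EFin \o f).
  by move=> mf; apply/measurable_EFinP; exact: adapted_measurable mf.
transitivity (\int[P]_w (G w * ((S w + step_sum k w) ^+ 2 + xi k w ^+ 2 * (u k.+1 - u k)))%:E)%E.
  rewrite -one_step_square; last 5 first.
  - by rewrite k0 ui.
  - exact: mGk.
  - exact: measurable_funD.
  - exact: mxi.
  - exact: G0.
  by apply: eq_integral => w _; rewrite /step_sum big_ord_recr /= addrA.
have pq w : 0 <= xi k w ^+ 2 * (u k.+1 - u k) by rewrite mulr_ge0 ?sqr_ge0// subr_ge0 ui.
have mxq : measurable_fun [set: OF (u k)] (fun w => G w * (xi k w ^+ 2 * (u k.+1 - u k))).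
  by apply: measurable_funM => //; apply: measurable_funM => //; apply: measurable_funX; exact: mxi.
transitivity (\int[P]_w (G w * (S w + step_sum k w) ^+ 2)%:E +
              \int[P]_w (G w * (xi k w ^+ 2 * (u k.+1 - u k)))%:E)%E.
  rewrite -ge0_integralD//.
  - by apply: eq_integral => w _; rewrite -EFinD mulrDr.
  - by move=> w _; rewrite lee_fin mulr_ge0// sqr_ge0.
  - by apply: mm; apply: measurable_funM => //; apply: measurable_funX; exact: measurable_funD.
  - by move=> w _; rewrite lee_fin mulr_ge0.
  - exact: mm.
rewrite (IH (ltnW kN)) -ge0_integralD//.
- by apply: eq_integral => w _; rewrite -EFinD -mulrDr /step_qv big_ord_recr /= addrA.
- by move=> w _; rewrite lee_fin mulr_ge0// addr_ge0 ?sqr_ge0// step_qv_ge0// ltnW.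
- by apply: mm; apply: measurable_funM => //; apply: measurable_funD => //; exact: measurable_funX.
- by move=> w _; rewrite lee_fin mulr_ge0.
- exact: mm.
Qed.

(** Submartingale property of fourth powers. With [G] the indicator of an event known at time [u 0]
    it drives the maximal inequality for exits from a ball. *)
Lemma step_power4_ge k : (k <= N)%N ->
  (\int[P]_w (G w * S w ^+ 4)%:E <= \int[P]_w (G w * (S w + step_sum k w) ^+ 4)%:E)%E.
Proof.
elim: k => [_|k IH kN].
  by under [leRHS]eq_integral do rewrite /step_sum big_ord0 addr0.
have u0k : u 0%N <= u k by apply: step_time_le; rewrite leq0n ltnW.
apply: (le_trans (IH (ltnW kN))).
have := @one_step_power4 (u k) (u k.+1) G (fun w => S w + step_sum k w) (xi k).
move=> /(_ _ _ _ _ _)/andP[| | | | |+ _].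
- by rewrite step_time_ge0 ?ui// ltnW.
- exact: adapted_le mG.
- by apply: measurable_funD; [exact: adapted_le mS|exact: adapted_step_sum (ltnW kN)].
- exact: mxi.
- exact: G0.
- by under [X in (_ <= X)%E -> _]eq_integral do rewrite -addrA;
  under [X in _ -> (_ <= X)%E]eq_integral do rewrite /step_sum big_ord_recr /=.
Qed.
End weighted.

Lemma step_qv_le C k w : (forall i w, (i < N)%N -> `|xi i w| <= C) -> (k <= N)%N ->
  step_qv k w <= C ^+ 2 * (u k - u 0).
Proof.
move=> xiC kN.
have -> : C ^+ 2 * (u k - u 0) = \sum_(i < k) C ^+ 2 * (u i.+1 - u i).
  by rewrite -mulr_sumr -(big_mkord xpredT (fun i => u i.+1 - u i)) telescope_sumr.
apply: ler_sum => i _; have iN : (i < N)%N by apply: leq_trans kN.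
apply: ler_wpM2r; first by rewrite subr_ge0 ui.
by apply: sqr_le_norm; exact: xiC.
Qed.

Lemma step_square1 k : (k <= N)%N ->
  (\int[P]_w (step_sum k w ^+ 2)%:E = \int[P]_w (step_qv k w)%:E)%E.
Proof.
move=> kN.
have := @step_square (cst 1) (cst 0) (measurable_cst _) (measurable_cst _) (fun=> ler01) k kN.
under eq_integral do rewrite /= mul1r add0r.
by under [X in _ = X -> _]eq_integral do rewrite /= mul1r expr0n add0r.
Qed.

Lemma step_bounded_square C k : (forall i w, (i < N)%N -> `|xi i w| <= C) -> (k <= N)%N ->
  (\int[P]_w (step_sum k w ^+ 2)%:E <= (C ^+ 2 * (u k - u 0))%:E)%E.
Proof.
move=> xiC kN; rewrite step_square1//.
apply: (@le_trans _ _ (\int[P]_w (C ^+ 2 * (u k - u 0))%:E)%E).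
  apply: ge0_le_integral => //=.
  - by move=> w _; rewrite lee_fin step_qv_ge0.
  - by apply/measurable_EFinP; exact: adapted_measurable (adapted_step_qv kN).
  - by move=> w _; rewrite lee_fin step_qv_le.
by rewrite integral_cst// [X in (_ * X)%E]probability_setT mule1.
Qed.

(** The constant 3 reproduces itself exactly: with a = u k - u 0 and D the next step, 3 a^2 + 6 a D
    + 3 D^2 = 3 (a + D)^2. *)
Lemma step_bounded_power4 C k : (forall i w, (i < N)%N -> `|xi i w| <= C) -> (k <= N)%N ->
  (\int[P]_w (step_sum k w ^+ 4)%:E <= (3 * C ^+ 4 * (u k - u 0) ^+ 2)%:E)%E.
Proof.
move=> xiC; elim: k => [_|k IH kN].
  under eq_integral do rewrite /step_sum big_ord0 expr0n /=.
  by rewrite integral0 lee_fin subrr expr0n mulr0.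
have m1 : measurable_fun [set: OF (u k)] (cst (1 : R)) by exact: measurable_cst.
have mSk := adapted_step_sum (ltnW kN).
have ut : 0 <= u k <= u k.+1 by rewrite step_time_ge0 ?ui// ltnW.
have := @one_step_power4 (u k) (u k.+1) (cst 1) (step_sum k) (xi k) ut m1 mSk (mxi kN) (fun=> ler01).
move=> /andP[_ h].
apply: (@le_trans _ _ (\int[P]_w
   (cst 1 w * (step_sum k w + xi k w * (B (u k.+1) w - B (u k) w)) ^+ 4)%:E)%E).
  rewrite le_eqVlt; apply/orP; left; apply/eqP; apply: eq_integral => w _.
  by rewrite /step_sum big_ord_recr /= mul1r.
apply: (le_trans h).
set D := u k.+1 - u k.
have D0 : 0 <= D by rewrite subr_ge0 ui.
have u0k : 0 <= u k - u 0 by rewrite subr_ge0; apply: step_time_le; rewrite leq0n ltnW.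
have xk w : xi k w ^+ 2 <= C ^+ 2.
  by apply: sqr_le_norm; exact: xiC.
have xk4 w : xi k w ^+ 4 <= C ^+ 4.
  by rewrite !(exprM _ 2 2) ler_pXn2r ?nnegrE ?sqr_ge0 ?xk.
have mE n : measurable_fun [set: Omega] (fun w => (step_sum k w ^+ n)%:E).
  by apply/measurable_EFinP; apply: measurable_funX; exact: adapted_measurable mSk.
apply: (@le_trans _ _ (\int[P]_w ((step_sum k w ^+ 4)%:E + ((6 * C ^+ 2 * D)%:E * (step_sum k w ^+ 2)%:E
   + (3 * C ^+ 4 * D ^+ 2)%:E)))%E).
  apply: ge0_le_integral => //=.
  - by move=> w _; rewrite lee_fin; pos.
  - apply/measurable_EFinP; apply: (@adapted_measurable (u k)).
    by repeat first [apply: measurable_funM|apply: measurable_funD|apply: measurable_funX|exact: mSk|exact: mxi|exact: measurable_cst].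
  - by apply: emeasurable_funD => //; apply: emeasurable_funD => //; apply: emeasurable_funM.
  - move=> w _; rewrite -EFinM -!EFinD lee_fin mul1r -!addrA lerD2l.
    apply: lerD.
      have := xk w; have : 0 <= step_sum k w ^+ 2 by exact: sqr_ge0.
      move: (step_sum k w ^+ 2) (xi k w ^+ 2) => p q p0 qC.
      have : p * D * q <= p * D * C ^+ 2 by rewrite ler_wpM2l// mulr_ge0.
      by move=> ?; lra.
    have := xk4 w; have : 0 <= D ^+ 2 by exact: sqr_ge0.
    move: (D ^+ 2) (xi k w ^+ 4) (C ^+ 4) => p q r p0 qC.
    have : p * q <= p * r by rewrite ler_wpM2l.
    by move=> ?; lra.
have z1 w : (0 <= (6 * C ^+ 2 * D)%:E * (step_sum k w ^+ 2)%:E)%E by rewrite -EFinM lee_fin; pos.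
have z2 : (0 <= (3 * C ^+ 4 * D ^+ 2)%:E)%E by rewrite lee_fin; pos.
rewrite ge0_integralD; [|by []|by move=> w _; rewrite lee_fin; pos|exact: mE
  |by move=> w _; rewrite adde_ge0|by apply: emeasurable_funD => //; apply: emeasurable_funM].
rewrite ge0_integralD; [|by []|by []|by apply: emeasurable_funM|by []|by []].
rewrite ge0_integralZl; [|by []|exact: mE|by move=> w _; rewrite lee_fin; pos|by rewrite lee_fin; pos].
rewrite integral_prob_cst.
apply: (@le_trans _ _ ((3 * C ^+ 4 * (u k - u 0) ^+ 2)%:E + ((6 * C ^+ 2 * D)%:E * (C ^+ 2 * (u k - u 0))%:E
   + (3 * C ^+ 4 * D ^+ 2)%:E))%E).
  apply: leeD; first exact: (IH (ltnW kN)).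
  rewrite leeD2r// lee_wpmul2l ?lee_fin//; first by pos.
  by apply: step_bounded_square => //; exact: ltnW.
rewrite -EFinM -!EFinD lee_fin /D le_eqVlt; apply/orP; left; apply/eqP; ring.
Qed.

End steps.

Section lenglart.
Variables (u : nat -> R) (N : nat) (xi : nat -> Omega -> R).
Hypothesis u0 : 0 <= u 0.
Hypothesis ui : forall i, (i < N)%N -> u i <= u i.+1.
Hypothesis mxi : forall i, (i < N)%N -> measurable_fun [set: OF (u i)] (xi i).

(* Truncate the coefficients as soon as the quadratic variation exceeds eta. *)
Lemma step_lenglart (e eta : R) (Gam : set Omega) : 0 < e -> 0 <= eta -> measurable Gam ->
  (P (Gam `&` [set w | (e < `|step_sum u xi N w|)%R]) <=
   P (Gam `&` [set w | (eta < step_qv u xi N w)%R]) + (eta / e ^+ 2)%:E)%E.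
Proof.
move=> e0 eta0 mGam.
pose qv := step_qv u xi.
(* [qv i.+1] involves the coefficients up to index i only, so it is known at time [u i] and the
   truncated coefficients remain adapted. *)
pose xi' i w := if qv i.+1 w <= eta then xi i w else 0.
have qvS i w : qv i.+1 w = qv i w + xi i w ^+ 2 * (u i.+1 - u i).
  by rewrite /qv /step_qv big_ord_recr.
have mxi' i : (i < N)%N -> measurable_fun [set: OF (u i)] (xi' i).
  move=> iN; apply: measurable_fun_ifT => //; last exact: mxi.
  apply: measurable_fun_ler => //.
  rewrite (_ : qv i.+1 = fun w => qv i w + xi i w ^+ 2 * (u i.+1 - u i)); last exact/funext.
  apply: measurable_funD; first exact: (adapted_step_qv ui mxi (ltnW iN)).
  by apply: measurable_funM => //; apply: measurable_funX; exact: mxi.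
have inc i w : (i < N)%N -> qv i w <= qv i.+1 w.
  by move=> iN; rewrite qvS lerDl mulr_ge0 ?sqr_ge0// subr_ge0 ui.
have H k w : (k <= N)%N -> [/\ step_qv u xi' k w <= eta,
    qv k w <= eta -> step_qv u xi' k w = qv k w &
    qv k w <= eta -> step_sum u xi' k w = step_sum u xi k w].
  elim: k => [_|k IH kN].
    by rewrite /qv /step_qv /step_sum !big_ord0.
  have [h1 h2 h3] := IH (ltnW kN).
  have e1 : step_qv u xi' k.+1 w = step_qv u xi' k w + xi' k w ^+ 2 * (u k.+1 - u k).
    by rewrite /step_qv big_ord_recr.
  have e2 xx : step_sum u xx k.+1 w = step_sum u xx k w + xx k w * (B (u k.+1) w - B (u k) w).
    by rewrite /step_sum big_ord_recr.
  rewrite e1 !e2 /xi'; case: ifPn => [le|nle].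
    have lek := le_trans (inc k w kN) le.
    by rewrite h2// h3// -qvS; split.
  by rewrite expr0n mul0r addr0; split => // /(fun h => negP nle h).
(* Where the quadratic variation ends below [eta] nothing has been truncated; elsewhere the first
   event on the right holds. The truncated sum is then controlled by its second moment, at most
   [eta]. *)
have sub : Gam `&` [set w | e < `|step_sum u xi N w|] `<=`
   (Gam `&` [set w | eta < qv N w]) `|` [set w | e < `|step_sum u xi' N w|].
  move=> w [Gw /= ew]; have [le|lt] := leP (qv N w) eta; last by left.
  by right => /=; have [_ _ ->] := H N w (leqnn _).
have mS := adapted_measurable (adapted_step_sum u0 ui mxi (leqnn N)).
have mS' := adapted_measurable (adapted_step_sum u0 ui mxi' (leqnn N)).
have mq := adapted_measurable (adapted_step_qv ui mxi (leqnn N)).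
have mlt (f : Omega -> R) c : measurable_fun [set: Omega] f -> measurable [set w | c < f w].
  by move=> mf; rewrite -[X in measurable X]setTI; exact: measurable_fun_ltr.
have mn (f : Omega -> R) c : measurable_fun [set: Omega] f -> measurable [set w | c < `|f w|].
  by move=> mf; apply: (mlt (fun w => `|f w|)); exact: measurableT_comp.
apply: (@le_trans _ _ (P ((Gam `&` [set w | eta < qv N w]) `|` [set w | e < `|step_sum u xi' N w|]))).
  apply: le_measure => //; rewrite inE.
  - by apply: measurableI => //; exact: mn.
  - by apply: measurableU; [apply: measurableI => //; exact: mlt|exact: mn].
apply: (le_trans (measureU2 _ _ _)).
- by apply: measurableI => //; exact: mlt.
- exact: mn.
apply: leeD => //.
have mk := @markov_subset _ _ _ P [set w | e < `|step_sum u xi' N w|]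
   (fun w => step_sum u xi' N w ^+ 2) (e ^+ 2).
have {}mk : ((e ^+ 2)%:E * P [set w | (e < `|step_sum u xi' N w|)%R] <= eta%:E)%E.
  apply: le_trans (mk _ _ _ _ _) _.
  - exact: mn.
  - exact: measurable_funX.
  - by move=> w; exact: sqr_ge0.
  - exact: sqr_ge0.
  - move=> w /= /ltW h; rewrite -[X in _ <= X]ger0_norm ?sqr_ge0// normrX.
    by rewrite ler_pXn2r ?nnegrE// ltW.
  rewrite (step_square1 u0 ui mxi' (leqnn N)).
  apply: (@le_trans _ _ (\int[P]_w eta%:E)%E).
    apply: ge0_le_integral => //=.
    - by move=> w _; rewrite lee_fin; apply: sumr_ge0 => i _; rewrite mulr_ge0 ?sqr_ge0// subr_ge0 ui.
    - by apply/measurable_EFinP; exact: adapted_measurable (adapted_step_qv ui mxi' (leqnn N)).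
    - by move=> w _; rewrite lee_fin; have [] := H N w (leqnn _).
  by rewrite integral_cst// [X in (_ * X)%E]probability_setT mule1.
have e2 : 0 < e ^+ 2 by rewrite exprn_gt0.
by rewrite mulrC EFinM lee_pdivlMl.
Qed.
End lenglart.
End brownian_steps.

Ltac minmax_lra := repeat match goal with
  | |- context [Order.min ?x ?y] =>
    lazymatch x with context [Order.min _ _] => fail | context [Order.max _ _] => fail
    | _ => lazymatch y with context [Order.min _ _] => fail | context [Order.max _ _] => fail
    | _ => case: (leP x y) => ? end end
  | |- context [Order.max ?x ?y] =>
    lazymatch x with context [Order.min _ _] => fail | context [Order.max _ _] => fail
    | _ => lazymatch y with context [Order.min _ _] => fail | context [Order.max _ _] => fail
    | _ => case: (leP x y) => ? end end
  end; lra.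

(** * Clamping times to an interval *)

Section clamp.
Context {R : realType}.
Implicit Types a b u : R.
Definition clamp a b u : R := Num.max a (Num.min u b).

Lemma clamp_le a b u u' : u <= u' -> clamp a b u <= clamp a b u'.
Proof. by move=> uu'; rewrite /clamp; minmax_lra. Qed.

Lemma clamp_bounds a b u : a <= b -> a <= clamp a b u <= b.
Proof. by move=> ab; rewrite /clamp; minmax_lra. Qed.

Lemma clamp_left a b u : u <= a -> a <= b -> clamp a b u = a.
Proof. by move=> *; rewrite /clamp; minmax_lra. Qed.

Lemma clamp_right a b u : b <= u -> a <= b -> clamp a b u = b.
Proof. by move=> *; rewrite /clamp; minmax_lra. Qed.

Lemma clamp_ge_self a b u : u <= b -> u <= clamp a b u.
Proof. by move=> ub; rewrite /clamp; minmax_lra. Qed.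

Lemma clamp_shift_min a h u c : 0 <= c <= h ->
  a + Num.min (clamp a (a + h) u - a) c = clamp a (a + c) u.
Proof. by move=> /andP[c0 ch]; rewrite /clamp; minmax_lra. Qed.

Lemma clamp_itv a b p q (x : R) : a < x <= b ->
  (clamp a b p < x <= clamp a b q) = (p < x <= q).
Proof. by move=> /andP[ax xb]; apply/idP/idP; rewrite /clamp; minmax_lra. Qed.
End clamp.

(** * Integrals of simple processes over a subinterval *)

Section simple_processes.
Context d (Omega : measurableType d) (R : realType) (P : probability Omega R).
Variable B : R -> Omega -> R.
Hypothesis Pc : measure_is_complete P.
Hypothesis BM : brownian_motion P B.
Local Notation OF s := (g_sigma_algebraType (filtration_gen P B 0 s)).
Implicit Type H : simple_process Omega R.
Local Notation lam := (@lebesgue_measure R).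

(** Clamping the partition to [[a, b]] makes the increment of the integral over [[a, b]] a discrete
    sum over ordered times again. *)
Definition sp_incr H a b (w : Omega) : R := \sum_(i < sp_size H)
  sp_coef H i w * (B (clamp a b (sp_time H i.+1)) w - B (clamp a b (sp_time H i)) w).
Definition sp_qv H a b (w : Omega) : R := \sum_(i < sp_size H)
  sp_coef H i w ^+ 2 * (clamp a b (sp_time H i.+1) - clamp a b (sp_time H i)).
Definition sp_map (phi : R -> R) H : simple_process Omega R :=
  SimpleProcess (sp_size H) (sp_time H) (fun i w => phi (sp_coef H i w)).

Lemma sp_integralB H a b w : a <= b ->
  sp_integral B H b w - sp_integral B H a w = sp_incr H a b w.
Proof.
move=> ab; rewrite /sp_integral -sumrB; apply: eq_bigr => i _; rewrite -mulrBr.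
congr (_ * _).
have E u : B (Num.min u b) w - B (Num.min u a) w = B (clamp a b u) w - B a w.
  rewrite /clamp; case: (leP u a) => ua.
    by rewrite (min_idPl _) ?(le_trans ua)// (max_idPl _)// !subrr.
  by rewrite (max_idPr _)// le_min (ltW ua).
have := E (sp_time H i.+1); have := E (sp_time H i); lra.
Qed.

Lemma sp_time_mono t T H : sp_wf P B t T H ->
  forall i j, (i <= j <= sp_size H)%N -> sp_time H i <= sp_time H j.
Proof.
move=> [_ _ mono _ _] i; elim=> [|j IH] /andP[ij jN].
  by move: ij; rewrite leqn0 => /eqP ->.
move: ij; rewrite leq_eqVlt => /predU1P[->//|]; rewrite ltnS => ij.
by apply: le_trans (mono j jN); apply: IH; rewrite ij ltnW.
Qed.

Lemma sp_integral_start t T H w : sp_wf P B t T H -> sp_integral B H t w = 0.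
Proof.
move=> wf; rewrite /sp_integral big1// => i _.
have [t0 _ _ _ _] := wf.
have h j : (j <= sp_size H)%N -> t <= sp_time H j.
  by move=> jN; rewrite -t0; apply: (sp_time_mono wf); rewrite leq0n.
by rewrite !(min_idPr _) ?subrr ?mulr0 ?h// ltnW.
Qed.

(** The partition intervals are disjoint, so at most one term of [sp_val] is nonzero at [u];
    [phi 0 = 0] covers the times at which none is. *)
Lemma sp_val_map t T phi H u w : sp_wf P B t T H -> phi 0 = 0 ->
  sp_val (sp_map phi H) u w = phi (sp_val H u w).
Proof.
move=> wf phi0; rewrite /sp_val /=.
pose I (i : 'I_(sp_size H)) := sp_time H i < u <= sp_time H i.+1.
have indE (i : 'I_(sp_size H)) : \1_(`]sp_time H i, sp_time H i.+1]%classic) u = (I i)%:R :> R.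
  rewrite indicE; case: (boolP (I i)) => h; first by rewrite mem_set//= in_itv.
  by rewrite memNset//= in_itv; exact/negP.
under eq_bigr do rewrite indE.
under [in RHS]eq_bigr do rewrite indE.
have [[i0 Ii0]|noI] := pselect (exists i, I i); last first.
  have nI i : I i = false by apply/negP => h; apply: noI; exists i.
  by rewrite !big1 ?phi0// => i _; rewrite nI mulr0.
have uniq i : i != i0 -> I i = false.
  move=> ii0; apply/negP => /andP[h1 h2]; move: Ii0 => /andP[h3 h4].
  move: ii0; rewrite neq_ltn => /orP[lt|lt].
    have : sp_time H i.+1 <= sp_time H i0 by apply: (sp_time_mono wf); rewrite lt ltnW.
    by lra.
  have : sp_time H i0.+1 <= sp_time H i by apply: (sp_time_mono wf); rewrite lt ltnW.
  by lra.
rewrite (bigD1 i0)//= [in RHS](bigD1 i0)//= Ii0 !mulr1 !big1 ?addr0// => i /uniq ->;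
  by rewrite mulr0.
Qed.

Lemma sp_val_integral t T H a b w : sp_wf P B t T H -> t <= a -> a <= b -> b <= T ->
  (\int[lam]_(u in `[a, b]) (sp_val H u w ^+ 2)%:E = (sp_qv H a b w)%:E)%E.
Proof.
move=> wf ta ab bT.
under eq_integral => u _.
  rewrite -(@sp_val_map t T (fun x => x ^+ 2) H u w wf) ?expr0n// /sp_val /= -sumEFin.
  over.
rewrite ge0_integral_sum//; last 2 first.
- move=> i; apply/measurable_EFinP; apply: measurable_funM; first exact: measurable_cst.
  by apply: measurable_funTS; apply: measurable_indic; exact: measurable_itv.
- by move=> i u _; rewrite lee_fin mulr_ge0 ?sqr_ge0.
rewrite /sp_qv -sumEFin; apply: eq_bigr => i _.
under eq_integral do rewrite EFinM.
have mI : measurable_fun [set: R] (fun x : R => (\1_(`]sp_time H i, sp_time H i.+1]%classic) x)%:E : \bar R).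
  by apply/measurable_EFinP; apply: measurable_indic; exact: measurable_itv.
rewrite ge0_integralZl; [|by []|exact: measurable_funTS|by move=> u _; rewrite lee_fin|by rewrite lee_fin sqr_ge0].
suff -> : (\int[lam]_(x in `[a, b]) (\1_(`]sp_time H i, sp_time H i.+1]%classic) x)%:E =
    (clamp a b (sp_time H i.+1) - clamp a b (sp_time H i))%:E)%E by rewrite -EFinM.
rewrite -integral_itv_obnd_cbnd; last exact: measurable_funTS.
rewrite integral_indic//.
have mono := sp_time_mono wf.
have le : clamp a b (sp_time H i) <= clamp a b (sp_time H i.+1).
  by apply: clamp_le; apply: mono; rewrite leqnSn /=.
have -> : (`]sp_time H i, sp_time H i.+1] `&` `]a, b] : set R) =
   `]clamp a b (sp_time H i), clamp a b (sp_time H i.+1)]%classic.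
  apply/seteqP; split => u /=; rewrite !in_itv/=.
    by move=> [h1 h2]; rewrite clamp_itv.
  move=> h; have /andP[h1 h2] := h.
  have /andP[c1 c2] := clamp_bounds (sp_time H i) ab.
  have /andP[c3 c4] := clamp_bounds (sp_time H i.+1) ab.
  have h3 : a < u <= b by apply/andP; split; lra.
  by split => //; rewrite -(clamp_itv _ _ h3).
apply: (etrans (@lebesgue_measure_itv R `]_, _])); rewrite /= lte_fin.
case: ltP => [_|ge]; first by rewrite EFinB.
by congr (_%:E); lra.
Qed.

Section one_process.
Variables (t T : R) (H : simple_process Omega R) (a b : R).
Hypothesis t0 : 0 <= t.
Hypothesis wf : sp_wf P B t T H.
Hypotheses (ta : t <= a) (ab : a <= b) (bT : b <= T).

Let u i := clamp a b (sp_time H i).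
(** A coefficient fixed at a time [>= b] multiplies a vanishing increment, but it need not be known
    at the clamped time [b]; it is replaced by 0 to keep adaptedness. *)
Let xi i w := if sp_time H i < b then sp_coef H i w else 0.
Let N := sp_size H.

Let u_ge0 : 0 <= u 0%N.
Proof. by have /andP[h _] := clamp_bounds (sp_time H 0) ab; exact: (le_trans t0 (le_trans ta h)). Qed.

Let u_le i : (i < N)%N -> u i <= u i.+1.
Proof. by move=> iN; apply: clamp_le; case: wf => _ _ + _ _; exact. Qed.

Let u_start : u 0%N = a.
Proof. by case: wf => h _ _ _ _; rewrite /u h clamp_left. Qed.

Let u_end : u N = b.
Proof. by case: wf => _ h _ _ _; rewrite /u /N h clamp_right. Qed.

Let mxi i : (i < N)%N -> measurable_fun [set: OF (u i)] (xi i).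
Proof.
move=> iN; rewrite /xi; case: ltP => [lt|_]; last exact: measurable_cst.
apply: (@adapted_le _ _ _ _ _ (sp_time H i)).
  by rewrite /u /clamp; minmax_lra.
by apply/measurable_wrtP; case: wf => _ _ _ + _; exact.
Qed.

Let incrE w : sp_incr H a b w = step_sum B u xi N w.
Proof.
apply: eq_bigr => i _; rewrite /xi; case: ltP => // le.
rewrite /u !clamp_right ?subrr ?mulr0//.
by apply: (le_trans le); apply: (sp_time_mono wf); rewrite leqnSn /=.
Qed.

Let qvE w : sp_qv H a b w = step_qv u xi N w.
Proof.
apply: eq_bigr => i _; rewrite /xi; case: ltP => // le.
rewrite /u !clamp_right ?subrr ?mulr0//.
by apply: (le_trans le); apply: (sp_time_mono wf); rewrite leqnSn /=.
Qed.

Lemma adapted_sp_incr : measurable_fun [set: OF b] (sp_incr H a b).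
Proof.
rewrite (_ : sp_incr H a b = step_sum B u xi N); last exact/funext.
by apply: (@adapted_le _ _ _ _ _ (u N)); [rewrite u_end|exact: (adapted_step_sum u_ge0 u_le mxi (leqnn N))].
Qed.

Lemma adapted_sp_qv : measurable_fun [set: OF b] (sp_qv H a b).
Proof.
rewrite (_ : sp_qv H a b = step_qv u xi N); last exact/funext.
by apply: (@adapted_le _ _ _ _ _ (u N)); [rewrite u_end|exact: (adapted_step_qv u_le mxi (leqnn N))].
Qed.

Lemma sp_qv_ge0 w : 0 <= sp_qv H a b w.
Proof. by rewrite qvE; apply: sumr_ge0 => i _; rewrite mulr_ge0 ?sqr_ge0// subr_ge0 u_le. Qed.

Lemma sp_lenglart (e eta : R) (Gam : set Omega) : 0 < e -> 0 <= eta -> measurable Gam ->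
  (P (Gam `&` [set w | (e < `|sp_incr H a b w|)%R]) <=
   P (Gam `&` [set w | (eta < sp_qv H a b w)%R]) + (eta / e ^+ 2)%:E)%E.
Proof.
move=> e0 eta0 mG.
have := @step_lenglart _ _ _ P B Pc BM u N xi u_ge0 u_le mxi e eta Gam e0 eta0 mG.
rewrite (_ : sp_incr H a b = step_sum B u xi N); last exact/funext.
by rewrite (_ : sp_qv H a b = step_qv u xi N); last exact/funext.
Qed.

Lemma sp_square : (\int[P]_w (sp_incr H a b w ^+ 2)%:E = \int[P]_w (sp_qv H a b w)%:E)%E.
Proof.
under eq_integral do rewrite incrE; under [RHS]eq_integral do rewrite qvE.
exact: (step_square1 Pc BM u_ge0 u_le mxi (leqnn N)).
Qed.

Lemma sp_power4_ge (G S : Omega -> R) : measurable_fun [set: OF a] G ->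
  measurable_fun [set: OF a] S -> (forall w, 0 <= G w) ->
  (\int[P]_w (G w * S w ^+ 4)%:E <= \int[P]_w (G w * (S w + sp_incr H a b w) ^+ 4)%:E)%E.
Proof.
move=> mG' mS' G0.
have au : a <= u 0%N by rewrite u_start.
have mG := adapted_le au mG'; have mS := adapted_le au mS'.
under [leRHS]eq_integral do rewrite incrE.
exact: (step_power4_ge Pc BM u_ge0 u_le mxi mG mS G0 (leqnn N)).
Qed.

Variable C : R.
Hypothesis coefC : forall i w, (i < N)%N -> `|sp_coef H i w| <= C.

Let C0 : forall w : Omega, 0 <= C \/ N = 0%N.
Proof.
move=> w; case: (posnP N) => [->|N0]; first by right.
by left; apply: le_trans (coefC w N0).
Qed.

Lemma sp_power4_le :
  (\int[P]_w (sp_incr H a b w ^+ 4)%:E <= (3 * C ^+ 4 * (b - a) ^+ 2)%:E)%E.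
Proof.
under eq_integral do rewrite incrE.
rewrite -u_end -u_start.
apply: (step_bounded_power4 Pc BM u_ge0 u_le mxi) => // i w iN.
rewrite /xi; case: ltP => // _; first exact: coefC.
by rewrite normr0; apply: le_trans (coefC w iN).
Qed.

Lemma sp_qv_le w : sp_qv H a b w <= C ^+ 2 * (b - a).
Proof.
rewrite qvE -u_end -u_start.
apply: (step_qv_le u_le) => // i w' iN.
rewrite /xi; case: ltP => // _; first exact: coefC.
by rewrite normr0; apply: le_trans (coefC w' iN).
Qed.

(** The mean is read off from the isometry alone: E (1 + S)^2 = 1 + E qv and E S^2 = E qv force 2 E
    S = 0. *)
Lemma sp_mean0 : P.-integrable [set: Omega] (EFin \o sp_incr H a b) /\
  (\int[P]_w (sp_incr H a b w)%:E = 0)%E.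
Proof.
have mS : measurable_fun [set: Omega] (sp_incr H a b).
  exact: (adapted_measurable Pc BM adapted_sp_incr).
have mq : measurable_fun [set: Omega] (sp_qv H a b).
  exact: (adapted_measurable Pc BM adapted_sp_qv).
have qb : (\int[P]_w (sp_qv H a b w)%:E <= (C ^+ 2 * (b - a))%:E)%E.
  rewrite -[leRHS](integral_prob_cst P); apply: ge0_le_integral => //=.
  - by move=> w _; rewrite lee_fin sp_qv_ge0.
  - exact/measurable_EFinP.
  - by move=> w _; rewrite lee_fin; exact: sp_qv_le.
have iq : P.-integrable [set: Omega] (EFin \o sp_qv H a b).
  apply/integrableP; split; first exact/measurable_EFinP.
  under eq_integral do rewrite /= ger0_norm ?sp_qv_ge0//.
  exact: le_lt_trans qb (ltry _).
have i2 : P.-integrable [set: Omega] (EFin \o (fun w => sp_incr H a b w ^+ 2)).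
  apply/integrableP; split; first by apply/measurable_EFinP; exact: measurable_funX.
  under eq_integral do rewrite /= ger0_norm ?sqr_ge0//.
  by rewrite sp_square; exact: le_lt_trans qb (ltry _).
have ic (c : R) : P.-integrable [set: Omega] (EFin \o cst c) by exact: finite_measure_integrable_cst.
have i1 : P.-integrable [set: Omega] (EFin \o sp_incr H a b).
  apply: (@le_integrable _ _ _ _ _ _ _ (EFin \o (fun w => 1 + sp_incr H a b w ^+ 2))) => //.
  - exact/measurable_EFinP.
  - move=> w _ /=; rewrite lee_fin [X in _ <= X]ger0_norm; last by rewrite addr_ge0 ?sqr_ge0.
    by rewrite ler_norml; apply/andP; split; have := sqr_ge0 (sp_incr H a b w - 1);
     have := sqr_ge0 (sp_incr H a b w + 1); rewrite !expr2; nra.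
  - exact: (integrableD measurableT (ic 1) i2).
split => //.
have key : (\int[P]_w ((1 + sp_incr H a b w) ^+ 2)%:E = \int[P]_w (1 + sp_qv H a b w)%:E)%E.
  have := @step_square _ _ _ P B Pc BM u N xi u_ge0 u_le mxi (cst 1) (cst 1)
    (measurable_cst _) (measurable_cst _) (fun=> ler01) N (leqnn N).
  under eq_integral do rewrite /= mul1r -incrE.
  by under [X in _ = X -> _]eq_integral do rewrite /= mul1r expr1n -qvE.
have e1 : (\int[P]_w ((1 + sp_incr H a b w) ^+ 2)%:E =
   1 + (2%:E * \int[P]_w (sp_incr H a b w)%:E + \int[P]_w (sp_incr H a b w ^+ 2)%:E))%E.
  under eq_integral => w _.
    have -> : ((1 + sp_incr H a b w) ^+ 2)%:E =
      (1%:E + (2%:E * (sp_incr H a b w)%:E + (sp_incr H a b w ^+ 2)%:E))%E.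
      by rewrite -EFinM -!EFinD; congr (_%:E); ring.
    over.
  rewrite integralD//; last 2 first.
  - exact: (ic 1).
  - by apply: integrableD => //; exact: integrableZl.
  by rewrite (integral_prob_cst P 1) integralD// ?integralZl//; exact: integrableZl.
have e2 : (\int[P]_w (1 + sp_qv H a b w)%:E = 1 + \int[P]_w (sp_qv H a b w)%:E)%E.
  under eq_integral do rewrite EFinD.
  by rewrite integralD//; [rewrite (integral_prob_cst P 1)|exact: (ic 1)].
move: key; rewrite e1 e2 sp_square.
have f1 := integrable_fin_num measurableT i1; have f2 := integrable_fin_num measurableT iq.
move: f1 f2; rewrite /comp.
case: (\int[P]_w (sp_incr H a b w)%:E)%E => // x _.
case: (\int[P]_w (sp_qv H a b w)%:E)%E => // y _.
by rewrite -EFinM -!EFinD => -[h]; congr (_%:E); lra.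
Qed.
End one_process.

Lemma sp_wf_map t T (phi : R -> R) H : sp_wf P B t T H -> measurable_fun [set: R] phi ->
  (forall K, exists K', forall x, `|x| <= K -> `|phi x| <= K') -> sp_wf P B t T (sp_map phi H).
Proof.
move=> [h1 h2 h3 h4 [K h5]] mphi phib; split => //.
  move=> i iN D mD; rewrite comp_preimage; apply: h4 => //.
  by rewrite -[X in measurable X]setTI; exact: mphi.
by have [K' HK'] := phib K; exists K' => i w iN; apply: HK'; exact: h5.
Qed.
End simple_processes.

(** * Countable dense sets of times *)

Section dense_times.
Context {R : realType}.
Implicit Types a b : R.

(** An enumeration of the rationals of [0, 1]. Indices that decode to nothing, or to a rational
    outside, get the default 0, which is itself a point of [0, 1]. *)
Definition rat01 (n : nat) : R :=
  if (unpickle n : option rat) is Some q then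
    if (0 <= q <= 1) then ratr q else 0 else 0.

Definition dense_time a b n : R := a + (b - a) * rat01 n.

Lemma rat01_itv n : 0 <= rat01 n <= 1.
Proof.
rewrite /rat01; case: unpickle => [q|]; last by rewrite lexx ler01.
case: ifPn => [/andP[q0 q1]|_]; last by rewrite lexx ler01.
by rewrite ler0q q0 -(rmorph1 (ratr : rat -> R)) ler_rat.
Qed.

Lemma dense_time_itv a b n : a <= b -> a <= dense_time a b n <= b.
Proof.
move=> ab; have /andP[h0 h1] := rat01_itv n; rewrite /dense_time; apply/andP; split; nra.
Qed.

(** The approximation is from the left: a process evaluated at that dense time is then known at time
    [u]. *)
Lemma dense_timeP a b u e : a <= u <= b -> 0 < e ->
  exists n, `|dense_time a b n - u| < e /\ dense_time a b n <= u.
Proof.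
move=> /andP[au ub] e0.
have [lt|ge] := ltP a u; last first.
  have -> : u = a by apply/eqP; rewrite eq_le ge au.
  exists (pickle (0 : rat)); rewrite /dense_time /rat01 pickleK /= rmorph0.
  by rewrite mulr0 addr0 subrr normr0.
have ab : 0 < b - a by lra.
pose l := Num.max 0 ((u - e - a) / (b - a)).
have l0 : 0 <= l by rewrite /l le_max lexx.
have lr : l < (u - a) / (b - a).
  have h1 : 0 < (u - a) / (b - a) by apply: divr_gt0; lra.
  have h2 : (u - e - a) / (b - a) < (u - a) / (b - a) by rewrite ltr_pM2r ?invr_gt0//; lra.
  by rewrite /l; minmax_lra.
have [q] := rat_in_itvoo lr; rewrite in_itv/= => /andP[lq qr].
have q0 : 0 <= q by rewrite -(ler0q R); lra.
have r1 : (u - a) / (b - a) <= 1 by rewrite ler_pdivrMr// mul1r; lra.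
have q1 : q <= 1 by rewrite -(ler_rat R) rmorph1; lra.
exists (pickle q); rewrite /dense_time /rat01 pickleK /= q0 q1.
have h1 : (b - a) * ratr q < u - a by rewrite -ltr_pdivlMl// mulrC.
have h2 : u - e - a < (b - a) * ratr q.
  rewrite -ltr_pdivrMl// mulrC; apply: le_lt_trans lq.
  by rewrite /l le_max lexx orbT.
by split; [rewrite ltr_norml; apply/andP; split; lra|lra].
Qed.

Lemma within_continuous_dist (A : set R) (f : R -> R) u e : {within A, continuous f} ->
  A u -> 0 < e -> exists2 r, 0 < r & forall y, A y -> `|u - y| < r -> `|f u - f y| < e.
Proof.
move=> cf Au e0; have := cf; rewrite subspace_continuousP => /(_ u Au) /cvgrPdist_lt /(_ _ e0) h.
have /nbhs_ballP[r r0 hr] : \forall t \near nbhs u, A t -> `|f u - f t| < e by exact: h.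
by exists r => // y Ay uy; apply: hr.
Qed.

Lemma dense_le (f : R -> R) a b c : a <= b -> {within `[a, b], continuous f} ->
  (forall n, f (dense_time a b n) <= c) -> forall u, a <= u <= b -> f u <= c.
Proof.
move=> ab cf H u uab; rewrite leNgt; apply/negP => cu.
have uI : `[a, b]%classic u by rewrite /= in_itv.
have e0 : 0 < f u - c by rewrite subr_gt0.
have [r r0 hr] := within_continuous_dist cf uI e0.
have [n [hn _]] := dense_timeP uab r0.
have := hr (dense_time a b n); rewrite /= in_itv/= dense_time_itv// distrC => /(_ isT hn).
by rewrite ltr_norml => /andP[_]; have := H n; lra.
Qed.
End dense_times.

Ltac abs_lra := repeat match goal with
  | |- context [Order.min ?x ?y] =>
    lazymatch x with context [Order.min _ _] => fail | context [Order.max _ _] => fail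
    | _ => lazymatch y with context [Order.min _ _] => fail | context [Order.max _ _] => fail
    | _ => case: (leP x y) => ? end end
  | |- context [Order.max ?x ?y] =>
    lazymatch x with context [Order.min _ _] => fail | context [Order.max _ _] => fail
    | _ => lazymatch y with context [Order.min _ _] => fail | context [Order.max _ _] => fail
    | _ => case: (leP x y) => ? end end
  end; repeat match goal with |- context [ `|?x| ] => case: (ger0P x) => ? end; lra.

(** * Truncation of values *)

Section clip.
Context {R : realType}.
Implicit Types C x : R.
Definition clip C x : R := Num.max (- C) (Num.min x C).

Lemma clip_bound C x : 0 <= C -> `|clip C x| <= C.
Proof. by move=> C0; rewrite /clip ler_norml; minmax_lra. Qed.

Lemma clip0 C : 0 <= C -> clip C 0 = 0.
Proof. by move=> C0; rewrite /clip; minmax_lra. Qed.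

Lemma clip_dist C x h : `|h| <= C -> `|clip C x - h| <= `|x - h|.
Proof.
rewrite ler_norml => /andP[h1 h2]; rewrite /clip; abs_lra.
Qed.

(** The clip is the nearest point of [[- C, C]], an interval that contains [h]. What clipping cuts
    off is thus small wherever [x] approximates a bounded integrand. *)
Lemma clip_resid C x h : `|h| <= C -> `|x - clip C x| <= `|x - h|.
Proof.
rewrite ler_norml => /andP[h1 h2]; rewrite /clip; abs_lra.
Qed.

Lemma measurable_clip C : measurable_fun [set: R] (clip C).
Proof. by apply: measurable_maxr => //; exact: measurable_minr. Qed.
End clip.

Section measurable_helpers.
Context d (Omega : measurableType d) (R : realType).

Lemma measurable_ltr_set (f : Omega -> R) c : measurable_fun [set: Omega] f ->
  measurable [set w | c < f w].
Proof. by move=> mf; rewrite -[X in measurable X]setTI; exact: measurable_fun_ltr. Qed.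

Lemma measurable_ler_set (f : Omega -> R) c : measurable_fun [set: Omega] f ->
  measurable [set w | f w <= c].
Proof. by move=> mf; rewrite -[X in measurable X]setTI; exact: measurable_fun_ler. Qed.

Lemma measurable_ltr_norm_set (f : Omega -> R) c : measurable_fun [set: Omega] f ->
  measurable [set w | c < `|f w|].
Proof. by move=> mf; apply: (@measurable_ltr_set (fun w => `|f w|)); exact: measurableT_comp. Qed.

Lemma measurable_forall_le (X : R -> Omega -> R) a b c : a <= b ->
  (forall w, {within `[a, b], continuous (X ^~ w)}) ->
  (forall u, a <= u <= b -> measurable_fun [set: Omega] (X u)) ->
  measurable [set w | forall u, a <= u <= b -> X u w <= c].
Proof.
move=> ab cX mX.
rewrite (_ : [set w | _] = \bigcap_n [set w | X (dense_time a b n) w <= c]); last first.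
  apply/seteqP; split => w /= h; first by move=> n _; apply: h; exact: dense_time_itv.
  by apply: dense_le => // n; exact: h.
apply: bigcapT_measurable => n; apply: measurable_ler_set; apply: mX.
exact: dense_time_itv.
Qed.

Lemma measurable_param_integral (a b : R) (f : R * Omega -> R) :
  measurable_fun (`[a, b] `*` [set: Omega]) f ->
  (forall p, 0 <= f p) ->
  measurable_fun [set: Omega]
    (fun w => \int[lebesgue_measure]_(u in `[a, b]) (f (u, w))%:E)%E.
Proof.
move=> mf f0.
pose g (p : measurableTypeR R * Omega) : \bar R :=
  ((fun p => (f p)%:E) \_ (`[a, b] `*` [set: Omega])) p.
have mg : measurable_fun [set: measurableTypeR R * Omega] g.
  apply/(measurable_restrictT _ _).1; last exact/measurable_EFinP.
  by apply: measurableX => //; exact: measurable_itv.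
have g0 p : (0 <= g p)%E.
  by rewrite /g patchE; case: ifP => // _; rewrite lee_fin.
have := @measurable_fun_fubini_tonelli_G _ _ _ _ R (@lebesgue_measure R) g mg g0.
apply: eq_measurable_fun => w _; rewrite /fubini_G [RHS]integral_mkcond.
apply: eq_integral => u _; rewrite /g !patchE.
case: ifPn; case: ifPn => //.
- by move=> /negP h; rewrite inE/= => -[h1 _]; exfalso; apply: h; rewrite inE.
- by rewrite inE/= => h; move=> /negP h1; exfalso; apply: h1; rewrite inE/=.
Qed.

End measurable_helpers.

(** * Replacing the approximating simple processes by bounded ones *)

Section clip_approximation.
Context d (Omega : measurableType d) (R : realType) (P : probability Omega R).
Variable B : R -> Omega -> R.
Hypothesis Pc : measure_is_complete P.
Hypothesis BM : brownian_motion P B.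
Local Notation OF s := (g_sigma_algebraType (filtration_gen P B 0 s)).
Local Notation lam := (@lebesgue_measure R).

Lemma cvg_in_probP (Z : nat -> Omega -> \bar R) (e del : R) : cvg_in_prob P Z ->
  0 < e -> 0 < del ->
  exists N, forall n, (N <= n)%N -> (P [set w | (e%:E < `|Z n w|)%E] <= del%:E)%E.
Proof.
move=> cZ e0 del0; have /fine_cvgP[_ /cvgrPdist_lt/(_ _ del0)] := cZ _ e0.
have /fine_cvgP[[N0 _ fN0] _] := cZ _ e0.
move=> [N _ hN]; exists (maxn N0 N) => n; rewrite geq_max => /andP[n0 n1].
have := hN n n1; rewrite /= sub0r normrN => h.
rewrite -(fineK (fN0 n n0)) lee_fin.
by apply: le_trans (ler_norm _) (ltW h).
Qed.

Variables (t T : R) (H M : R -> Omega -> R) (Hn : nat -> simple_process Omega R).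
Hypothesis t0 : 0 <= t.
Hypothesis mH : measurable_fun (`[t, T] `*` [set: Omega]) (fun p : R * Omega => H p.1 p.2).
Hypothesis wf : forall n, sp_wf P B t T (Hn n).
Hypothesis cH : cvg_in_prob P (fun n w => \int[lam]_(u in `[t, T])
              ((sp_val (Hn n) u w - H u w) ^+ 2)%:E)%E.

Definition sp_err n w : \bar R :=
  (\int[lam]_(u in `[t, T]) ((sp_val (Hn n) u w - H u w) ^+ 2)%:E)%E.

Lemma sp_coef_measurable n i : (i < sp_size (Hn n))%N -> t <= T ->
  measurable_fun [set: Omega] (sp_coef (Hn n) i).
Proof.
move=> iN tT; apply: (@adapted_measurable _ _ _ _ _ Pc BM (sp_time (Hn n) i)).
by apply/measurable_wrtP; have [_ _ _ + _] := wf n; exact.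
Qed.

Lemma sp_val_measurable n : t <= T ->
  measurable_fun [set: R * Omega] (fun p : R * Omega => sp_val (Hn n) p.1 p.2).
Proof.
move=> tT; apply: measurable_sum => i; apply: measurable_funM.
  by apply: measurableT_comp measurable_snd; apply: sp_coef_measurable.
apply: measurableT_comp measurable_fst; apply: measurable_indic; exact: measurable_itv.
Qed.

Lemma sp_err_measurable n : t <= T -> measurable_fun [set: Omega] (sp_err n).
Proof.
move=> tT.
apply: (@measurable_param_integral _ _ _ t T (fun p => (sp_val (Hn n) p.1 p.2 - H p.1 p.2) ^+ 2)).
  apply: measurable_funX; apply: measurable_funB => //.
  by apply: measurable_funTS; exact: sp_val_measurable.
by move=> p; exact: sqr_ge0.
Qed.

Lemma sp_err_ge0 n w : (0 <= sp_err n w)%E.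
Proof. by apply: integral_ge0 => u _; rewrite lee_fin sqr_ge0. Qed.

Lemma process_section_measurable w : measurable_fun `[t, T] (H ^~ w).
Proof.
apply: (@measurable_comp _ _ _ _ _ _ (`[t, T] `*` [set: Omega]) (fun p : R * Omega => H p.1 p.2)
  `[t, T]%classic (fun u => (u, w))) => //.
- by apply: measurableX => //; exact: measurable_itv.
- by move=> p /= [u uI <-].
- by apply: measurable_funTS; exact: measurable_fun_pair.
Qed.

Variables (s C : R) (Gam : set Omega).
Hypothesis ts : t <= s <= T.
Hypothesis C0 : 0 <= C.
Hypothesis mGam : measurable Gam.
Hypothesis HC : forall w u, Gam w -> t <= u <= s -> `|H u w| <= C.

Local Notation Hc n := (sp_map (clip C) (Hn n)).

Lemma sp_wf_clip n : sp_wf P B t T (Hc n).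
Proof.
apply: sp_wf_map => //; first exact: measurable_clip.
by move=> K; exists C => x _; exact: clip_bound.
Qed.

Lemma sub_integral_err n w (f : R -> R) : Gam w ->
  (forall x h, `|h| <= C -> f x ^+ 2 <= (x - h) ^+ 2) -> measurable_fun [set: R] f ->
  (\int[lam]_(u in `[t, s]) (f (sp_val (Hn n) u w) ^+ 2)%:E <= sp_err n w)%E.
Proof.
move=> Gw fx mf; have /andP[t_s sT] := ts.
have mv : measurable_fun [set: R] (fun u => sp_val (Hn n) u w).
  apply: (measurableT_comp (sp_val_measurable n (le_trans t_s sT)) (measurable_fun_pair _ _)) => //.
have mHs : measurable_fun `[t, s] (H ^~ w).
  apply: measurable_funS (process_section_measurable w) => //.
  by move=> u /=; rewrite !in_itv/= => /andP[-> /le_trans ->].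
have mdiff : measurable_fun `[t, T] (fun u => ((sp_val (Hn n) u w - H u w) ^+ 2)%:E).
  apply/measurable_EFinP; apply: measurable_funX; apply: measurable_funB.
    exact: measurable_funTS.
  exact: process_section_measurable.
apply: (@le_trans _ _ (\int[lam]_(u in `[t, s]) ((sp_val (Hn n) u w - H u w) ^+ 2)%:E)%E).
  apply: ge0_le_integral => //=.
  - by move=> u _; rewrite lee_fin sqr_ge0.
  - apply/measurable_EFinP; apply: measurable_funTS; apply: measurable_funX.
    exact: measurableT_comp mf mv.
  - apply: measurable_funS mdiff => //.
    by move=> u /=; rewrite !in_itv/= => /andP[-> /le_trans ->].
  - by move=> u; rewrite in_itv/= => uts; rewrite lee_fin fx// HC.
apply: ge0_subset_integral => //=; first by move=> u _; rewrite lee_fin sqr_ge0.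
by move=> u /=; rewrite !in_itv/= => /andP[-> /le_trans ->].
Qed.

(** The integral of [Hn] splits into the clipped integral and that of [x - clip C x]. On [Gam] the
    integrand is bounded by [C], so the quadratic variation of the second part is at most the
    approximation error [sp_err], and Lenglart's inequality makes this part small. *)
Lemma clip_incr_cvg (e del : R) : measurable_fun [set: Omega] (M s) ->
  cvg_in_prob P (fun n w => (sp_integral B (Hn n) s w - M s w)%:E) ->
  0 < e -> 0 < del -> exists N, forall n, (N <= n)%N ->
  (P (Gam `&` [set w | (e < `|sp_incr B (Hc n) t s w - M s w|)%R]) <= del%:E)%E.
Proof.
move=> mM cM e0 del0; have /andP[t_s sT] := ts; have tT := le_trans t_s sT.
(* Chosen so that the Lenglart term [eta / (e / 2) ^+ 2] equals [del / 3]. *)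
pose eta := (e / 2) ^+ 2 * (del / 3).
have e20 : 0 < e / 2 by lra.
have eta0 : 0 < eta by rewrite mulr_gt0 ?exprn_gt0//; lra.
have [N1 hN1] := cvg_in_probP cM e20 (ltac:(lra) : 0 < del / 3).
have [N2 hN2] := cvg_in_probP cH (ltac:(lra) : 0 < eta / 2) (ltac:(lra) : 0 < del / 3).
exists (maxn N1 N2) => n; rewrite geq_max => /andP[/hN1 h1 /hN2 h2].
pose K := sp_map (fun x => x - clip C x) (Hn n).
have mK : measurable_fun [set: R] (fun x : R => x - clip C x).
  by apply: measurable_funB => //; exact: measurable_clip.
have wfK : sp_wf P B t T K.
  apply: sp_wf_map => //.
  move=> k; exists (k + C) => x xk; apply: le_trans (ler_normB _ _) _.
  by apply: lerD => //; exact: clip_bound.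
have split w : sp_integral B (Hn n) s w = sp_incr B (Hc n) t s w + sp_incr B K t s w.
  rewrite -[LHS]subr0 -(sp_integral_start w (wf n)) sp_integralB//.
  rewrite /sp_incr -big_split /=; apply: eq_bigr => i _.
  by rewrite -mulrDl addrCA subrr addr0.
have ad (H0 : simple_process Omega R) : sp_wf P B t T H0 -> measurable_fun [set: Omega] (sp_incr B H0 t s).
  move=> wf0; apply: (adapted_measurable Pc BM (s := s)).
  exact: (adapted_sp_incr t0 wf0 (lexx t) t_s sT).
have adq : measurable_fun [set: Omega] (sp_qv K t s).
  apply: (adapted_measurable Pc BM (s := s)).
  exact: (adapted_sp_qv wfK t_s sT).
have mI := ad _ (sp_wf_clip n); have mIK := ad _ wfK.
pose E1 := [set w | e / 2 < `|sp_integral B (Hn n) s w - M s w|].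
pose E2 := Gam `&` [set w | e / 2 < `|sp_incr B K t s w|].
have mE1 : measurable E1.
  apply: measurable_ltr_norm_set; apply: measurable_funB => //.
  by rewrite (_ : sp_integral _ _ _ = fun w => sp_incr B (Hc n) t s w + sp_incr B K t s w); [exact: measurable_funD|exact/funext].
have mE2 : measurable E2 by apply: measurableI => //; exact: measurable_ltr_norm_set.
apply: (@le_trans _ _ (P (E1 `|` E2))).
  apply: le_measure; rewrite ?inE//.
  - by apply: measurableI => //; apply: measurable_ltr_norm_set; exact: measurable_funB.
  - exact: measurableU.
  - move=> w [Gw /= ew]; rewrite /E1 /E2 /= split.
    have [lt|le] := ltP (e / 2) (`|sp_incr B K t s w|); first by right.
    left; move: ew le.
    set p := sp_incr B _ t s w; set q := sp_incr B K t s w => ew le.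
    have := ler_normD (p + q - M s w) (- q); rewrite normrN.
    have -> : p + q - M s w - q = p - M s w by ring.
    by lra.
apply: (le_trans (measureU2 _ mE1 mE2)).
have h1' : (P E1 <= (del / 3)%:E)%E.
  apply: le_trans h1; rewrite le_eqVlt; apply/orP; left; apply/eqP; congr (P _).
have h2' : (P (Gam `&` [set w | (eta < sp_qv K t s w)%R]) <= (del / 3)%:E)%E.
  apply: le_trans h2; apply: le_measure; rewrite ?inE//.
  - by apply: measurableI => //; exact: measurable_ltr_set.
  - have me : measurable_fun [set: Omega] (fun w => `|sp_err n w|)%E.
      by apply: measurableT_comp => //; exact: sp_err_measurable.
    have := emeasurable_fun_o_infty measurableT me (eta / 2)%:E.
    by rewrite setTI.
  - move=> w [Gw /= qw]; rewrite gee0_abs ?sp_err_ge0// -/(sp_err n w).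
    apply: lt_le_trans (sub_integral_err n Gw _ mK); last first.
      move=> x h hC; have := clip_resid x hC.
      by rewrite -[X in _ -> _ <= X]ger0_norm ?sqr_ge0// normrX => /sqr_le_norm.
    rewrite (_ : (fun u : R => _) = fun u => (sp_val K u w ^+ 2)%:E); last first.
      by apply/funext => u; rewrite (sp_val_map _ _ (wf n)) ?clip0 ?subrr.
    rewrite (sp_val_integral w wfK (lexx t) t_s sT) lte_fin.
    by lra.
have h3 := sp_lenglart Pc BM t0 wfK (lexx t) t_s e20 (ltW eta0) mGam.
have e3 : eta / (e / 2) ^+ 2 = del / 3.
  by rewrite /eta mulrAC divff ?mul1r// expf_neq0// gt_eqF.
rewrite e3 in h3.
apply: (@le_trans _ _ ((del / 3)%:E + ((del / 3)%:E + (del / 3)%:E))%E).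
  by apply: leeD => //; apply: le_trans h3 _; rewrite leeD2r.
by rewrite -!EFinD lee_fin; lra.
Qed.


(** On [Gam] the squares of the clipped process and of [H] differ by at most [2 * C] times the
    distance. Young's inequality with weight [kap] splits this into a constant that integrates to at
    most [e / 2] and a multiple of the approximation error, which is at most [e / 2] off a rare
    event. *)
Lemma clip_qv_cvg (c th e del : R) : 0 <= c -> 0 <= th ->
  (forall w u, Gam w -> t <= u <= s -> c - th <= H u w ^+ 2 <= c + th) ->
  0 < e -> 0 < del -> exists N, forall n, (N <= n)%N ->
  (P (Gam `&` [set w | (th * (s - t) + e < `|sp_qv (Hc n) t s w - c * (s - t)|)%R]) <= del%:E)%E.
Proof.
move=> c0 th0 Hc2 e0 del0; have /andP[t_s sT] := ts; have tT := le_trans t_s sT.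
(* 2 C |p - q| <= (p - q)^2 / kap + kap C^2 *)
pose D := C ^+ 2 * (s - t) + 1.
have D0 : 0 < D by rewrite ltr_wpDl// mulr_ge0 ?sqr_ge0// subr_ge0.
pose kap := e / 2 / D.
have kap0 : 0 < kap by rewrite divr_gt0//; lra_only e0.
have kapC : kap * (C ^+ 2 * (s - t)) <= e / 2.
  have : kap * D = e / 2 by rewrite /kap divfK// gt_eqF.
  by rewrite /D mulrDr => h; lra_only h kap0.
have [N hN] := cvg_in_probP cH (mulr_gt0 kap0 (divr_gt0 e0 (ltr0n _ 2))) del0.
exists N => n /hN; apply: le_trans; apply: le_measure; rewrite ?inE//.
- apply: measurableI => //; apply: measurable_ltr_norm_set; apply: measurable_funB => //.
  apply: (adapted_measurable Pc BM (s := s)).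
  exact: (adapted_sp_qv (sp_wf_clip n) t_s sT).
- have me : measurable_fun [set: Omega] (fun w => `|sp_err n w|)%E.
    by apply: measurableT_comp => //; exact: sp_err_measurable.
  have := emeasurable_fun_o_infty measurableT me (kap * (e / 2))%:E.
  by rewrite setTI.
move=> w [Gw /= qw]; rewrite gee0_abs ?sp_err_ge0// -/(sp_err n w).
rewrite ltNge; apply/negP => errle; move: qw; apply/negP; rewrite -leNgt.
have mv : measurable_fun [set: R] (fun u => sp_val (Hc n) u w).
  rewrite (_ : (fun u => _) = fun u => clip C (sp_val (Hn n) u w)); last first.
    by apply/funext => u; rewrite (sp_val_map _ _ (wf n)) ?clip0.
  apply: measurableT_comp; first exact: measurable_clip.
  exact: (measurableT_comp (sp_val_measurable n (le_trans t_s sT)) (measurable_fun_pair _ _)).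
have mvn : measurable_fun [set: R] (fun u => sp_val (Hn n) u w).
  exact: (measurableT_comp (sp_val_measurable n (le_trans t_s sT)) (measurable_fun_pair _ _)).
have sub : `[t, s] `<=` (`[t, T] : set R).
  by move=> u /=; rewrite !in_itv/= => /andP[-> /le_trans ->].
have mHs : measurable_fun `[t, s] (H ^~ w).
  by apply: measurable_funS (process_section_measurable w).
have mdiff : measurable_fun `[t, s] (fun u => ((sp_val (Hn n) u w - H u w) ^+ 2)%:E).
  apply/measurable_EFinP; apply: measurable_funX; apply: measurable_funB => //.
  exact: measurable_funTS.
have mdiff' : measurable_fun `[t, s] (fun u => (kap^-1%:E * ((sp_val (Hn n) u w - H u w) ^+ 2)%:E)%E).
  by apply: emeasurable_funM.
have mclip : measurable_fun `[t, s] (fun u => (sp_val (Hc n) u w ^+ 2)%:E).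
  by apply/measurable_EFinP; apply: measurable_funX; exact: measurable_funTS.
have errs : (\int[lam]_(u in `[t, s]) (kap^-1%:E * ((sp_val (Hn n) u w - H u w) ^+ 2)%:E) <= (e / 2)%:E)%E.
  rewrite ge0_integralZl//; last 2 first.
  - by move=> u _; rewrite lee_fin sqr_ge0.
  - by rewrite lee_fin invr_ge0 ltW.
  apply: (@le_trans _ _ (kap^-1%:E * (kap * (e / 2))%:E)%E).
    apply: lee_wpmul2l; first by rewrite lee_fin invr_ge0 ltW.
    apply: le_trans errle; apply: ge0_subset_integral => //=.
    - apply/measurable_EFinP; apply: measurable_funX; apply: measurable_funB.
        exact: measurable_funTS.
      exact: process_section_measurable.
    - by move=> u _; rewrite lee_fin sqr_ge0.
  by rewrite -EFinM mulKf ?gt_eqF.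
have icst (k : R) : (\int[lam]_(u in `[t, s]) k%:E = (k * (s - t))%:E)%E.
  rewrite integral_cst// EFinM; congr (_ * _)%E.
  apply: (etrans (@lebesgue_measure_itv R `[t, s])); rewrite /= lte_fin.
  by case: ltP => [_|ge]; [rewrite EFinB|congr (_%:E); lra].
have pw u : t <= u <= s -> `|sp_val (Hc n) u w ^+ 2 - H u w ^+ 2| <=
    kap * C ^+ 2 + kap^-1 * (sp_val (Hn n) u w - H u w) ^+ 2.
  move=> uts; rewrite (sp_val_map _ _ (wf n)) ?clip0//.
  have hC := HC Gw uts; have cb := clip_bound (sp_val (Hn n) u w) C0.
  have := clip_dist (sp_val (Hn n) u w) hC.
  move: (sp_val (Hn n) u w) cb => p cb; set q := clip C p in cb *; set h := H u w in hC *.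
  move=> cd.
  have s1 : (q - h) ^+ 2 <= (p - h) ^+ 2.
    by move: cd => /sqr_le_norm; rewrite real_normK ?num_real.
  apply: (@le_trans _ _ (kap * C ^+ 2 + kap^-1 * (q - h) ^+ 2)); last first.
    by rewrite lerD2l ler_wpM2l// invr_ge0 ltW.
  have qh : `|q + h| <= 2 * C by apply: le_trans (ler_normD _ _) _; lra_only cb hC.
  rewrite subr_sqr normrM -(real_normK (num_real (q - h))).
  apply: (@le_trans _ _ (`|q - h| * (2 * C))); first exact: ler_wpM2l.
  have : 0 <= (kap * C - `|q - h|) ^+ 2 / kap by rewrite divr_ge0 ?sqr_ge0// ltW.
  have -> : (kap * C - `|q - h|) ^+ 2 / kap = kap * C ^+ 2 + kap^-1 * `|q - h| ^+ 2 - `|q - h| * (2 * C).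
    by field; rewrite gt_eqF.
  by move=> h1; lra_only h1.
have c0' := c0.
have kC : 0 <= kap * C ^+ 2 by rewrite mulr_ge0 ?sqr_ge0// ltW.
have up : ((sp_qv (Hc n) t s w)%:E <= ((c + th + kap * C ^+ 2) * (s - t))%:E + (e / 2)%:E)%E.
  rewrite -(sp_val_integral w (sp_wf_clip n) (lexx t) t_s sT).
  apply: (@le_trans _ _ (\int[lam]_(u in `[t, s]) ((c + th + kap * C ^+ 2)%:E +
     kap^-1%:E * ((sp_val (Hn n) u w - H u w) ^+ 2)%:E))%E).
    apply: ge0_le_integral => //=.
    - by move=> u _; rewrite lee_fin sqr_ge0.
    - by apply: emeasurable_funD.
    - move=> u; rewrite in_itv/= => uts; rewrite -EFinM -EFinD lee_fin.
      have := pw u uts; rewrite ler_norml => /andP[_ h3].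
      by have /andP[h1 h2] := Hc2 w u Gw uts; lra_only h1 h2 h3.
  rewrite ge0_integralD//; last 2 first.
  - by move=> u _; rewrite lee_fin; lra_only c0' th0 kC.
  - by move=> u _; rewrite mule_ge0// lee_fin ?sqr_ge0// invr_ge0 ltW.
  by rewrite icst leeD2l.
have lo : ((c * (s - t))%:E <= (sp_qv (Hc n) t s w)%:E + ((th + kap * C ^+ 2) * (s - t))%:E + (e / 2)%:E)%E.
  rewrite -(sp_val_integral w (sp_wf_clip n) (lexx t) t_s sT) -icst.
  apply: (@le_trans _ _ (\int[lam]_(u in `[t, s]) ((sp_val (Hc n) u w ^+ 2)%:E + (th + kap * C ^+ 2)%:E +
     kap^-1%:E * ((sp_val (Hn n) u w - H u w) ^+ 2)%:E))%E).
    apply: ge0_le_integral => //=.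
    - apply: emeasurable_funD => //; exact: emeasurable_funD.
    - move=> u; rewrite in_itv/= => uts; rewrite -EFinM -!EFinD lee_fin.
      have := pw u uts; rewrite ler_norml => /andP[h3 _].
      by have /andP[h1 h2] := Hc2 w u Gw uts; lra_only h1 h2 h3.
  rewrite ge0_integralD//; last 3 first.
  - by move=> u _; rewrite -EFinD lee_fin addr_ge0 ?sqr_ge0//; lra_only th0 kC.
  - exact: emeasurable_funD.
  - by move=> u _; rewrite mule_ge0// lee_fin ?sqr_ge0// invr_ge0 ltW.
  rewrite ge0_integralD//; last 2 first.
  - by move=> u _; rewrite lee_fin sqr_ge0.
  - by move=> u _; rewrite lee_fin; lra_only c0' th0 kC.
  by rewrite icst leeD2l.
move: up lo; rewrite -!EFinD !lee_fin ler_norml => up lo.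
by apply/andP; split; [lra_only lo kapC|lra_only up kapC].
Qed.

End clip_approximation.

(** * Expectations with real values *)

Section means.
Context d (Omega : measurableType d) (R : realType) (P : probability Omega R).
Implicit Types (f g : Omega -> R) (A : set Omega).

(** Integrability bundled with a real value of the expectation, so that linear combinations and
    comparisons are carried out in [R]. *)
Definition mean_is f m := P.-integrable [set: Omega] (EFin \o f) /\
  (\int[P]_w (f w)%:E = m%:E)%E.

Lemma mean_isP f : P.-integrable [set: Omega] (EFin \o f) ->
  mean_is f (fine (\int[P]_w (f w)%:E)).
Proof. by move=> fi; split => //; rewrite fineK//; exact: integrable_fin_num. Qed.

Lemma mean_is_add f g m k : mean_is f m -> mean_is g k -> mean_is (fun w => f w + g w) (m + k).
Proof.
move=> [fi fm] [gi gk]; split; first exact: (integrableD measurableT fi gi).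
by rewrite EFinD -fm -gk -integralD//; under eq_integral do rewrite EFinD.
Qed.

Lemma mean_is_scale a f m : mean_is f m -> mean_is (fun w => a * f w) (a * m).
Proof.
move=> [fi fm]; split; first exact: (integrableZl measurableT a fi).
by rewrite EFinM -fm -integralZl//; under eq_integral do rewrite EFinM.
Qed.

Lemma mean_is_cst (c : R) : mean_is (fun=> c) c.
Proof.
split; last exact: integral_prob_cst.
by apply: (finite_measure_integrable_cst P c).
Qed.

Lemma mean_is_indic A : measurable A -> mean_is \1_A (fine (P A)).
Proof.
move=> mA; split; last by rewrite integral_indic// setIT fineK// fin_num_measure.
by apply: integrable_indic => //; rewrite ltey_eq fin_num_measure.
Qed.

Lemma mean_is_le f g m k : (forall w, f w <= g w) -> mean_is f m -> mean_is g k -> m <= k.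
Proof.
move=> fg [fi fm] [gi gk]; rewrite -lee_fin -fm -gk; apply: le_integral => //.
by move=> w _; rewrite lee_fin.
Qed.

Lemma mean_is_bounded f c : measurable_fun [set: Omega] f -> (forall w, `|f w| <= c) ->
  mean_is f (fine (\int[P]_w (f w)%:E)).
Proof.
move=> mf fc; apply: mean_isP.
apply: (@le_integrable _ _ _ P _ measurableT _ (EFin \o cst c)).
- exact/measurable_EFinP.
- by move=> w _ /=; rewrite lee_fin (le_trans (fc w))// ler_norm.
- by have [] := mean_is_cst c.
Qed.

Lemma mean_is_ge0 f m : measurable_fun [set: Omega] f -> (forall w, 0 <= f w) ->
  (\int[P]_w (f w)%:E <= m%:E)%E -> exists2 k, mean_is f k & k <= m.
Proof.
move=> mf f0 fm.
have fi : P.-integrable [set: Omega] (EFin \o f).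
  apply/integrableP; split; first exact/measurable_EFinP.
  under eq_integral do rewrite /= ger0_norm//.
  by apply: le_lt_trans fm _; rewrite ltry.
have h := mean_isP fi; exists (fine (\int[P]_w (f w)%:E)) => //.
by rewrite -lee_fin; have [_ <-] := h.
Qed.
End means.

(** * Moments of a stochastic integral on an event where it is bounded *)

Section local_moments.
Context d (Omega : measurableType d) (R : realType) (P : probability Omega R).
Variable B : R -> Omega -> R.
Hypothesis Pc : measure_is_complete P.
Hypothesis BM : brownian_motion P B.
Local Notation lam := (@lebesgue_measure R).
Variables (t T : R) (H M : R -> Omega -> R) (Hn : nat -> simple_process Omega R).
Hypothesis t0 : 0 <= t.
Hypothesis mH : measurable_fun (`[t, T] `*` [set: Omega]) (fun p : R * Omega => H p.1 p.2).
Hypothesis wf : forall n, sp_wf P B t T (Hn n).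
Hypothesis cH : cvg_in_prob P (fun n w => \int[lam]_(u in `[t, T])
              ((sp_val (Hn n) u w - H u w) ^+ 2)%:E)%E.
Variables (s C K : R) (Gam : set Omega).
Hypothesis ts : t <= s <= T.
Hypothesis C0 : 0 <= C.
Hypothesis mGam : measurable Gam.
Hypothesis HC : forall w u, Gam w -> t <= u <= s -> `|H u w| <= C.
Hypothesis mM : measurable_fun [set: Omega] (M s).
Hypothesis cM : cvg_in_prob P (fun n w => (sp_integral B (Hn n) s w - M s w)%:E).
Hypothesis MK : forall w, Gam w -> `|M s w| <= K.
Hypothesis K0 : 0 <= K.

Local Notation Hc n := (sp_map (clip C) (Hn n)).
Local Notation S n := (sp_incr B (Hc n) t s).
Let pG := fine (P (~` Gam)).

Lemma clip_coef_le n i w : (i < sp_size (Hc n))%N -> `|sp_coef (Hc n) i w| <= C.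
Proof. by move=> _; exact: clip_bound. Qed.

Lemma clip_incr_measurable n : measurable_fun [set: Omega] (S n).
Proof.
have /andP[t_s sT] := ts; apply: (adapted_measurable Pc BM (s := s)).
exact: (adapted_sp_incr t0 (sp_wf_clip wf C0 n) (lexx t) t_s sT).
Qed.

Lemma clip_qv_measurable n : measurable_fun [set: Omega] (sp_qv (Hc n) t s).
Proof.
have /andP[t_s sT] := ts; apply: (adapted_measurable Pc BM (s := s)).
exact: (adapted_sp_qv (sp_wf_clip wf C0 n) t_s sT).
Qed.

Lemma clip_incr_mean0 n : mean_is P (S n) 0.
Proof.
have /andP[t_s sT] := ts.
have [h1 h2] := sp_mean0 Pc BM t0 (sp_wf_clip wf C0 n) (lexx t) t_s sT (@clip_coef_le n).
by split.
Qed.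

Lemma clip_incr_mean2 n : exists2 q, mean_is P (fun w => S n w ^+ 2) q &
  mean_is P (sp_qv (Hc n) t s) q /\ q <= C ^+ 2 * (s - t).
Proof.
have /andP[t_s sT] := ts; have wfc := sp_wf_clip wf C0 n.
have qv0 := sp_qv_ge0 wfc t_s.
have qvC := sp_qv_le wfc (lexx t) t_s sT (@clip_coef_le n).
have h : (\int[P]_w (sp_qv (Hc n) t s w)%:E <= (C ^+ 2 * (s - t))%:E)%E.
  rewrite -[leRHS](integral_prob_cst P); apply: ge0_le_integral => //=.
  - by move=> w _; rewrite lee_fin.
  - by apply/measurable_EFinP; exact: clip_qv_measurable.
  - by move=> w _; rewrite lee_fin.
have [q hq qC] := mean_is_ge0 (clip_qv_measurable n) qv0 h.
have sq := sp_square Pc BM t0 wfc (lexx t) t_s.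
exists q => //; split; last by rewrite sq; have [_ ->] := hq.
have h2 : (\int[P]_w (S n w ^+ 2)%:E <= (C ^+ 2 * (s - t))%:E)%E by rewrite sq.
have [k hk _] := mean_is_ge0 (measurable_funX 2 (clip_incr_measurable n)) (fun w => sqr_ge0 _) h2.
by have [] := hk.
Qed.

Lemma clip_incr_mean4 n : exists2 q, mean_is P (fun w => S n w ^+ 4) q &
  q <= 3 * C ^+ 4 * (s - t) ^+ 2.
Proof.
have /andP[t_s sT] := ts; apply: mean_is_ge0.
- by apply: measurable_funX; exact: clip_incr_measurable.
- by move=> w; rewrite (_ : 4%N = (2 * 2)%N)// exprM sqr_ge0.
- exact: (sp_power4_le Pc BM t0 (sp_wf_clip wf C0 n) (lexx t) t_s sT (@clip_coef_le n)).
Qed.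

Let bad n (e : R) := Gam `&` [set w | (e < `|S n w - M s w|)%R].

Let mbad n e : measurable (bad n e).
Proof.
apply: measurableI => //; apply: measurable_ltr_norm_set; apply: measurable_funB => //.
exact: clip_incr_measurable.
Qed.

Let badP (e : R) : 0 < e -> exists n, fine (P (bad n e)) <= e.
Proof.
move=> e0; have [N hN] := clip_incr_cvg Pc BM t0 mH wf cH ts C0 mGam HC mM cM e0 e0.
by exists N; rewrite -lee_fin fineK ?fin_num_measure//; exact: hN.
Qed.

Lemma indicEb (A : set Omega) w : (A w /\ \1_A w = 1 :> R) \/ (~ A w /\ \1_A w = 0 :> R).
Proof.
have [Aw|nAw] := pselect (A w); [left|right]; split => //.
  by rewrite indicE mem_set.
by rewrite indicE memNset.
Qed.

(** The clipped integral [S n] has mean 0, so its mean on [Gam] is minus its mean off [Gam]. There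
    the bound [|S| <= kap * S ^+ 2 + (2 * kap)^-1] trades the variance against the probability of
    leaving [Gam], which in the application is of order (s - t)^2. The sign [z] gives both one-sided
    bounds. *)
Lemma first_moment (kap : R) (z : R) : 0 < kap -> `|z| = 1 -> 
  exists2 m, mean_is P (fun w => M s w * \1_Gam w) m &
  z * m <= kap * (C ^+ 2 * (s - t)) + (2 * kap)^-1 * pG.
Proof.
move=> kap0 z1.
have K0' := K0.
have MG w : `|M s w * \1_Gam w| <= K.
  by case: (indicEb Gam w) => -[Gw ->]; rewrite ?mulr1 ?mulr0 ?normr0//; exact: MK.
have mMG : measurable_fun [set: Omega] (fun w => M s w * \1_Gam w).
  by apply: measurable_funM.
have hm := mean_is_bounded P mMG MG; eexists; first exact: hm.
set m := fine _ in hm *.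
rewrite leNgt; apply/negP => lt.
(* The error terms below add up to at most [e * L], and [e] is chosen so that this is [gap / 2]. *)
pose L := K + (2 * kap)^-1 + 1.
have k2 : 0 < (2 * kap)^-1 by rewrite invr_gt0 mulr_gt0.
pose gap := z * m - (kap * (C ^+ 2 * (s - t)) + (2 * kap)^-1 * pG).
have gap0 : 0 < gap by rewrite subr_gt0.
have L0 : 0 < L by rewrite /L; move: K0 k2; lra.
have [n hn] := badP (divr_gt0 gap0 (ltac:(lra) : 0 < 2 * L)).
set e := gap / (2 * L) in hn.
have e0 : 0 < e by rewrite divr_gt0// mulr_gt0.
have eL : e * (2 * L) = gap by rewrite /e divfK// gt_eqF// mulr_gt0.
have [q hq [_ qC]] := clip_incr_mean2 n.
have hG := mean_is_indic P (measurableC mGam).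
have hB := mean_is_indic P (mbad n e).
have pw w : z * (M s w * \1_Gam w) <= z * S n w + (kap * S n w ^+ 2 +
    (e + ((2 * kap)^-1 * \1_(~` Gam) w + (K + (2 * kap)^-1) * \1_(bad n e) w))).
  have sq : `|S n w| <= kap * S n w ^+ 2 + (2 * kap)^-1.
    have : 0 <= (2 * kap * `|S n w| - 1) ^+ 2 / (4 * kap).
      by rewrite divr_ge0 ?sqr_ge0// mulr_ge0// ltW.
    have -> : (2 * kap * `|S n w| - 1) ^+ 2 / (4 * kap) =
       kap * `|S n w| ^+ 2 - `|S n w| + (2 * kap)^-1 / 2 by field; rewrite gt_eqF.
    by rewrite real_normK ?num_real//; lra.
  have nz x : z * x <= `|x| by rewrite (le_trans (ler_norm _))// normrM z1 mul1r.
  have nz' x : - (z * x) <= `|x| by rewrite -mulrN (le_trans (nz _))// normrN.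
  have sq0 : 0 <= kap * S n w ^+ 2 by rewrite mulr_ge0 ?sqr_ge0// ltW.
  case: (indicEb Gam w) => -[Gw E1]; case: (indicEb (~` Gam) w) => -[Gw' E2] //;
    case: (indicEb (bad n e) w) => -[Bw E3]; rewrite E1 E2 E3.
  - by have := MK Gw; have := nz (M s w); have := nz' (S n w); lra.
  - have le : `|S n w - M s w| <= e by rewrite leNgt; apply/negP => ?; apply: Bw.
    by have := nz' (S n w - M s w); lra.
  - by have [] := Bw.
  - by have := nz' (S n w); lra.
have := mean_is_le pw (mean_is_scale z hm) (mean_is_add (mean_is_scale z (clip_incr_mean0 n))
   (mean_is_add (mean_is_scale kap hq) (mean_is_add (mean_is_cst P e)
   (mean_is_add (mean_is_scale (2 * kap)^-1 hG) (mean_is_scale (K + (2 * kap)^-1) hB))))).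
rewrite mulr0 add0r -/pG.
have h1 : kap * q <= kap * (C ^+ 2 * (s - t)) by rewrite ler_wpM2l// ltW.
have h2 : (K + (2 * kap)^-1) * fine (P (bad n e)) <= (K + (2 * kap)^-1) * e.
  by rewrite ler_wpM2l//; lra.
have : e * L = gap / 2 by rewrite -eL; lra.
by rewrite /L /gap; lra.
Qed.

Variables (c th : R).
Hypothesis c0 : 0 <= c.
Hypothesis th0 : 0 <= th.
Hypothesis Hcth : forall w u, Gam w -> t <= u <= s -> c - th <= H u w ^+ 2 <= c + th.

(** By the isometry the second moment of [S n] is the mean of its quadratic variation, close to
    [c * (s - t)] on [Gam]. For the lower bound the part of E S^2 off [Gam] must be removed: S^2 <=
    S^4 + 1 there, and the fourth moment is of order (s - t)^2. *)
Lemma second_moment : exists2 m, mean_is P (fun w => M s w ^+ 2 * \1_Gam w) m &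
  c * (s - t) - (th * (s - t) + (1 + c * (s - t)) * pG + 3 * C ^+ 4 * (s - t) ^+ 2) <= m <=
  c * (s - t) + (th * (s - t) + C ^+ 2 * (s - t) * pG).
Proof.
have /andP[t_s sT] := ts; have K0' := K0.
have K21 : 0 <= 2 * K + 1 by rewrite addr_ge0// mulr_ge0.
have D0 : 0 <= s - t by rewrite subr_ge0.
have cD0 : 0 <= c * (s - t) by rewrite mulr_ge0.
have tD0 : 0 <= th * (s - t) by rewrite mulr_ge0.
have CD0 : 0 <= C ^+ 2 * (s - t) by rewrite mulr_ge0 ?sqr_ge0.
have MG w : `|M s w ^+ 2 * \1_Gam w| <= K ^+ 2.
  case: (indicEb Gam w) => -[Gw ->]; rewrite ?mulr1 ?mulr0 ?normr0 ?sqr_ge0// normrX.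
  by rewrite ler_pXn2r ?nnegrE//; exact: MK.
have mMG : measurable_fun [set: Omega] (fun w => M s w ^+ 2 * \1_Gam w).
  by apply: measurable_funM => //; exact: measurable_funX.
have hm := mean_is_bounded P mMG MG; eexists; first exact: hm.
set m := fine _ in hm *.
have pG0 : 0 <= pG by rewrite /pG fine_ge0.
have hG := mean_is_indic P (measurableC mGam).
(* Every error due to the approximation is at most a constant times [e]; [small] then lets [e] tend
   to 0. *)
have [Lw L0 HL] : exists2 L, 0 < L & forall e, 0 < e -> e <= 1 ->
  c * (s - t) - (th * (s - t) + (1 + c * (s - t)) * pG + 3 * C ^+ 4 * (s - t) ^+ 2) - L * e <= m <=
  c * (s - t) + (th * (s - t) + C ^+ 2 * (s - t) * pG) + L * e.
  exists (2 * K + 1 + K ^+ 2 + 1 + C ^+ 2 * (s - t) + c * (s - t) + 2).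
    by move: K0 (sqr_ge0 K) cD0 CD0; lra.
  move=> e e0 e1.
  have [N1 hN1] := clip_incr_cvg Pc BM t0 mH wf cH ts C0 mGam HC mM cM e0 e0.
  have [N2 hN2] := clip_qv_cvg Pc BM mH wf cH ts C0 mGam HC c0 th0 Hcth e0 e0.
  pose n := maxn N1 N2.
  have pb : fine (P (bad n e)) <= e.
    by rewrite -lee_fin fineK ?fin_num_measure//; apply: hN1; exact: leq_maxl.
  pose bq := Gam `&` [set w | (th * (s - t) + e < `|sp_qv (Hc n) t s w - c * (s - t)|)%R].
  have mbq : measurable bq.
    apply: measurableI => //; apply: measurable_ltr_norm_set; apply: measurable_funB => //.
    exact: clip_qv_measurable.
  have pbq : fine (P bq) <= e.
    by rewrite -lee_fin fineK ?fin_num_measure//; apply: hN2; exact: leq_maxr.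
  have [q hq [hqv qC]] := clip_incr_mean2 n; have [p4 hp4 p4C] := clip_incr_mean4 n.
  have hB := mean_is_indic P (mbad n e); have hbq := mean_is_indic P mbq.
  have qv0 := sp_qv_ge0 (sp_wf_clip wf C0 n) t_s.
  have qvC := sp_qv_le (sp_wf_clip wf C0 n) (lexx t) t_s sT (@clip_coef_le n).
  have qup w : sp_qv (Hc n) t s w <= (c * (s - t) + th * (s - t) + e) +
      (C ^+ 2 * (s - t) * \1_(~` Gam) w + C ^+ 2 * (s - t) * \1_bq w).
    have := qvC w.
    case: (indicEb (~` Gam) w) => -[Gw E2]; case: (indicEb bq w) => -[Bw E3]; rewrite E2 E3; try lra_only cD0 tD0 CD0 e0.
    have le : `|sp_qv (Hc n) t s w - c * (s - t)| <= th * (s - t) + e.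
      by rewrite leNgt; apply/negP => ?; apply: Bw; split => //; exact: contrapT.
    by move: le; rewrite ler_norml => /andP[]; lra_only e0.
  have qlo w : c * (s - t) - th * (s - t) - e <= sp_qv (Hc n) t s w +
      (c * (s - t) * \1_(~` Gam) w + c * (s - t) * \1_bq w).
    have := qv0 w.
    case: (indicEb (~` Gam) w) => -[Gw E2]; case: (indicEb bq w) => -[Bw E3]; rewrite E2 E3; try lra_only cD0 tD0 CD0 e0.
    have le : `|sp_qv (Hc n) t s w - c * (s - t)| <= th * (s - t) + e.
      by rewrite leNgt; apply/negP => ?; apply: Bw; split => //; exact: contrapT.
    by move: le; rewrite ler_norml => /andP[]; lra_only e0.
  have up w : M s w ^+ 2 * \1_Gam w <= S n w ^+ 2 + (e * (2 * K + 1) + K ^+ 2 * \1_(bad n e) w).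
    have s0 := sqr_ge0 (S n w); have K2 := sqr_ge0 K; have eK : 0 <= e * (2 * K + 1) by rewrite mulr_ge0// ltW.
    case: (indicEb Gam w) => -[Gw E1]; case: (indicEb (bad n e) w) => -[Bw E3]; rewrite E1 E3; try lra_only s0 K2 eK.
    + have : M s w ^+ 2 <= K ^+ 2 by rewrite -(real_normK (num_real (M s w))) ler_pXn2r ?nnegrE//; exact: MK.
      by move=> h; lra_only s0 eK h.
    + have le : `|S n w - M s w| <= e by rewrite leNgt; apply/negP => ?; apply: Bw.
      have := MK Gw; move: le; rewrite !ler_norml => /andP[a1 a2] /andP[a3 a4].
      by nra.
  have lo w : S n w ^+ 2 <= M s w ^+ 2 * \1_Gam w + (S n w ^+ 4 + (\1_(~` Gam) w + (\1_(bad n e) w + e * (2 * K + 1)))).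
    have s0 := sqr_ge0 (M s w); have eK : 0 <= e * (2 * K + 1) by rewrite mulr_ge0// ltW.
    have s4 : S n w ^+ 2 <= S n w ^+ 4 + 1.
      by rewrite (_ : 4%N = (2 * 2)%N)// exprM; have := sqr_ge0 (S n w ^+ 2 - 1); have := sqr_ge0 (S n w ^+ 2); lra_only e0.
    have s40 : 0 <= S n w ^+ 4 by rewrite (_ : 4%N = (2 * 2)%N)// exprM sqr_ge0.
    case: (indicEb Gam w) => -[Gw E1]; case: (indicEb (~` Gam) w) => -[Gw' E2] //;
      case: (indicEb (bad n e) w) => -[Bw E3]; rewrite E1 E2 E3; try lra_only s0 s4 s40 eK.
    + have le : `|S n w - M s w| <= e by rewrite leNgt; apply/negP => ?; apply: Bw.
      have := MK Gw; move: le; rewrite !ler_norml => /andP[a1 a2] /andP[a3 a4].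
      by nra.
  have P1 := mean_is_le up hm (mean_is_add hq (mean_is_add (mean_is_cst P _) (mean_is_scale _ hB))).
  have P2 := mean_is_le lo hq (mean_is_add hm (mean_is_add hp4 (mean_is_add hG (mean_is_add hB (mean_is_cst P _))))).
  have P3 := mean_is_le qup hqv (mean_is_add (mean_is_cst P _) (mean_is_add (mean_is_scale _ hG) (mean_is_scale _ hbq))).
  have P4 := mean_is_le qlo (mean_is_cst P _) (mean_is_add hqv (mean_is_add (mean_is_scale _ hG) (mean_is_scale _ hbq))).
  rewrite -/pG in P2 P3 P4.
  have b1 : K ^+ 2 * fine (P (bad n e)) <= K ^+ 2 * e by rewrite ler_wpM2l ?sqr_ge0.
  have b2 : C ^+ 2 * (s - t) * fine (P bq) <= C ^+ 2 * (s - t) * e by rewrite ler_wpM2l.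
  have b3 : c * (s - t) * fine (P bq) <= c * (s - t) * e by rewrite ler_wpM2l.
  have b4 : 0 <= K ^+ 2 * e by rewrite mulr_ge0 ?sqr_ge0// ltW.
  have b5 : 0 <= c * (s - t) * e by rewrite mulr_ge0// ltW.
  have b6 : 0 <= C ^+ 2 * (s - t) * e by rewrite mulr_ge0// ltW.
  have b7 : 0 <= K * e by rewrite mulr_ge0// ltW.
  by apply/andP; split; lra_only b1 b2 b3 b4 b5 b6 b7 P1 P2 P3 P4 pb pbq qC p4C pG0 cD0 tD0 CD0 e0 e1.
have small (x y : R) : (forall e, 0 < e -> e <= 1 -> x <= y + Lw * e) -> x <= y.
  move=> h; apply/ler_addgt0Pr => e e0.
  have e1 : 0 < Num.min 1 (e / Lw) by rewrite lt_min ltr01 divr_gt0.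
  have e2 : Num.min 1 (e / Lw) <= 1 by rewrite ge_min lexx.
  apply: le_trans (h _ e1 e2) _; rewrite lerD2l.
  by rewrite mulrC -ler_pdivlMr// ge_min lexx orbT.
by apply/andP; split; apply: small => e e0 e1; have /andP[] := HL e e0 e1; lra.
Qed.

End local_moments.

(** * Joint measurability of continuous processes *)

Section continuous_process.
Context d (Omega : measurableType d) (R : realType).

Lemma nat_inv_lt (e : R) : 0 < e -> exists n : nat, n.+1%:R^-1 < e.
Proof.
move=> e0; exists (Num.trunc e^-1).
rewrite -[ltRHS]invrK ltf_pV2 ?posrE ?invr_gt0//.
exact: truncnS_gt.
Qed.

(** The set where [X > c] is a countable union of rectangles: a short time interval starting at a
    dense time, times the event that the path is at least [c + l.+1%:R^-1] on the whole of that
    interval. *)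
Lemma continuous_process_measurable (X : R -> Omega -> R) a b : a <= b ->
  (forall w, {within `[a, b], continuous (X ^~ w)}) ->
  (forall u, a <= u <= b -> measurable_fun [set: Omega] (X u)) ->
  measurable_fun (`[a, b] `*` [set: Omega]) (fun p : R * Omega => X p.1 p.2).
Proof.
move=> ab cX mX.
apply: (measurability (@RGenOInfty.G R)) => [|/= _ [_] [c] -> <-].
  exact: RGenOInfty.measurableE.
pose q k m := Num.min b (dense_time a b k + m.+1%:R^-1).
have qb k m : dense_time a b k <= q k m.
  by have /andP[h1 h2] := dense_time_itv k ab; rewrite /q le_min h2 lerDl invr_ge0 ler0n.
pose F k m l : set (R * Omega) := `[dense_time a b k, q k m]%classic `*`
  [set w | forall u, dense_time a b k <= u <= q k m -> - X u w <= - (c + l.+1%:R^-1)].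
rewrite (_ : _ `&` _ = \bigcup_k \bigcup_m \bigcup_l F k m l); last first.
  apply/seteqP; split => -[u w] /=.
    rewrite !in_itv/= andbT => -[[uab _] cu].
    have [l hl] := nat_inv_lt (divr_gt0 (ltac:(by rewrite subr_gt0) : 0 < X u w - c) (ltr0n _ 2)).
    have uI : `[a, b]%classic u by rewrite /= in_itv.
    have [r r0 hr] := within_continuous_dist (cX w) uI (divr_gt0 (ltac:(by rewrite subr_gt0) : 0 < X u w - c) (ltr0n _ 2)).
    have [m hm] := nat_inv_lt r0.
    have m0 : 0 < m.+1%:R^-1 :> R by rewrite invr_gt0 ltr0n.
    have [k [hk ku]] := dense_timeP uab m0.
    have /andP[k1 k2] := dense_time_itv k ab; have /andP[au ub] := uab.
    exists k => //; exists m => //; exists l => //; split => /=.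
      move: hk; rewrite ltr_norml => /andP[hk1 hk2].
      by rewrite in_itv/= ku andTb /q le_min ub andTb -lerBlDl -[u - _]opprB lerNl ltW.
    move=> v /andP[kv]; rewrite /q le_min => /andP[vb vm].
    have vI : `[a, b]%classic v by rewrite /= in_itv/= vb (le_trans k1).
    have uv : `|u - v| < r.
      move: (m.+1%:R^-1) hm m0 hk vm => em hm m0; rewrite !ltr_norml => /andP[p1 p2] vm.
      by apply/andP; split; [lra_only ku vm hm|lra_only p1 kv hm].
    have := hr v vI uv; rewrite ltr_norml => /andP[p1 p2].
    by move: (l.+1%:R^-1) hl => el hl; lra_only hl p1 p2.
  move=> [k _ [m _ [l _ [/=]]]]; rewrite !in_itv/= => /andP[ku um] h.
  have /andP[k1 k2] := dense_time_itv k ab.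
  have l0 : 0 < l.+1%:R^-1 :> R by rewrite invr_gt0 ltr0n.
  split; first by split => //; rewrite (le_trans k1 ku)/= (le_trans um)// /q ge_min lexx.
  by rewrite andbT; have := h u; rewrite ku um => /(_ isT); move: (l.+1%:R^-1) l0 => el l0 h1; lra_only l0 h1.
apply: bigcupT_measurable => k; apply: bigcupT_measurable => m; apply: bigcupT_measurable => l.
have /andP[k1 k2] := dense_time_itv k ab.
have sub u : dense_time a b k <= u <= q k m -> a <= u <= b.
  by rewrite /q le_min => /andP[h1 /andP[-> _]]; rewrite (le_trans k1).
apply: measurableX; first exact: measurable_itv.
apply: (@measurable_forall_le _ _ _ (fun u w => - X u w)) => //.
- move=> w; have cN : {within `[a, b], continuous (fun u => - X u w)}.
    by move=> x; apply: cvgN; exact: cX.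
  apply: continuous_subspaceW cN => u /=; rewrite !in_itv/=; exact: sub.
- by move=> u /sub uab; apply: measurableT_comp => //; exact: mX.
Qed.
End continuous_process.

(** * Borel measurability of a function from its composition with a continuous path *)

Section borel_from_path.
Context (R : realType).
Implicit Types (f z : R -> R).

(** With [h y] the hitting time of level [y], continuity gives z (h y) = y for [y] between [x] and
    [z s]. The map [h] is nondecreasing, hence Borel, and f = (f o z) o h on that interval. *)
Lemma borel_hitting f z T x s : {within `[0, T], continuous z} ->
  measurable_fun `[0, T] (f \o z) -> z 0 = x -> 0 <= s <= T -> x < z s ->
  measurable_fun `[x, z s] f.
Proof.
move=> cz mfz z0 /andP[s0 sT] xzs.
(* Capping the level at [z s] keeps [D y] nonempty for every real [y], so that [h] is nondecreasing
   on the whole line. *)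
pose D (y : R) := [set u | 0 <= u <= s /\ Num.min y (z s) <= z u].
pose h (y : R) := inf (D y).
have Ds y : D y s by split; [rewrite s0 lexx|rewrite ge_min lexx orbT].
have Dlb y : lbound (D y) 0 by move=> u [/andP[]].
have Dinf y : has_inf (D y) by split; [exists s|exists 0].
have h0 y : 0 <= h y by apply: lb_le_inf; [exists s|exact: Dlb].
have hs y : h y <= s by apply: ge_inf; [exists 0; exact: Dlb|exact: Ds].
have h_nd : {homo h : y y' / y <= y'}.
  move=> y y' yy'; apply: lb_le_inf; first by exists s.
  move=> u [us yu]; apply: ge_inf; first by exists 0; exact: Dlb.
  split => //; apply: le_trans yu; minmax_lra.
have hI y : `[0, T]%classic (h y) by rewrite /= in_itv/= h0 (le_trans (hs y)).
have zh y : x <= y <= z s -> z (h y) = y.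
  move=> /andP[xy yz]; apply/eqP; rewrite eq_le; apply/andP; split; rewrite leNgt; apply/negP => lt.
    have [r r0 hr] := within_continuous_dist cz (hI y) (ltac:(by rewrite subr_gt0) : 0 < z (h y) - y).
    have hp : 0 < h y.
      by rewrite lt_neqAle h0 andbT; apply/eqP => e; move: lt; rewrite -e z0 ltNge xy.
    pose u := Num.max 0 (h y - r / 2).
    have u0 : 0 <= u by rewrite /u le_max lexx.
    have uh : u < h y by rewrite /u; minmax_lra.
    have uI : `[0, T]%classic u by rewrite /= in_itv/= u0 (le_trans (ltW uh))// (le_trans (hs y)).
    have ud : `|h y - u| < r by rewrite ger0_norm ?subr_ge0 ?ltW// /u; minmax_lra.
    have := hr u uI ud; rewrite ltr_norml => /andP[_ hu].
    have : h y <= u.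
      apply: ge_inf; first by exists 0; exact: Dlb.
      split; first by rewrite u0 (le_trans (ltW uh)).
      by rewrite ge_min; apply/orP; left; lra_only hu.
    by rewrite leNgt uh.
  have [r r0 hr] := within_continuous_dist cz (hI y) (ltac:(by rewrite subr_gt0) : 0 < y - z (h y)).
  have [u [/andP[u0 us] yu] uh] := inf_adherent r0 (Dinf y).
  have hu : h y <= u.
    apply: ge_inf; first by exists 0; exact: Dlb.
    by split => //; rewrite u0.
  have uI : `[0, T]%classic u by rewrite /= in_itv/= u0 (le_trans us).
  have ud : `|h y - u| < r by move: uh; rewrite -/(h y) ltr_norml => {}uh; apply/andP; split; [lra_only uh|lra_only hu r0].
  have := hr u uI ud; rewrite ltr_norml => /andP[hu1 hu2].
  by move: yu; rewrite (min_idPl yz) => h1; lra_only h1 hu1.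
have : measurable_fun `[x, z s] ((f \o z) \o h).
  apply: (measurable_comp (F := `[0, T]%classic)) => //.
  - by move=> _ [y _ <-].
  - by apply: nondecreasing_measurable => //; exact: measurable_itv.
by apply: eq_measurable_fun => y; rewrite inE/= in_itv/= => /zh ->.
Qed.

Lemma borel_path f z T x s : {within `[0, T], continuous z} ->
  measurable_fun `[0, T] (f \o z) -> z 0 = x -> 0 <= s <= T -> z s != x ->
  measurable_fun (if x < z s then `[x, z s]%classic else `[z s, x]%classic) f.
Proof.
move=> cz mfz z0 sT zx; case: ltP => xz; first exact: borel_hitting mfz z0 sT xz.
have lt : - x < - z s by rewrite ltrN2 lt_neqAle zx.
have : measurable_fun `[- x, - z s] (fun y => f (- y)).
  apply: (@borel_hitting (fun y => f (- y)) (fun u => - z u) T (- x) s) => //.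
  - by move=> u; apply: cvgN; exact: cz.
  - by apply: eq_measurable_fun mfz => u _ /=; rewrite opprK.
  - by rewrite z0.
move=> mf; apply: (@eq_measurable_fun _ _ _ _ _ ((fun y => f (- y)) \o -%R)).
  by move=> y _ /=; rewrite opprK.
apply: (measurable_comp (F := `[- x, - z s]%classic)) => //.
- by move=> _ [y /= ] + <-; rewrite !in_itv/= => /andP[h1 h2]; apply/andP; split; lra.
Qed.

Definition rat_nth n : R := if (unpickle n : option rat) is Some q then ratr q else 0.

Lemma rat_nthP (x y : R) : x < y -> exists n, x < rat_nth n < y.
Proof.
move=> xy; have [q] := rat_in_itvoo xy; rewrite in_itv/= => h.
by exists (pickle q); rewrite /rat_nth pickleK.
Qed.

Let A f (q : R) := [set x | q <= x /\ measurable_fun `[q, x] f].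

Let A_down f q x y : A f q x -> q <= y -> y <= x -> A f q y.
Proof.
move=> [qx mf] qy yx; split => //; apply: measurable_funS mf => //.
by move=> u /=; rewrite !in_itv/= => /andP[-> /le_trans ->].
Qed.

(** [A f q] is an interval. Either it has a largest element, at which its definition applies, or it
    is exhausted by the segments from [q] to its rational elements. *)
Let A_measurable f q : measurable (A f q) /\ measurable_fun (A f q) f.
Proof.
have mA : measurable (A f q).
  apply: is_interval_measurable => x y Ax Ay u /andP[xu uy].
  by apply: A_down Ay _ uy; case: Ax => qx _; exact: le_trans xu.
split => //.
have [[m [Am hm]]|no] := pselect (exists m, A f q m /\ forall x, A f q x -> x <= m).
  rewrite (_ : A f q = `[q, m]%classic); first by case: Am.
  apply/seteqP; split => x /=; rewrite in_itv/=.
    by move=> Ax; rewrite hm// andbT; case: Ax.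
  by move=> /andP[qx xm]; exact: A_down Am qx xm.
rewrite (_ : A f q = \bigcup_n (if `[< A f q (rat_nth n) >] then `[q, rat_nth n]%classic else set0)); last first.
  apply/seteqP; split => x.
    move=> Ax; have [y Ay xy] : exists2 y, A f q y & x < y.
      apply: contrapT => h; apply: no; exists x; split => // y Ay.
      by rewrite leNgt; apply/negP => xy; apply: h; exists y.
    have [n /andP[xn ny]] := rat_nthP xy; exists n => //.
    have An : A f q (rat_nth n) by apply: A_down Ay _ (ltW ny); case: Ax => qx _; lra.
    by rewrite asboolT//= in_itv/= (ltW xn) andbT; case: Ax.
  move=> [n _]; case: asboolP => // An /=; rewrite in_itv/= => /andP[qx xn].
  exact: A_down An qx xn.
apply/measurable_fun_bigcup => n; first by case: asboolP.
by case: asboolP => [[]|_] //; exact: measurable_fun_set0.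
Qed.

(** Each point of [I] is an endpoint of a nondegenerate segment on which [f] is measurable, and such
    a segment contains a rational. The maximal intervals of measurability to the right and to the
    left of rationals are countably many; those to the left are obtained by reflection. *)
Lemma borel_cover f (I : set R) : measurable I ->
  (forall x, I x -> exists2 y, y != x &
     measurable_fun (if x < y then `[x, y]%classic else `[y, x]%classic) f) ->
  measurable_fun I f.
Proof.
move=> mI H.
pose g (y : R) := f (- y).
pose E n := A f (rat_nth n) `|` -%R @^-1` A g (- rat_nth n).
have mN q : measurable (-%R @^-1` A g q).
  by rewrite -[X in measurable X]setTI; apply: oppr_measurable => //; case: (A_measurable g q).
have mE n : measurable (E n) by apply: measurableU => //; case: (A_measurable f (rat_nth n)).
have fE n : measurable_fun (E n) f.
  apply/measurable_funU => //; first by case: (A_measurable f (rat_nth n)).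
  split; first by case: (A_measurable f (rat_nth n)).
  apply: (@eq_measurable_fun _ _ _ _ _ (g \o -%R)).
    by move=> y _ /=; rewrite /g opprK.
  have [m1 m2] := A_measurable g (- rat_nth n).
  apply: (measurable_comp m1) => //.
  by move=> _ [y /= h <-].
apply: (@measurable_funS _ _ _ _ (\bigcup_n E n)).
- exact: bigcupT_measurable.
- move=> x Ix; have [y yx] := H x Ix; case: ltP => xy mf.
    have [n /andP[n1 n2]] := rat_nthP xy; exists n => //; right; split; first by rewrite lerN2 ltW.
    apply: (measurable_comp (F := `[x, rat_nth n]%classic)).
    + exact: measurable_itv.
    + by move=> _ [u /= + <-]; rewrite !in_itv/= => /andP[h1 h2]; apply/andP; split; lra.
    + apply: measurable_funS mf => //.
      by move=> u /=; rewrite !in_itv/= => /andP[-> h]; rewrite (le_trans h)// ltW.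
    + exact: oppr_measurable.
  have lt : y < x by rewrite lt_neqAle yx.
  have [n /andP[n1 n2]] := rat_nthP lt; exists n => //; left; split; first exact: ltW.
  apply: measurable_funS mf => //.
  by move=> u /=; rewrite !in_itv/= => /andP[h ->]; rewrite (le_trans _ h)// ltW.
- by apply/measurable_fun_bigcup.
Qed.

(** The closure adds at most one point above and one below the interval, and any function is
    measurable on a singleton. *)
Lemma closure_interval_measurable f (I : set R) : is_interval I -> measurable_fun I f ->
  measurable (closure I) /\ measurable_fun (closure I) f.
Proof.
move=> itvI mf; have mI := is_interval_measurable itvI.
have mcl : measurable (closure I) by apply: closed_measurable; exact: closed_closure.
split => //.
pose U := closure I `&` ubound I; pose L := closure I `&` lbound I.
have U1 : exists a, U `<=` [set a].
  have [[a [ca Ua]]|no] := pselect (exists a, U a); last first.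
    by exists 0 => x Ux; exfalso; apply: no; exists x.
  exists a => x [cx Ux] /=.
  have key y (c : R) : closure I y -> ubound I c -> y <= c.
    move=> cy Uz; rewrite leNgt; apply/negP => zy.
    have [u [Iu zu]] : I `&` `]c, +oo[%classic !=set0.
      by apply: cy; apply: open_nbhs_nbhs; split; [exact: interval_open|rewrite /= in_itv/= zy].
    by move: zu; rewrite /= in_itv/= andbT; have := Uz u Iu; lra.
  by apply/eqP; rewrite eq_le !key.
have L1 : exists a, L `<=` [set a].
  have [[a [ca Ua]]|no] := pselect (exists a, L a); last first.
    by exists 0 => x Ux; exfalso; apply: no; exists x.
  exists a => x [cx Ux] /=.
  have key y (c : R) : closure I y -> lbound I c -> c <= y.
    move=> cy Uz; rewrite leNgt; apply/negP => zy.
    have [u [Iu zu]] : I `&` `]-oo, c[%classic !=set0.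
      by apply: cy; apply: open_nbhs_nbhs; split; [exact: interval_open|rewrite /= in_itv/= zy].
    by move: zu; rewrite /= in_itv/=; have := Uz u Iu; lra.
  by apply/eqP; rewrite eq_le !key.
have [a Ua] := U1; have [b Lb] := L1.
apply: (@measurable_funS _ _ _ _ (I `|` ([set a] `|` [set b]))).
- by apply: measurableU => //; apply: measurableU; exact: measurable_set1.
- move=> x cx; have [Ix|nIx] := pselect (I x); first by left.
  right; have [h|h] := pselect (exists2 u, I u & x < u); last first.
    left; apply: Ua; split => // u Iu; rewrite leNgt; apply/negP => xu; apply: h; by exists u.
  right; apply: Lb; split => // u Iu; rewrite leNgt; apply/negP => ux; apply: nIx.
  have [v Iv xv] := h; apply: (itvI _ _ Iu Iv); by rewrite !ltW.
- apply/measurable_funU => //; first by apply: measurableU; exact: measurable_set1.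
  split => //; apply/measurable_funU; [exact: measurable_set1|exact: measurable_set1|].
  by split; exact: measurable_fun_set1.
Qed.
End borel_from_path.

(** * Almost sure modifications under a complete measure *)

Section complete_measure.
Context d (Omega : measurableType d) (R : realType) (P : probability Omega R).
Hypothesis Pc : measure_is_complete P.

Lemma ae_eq_measure (A A' : set Omega) : measurable A' ->
  {ae P, forall w, A w <-> A' w} -> measurable A /\ P A = P A'.
Proof.
move=> mA' [N [mN PN sN]].
have n1 : measurable (A `\` A').
  apply: Pc; exists N; split => // w [Aw nA']; apply: sN => /= h; apply: nA'; exact/h.
have n2 : measurable (A' `\` A).
  apply: Pc; exists N; split => // w [Aw nA']; apply: sN => /= h; apply: nA'; exact/h.
have E : A = (A' `\` (A' `\` A)) `|` (A `\` A').
  apply/seteqP; split => w.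
    move=> Aw; have [A'w|nA'w] := pselect (A' w); [left|right] => //; split => //; by case.
  by move=> [[A'w h]|[//]]; apply: contrapT => nAw; apply: h.
have mA : measurable A by rewrite E; apply: measurableU => //; apply: measurableD.
split => //; apply/eqP; rewrite eq_le; apply/andP; split.
  apply: (@le_trans _ _ (P (A' `|` N))).
    apply: le_measure; rewrite ?inE//; first exact: measurableU.
    move=> w Aw; have [A'w|nA'w] := pselect (A' w); [by left|right].
    by apply: sN => /= h; apply: nA'w; exact/h.
  by apply: (@le_trans _ _ (P A' + P N)%E); [exact: measureU2|rewrite PN adde0].
apply: (@le_trans _ _ (P (A `|` N))).
  apply: le_measure; rewrite ?inE//; first exact: measurableU.
  move=> w A'w; have [Aw|nAw] := pselect (A w); [by left|right].
  by apply: sN => /= h; apply: nAw; exact/h.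
by apply: (@le_trans _ _ (P A + P N)%E); [exact: measureU2|rewrite PN adde0].
Qed.

Lemma ae_of_null (A : set Omega) : measurable A -> P A = 0 -> {ae P, forall w, ~ A w}.
Proof. by move=> mA PA; exists A; split => // w /contrapT. Qed.

Lemma cvg_in_prob_ae (Z Z' : nat -> Omega -> \bar R) : cvg_in_prob P Z ->
  (forall n, measurable_fun [set: Omega] (Z' n)) ->
  {ae P, forall w, forall n, Z n w = Z' n w} -> cvg_in_prob P Z'.
Proof.
move=> cZ mZ' h e e0; have := cZ e e0.
rewrite (_ : (fun n => P [set w | (e%:E < `|Z n w|)%E]) = fun n => P [set w | (e%:E < `|Z' n w|)%E])//.
apply/funext => n.
have mA : measurable [set w | (e%:E < `|Z' n w|)%E].
  have mN : measurable_fun [set: Omega] (fun w => `|Z' n w|)%E by apply: measurableT_comp => //.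
  by have := emeasurable_fun_o_infty measurableT mN e%:E; rewrite setTI.
apply: (ae_eq_measure mA _).2; apply: filterS h => w hw /=.
by rewrite hw.
Qed.

Lemma mean_is_uniq f m k : mean_is P f m -> mean_is P f k -> m = k.
Proof. by move=> [_ h1] [_ h2]; move: h1; rewrite h2 => -[]. Qed.
End complete_measure.

(** * Nondegeneracy of solutions and measurability of the coefficients *)

Section solutions.
Context d (Omega : measurableType d) (R : realType) (P : probability Omega R).
Variable B : R -> Omega -> R.
Hypothesis Pc : measure_is_complete P.
Hypothesis BM : brownian_motion P B.
Local Notation lam := (@lebesgue_measure R).
Variables (I : set R) (mu sigma : R -> R).
Hypothesis I_itv : is_interval I.
Hypothesis sigma_gt0 : forall x, I x -> 0 < sigma x.

Lemma sol_measurable T t x X : strong_solution P B I mu sigma T t x X ->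
  forall u, t <= u <= T -> measurable_fun [set: Omega] (X u).
Proof.
move=> [_ _ aX _ _] u uT; apply: (adapted_measurable Pc BM (s := u)).
by apply/measurable_wrtP; exact: aX.
Qed.

Lemma sp_integral_measurable t T H s : 0 <= t -> t <= s <= T -> sp_wf P B t T H ->
  measurable_fun [set: Omega] (sp_integral B H s).
Proof.
move=> t0 /andP[ts sT] wf; rewrite (_ : sp_integral B H s = sp_incr B H t s).
  by apply: (adapted_measurable Pc BM (s := s)); exact: (adapted_sp_incr t0 wf (lexx t)).
by apply/funext => w; rewrite -sp_integralB// (sp_integral_start w wf) subr0.
Qed.

(** A constant solution has the deterministic stochastic integral [- (mu x * s)]. The first-moment
    estimate forces it to vanish, and then the lower bound for the second moment, about sigma(x)^2
    s, is violated for small [s]. *)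
Lemma sol_not_constant T x X : 0 < T -> I x -> strong_solution P B I mu sigma T 0 x X ->
  ~ {ae P, forall w, forall s, 0 <= s <= T -> X s w = x}.
Proof.
move=> T0 Ix solX cX; have [cont cl ad X0 [intmu [M [ito eqX]]]] := solX.
have [mH _ _ _ [Hn [wf cH cM]]] := ito.
have s0 := sigma_gt0 Ix; set sg := sigma x in s0.
(* Under this smallness the fourth-moment term [3 * sg ^+ 4 * s ^+ 2] is at most half of
   [sg ^+ 2 * s]. *)
have [s sT s60] : exists2 s, 0 < s <= T & 6 * sg ^+ 2 * s <= 1.
  exists (Num.min T (6 * sg ^+ 2)^-1).
    by rewrite lt_min T0 invr_gt0 ge_min lexx/= mulr_gt0// exprn_gt0.
  have p : 0 < 6 * sg ^+ 2 by rewrite mulr_gt0// exprn_gt0.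
  by rewrite mulrC -ler_pdivlMr// div1r ge_min lexx orbT.
have /andP[sp sT'] := sT.
pose Gam := [set w | forall u, 0 <= u <= T -> `|X u w - x| <= 0].
have mGam : measurable Gam.
  apply: (@measurable_forall_le _ _ _ (fun u w => `|X u w - x|)); first exact: ltW.
    move=> w u; apply: cvg_norm; apply: cvgB; [exact: cont|exact: cvg_cst].
  move=> u uT; apply: measurableT_comp => //; apply: measurable_funB => //.
  exact: (sol_measurable solX).
have GE w u : Gam w -> 0 <= u <= T -> X u w = x.
  by move=> Gw uT; apply/eqP; rewrite -subr_eq0 -normr_le0; exact: Gw.
have PG : P (~` Gam) = 0.
  apply/eqP; rewrite eq_le measure_ge0 andbT; have [N [mN PN sN]] := cX.
  rewrite -PN; apply: le_measure; rewrite ?inE//; first exact: measurableC.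
  by move=> w nG; apply: sN => /= h; apply: nG => u uT; rewrite h// subrr normr0.
pose c := - (mu x * s); pose M' (u : R) (w : Omega) := c.
have cM' : cvg_in_prob P (fun n w => (sp_integral B (Hn n) s w - M' s w)%:E).
  apply: (cvg_in_prob_ae Pc (cM s _)); first by rewrite ltW.
    move=> n; apply/measurable_EFinP; apply: measurable_funB => //.
    - by apply: sp_integral_measurable (wf n) => //; rewrite ltW.
    - exact: measurable_cst.
  have nG := ae_of_null (measurableC mGam) PG.
  apply: filterS2 nG eqX => w /= /contrapT Gw eX n; rewrite /M'.
  have := eX s; rewrite (ltW sp) sT' => /(_ isT); rewrite (GE w s Gw) ?(ltW sp) ?sT'//.
  rewrite (_ : \int[lam]_(u in `[0, s]) mu (X u w) = mu x * s).
    by move=> e; congr (_ - _)%:E; rewrite /c; lra.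
  rewrite /Rintegral (_ : (\int[lam]_(u in `[0%R, s]) (mu (X u w))%:E = (mu x * s)%:E)%E)//.
  under eq_integral => u.
    rewrite inE/= in_itv/= => /andP[u0 us]; rewrite (GE w u Gw) ?u0 ?(le_trans us)//; over.
  rewrite integral_cst//= EFinM; congr (_ * _)%E.
  by apply: (etrans (@lebesgue_measure_itv R `[0, s])); rewrite /= lte_fin sp oppr0 adde0.
have HC w u : Gam w -> 0 <= u <= s -> `|sigma (X u w)| <= sg.
  by move=> Gw /andP[u0 us]; rewrite (GE w u Gw) ?u0 ?(le_trans us)// ger0_norm// ltW.
have MK w : Gam w -> `|M' s w| <= `|c| by [].
have mM' : measurable_fun [set: Omega] (M' s) by exact: measurable_cst.
have s0T : 0 <= s <= T by rewrite ltW.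
have hG := mean_is_indic P mGam.
have PG1 : fine (P Gam) = 1.
  by have := probability_setC P (measurableC mGam); rewrite setCK PG sube0 => ->.
rewrite PG1 in hG.
have PG0 : fine (P (~` Gam)) = 0 by rewrite PG.
have fm z : `|z| = 1 -> z * c <= 0.
  move=> z1; apply/ler_addgt0Pr => e e0; rewrite add0r.
  pose kap := e / (sg ^+ 2 * s).
  have sgs : 0 < sg ^+ 2 * s by rewrite mulr_gt0// exprn_gt0.
  have kap0 : 0 < kap by rewrite divr_gt0.
  have [m hm] := first_moment Pc BM (lexx 0) mH wf cH s0T (ltW s0) mGam HC mM' cM' MK (normr_ge0 c) kap0 z1.
  have -> : m = c by rewrite (mean_is_uniq hm (mean_is_scale c hG)) mulr1.
  by rewrite PG0 mulr0 addr0 subr0 /kap divfK// gt_eqF.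
have c0 : c = 0.
  by have := fm 1 (normr1 _); have := fm (-1) (normrN1 _); lra.
have Hc w u : Gam w -> 0 <= u <= s -> sg ^+ 2 - 0 <= sigma (X u w) ^+ 2 <= sg ^+ 2 + 0.
  by move=> Gw /andP[u0 us]; rewrite (GE w u Gw) ?u0 ?(le_trans us)// subr0 addr0 lexx.
have [m hm] := second_moment Pc BM (lexx 0) mH wf cH s0T (ltW s0) mGam HC mM' cM' MK (normr_ge0 c) (sqr_ge0 sg) (lexx 0) Hc.
have -> : m = 0 by rewrite (mean_is_uniq hm (mean_is_scale (c ^+ 2) hG)) c0 expr0n mul0r.
move=> /andP[+ _]; rewrite PG0 subr0 mulr0 mul0r !add0r.
have sgs : 0 < sg ^+ 2 * s by rewrite mulr_gt0// exprn_gt0.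
have -> : 3 * sg ^+ 4 * s ^+ 2 = (3 * (sg ^+ 2 * s)) * (sg ^+ 2 * s) by ring.
move: s60; rewrite -mulrA; move: (sg ^+ 2 * s) sgs => y y0 y1; nra.
Qed.

(** By [sol_not_constant] there is a single path which starts at [x], leaves it, and along which [f]
    is measurable; its hitting times do the rest. *)
Lemma coef_measurable T x X (f : R -> R) : 0 < T -> I x -> strong_solution P B I mu sigma T 0 x X ->
  {ae P, forall w, measurable_fun `[0, T] (f \o X ^~ w)} ->
  exists2 y, y != x &
     measurable_fun (if x < y then `[x, y]%classic else `[y, x]%classic) f.
Proof.
move=> T0 Ix solX mf; have [cont _ _ X0 _] := solX.
have [w [mfw X0w nw]] : exists w, [/\ measurable_fun `[0, T] (f \o X ^~ w), X 0 w = x &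
    ~ forall s, 0 <= s <= T -> X s w = x].
  apply: contrapT => no; apply: (sol_not_constant T0 Ix solX).
  apply: filterS2 mf X0 => w h1 h2; apply: contrapT => h3; apply: no; by exists w.
have [s sT Xs] : exists2 s, 0 <= s <= T & X s w != x.
  apply: contrapT => no; apply: nw => s sT; apply/eqP; apply: contrapT => /negP h; apply: no; by exists s.
exists (X s w) => //; exact: (borel_path (cont w) mfw X0w sT Xs).
Qed.

(** Along paths, [mu] is measurable because the drift is integrable, and [sigma] because the
    integrand of an Ito integral is jointly measurable. *)
Lemma borel_coefficients T (X : R -> R -> Omega -> R) : 0 < T ->
  (forall x, I x -> strong_solution P B I mu sigma T 0 x (X x)) ->
  [/\ measurable (closure I), measurable_fun (closure I) mu & measurable_fun (closure I) sigma].
Proof.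
move=> T0 solX.
have mI := is_interval_measurable I_itv.
have mm : measurable_fun I mu.
  apply: borel_cover => // x Ix; apply: (coef_measurable T0 Ix (solX x Ix)).
  have [_ _ _ _ [im _]] := solX x Ix; apply: filterS im => w /measurable_int.
  by move=> /measurable_EFinP.
have ms : measurable_fun I sigma.
  apply: borel_cover => // x Ix; apply: (coef_measurable T0 Ix (solX x Ix)).
  have [_ _ _ _ [_ [M [[mH _ _ _ _] _]]]] := solX x Ix; apply: aeW => w.
  exact: (@process_section_measurable _ _ _ 0 T (fun u w => sigma (X x u w)) mH w).
have [h1 h2] := closure_interval_measurable I_itv mm.
by have [h3 h4] := closure_interval_measurable I_itv ms.
Qed.
End solutions.

Section uniform_continuity.
Context {R : realType}.

Lemma segment_uniform_continuous (a b e : R) (f : R -> R) :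
  {within `[a, b], continuous f} -> 0 < e ->
  exists2 r, 0 < r & forall u v, a <= u <= b -> a <= v <= b -> `|u - v| < r -> `|f u - f v| < e.
Proof.
move=> cf e0.
have /compact_near_coveringP cov := @segment_compact R a b.
pose Q (r u : R) := a <= u <= b -> forall v, a <= v <= b -> `|u - v| < r -> `|f u - f v| < e.
have h x : `[a, b]%classic x -> \forall x' \near x & r \near 0^'+, Q r x'.
  move=> abx; have [r r0 hr] := within_continuous_dist cf abx (ltac:(lra) : 0 < e / 2).
  exists (ball x (r / 2), [set s : R | 0 < s < r / 2]).
    split; first by apply: nbhsx_ballx; lra.
    near=> s => /=; apply/andP; split; first by near: s; exact: nbhs_right_gt.
    by near: s; apply: nbhs_right_lt; lra.
  move=> [u s] /= [xu /andP[s0 sr]] abu v abv uv.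
  have := hr u; rewrite /= in_itv/= abu => /(_ isT).
  have := hr v; rewrite /= in_itv/= abv => /(_ isT).
  have h1 : `|x - u| < r by apply: lt_trans xu _; lra.
  have h2 : `|x - v| < r.
    rewrite (_ : x - v = (x - u) + (u - v)); last by ring.
    by apply: le_lt_trans (ler_normD _ _) _; move: (xu : `|x - u| < r / 2); lra.
  move=> /(_ h2) + /(_ h1).
  rewrite (_ : f u - f v = (f x - f v) - (f x - f u)); last by ring.
  by move=> p q; apply: le_lt_trans (ler_normB _ _) _; lra.
have [r [r0 hr]] : exists r : R, 0 < r /\ forall u, `[a, b]%classic u -> Q r u.
  near (0:R)^'+ => r; exists r; split; first by near: r; exact: nbhs_right_gt.
  by near: r; exact: (cov _ _ _ _ h).
exists r => // u v abu; apply: hr => //; by rewrite /= in_itv.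
Unshelve. all: by end_near. Qed.
End uniform_continuity.

(** * Events that every outcome eventually leaves, and parameter integrals *)

Section vanishing_events.
Context d (Omega : measurableType d) (R : realType) (P : probability Omega R).

Lemma integral_vanishing (f : Omega -> R) (U : nat -> set Omega) e :
  P.-integrable [set: Omega] (EFin \o f) -> (forall n, measurable (U n)) ->
  (forall w, exists N, forall n, (N <= n)%N -> ~ U n w) -> 0 < e ->
  exists N, forall n, (N <= n)%N -> exists2 m, mean_is P (fun w => `|f w| * \1_(U n) w) m & m <= e.
Proof.
move=> fi mU hU e0.
have mf : measurable_fun [set: Omega] f by apply/measurable_EFinP; exact: measurable_int fi.
have mg n : measurable_fun [set: Omega] (fun w => `|f w| * \1_(U n) w).
  by apply: measurable_funM; [exact: measurableT_comp|exact: measurable_indic].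
have le n w : `| `|f w| * \1_(U n) w| <= `|f w|.
  rewrite ger0_norm ?mulr_ge0// -[leRHS]mulr1 ler_wpM2l// indicE; by case: (_ \in _); rewrite ?ler01.
have ie n : P.-integrable [set: Omega] (EFin \o (fun w => `|f w| * \1_(U n) w)).
  apply: le_integrable fi => //; first exact/measurable_EFinP.
  by move=> w _ /=; rewrite lee_fin.
have c0 w : (fun n => (`|f w| * \1_(U n) w)%:E) @ \oo --> (cst 0%E w : \bar R).
  have [N hN] := hU w; apply: cvg_near_cst; exists N => // n /= Nn.
  by rewrite indicE memNset ?mulr0//; exact: hN.
have [_ _ ] := @dominated_convergence _ _ _ P _ measurableT
   (fun n w => (`|f w| * \1_(U n) w)%:E) (cst 0%E) (fun w => `|f w|%:E)
   (fun n => (measurable_EFinP _ _).2 (mg n)) (@measurable_cst _ _ _ _ _ _)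
   (aeW P (fun w _ => c0 w)) (integrable_abse fi)
   (aeW P (fun w => (fun n _ => (le n w : (`|(`|f w| * \1_(U n) w)%:E| <= `|f w|%:E)%E)))).
rewrite integral0_eq// => /fine_cvgP[_ /cvgrPdist_le/(_ _ e0) [N _ hN]].
exists N => n /hN /= hn; exists (fine (\int[P]_w (`|f w| * \1_(U n) w)%:E)); first exact: mean_isP.
by move: hn; rewrite sub0r normrN; apply: le_trans; exact: ler_norm.
Qed.

Lemma prob_vanishing (U : nat -> set Omega) e : (forall n, measurable (U n)) ->
  (forall w, exists N, forall n, (N <= n)%N -> ~ U n w) -> 0 < e ->
  exists N, forall n, (N <= n)%N -> fine (P (U n)) <= e.
Proof.
move=> mU hU e0.
have [N hN] := integral_vanishing (mean_is_cst P 1).1 mU hU e0.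
exists N => n /hN [m hm me]; apply: le_trans me.
apply: (mean_is_le _ (mean_is_indic P (mU n)) hm) => w.
by rewrite normr1 mul1r.
Qed.

Lemma mean_is_sum n (f : nat -> Omega -> R) (m : nat -> R) :
  (forall i, (i < n)%N -> mean_is P (f i) (m i)) ->
  mean_is P (fun w => \sum_(i < n) f i w) (\sum_(i < n) m i).
Proof.
elim: n => [|n IH] h.
  by rewrite big_ord0 (_ : (fun w => _) = cst 0); [exact: mean_is_cst|apply/funext => w; rewrite big_ord0].
rewrite big_ord_recr/= (_ : (fun w => _) = fun w => \sum_(i < n) f i w + f n w).
  by apply: mean_is_add; [apply: IH => i ni; apply: h; exact: ltnW|exact: h].
by apply/funext => w; rewrite big_ord_recr.
Qed.

Lemma measurable_param_Rintegral (a b : R) (f : R * Omega -> R) :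
  measurable_fun (`[a, b] `*` [set: Omega]) f ->
  measurable_fun [set: Omega] (fun w => \int[lebesgue_measure]_(u in `[a, b]) f (u, w)).
Proof.
move=> mf.
have mp := measurable_param_integral (measurable_funrpos mf) (fun p => funrpos_ge0 f p).
have mn := measurable_param_integral (measurable_funrneg mf) (fun p => funrneg_ge0 f p).
apply: (measurableT_comp (@fine_measurable R setT measurableT)).
apply: eq_measurable_fun (emeasurable_funB mp mn) => w _.
rewrite [RHS]integralE; congr (_ - _)%E; apply: eq_integral => u _.
  by rewrite funeposE EFin_max.
by rewrite funenegE EFin_max.
Qed.

Lemma lebesgue_segment (a b : R) : a <= b ->
  (lebesgue_measure (`[a, b]%classic : set R) = (b - a)%:E)%E.
Proof.
move=> ab; apply: (etrans (@lebesgue_measure_itv R `[a, b])); rewrite /= lte_fin.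
by case: ltP => [_|ge]; [rewrite EFinB|congr (_%:E); lra].
Qed.

Lemma bounded_segment_integrable (a b C : R) (f : R -> R) : a <= b -> measurable_fun `[a, b] f ->
  (forall u, a <= u <= b -> `|f u| <= C) ->
  lebesgue_measure.-integrable `[a, b] (EFin \o f).
Proof.
move=> ab mf fC; have mI : measurable (`[a, b]%classic : set (measurableTypeR R)) by exact: measurable_itv.
apply: (@le_integrable _ _ _ _ _ mI _ (EFin \o cst C)).
- exact/measurable_EFinP.
- by move=> u /=; rewrite in_itv/= => /fC h; rewrite lee_fin (le_trans h)// ler_norm.
- apply/integrableP; split; first by apply/measurable_EFinP; exact: measurable_cst.
  rewrite (_ : (fun x => _) = cst `|C|%:E)// integral_cst//.
  by rewrite [X in (_ * X)%E](lebesgue_segment ab) -EFinM ltry.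
Qed.

Lemma Rintegral_near (a b k C : R) (f : R -> R) : a <= b -> measurable_fun `[a, b] f ->
  (forall u, a <= u <= b -> `|f u - k| <= C) ->
  `|\int[lebesgue_measure]_(u in `[a, b]) f u - k * (b - a)| <= C * (b - a).
Proof.
move=> ab mf fC; have mI : measurable (`[a, b]%classic : set (measurableTypeR R)) by exact: measurable_itv.
have ci c : lebesgue_measure.-integrable `[a, b] (EFin \o (cst c : R -> R)).
  by apply: (@bounded_segment_integrable _ _ `|c|) => //; exact: measurable_cst.
have fi : lebesgue_measure.-integrable `[a, b] (EFin \o f).
  apply: (@bounded_segment_integrable _ _ (C + `|k|)) => // u uab.
  rewrite -(subrK k (f u)); apply: le_trans (ler_normD _ _) _.
  by rewrite lerD2r; exact: fC.
have cst_int c : \int[lebesgue_measure]_(u in `[a, b]) c = c * (b - a).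
  rewrite Rintegral_cst//; congr (_ * _).
  by rewrite -[RHS]/(fine (b - a)%:E) -(lebesgue_segment ab).
have up : \int[lebesgue_measure]_(u in `[a, b]) f u <= (k + C) * (b - a).
  rewrite -cst_int; apply: le_Rintegral => //; first exact: ci.
  by move=> u /=; rewrite in_itv/= => /fC; rewrite ler_norml => /andP[? ?]; lra.
have lo : (k - C) * (b - a) <= \int[lebesgue_measure]_(u in `[a, b]) f u.
  rewrite -cst_int; apply: le_Rintegral => //; first exact: ci.
  by move=> u /=; rewrite in_itv/= => /fC; rewrite ler_norml => /andP[? ?]; lra.
move: (\int[lebesgue_measure]_(u in _) _) up lo => J up lo.
by rewrite ler_norml; apply/andP; split; lra.
Qed.
End vanishing_events.

(** * Probability that a solution leaves a ball in short time *)

Section solution_martingale.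
Context d (Omega : measurableType d) (R : realType) (P : probability Omega R).
Variable B : R -> Omega -> R.
Hypothesis Pc : measure_is_complete P.
Hypothesis BM : brownian_motion P B.
Local Notation lam := (@lebesgue_measure R).
Variables (I : set R) (mu sigma : R -> R).
Hypothesis mcl : measurable (closure I).
Hypothesis mmu : measurable_fun (closure I) mu.
Variables (t T x : R) (X : R -> Omega -> R).
Hypothesis t0 : 0 <= t.
Hypothesis solX : strong_solution P B I mu sigma T t x X.

Lemma sp_incr_cat (H : simple_process Omega R) a b c w : a <= b -> b <= c ->
  sp_incr B H a c w = sp_incr B H a b w + sp_incr B H b c w.
Proof.
move=> ab bc; rewrite -!sp_integralB//; first by ring.
exact: le_trans bc.
Qed.

(** The stochastic integral recovered from the path. It agrees almost surely with the process [M] of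
    the definition of a solution, and as a functional of [X] it is measurable at each time. *)
Definition sol_mart s w := X s w - x - \int[lam]_(u in `[t, s]) mu (X u w).

Lemma sol_coef_measurable (f : R -> R) a b : measurable_fun (closure I) f ->
  t <= a -> a <= b -> b <= T ->
  measurable_fun (`[a, b] `*` [set: Omega]) (fun p : R * Omega => f (X p.1 p.2)).
Proof.
move=> mf ta ab bT; have [cont cl _ _ _] := solX.
have sub u : a <= u <= b -> t <= u <= T.
  by move=> /andP[h1 h2]; rewrite (le_trans ta)// (le_trans h2).
apply: (@measurable_comp _ _ _ _ _ _ (closure I) f (`[a, b]%classic `*` [set: Omega])
   (fun p : R * Omega => X p.1 p.2)) => //.
- by move=> _ [[u w] /= [+ _] <-]; rewrite in_itv/= => /sub; exact: cl.
- apply: continuous_process_measurable => //.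
    move=> w; apply: continuous_subspaceW (cont w) => u /=; rewrite !in_itv/=; exact: sub.
  by move=> u /sub uT; exact: (sol_measurable Pc BM solX).
Qed.

Lemma sol_path_measurable (f : R -> R) a b w : measurable_fun (closure I) f ->
  t <= a -> a <= b -> b <= T -> measurable_fun `[a, b] (fun u => f (X u w)).
Proof.
move=> mf ta ab bT.
exact: (@process_section_measurable _ _ _ a b (fun u w => f (X u w)) (sol_coef_measurable mf ta ab bT) w).
Qed.

Lemma sol_mart_measurable s : t <= s <= T -> measurable_fun [set: Omega] (sol_mart s).
Proof.
move=> /andP[ts sT]; apply: measurable_funB; first apply: measurable_funB => //.
  by apply: (sol_measurable Pc BM solX); rewrite ts.
apply: (@measurable_param_Rintegral _ _ _ t s (fun p => mu (X p.1 p.2))).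
exact: sol_coef_measurable.
Qed.

Lemma sol_approx : exists Hn : nat -> simple_process Omega R,
  [/\ forall n, sp_wf P B t T (Hn n),
      cvg_in_prob P (fun n w => \int[lam]_(u in `[t, T])
              ((sp_val (Hn n) u w - sigma (X u w)) ^+ 2)%:E)%E &
      forall s, t <= s <= T ->
        cvg_in_prob P (fun n w => (sp_integral B (Hn n) s w - sol_mart s w)%:E)].
Proof.
have [_ _ _ _ [_ [M [[_ _ _ _ [Hn [wf cH cM]]] eX]]]] := solX.
exists Hn; split => // s sT; apply: (cvg_in_prob_ae Pc (cM s sT)).
  move=> n; apply/measurable_EFinP; apply: measurable_funB; last exact: sol_mart_measurable.
  exact: (sp_integral_measurable Pc BM t0 sT (wf n)).
apply: filterS eX => w /(_ s sT) e n; rewrite /sol_mart; congr (_ - _)%:E.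
by rewrite e; ring.
Qed.

Definition stay rho s := [set w | forall u, t <= u <= s -> `|X u w - x| <= rho].

Lemma stay_measurable_wrt d' (Om : measurableType d') rho s (Y : R -> Om -> R) : t <= s ->
  (forall w, {within `[t, s], continuous (Y ^~ w)}) ->
  (forall u, t <= u <= s -> measurable_fun [set: Om] (Y u)) ->
  measurable [set w | forall u, t <= u <= s -> `|Y u w - x| <= rho].
Proof.
move=> ts cY mY; apply: (@measurable_forall_le _ _ _ (fun u w => `|Y u w - x|)) => //.
  by move=> w u; apply: cvg_norm; apply: cvgB; [exact: cY|exact: cvg_cst].
by move=> u uT; apply: measurableT_comp => //; apply: measurable_funB => //; exact: mY.
Qed.

Lemma sol_continuous a b w : t <= a -> b <= T -> {within `[a, b], continuous (X ^~ w)}.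
Proof.
move=> ta bT; have [cont _ _ _ _] := solX.
apply: continuous_subspaceW (cont w) => u /=; rewrite !in_itv/= => /andP[h1 h2].
by rewrite (le_trans ta)// (le_trans h2).
Qed.

Lemma stay_measurable rho s : t <= s <= T -> measurable (stay rho s).
Proof.
move=> /andP[ts sT]; apply: stay_measurable_wrt => //; first by move=> w; exact: sol_continuous.
move=> u /andP[tu us]; apply: (sol_measurable Pc BM solX).
by rewrite tu (le_trans us).
Qed.

Lemma sol_adapted u s : t <= u -> u <= s -> s <= T ->
  measurable_fun [set: g_sigma_algebraType (filtration_gen P B 0 s)] (X u).
Proof.
move=> tu us sT; apply: (@adapted_le _ _ _ _ _ u) => //.
by apply/measurable_wrtP; have [_ _ + _ _] := solX; apply; rewrite tu (le_trans us).
Qed.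

Lemma stay_adapted rho s : t <= s <= T ->
  measurable (stay rho s : set (g_sigma_algebraType (filtration_gen P B 0 s))).
Proof.
move=> /andP[ts sT]; apply: (@stay_measurable_wrt _ (g_sigma_algebraType (filtration_gen P B 0 s)) rho s X) => //.
  by move=> w; exact: sol_continuous.
by move=> u /andP[tu us]; exact: sol_adapted.
Qed.

Variables (rho C : R).
Hypothesis rho0 : 0 < rho.
Hypothesis C0 : 0 <= C.
Hypothesis muC : forall y, `|y - x| <= rho -> `|mu y| <= C.
Hypothesis sigmaC : forall y, `|y - x| <= rho -> `|sigma y| <= C.
Hypothesis msigma : measurable_fun (closure I) sigma.
Variable D : R.
Hypothesis D0 : 0 < D.
Hypothesis tD : t + D <= T.

Definition grid n j : R := t + D * j%:R / n%:R.

Lemma gridS n j : (0 < n)%N -> grid n j.+1 = grid n j + D / n%:R.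
Proof. by move=> n0; rewrite /grid -natr1; field; rewrite pnatr_eq0 -lt0n. Qed.

Lemma grid_mono n i j : (0 < n)%N -> (i <= j)%N -> grid n i <= grid n j.
Proof. by move=> n0 ij; rewrite lerD2l ler_wpM2r ?invr_ge0 ?ler0n// ler_wpM2l ?ler_nat// ltW. Qed.

Lemma grid_itv n j : (0 < n)%N -> (j <= n)%N -> t <= grid n j <= t + D.
Proof.
move=> n0 jn; rewrite /grid lerDl lerD2l; apply/andP; split.
  by rewrite divr_ge0 ?ler0n// mulr_ge0 ?ler0n// ltW.
by rewrite ler_pdivrMr ?ltr0n// ler_wpM2l ?ler_nat// ltW.
Qed.

Lemma grid_end n : (0 < n)%N -> grid n n = t + D.
Proof. by move=> n0; rewrite /grid mulfK// pnatr_eq0 -lt0n. Qed.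

(** For each path this fails on fine meshes, by uniform continuity; it lets exits be detected at
    mesh times only. *)
Definition osc n := [set w | exists2 j, (j < n.+1)%N & exists2 u,
  grid n.+1 j <= u <= grid n.+1 j.+1 & rho / 2 < `|X u w - X (grid n.+1 j) w|].

(** The first mesh time at distance at least [rho / 2], with the path still inside the ball up to
    then: the event is known at that mesh time, and the coefficients are bounded along the path so
    far. *)
Definition first_far n j := stay rho (grid n.+1 j) `&`
  ([set w | rho / 2 <= `|X (grid n.+1 j) w - x| ] `&`
   [set w | forall i, (i < j)%N -> `|X (grid n.+1 i) w - x| < rho / 2]).

Let gridT n j : (j <= n.+1)%N -> t <= grid n.+1 j <= T.
Proof. by move=> jn; have /andP[-> h] := grid_itv (ltn0Sn n) jn; exact: le_trans tD. Qed.

Lemma osc_measurable n : measurable (osc n).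
Proof.
rewrite (_ : osc n = \bigcup_(j in `I_n.+1) ~` [set w | forall u, grid n.+1 j <= u <= grid n.+1 j.+1 ->
    `|X u w - X (grid n.+1 j) w| <= rho / 2]); last first.
  apply/seteqP; split => w /=.
    move=> [j jn [u uj h]]; exists j => // /(_ u uj); lra.
  move=> [j /= jn h]; exists j => //; apply: contrapT => no; apply: h => u uj.
  by rewrite leNgt; apply/negP => h; apply: no; exists u.
apply: bigcup_measurable => j /= jn; apply: measurableC.
have /andP[h1 h2] := gridT (ltnW jn); have /andP[h3 h4] := gridT jn.
have h5 := grid_mono (ltn0Sn n) (leqnSn j).
apply: (@measurable_forall_le _ _ _ (fun u w => `|X u w - X (grid n.+1 j) w|)) => //.
  by move=> w u; apply: cvg_norm; apply: cvgB; [exact: sol_continuous|exact: cvg_cst].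
move=> u /andP[uj uj']; apply: measurableT_comp => //; apply: measurable_funB;
  apply: (sol_measurable Pc BM solX); last by rewrite h1.
by rewrite (le_trans h1)// (le_trans uj').
Qed.

Lemma osc_vanish w : exists N, forall n, (N <= n)%N -> ~ osc n w.
Proof.
have cX : {within `[t, t + D], continuous (X ^~ w)} by exact: sol_continuous.
have [r r0 hr] := segment_uniform_continuous cX (divr_gt0 rho0 (ltr0n _ 2)).
have [N hN] := nat_inv_lt (divr_gt0 r0 D0).
exists N => n Nn [j jn [u /andP[uj uj']]]; apply/negP; rewrite -leNgt; apply: ltW.
have /andP[h1 h2] := grid_itv (ltn0Sn n) (ltnW jn).
have /andP[h3 h4] := grid_itv (ltn0Sn n) jn.
apply: hr; rewrite ?h1 ?h2 ?(le_trans h1 uj) ?(le_trans uj' h4)//.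
rewrite ger0_norm ?subr_ge0//; move: uj'; rewrite gridS// => uj'.
have : D / n.+1%:R < r.
  rewrite mulrC -ltr_pdivlMr//; apply: le_lt_trans hN.
  by rewrite lef_pV2 ?posrE ?ltr0n// ler_nat.
by move: (D / n.+1%:R) uj' => z; lra.
Qed.

(** Induction over mesh cells: from a distance below [rho / 2], a cell with oscillation at most
    [rho / 2] does not leave the ball. So an exit needs a wrong start, a large oscillation, or a
    mesh time at distance at least [rho / 2]. *)
Lemma far_cover n : ~` stay rho (t + D) `<=`
  osc n `|` (\bigcup_(j in `I_n.+1) first_far n j `|` [set w | X t w != x]).
Proof.
move=> w nst; apply: contrapT => /not_orP[nosc /not_orP[nfar /negP/negPn/eqP Xt]].
apply: nst.
have osc_le j u : (j < n.+1)%N -> grid n.+1 j <= u <= grid n.+1 j.+1 ->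
    `|X u w - X (grid n.+1 j) w| <= rho / 2.
  by move=> jn uj; rewrite leNgt; apply/negP => h; apply: nosc; exists j => //; exists u.
have g0 : grid n.+1 0 = t by rewrite /grid mulr0 mul0r addr0.
suff H j : (j <= n.+1)%N -> stay rho (grid n.+1 j) w /\
    forall i, (i < j)%N -> `|X (grid n.+1 i) w - x| < rho / 2.
  by have [] := H n.+1 (leqnn _); rewrite grid_end.
elim: j => [_|j IH jn].
  split => // u; rewrite g0 => utt; have -> : u = t by apply/eqP; rewrite eq_le andbC.
  by rewrite Xt subrr normr0 ltW.
have [st near_] := IH (ltnW jn).
have small : `|X (grid n.+1 j) w - x| < rho / 2.
  rewrite ltNge; apply/negP => h; apply: nfar; exists j => //; by split => //; split.
split; last by move=> i; rewrite ltnS leq_eqVlt => /predU1P[->//|]; exact: near_.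
move=> u /andP[tu uj]; have [le|gt] := leP u (grid n.+1 j); first by apply: st; rewrite tu.
have := osc_le j u jn; rewrite (ltW gt) uj => /(_ isT) h.
rewrite (_ : X u w - x = (X u w - X (grid n.+1 j) w) + (X (grid n.+1 j) w - x)); last by ring.
by apply: le_trans (ler_normD _ _) _; lra.
Qed.

Lemma first_far_disjoint n i j w : first_far n i w -> first_far n j w -> i = j.
Proof.
wlog ij : i j / (i <= j)%N.
  move=> h Fi Fj; have /orP[le|le] := leq_total i j; first exact: h.
  by apply/esym; exact: h.
move=> [_ [h1 _]] [_ [_ h2]]; apply/eqP; rewrite eqn_leq ij leqNgt /=; apply/negP => lt.
by have := h2 i lt; move: h1 => /=; lra.
Qed.

Lemma first_far_adapted n j : (j <= n.+1)%N ->
  measurable (first_far n j : set (g_sigma_algebraType (filtration_gen P B 0 (grid n.+1 j)))).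
Proof.
move=> jn; have /andP[h1 h2] := gridT jn.
have mX i : (i <= j)%N -> measurable_fun [set: g_sigma_algebraType (filtration_gen P B 0 (grid n.+1 j))]
   (fun w => `|X (grid n.+1 i) w - x|).
  move=> ij; have /andP[h3 h4] := gridT (leq_trans ij jn).
  apply: measurableT_comp => //; apply: measurable_funB => //; apply: sol_adapted => //.
  exact: grid_mono.
apply: measurableI; first by apply: stay_adapted; rewrite h1.
apply: measurableI.
  by rewrite -[X in measurable X]setTI; apply: measurable_fun_ler => //; exact: mX.
rewrite (_ : [set w | _] = \bigcap_(i in `I_j) [set w | `|X (grid n.+1 i) w - x| < rho / 2]).
  apply: bigcap_measurableType => i /= ij.
  by rewrite -[X in measurable X]setTI; apply: measurable_fun_ltr => //; apply: mX; exact: ltnW.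
by apply/seteqP; split => w /= h i; exact: h.
Qed.

Lemma first_far_measurable n j : (j <= n.+1)%N -> measurable (first_far n j).
Proof.
move=> jn; have /andP[h1 h2] := gridT jn.
by apply: (filtration_measurable Pc BM); rewrite filtrationE; exact: first_far_adapted.
Qed.

Definition far n := \bigcup_(j in `I_n.+1) first_far n j.

Lemma far_measurable n : measurable (far n).
Proof. by apply: bigcup_measurable => j /= jn; apply: first_far_measurable; exact: ltnW. Qed.

Lemma sum_indic_first_far n w : \sum_(j < n.+1) \1_(first_far n j) w <= (1 : R).
Proof.
have [[j jn Fj]|no] := pselect (exists2 j, (j < n.+1)%N & first_far n j w); last first.
  rewrite big1 ?ler01// => j _; rewrite indicE memNset// => Fj; apply: no.
  by exists j.
rewrite (bigD1 (Ordinal jn))//= big1 ?addr0.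
  by rewrite indicE; case: (_ \in _); rewrite ?ler01.
move=> i /negP ij; rewrite indicE memNset// => Fi; apply: ij; apply/eqP/val_inj => /=.
exact: first_far_disjoint Fi Fj.
Qed.

Lemma common_index (Q : nat -> nat -> Prop) n :
  (forall j, (j < n)%N -> exists N, forall m, (N <= m)%N -> Q j m) ->
  exists m, forall j, (j < n)%N -> Q j m.
Proof.
move=> h; suff [N hN] : exists N, forall m, (N <= m)%N -> forall j, (j < n)%N -> Q j m.
  by exists N; exact: hN.
elim: n h => [|n IH] h; first by exists 0%N.
have [N1 h1] := IH (fun j jn => h j (ltnW jn)); have [N2 h2] := h n (ltnSn n).
exists (maxn N1 N2) => m; rewrite geq_max => /andP[m1 m2] j.
by rewrite ltnS leq_eqVlt => /predU1P[->|]; [exact: h2|exact: h1].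
Qed.

Lemma mean_is_le_norm (f h : Omega -> R) m : measurable_fun [set: Omega] h -> (forall w, `|h w| <= `|f w|) ->
  mean_is P f m -> exists k, mean_is P h k.
Proof.
move=> mh hf [fi _]; exists (fine (\int[P]_w (h w)%:E)); apply: mean_isP.
apply: (@le_integrable _ _ _ P _ measurableT _ (EFin \o f)) => //; first exact/measurable_EFinP.
by move=> w _ /=; rewrite lee_fin.
Qed.

Lemma mean_is_indicM (f : Omega -> R) m (A : set Omega) : mean_is P f m -> measurable A ->
  exists k, mean_is P (fun w => \1_A w * f w) k.
Proof.
move=> hf mA; have mf : measurable_fun [set: Omega] f by apply/measurable_EFinP; have [/integrableP[]] := hf.
apply: (mean_is_le_norm _ _ hf); first by apply: measurable_funM.
move=> w; have [[_ ->]|[_ ->]] := @indicEb _ _ R A w; rewrite ?mul1r// mul0r normr0//.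
Qed.

Lemma pow4_ge0 (y : R) : 0 <= y ^+ 4.
Proof. by rewrite (_ : 4%N = (2 * 2)%N)// exprM sqr_ge0. Qed.

Hypothesis CD : C * D <= rho / 4.

(** Doob's maximal inequality for fourth powers, uniform in the mesh. On [first_far n j] the drift
    contributes at most [rho / 4], so the stochastic integral is at least [rho / 4] and its clipped
    approximation at least [rho / 8] off a rare event. The submartingale property moves the fourth
    moment to time [t + D], and the events for different [j] are disjoint. *)
Lemma far_prob n : fine (P (far n)) <= 3 * C ^+ 4 * D ^+ 2 / (rho / 8) ^+ 4.
Proof.
have [Hn [wf cH cM]] := sol_approx.
have tT : t <= T by apply: le_trans tD; rewrite lerDl ltW.
have mH := sol_coef_measurable msigma (lexx t) tT (lexx T).
have sg_cl w u j : (j <= n.+1)%N -> stay rho (grid n.+1 j) w -> t <= u <= grid n.+1 j ->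
    `|sigma (X u w)| <= C.
  by move=> jn st uj; apply: sigmaC; exact: st.
have r8 : 0 < rho / 8 by rewrite divr_gt0.
have r84 : 0 < (rho / 8) ^+ 4 by rewrite exprn_gt0.
pose K := fine (P (far n)).
have mart_ge w j : (j < n.+1)%N -> first_far n j w -> rho / 4 <= `|sol_mart (grid n.+1 j) w|.
  move=> jn [st [/= far_ _]].
  have /andP[h1 h2] := gridT (ltnW jn); have /andP[_ h3] := grid_itv (ltn0Sn n) (ltnW jn).
  have := @Rintegral_near _ t (grid n.+1 j) 0 C (fun u => mu (X u w)) h1
    (sol_path_measurable w mmu (lexx t) h1 h2).
  have hC u : t <= u <= grid n.+1 j -> `|mu (X u w) - 0| <= C.
    by move=> uj; rewrite subr0; apply: muC; exact: st.
  move=> /(_ hC); rewrite mul0r subr0 => hI.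
  have hI' : `|\int[lam]_(u in `[t, grid n.+1 j]) mu (X u w)| <= rho / 4.
    apply: le_trans hI _; apply: le_trans CD; rewrite ler_wpM2l//; lra.
  rewrite /sol_mart; move: (\int[lam]_(u in _) _) hI' => J hI'.
  have := ler_normD (X (grid n.+1 j) w - x - J) J; rewrite subrK; lra.
(* [del] bounds the probability that the clipped approximation is bad at one mesh time; it is sent
   to 0 with the mesh fixed. *)
suff key del : 0 < del -> (rho / 8) ^+ 4 * K <= 3 * C ^+ 4 * D ^+ 2 + n.+1%:R * ((rho / 8) ^+ 4 * del).
  rewrite ler_pdivlMr// mulrC; apply/ler_addgt0Pr => e e0.
  have n0 : 0 < n.+1%:R * (rho / 8) ^+ 4 by rewrite mulr_gt0// ltr0n.
  apply: le_trans (key _ (divr_gt0 e0 n0)) _; rewrite lerD2l mulrA mulrC divfK// gt_eqF//.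
move=> del0.
have [m hm] := @common_index (fun j m => (P (stay rho (grid n.+1 j) `&`
    [set w | (rho / 8 < `|sp_incr B (sp_map (clip C) (Hn m)) t (grid n.+1 j) w - sol_mart (grid n.+1 j) w|)%R])
    <= del%:E)%E) n.+1 (fun j jn => clip_incr_cvg Pc BM t0 mH wf cH (gridT (ltnW jn)) C0
      (stay_measurable rho (gridT (ltnW jn))) (fun w u => @sg_cl w u j (ltnW jn))
      (sol_mart_measurable (gridT (ltnW jn))) (cM _ (gridT (ltnW jn))) r8 del0).
pose S s := sp_incr B (sp_map (clip C) (Hn m)) t s.
pose q j := grid n.+1 j.
have tDT : t <= t + D <= T by rewrite tD lerDl ltW.
have [q4 hq4 q4C] := clip_incr_mean4 Pc BM t0 wf tDT C0 m.
have step j : (j < n.+1)%N -> exists2 e, mean_is P (fun w => \1_(first_far n j) w * S (t + D) w ^+ 4) e &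
    (rho / 8) ^+ 4 * fine (P (first_far n j)) <= e + (rho / 8) ^+ 4 * del.
  move=> jn; have mF := first_far_measurable (ltnW jn).
  have [e he] := mean_is_indicM hq4 mF; exists e => //.
  have [p hp _] := clip_incr_mean4 Pc BM t0 wf (gridT (ltnW jn)) C0 m.
  have [a ha] := mean_is_indicM hp mF.
  have /andP[h1 h2] := gridT (ltnW jn); have /andP[_ h3] := grid_itv (ltn0Sn n) (ltnW jn).
  have wfm := sp_wf_clip wf C0 m.
  have ae : a <= e.
    rewrite -lee_fin -ha.2 -he.2 [leRHS](eq_integral (fun w => (\1_(first_far n j) w * (S (q j) w +
        sp_incr B (sp_map (clip C) (Hn m)) (q j) (t + D) w) ^+ 4)%:E)); last first.
      by move=> w _; rewrite /S -sp_incr_cat.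
    apply: (sp_power4_ge Pc BM t0 wfm h1 h3).
    - by apply: measurable_indic; exact: (first_far_adapted (ltnW jn)).
    - exact: (adapted_sp_incr t0 wfm (lexx t) h1 h2).
    - by move=> w; rewrite indicE ler0n.
  pose bad := stay rho (q j) `&` [set w | (rho / 8 < `|S (q j) w - sol_mart (q j) w|)%R].
  have mbad : measurable bad.
    apply: measurableI; first exact: (stay_measurable rho (gridT (ltnW jn))).
    apply: measurable_ltr_norm_set; apply: measurable_funB; last exact: (sol_mart_measurable (gridT (ltnW jn))).
    apply: (adapted_measurable Pc BM (s := q j)).
    exact: (adapted_sp_incr t0 wfm (lexx t) h1 h2).
  have pbad : fine (P bad) <= del by rewrite -lee_fin fineK ?fin_num_measure//; exact: hm.
  have pw w : (rho / 8) ^+ 4 * \1_(first_far n j) w <=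
      \1_(first_far n j) w * S (q j) w ^+ 4 + (rho / 8) ^+ 4 * \1_bad w.
    have b0 : 0 <= \1_bad w :> R by rewrite indicE.
    have [[Fw ->]|[Fw ->]] := @indicEb _ _ R (first_far n j) w; last first.
      by rewrite mulr0 mul0r add0r mulr_ge0// ltW.
    rewrite mulr1 mul1r.
    have [[Bw ->]|[Bw ->]] := @indicEb _ _ R bad w; first by rewrite mulr1 lerDr pow4_ge0.
    rewrite mulr0 addr0 -[leRHS]ger0_norm ?pow4_ge0// normrX.
    suff rs : rho / 8 <= `|S (q j) w| by apply: lerXn2r => //; rewrite nnegrE// ltW.
    have le : `|S (q j) w - sol_mart (q j) w| <= rho / 8.
      by rewrite leNgt; apply/negP => ?; apply: Bw; split => //; case: Fw.
    have := mart_ge w j jn Fw; rewrite -/(q j).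
    have := ler_normB (S (q j) w) (S (q j) w - sol_mart (q j) w).
    by rewrite (_ : S (q j) w - (S (q j) w - sol_mart (q j) w) = sol_mart (q j) w); [lra|ring].
  have := mean_is_le pw (mean_is_scale _ (mean_is_indic P mF)) (mean_is_add ha (mean_is_scale _ (mean_is_indic P mbad))).
  have : (rho / 8) ^+ 4 * fine (P bad) <= (rho / 8) ^+ 4 * del by rewrite ler_wpM2l// ltW.
  by lra.
have {step} /choice[e he] : forall j : 'I_n.+1, exists e, mean_is P (fun w => \1_(first_far n j) w * S (t + D) w ^+ 4) e /\
    (rho / 8) ^+ 4 * fine (P (first_far n j)) <= e + (rho / 8) ^+ 4 * del.
  by move=> j; have [e h1 h2] := step j (ltn_ord j); exists e.
pose e' i := if insub i is Some j then e j else 0.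
have e'E (j : 'I_n.+1) : e' j = e j by rewrite /e' valK.
have sume : \sum_(j < n.+1) e' j <= q4.
  apply: (mean_is_le _ (@mean_is_sum _ _ _ P n.+1 (fun j w => \1_(first_far n j) w * S (t + D) w ^+ 4) e' _) hq4).
    move=> w /=; rewrite -mulr_suml -[leRHS]mul1r ler_wpM2r ?pow4_ge0//; exact: sum_indic_first_far.
  by move=> i ni; have [+ _] := he (Ordinal ni); rewrite -e'E.
have sumF : K <= \sum_(j < n.+1) fine (P (first_far n j)).
  apply: (mean_is_le _ (mean_is_indic P (far_measurable n)) (@mean_is_sum _ _ _ P n.+1 (fun j => \1_(first_far n j)) (fun j => fine (P (first_far n j))) _)); last first.
    by move=> j jn; apply: mean_is_indic; apply: first_far_measurable; exact: ltnW.
  move=> w /=; have [[[j jn Fj] ->]|[_ ->]] := @indicEb _ _ R (far n) w; last first.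
    by apply: sumr_ge0 => j _; rewrite indicE.
  rewrite (bigD1 (Ordinal jn))//= indicE mem_set// lerDl; apply: sumr_ge0 => i _.
  by rewrite indicE.
apply: (@le_trans _ _ ((rho / 8) ^+ 4 * \sum_(j < n.+1) fine (P (first_far n j)))).
  by rewrite ler_wpM2l// ltW.
rewrite mulr_sumr; apply: (@le_trans _ _ (\sum_(j < n.+1) (e j + (rho / 8) ^+ 4 * del))).
  by apply: ler_sum => j _; have [_] := he j.
have -> : \sum_(j < n.+1) (e j + (rho / 8) ^+ 4 * del) = \sum_(j < n.+1) e' j + n.+1%:R * ((rho / 8) ^+ 4 * del).
  rewrite big_split/= sumr_const card_ord mulr_natl; congr (_ + _).
  by apply: eq_bigr => j _; rewrite e'E.
rewrite lerD2r; apply: le_trans sume _; apply: le_trans q4C _.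
by rewrite (_ : t + D - t = D)//; ring.
Qed.

(** Refining the mesh makes the oscillation event negligible, while the bound of [far_prob] does not
    depend on the mesh. The order D^2, a consequence of the fourth moments, makes exits o(D). *)
Lemma exit_prob : fine (P (~` stay rho (t + D))) <= 3 * C ^+ 4 * D ^+ 2 / (rho / 8) ^+ 4.
Proof.
have tDT : t <= t + D <= T by rewrite tD lerDl ltW.
have mst := measurableC (stay_measurable rho tDT).
apply/ler_addgt0Pr => e e0.
have [N hN] := prob_vanishing P osc_measurable osc_vanish e0.
have := hN N (leqnn _); have := far_prob N => f1 f2.
have mX : measurable [set w | X t w != x].
  have mXt : measurable_fun [set: Omega] (X t).
    by apply: (sol_measurable Pc BM solX); rewrite lexx (le_trans _ tD)// lerDl ltW.
  rewrite (_ : [set w | _] = X t @^-1` (~` [set x])).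
    by rewrite -[X in measurable X]setTI; apply: mXt => //; apply: measurableC; exact: measurable_set1.
  by apply/seteqP; split => w /= /eqP.
have PX : fine (P [set w | X t w != x]) = 0.
  have [_ _ _ [N' [mN' PN' sN']] _] := solX.
  have : (P [set w | X t w != x] <= P N')%E.
    by apply: le_measure; rewrite ?inE// => w /= /eqP h; apply: sN'.
  by rewrite PN' => h; rewrite (_ : P _ = 0%E)//; apply/eqP; rewrite eq_le h measure_ge0.
have pw w : \1_(~` stay rho (t + D)) w <= \1_(osc N) w + (\1_(far N) w + \1_[set w | X t w != x] w) :> R.
  have i0 (A : set Omega) : 0 <= \1_A w :> R by rewrite indicE.
  have := i0 (osc N); have := i0 (far N); have := i0 [set w | X t w != x].
  have [[/far_cover-/(_ N) h ->]|[_ ->]] := @indicEb _ _ R (~` stay rho (t + D)) w; last by lra.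
  have i1 (A : set Omega) : A w -> \1_A w = 1 :> R by move=> Aw; rewrite indicE mem_set.
  by case: h => [/i1 ->|[/i1 ->|/i1 ->]]; lra.
have := mean_is_le pw (mean_is_indic P mst) (mean_is_add (mean_is_indic P (osc_measurable N))
  (mean_is_add (mean_is_indic P (far_measurable N)) (mean_is_indic P mX))).
by rewrite PX; lra.
Qed.

End solution_martingale.

Lemma young_square (R : realFieldType) (th a z c2 : R) : 0 < th -> a ^+ 2 <= c2 ->
  (1 - th) * z ^+ 2 - th^-1 * c2 <= (a + z) ^+ 2 <= (1 + th) * z ^+ 2 + (1 + th^-1) * c2.
Proof.
move=> th0 ac.
have p1 : 0 <= (th * z - a) ^+ 2 / th by rewrite divr_ge0 ?sqr_ge0// ltW.
have p2 : 0 <= (th * z + a) ^+ 2 / th by rewrite divr_ge0 ?sqr_ge0// ltW.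
have q1 : (th * z - a) ^+ 2 / th = th * z ^+ 2 - 2 * (a * z) + th^-1 * a ^+ 2 by field; rewrite gt_eqF.
have q2 : (th * z + a) ^+ 2 / th = th * z ^+ 2 + 2 * (a * z) + th^-1 * a ^+ 2 by field; rewrite gt_eqF.
have q3 : th^-1 * a ^+ 2 <= th^-1 * c2 by rewrite ler_wpM2l// invr_ge0 ltW.
have a2 : 0 <= a ^+ 2 := sqr_ge0 a.
rewrite q1 in p1; rewrite q2 in p2.
have -> : (a + z) ^+ 2 = a ^+ 2 + 2 * (a * z) + z ^+ 2 by ring.
rewrite !mulrDl !mul1r; move: (th^-1 * c2) (th^-1 * a ^+ 2) p1 p2 q3 => u v p1 p2 q3.
by apply/andP; split; lra.
Qed.

(** All errors are brought to the single form [D * (th * const + D * G)], where [th] is the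
    oscillation of the coefficients on the ball and [G] collects the terms of order D^2. The
    constants enter as variables with defining equations, which keeps them atomic for the linear
    arithmetic. *)
Lemma moments_fixed d (Omega : measurableType d) (R : realType) (P : probability Omega R)
    (B : R -> Omega -> R) (I : set R) (mu sigma : R -> R) (t T x : R) (X : R -> Omega -> R)
    (rho C th D : R) :
  measure_is_complete P -> brownian_motion P B -> measurable (closure I) ->
  measurable_fun (closure I) mu -> measurable_fun (closure I) sigma -> 0 <= t ->
  strong_solution P B I mu sigma T t x X ->
  0 < rho -> 0 <= C -> 0 < th -> th <= 1 -> 0 < D -> D <= 1 ->
  t + D <= T -> C * D <= rho / 4 ->
  (forall y, `|y - x| <= rho -> [/\ `|mu y| <= C, `|sigma y| <= C, `|mu y - mu x| <= th &
     `|sigma y ^+ 2 - sigma x ^+ 2| <= th]) ->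
  forall K c G err : R, K = 3 * C ^+ 4 / (rho / 8) ^+ 4 -> c = sigma x ^+ 2 ->
  G = K + (K / (2 * th) + `|mu x| * K) + (2 * ((1 + c + C ^+ 2) * K + 3 * C ^+ 4) + (1 + th^-1) * C ^+ 2) ->
  err = D * (th * (C ^+ 2 + c + 3) + D * G) ->
  [/\ fine (P (~` stay t x X rho (t + D))) <= err,
   forall n, fine (P (far t x X rho D n)) <= err,
   exists2 m, mean_is P (fun w => (X (t + D) w - x) * \1_(stay t x X rho (t + D)) w) m & `|m - mu x * D| <= err &
   exists2 m, mean_is P (fun w => (X (t + D) w - x) ^+ 2 * \1_(stay t x X rho (t + D)) w) m & `|m - c * D| <= err].
Proof.
move=> Pc BM mcl mmu msigma t0 solX rho0 C0 th0 th1 D0 D1 tD CD Hy K c G err KE cE GE errE0.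
have muC y : `|y - x| <= rho -> `|mu y| <= C by case/Hy.
have sgC y : `|y - x| <= rho -> `|sigma y| <= C by case/Hy.
have tDT : t <= t + D <= T by rewrite tD lerDl ltW.
have [tsD sDT] := andP tDT.
have mst := stay_measurable Pc BM solX rho tDT.
set Ga := stay t x X rho (t + D) in mst *.
have exitp := exit_prob Pc BM mcl mmu t0 solX rho0 C0 muC sgC msigma D0 tD CD.
have [pG pGE] : exists pG, fine (P (~` Ga)) = pG by eexists.
rewrite pGE in exitp.
have pG0 : 0 <= pG by rewrite -pGE fine_ge0.
have K0 : 0 <= K by rewrite KE divr_ge0 ?exprn_ge0 ?mulr_ge0 ?exprn_ge0// ltW// divr_gt0.
have pGK : pG <= K * D ^+ 2 by apply: le_trans exitp _; rewrite KE mulrAC.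
have c0 : 0 <= c by rewrite cE sqr_ge0.
have [Hn [wf cH cM]] := sol_approx Pc BM mcl mmu t0 solX.
have tT : t <= T by rewrite (le_trans tsD).
have mH := sol_coef_measurable Pc BM mcl solX msigma (lexx t) tT (lexx T).
have HC w u : Ga w -> t <= u <= t + D -> `|sigma (X u w)| <= C by move=> h uD; apply: sgC; exact: h.
have Hc w u : Ga w -> t <= u <= t + D -> c - th <= sigma (X u w) ^+ 2 <= c + th.
  by move=> h uD; have [_ _ _] := Hy _ (h u uD); rewrite ler_norml => /andP[h1 h2]; apply/andP; split; rewrite cE; [lra_only h1|lra_only h2].
pose M := sol_mart mu t x X.
have mM := sol_mart_measurable Pc BM mcl mmu solX tDT.
pose A w := \int[lebesgue_measure]_(u in `[t, (t + D)%R]) mu (X u w).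
have Aest w : Ga w -> `|A w - mu x * D| <= th * D /\ `|A w| <= C * D.
  move=> h; have mp := sol_path_measurable Pc BM mcl solX w mmu (lexx t) tsD sDT.
  have h1 u : t <= u <= t + D -> `|mu (X u w) - mu x| <= th by move=> uD; have [] := Hy _ (h u uD).
  have h2 u : t <= u <= t + D -> `|mu (X u w) - 0| <= C by move=> uD; rewrite subr0; have [] := Hy _ (h u uD).
  have := Rintegral_near tsD mp h1; have := Rintegral_near tsD mp h2.
  by rewrite (_ : t + D - t = D) ?mul0r ?subr0//; ring.
have XM w : X (t + D) w - x = A w + M (t + D) w by rewrite /M /sol_mart -/(A w); ring.
have CD0 : 0 <= C * D by rewrite mulr_ge0// ltW.
have MK w : Ga w -> `|M (t + D) w| <= rho + C * D.
  move=> h; have [_ hA] := Aest w h; have := h (t + D); rewrite tsD lexx => /(_ isT) hX.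
  have -> : M (t + D) w = (X (t + D) w - x) - A w by rewrite XM; ring.
  by apply: le_trans (ler_normB _ _) _; exact: lerD.
have K1 : 0 <= rho + C * D by rewrite addr_ge0// ltW.
have fm z z1 := @first_moment _ _ _ _ _ Pc BM t T (fun u w => sigma (X u w)) M Hn t0 mH wf cH
  (t + D) C (rho + C * D) Ga tDT C0 mst HC mM (cM _ tDT) MK K1 th z th0 z1.
have [m1 hm1 up1] := fm 1 (normr1 _); have [m1' hm1' lo1] := fm (-1) (normrN1 _).
have em1 := mean_is_uniq hm1' hm1; rewrite {}em1 in lo1 => {hm1'}.
have [m2 hm2 /andP[lo2 up2]] := second_moment Pc BM t0 mH wf cH tDT C0 mst HC mM (cM _ tDT) MK K1 c0 (ltW th0) Hc.
have tDE : t + D - t = D by ring.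
rewrite pGE tDE in up1; rewrite pGE tDE in lo1; rewrite pGE !tDE in lo2; rewrite pGE !tDE in up2.
have hG := mean_is_indic P mst; have hGc : fine (P Ga) = 1 - pG.
  have := probability_setC P mst; rewrite -pGE => ->.
  by rewrite fineB ?fin_num_measure//= opprB addrC subrK.
have thi : 0 < th^-1 by rewrite invr_gt0.
have D20 : 0 <= D ^+ 2 by rewrite sqr_ge0.
have e1 : (2 * th)^-1 * pG <= D * (D * (K / (2 * th))).
  rewrite (_ : D * _ = (2 * th)^-1 * (K * D ^+ 2)); last by ring.
  by rewrite ler_wpM2l// invr_ge0 mulr_ge0// ltW.
have e2 : `|mu x| * D * pG <= D * (D * (`|mu x| * K)).
  apply: (@le_trans _ _ (`|mu x| * 1 * (K * D ^+ 2))).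
    apply: ler_pM => //; first by rewrite mulr_ge0// ltW.
    by rewrite ler_wpM2l.
  by rewrite le_eqVlt; apply/orP; left; apply/eqP; ring.
have e3 : pG <= D * (D * K) by rewrite mulrA mulrC -expr2.
have cD : c * D * pG <= D * (D * (c * K)).
  apply: (@le_trans _ _ (c * 1 * (K * D ^+ 2))).
    apply: ler_pM => //; first by rewrite mulr_ge0// ltW.
    by rewrite ler_wpM2l.
  by rewrite le_eqVlt; apply/orP; left; apply/eqP; ring.
have C2 : 0 <= C ^+ 2 := sqr_ge0 _.
have CDp : C ^+ 2 * D * pG <= D * (D * (C ^+ 2 * K)).
  apply: (@le_trans _ _ (C ^+ 2 * 1 * (K * D ^+ 2))).
    apply: ler_pM => //; first by rewrite mulr_ge0// ltW.
    by rewrite ler_wpM2l.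
  by rewrite le_eqVlt; apply/orP; left; apply/eqP; ring.
have [G2 G2E] : exists G2, G2 = (1 + c + C ^+ 2) * K + 3 * C ^+ 4 by eexists.
have C4 : 0 <= 3 * C ^+ 4 by rewrite mulr_ge0// exprn_ge0.
have cK : 0 <= c * K by rewrite mulr_ge0.
have CK : 0 <= C ^+ 2 * K by rewrite mulr_ge0.
have cdp : 0 <= C ^+ 2 * D * pG by rewrite mulr_ge0// mulr_ge0// ltW.
have pos (a : R) : 0 <= a -> 0 <= D * (D * a) by move=> a0; do 2! (apply: mulr_ge0; first exact: ltW).
have d1 := pos _ K0; have d2 := pos _ C4; have d3 := pos _ cK; have d4 := pos _ CK.
have est2 : `|m2 - c * D| <= D * (th + D * G2).
  have -> : D * (th + D * G2) = th * D + D * (D * K) + D * (D * (c * K)) + D * (D * (C ^+ 2 * K)) + D * (D * (3 * C ^+ 4)).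
    by rewrite G2E; ring.
  have e4 : 3 * C ^+ 4 * D ^+ 2 = D * (D * (3 * C ^+ 4)) by ring.
  by rewrite ler_norml; apply/andP; split; clear -lo2 up2 e3 cD CDp d2 d1 d3 d4 e4 cdp pG0; lra.
have est1 : `|m1| <= D * (th * C ^+ 2 + D * (K / (2 * th))).
  have -> : D * (th * C ^+ 2 + D * (K / (2 * th))) = th * (C ^+ 2 * D) + D * (D * (K / (2 * th))) by ring.
  move: (_^-1 * pG) (D * (D * (K / (2 * th)))) up1 lo1 e1 => u v up1 lo1 e1.
  by rewrite ler_norml; apply/andP; split; [lra_only lo1 e1|lra_only up1 e1].
have mXw : measurable_fun [set: Omega] (fun w => X (t + D) w - x).
  by apply: measurable_funB => //; exact: (sol_measurable Pc BM solX).
have D3 : 0 <= K / (2 * th) by rewrite divr_ge0// mulr_ge0// ltW.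
have D4 : 0 <= `|mu x| * K by rewrite mulr_ge0.
have G20 : 0 <= G2 by rewrite G2E; clear -K0 cK CK C4; lra.
have D5 : 0 <= (1 + th^-1) * C ^+ 2 by rewrite mulr_ge0// addr_ge0// ltW.
have d5 := pos _ D3; have d6 := pos _ D4; have d7 := pos _ G20; have d8 := pos _ D5.
have tD0 : 0 <= D * th by rewrite mulr_ge0// ltW.
have tDC : 0 <= D * th * C ^+ 2 by rewrite mulr_ge0.
have tDc : 0 <= D * th * c by rewrite mulr_ge0.
have errE : err = D * th * C ^+ 2 + D * th * c + 3 * (D * th) + (D * (D * K) + D * (D * (K / (2 * th))) +
   D * (D * (`|mu x| * K)) + 2 * (D * (D * G2)) + D * (D * ((1 + th^-1) * C ^+ 2))).
  by rewrite errE0 GE -G2E; ring.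
have farE n : fine (P (far t x X rho D n)) <= D * (D * K).
  have := far_prob Pc BM mcl mmu t0 solX rho0 C0 muC sgC msigma D0 tD CD n.
  by rewrite mulrAC -KE expr2 mulrC mulrA.
split.
- by rewrite pGE errE; clear -e3 tD0 tDC tDc d1 d5 d6 d7 d8; lra.
- by move=> n; apply: le_trans (farE n) _; rewrite errE; clear -tD0 tDC tDc d1 d5 d6 d7 d8; lra.
- have bY w : `|(X (t + D) w - x) * \1_Ga w| <= rho.
    have [[h ->]|[_ ->]] := @indicEb _ _ R Ga w; last by rewrite mulr0 normr0 ltW.
    by rewrite mulr1; apply: h; rewrite tsD lexx.
  have hY := mean_is_bounded P (measurable_funM mXw (measurable_indic mst)) bY.
  eexists; first exact: hY.
  set m := fine _ in hY *.
  have pw1 w : (X (t + D) w - x) * \1_Ga w <= M (t + D) w * \1_Ga w + (mu x * D + th * D) * \1_Ga w.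
    have [[h ->]|[_ ->]] := @indicEb _ _ R Ga w; last by rewrite !mulr0 addr0.
    have [+ _] := Aest w h; rewrite ler_norml XM !mulr1 => /andP[k1 k2]; clear -k1 k2; lra.
  have pw2 w : M (t + D) w * \1_Ga w + (mu x * D - th * D) * \1_Ga w <= (X (t + D) w - x) * \1_Ga w.
    have [[h ->]|[_ ->]] := @indicEb _ _ R Ga w; last by rewrite !mulr0 addr0.
    have [+ _] := Aest w h; rewrite ler_norml XM !mulr1 => /andP[k1 k2]; clear -k1 k2; lra.
  have := mean_is_le pw1 hY (mean_is_add hm1 (mean_is_scale _ hG)).
  have := mean_is_le pw2 (mean_is_add hm1 (mean_is_scale _ hG)) hY.
  rewrite hGc => h1 h2.
  have thp : 0 <= th * D * pG by rewrite mulr_ge0// mulr_ge0// ltW.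
  have mp : `|mu x * D * pG| <= D * (D * (`|mu x| * K)).
    by rewrite !normrM (ger0_norm pG0) (ger0_norm (ltW D0)).
  move: mp est1; rewrite !ler_norml errE => /andP[k1 k2] /andP[k3 k4]; apply/andP; split; clear -h1 h2 thp k1 k2 k3 k4 tD0 tDC tDc d1 d5 d6 d7 d8; lra.
- have bY w : `|(X (t + D) w - x) ^+ 2 * \1_Ga w| <= rho ^+ 2.
    have [[h ->]|[_ ->]] := @indicEb _ _ R Ga w; last by rewrite mulr0 normr0 sqr_ge0.
    rewrite mulr1 normrX; apply: lerXn2r; rewrite ?nnegrE//; first exact: ltW.
    by apply: h; rewrite tsD lexx.
  have hY := mean_is_bounded P (measurable_funM (measurable_funX 2 mXw) (measurable_indic mst)) bY.
  eexists; first exact: hY.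
  set m := fine _ in hY *.
  have young w : Ga w -> (1 - th) * M (t + D) w ^+ 2 - th^-1 * C ^+ 2 * D ^+ 2 <= (A w + M (t + D) w) ^+ 2
      <= (1 + th) * M (t + D) w ^+ 2 + (1 + th^-1) * C ^+ 2 * D ^+ 2.
    move=> h; have [_ hA] := Aest w h.
    have A2 : A w ^+ 2 <= C ^+ 2 * D ^+ 2.
      rewrite -exprMn -(real_normK (num_real (A w))); apply: lerXn2r => //; by rewrite nnegrE.
    by rewrite -!(mulrA _ (C ^+ 2)); exact: young_square.
  have pw1 w : (X (t + D) w - x) ^+ 2 * \1_Ga w <= (1 + th) * (M (t + D) w ^+ 2 * \1_Ga w) + (1 + th^-1) * C ^+ 2 * D ^+ 2.
    have pp : 0 <= (1 + th^-1) * C ^+ 2 * D ^+ 2 by rewrite mulr_ge0.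
    have [[h ->]|[_ ->]] := @indicEb _ _ R Ga w; last by rewrite !mulr0 add0r.
    by have /andP[_] := young w h; rewrite XM !mulr1.
  have pw2 w : (1 - th) * (M (t + D) w ^+ 2 * \1_Ga w) <= (X (t + D) w - x) ^+ 2 * \1_Ga w + th^-1 * C ^+ 2 * D ^+ 2.
    have pp : 0 <= th^-1 * C ^+ 2 * D ^+ 2 by rewrite mulr_ge0// mulr_ge0// ltW.
    have [[h ->]|[_ ->]] := @indicEb _ _ R Ga w; last by rewrite !mulr0 add0r.
    by have /andP[+ _] := young w h; rewrite XM !mulr1 lerBlDr.
  have := mean_is_le pw1 hY (mean_is_add (mean_is_scale _ hm2) (mean_is_cst P _)).
  have := mean_is_le pw2 (mean_is_scale _ hm2) (mean_is_add hY (mean_is_cst P _)).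
  have E1 : (1 + th^-1) * C ^+ 2 * D ^+ 2 = D * (D * ((1 + th^-1) * C ^+ 2)) by ring.
  have E2 : th^-1 * C ^+ 2 * D ^+ 2 = D * (D * ((1 + th^-1) * C ^+ 2)) - C ^+ 2 * D ^+ 2 by ring.
  have E3 : 0 <= C ^+ 2 * D ^+ 2 by rewrite mulr_ge0.
  rewrite E1 E2 => h1 h2.
  have tg : th * (D * (D * G2)) <= D * (D * G2) by rewrite -[leRHS]mul1r ler_wpM2r.
  have tt : th * (D * th) <= D * th by rewrite -[leRHS]mul1r ler_wpM2r.
  have tm : `|th * (m2 - c * D)| <= th * (D * (th + D * G2)) by rewrite normrM gtr0_norm// ler_wpM2l// ltW.
  rewrite !mulrDr in tm est2.
  have tm' : th * m2 + th * - (c * D) = th * m2 - D * th * c by ring.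
  rewrite tm' in tm.
  move: tm est2; rewrite !ler_norml errE => /andP[k1 k2] /andP[k3 k4]; apply/andP; split; clear -h1 h2 tg tt k1 k2 k3 k4 tD0 tDC tDc d1 d5 d6 d7 d8 E3; lra.
Qed.

(** Substitute for Ito's formula. The order of choice matters: [th] from [eps], the radius from the
    continuity of [mu], [sigma] and [sigma^2] at [x] with tolerances 1 and [th], and finally [D0]
    from the radius and [G]. *)
Lemma local_moments d (Omega : measurableType d) (R : realType) (P : probability Omega R)
    (B : R -> Omega -> R) (I : set R) (mu sigma : R -> R) (t T x : R) (X : R -> Omega -> R)
    (eps : R) :
  measure_is_complete P -> brownian_motion P B -> measurable (closure I) ->
  measurable_fun (closure I) mu -> measurable_fun (closure I) sigma -> 0 <= t -> t < T ->
  strong_solution P B I mu sigma T t x X ->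
  {for x, continuous mu} -> {for x, continuous sigma} -> 0 < eps ->
  exists2 rho0, 0 < rho0 & forall rho, 0 < rho <= rho0 ->
  exists2 D0, 0 < D0 & forall D, 0 < D <= D0 -> t + D <= T /\
  [/\ fine (P (~` stay t x X rho (t + D))) <= eps * D,
   forall n, fine (P (far t x X rho D n)) <= eps * D,
   exists2 m, mean_is P (fun w => (X (t + D) w - x) * \1_(stay t x X rho (t + D)) w) m &
     `|m - mu x * D| <= eps * D &
   exists2 m, mean_is P (fun w => (X (t + D) w - x) ^+ 2 * \1_(stay t x X rho (t + D)) w) m &
     `|m - sigma x ^+ 2 * D| <= eps * D].
Proof.
move=> Pc BM mcl mmu msigma t0 tT solX cmu csigma eps0.
pose C := `|mu x| + `|sigma x| + 1.
have C0 : 0 <= C by rewrite !addr_ge0.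
pose L := C ^+ 2 + sigma x ^+ 2 + 3.
have L0 : 0 < L by rewrite ltr_wpDl ?addr_ge0 ?sqr_ge0.
pose th := Num.min 1 (eps / (2 * L)).
have th0 : 0 < th by rewrite lt_min ltr01 divr_gt0// mulr_gt0.
have th1 : th <= 1 by rewrite ge_min lexx.
have thL : th * L <= eps / 2.
  have : th <= eps / (2 * L) by rewrite ge_min lexx orbT.
  by rewrite ler_pdivlMr ?mulr_gt0//; move: (th) => h; lra.
have near_ (f : R -> R) e : {for x, continuous f} -> 0 < e ->
    exists2 r, 0 < r & forall y, `|y - x| < r -> `|f y - f x| < e.
  move=> cf e0; have /cvgrPdist_lt/(_ _ e0) := cf; rewrite /prop_for.
  move=> /nbhs_ballP[r r0 hr]; exists r => // y yx; rewrite distrC; apply: hr.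
  by rewrite /ball/= distrC.
have [r1 r10 h1] := near_ mu _ cmu th0.
have [r2 r20 h2] := near_ sigma _ csigma ltr01.
have csig2 : {for x, continuous (fun y => sigma y ^+ 2)}.
  by rewrite /prop_for /continuous_at; under eq_fun do rewrite expr2; rewrite expr2; apply: cvgM.
have [r3 r30 h3] := near_ (fun y => sigma y ^+ 2) _ csig2 th0.
pose r := Num.min r1 (Num.min r2 r3).
have r0 : 0 < r by rewrite !lt_min r10 r20.
exists (r / 2); first by rewrite divr_gt0.
move=> rho /andP[rho0 rhor].
have Hy y : `|y - x| <= rho -> [/\ `|mu y| <= C, `|sigma y| <= C, `|mu y - mu x| <= th &
     `|sigma y ^+ 2 - sigma x ^+ 2| <= th].
  move=> yx; have : `|y - x| < r by lra_only yx rhor r0.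
  rewrite !lt_min => /andP[/h1 k1 /andP[/h2 k2 /h3 k3]].
  split; try exact: ltW.
    rewrite -(subrK (mu x) (mu y)); apply: le_trans (ler_normD _ _) _.
    by have h := normr_ge0 (sigma x); rewrite /C; lra_only h k1 th1.
  rewrite -(subrK (sigma x) (sigma y)); apply: le_trans (ler_normD _ _) _.
  by have h := normr_ge0 (mu x); rewrite /C; lra_only h k2.
set K := 3 * C ^+ 4 / (rho / 8) ^+ 4.
set c := sigma x ^+ 2.
set G := K + (K / (2 * th) + `|mu x| * K) + (2 * ((1 + c + C ^+ 2) * K + 3 * C ^+ 4) + (1 + th^-1) * C ^+ 2).
pose D0 := Num.min (Num.min 1 (T - t)) (Num.min (rho / (4 * (C + 1))) (eps / (2 * (`|G| + 1)))).
have C1 : 0 < C + 1 by lra.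
have G1 : 0 < `|G| + 1 by rewrite ltr_wpDl.
exists D0.
  by rewrite !lt_min ltr01 subr_gt0 tT !divr_gt0// mulr_gt0.
move=> D /andP[Dp]; rewrite !le_min => /andP[/andP[D1 DT] /andP[DC DG]].
have tD : t + D <= T by lra_only DT.
split => //.
have CD : C * D <= rho / 4.
  by move: DC; rewrite ler_pdivlMr ?mulr_gt0// => h; lra_only h Dp.
have errle : D * (th * (C ^+ 2 + c + 3) + D * G) <= eps * D.
  rewrite mulrC ler_wpM2r//; first exact: ltW.
  have : D * G <= D * (`|G| + 1).
    by rewrite ler_wpM2l ?(ltW Dp)//; have h := ler_norm G; lra_only h.
  have : D * (`|G| + 1) <= eps / 2.
    by move: DG; rewrite ler_pdivlMr ?mulr_gt0// => h; lra_only h.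
  by rewrite -/L => h4 h5; lra_only h4 h5 thL.
have [k1 kf [m1 k2 k3] [m2 k4 k5]] := moments_fixed Pc BM mcl mmu msigma t0 solX rho0 C0 th0 th1
  Dp D1 tD CD Hy (erefl K) (erefl c) (erefl G) (erefl _).
split; first exact: le_trans errle.
- by move=> n; exact: le_trans errle.
- by exists m1 => //; exact: le_trans errle.
by exists m2 => //; exact: le_trans errle.
Qed.

(** * Cylinder sets on the space of paths *)

Section path_space.
Context (R : realType).

(** Generates the product sigma-algebra of evaluations up to time [s] on the set of all real
    functions; its points play the role of future Brownian increments. *)
Definition path_gen (s : R) : set (set (R -> R)) := [set A | exists u (D : set R),
  [/\ 0 <= u <= s, measurable D & A = (fun e : R -> R => e u) @^-1` D]].

Lemma measurable_path_eval s u : 0 <= u <= s ->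
  measurable_fun [set: g_sigma_algebraType (path_gen s)] (fun e : R -> R => e u).
Proof.
move=> us _ D mD; rewrite setTI; apply: sub_sigma_algebra; by exists u, D.
Qed.

Lemma measurable_to_path d (Om : measurableType d) (Z : Om -> R -> R) s :
  (forall u, 0 <= u <= s -> measurable_fun [set: Om] (fun w => Z w u)) ->
  measurable_fun [set: Om] (Z : Om -> g_sigma_algebraType (path_gen s)).
Proof.
move=> mZ; apply: (@measurability _ _ _ (g_sigma_algebraType (path_gen s)) setT Z (path_gen s)) => //.
move=> _ [_ [u [D [us mD ->]]] <-]; exact: (mZ u us measurableT D mD).
Qed.

Definition cyl (l : seq (R * set R)) : set (R -> R) := [set e | forall p, p \in l -> p.2 (e p.1)].

Definition cyls (s : R) : set (set (R -> R)) := [set A | exists l : seq (R * set R),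
  (forall p, p \in l -> 0 <= p.1 <= s /\ measurable p.2) /\ A = cyl l].

Lemma cyls_setI s : setI_closed (cyls s).
Proof.
move=> _ _ [l [hl ->]] [k [hk ->]]; exists (l ++ k); split.
  by move=> p; rewrite mem_cat => /orP[/hl|/hk].
apply/seteqP; split => e /=.
  by move=> [h1 h2] p; rewrite mem_cat => /orP[/h1|/h2].
by move=> h; split => p pl; apply: h; rewrite mem_cat pl ?orbT.
Qed.

Lemma cyl_measurable s l : (forall p, p \in l -> 0 <= p.1 <= s /\ measurable p.2) ->
  measurable (cyl l : set (g_sigma_algebraType (path_gen s))).
Proof.
elim: l => [|p l IH] hl.
  by rewrite (_ : cyl [::] = setT); [exact: measurableT|apply/seteqP; split => // e _ p].
rewrite (_ : cyl (p :: l) = (fun e : R -> R => e p.1) @^-1` p.2 `&` cyl l).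
  apply: measurableI; last by apply: IH => q ql; apply: hl; rewrite inE ql orbT.
  have [p1 p2] := hl p (mem_head _ _).
  rewrite -[X in measurable X]setTI; exact: (measurable_path_eval p1).
apply/seteqP; split => e /=.
  by move=> h; split => [|q ql]; apply: h; rewrite inE ?eqxx ?ql ?orbT.
by move=> [h1 h2] q; rewrite inE => /predU1P[->|/h2].
Qed.

Lemma path_gen_cyls s : <<s path_gen s >> `<=` <<s cyls s >>.
Proof.
apply: smallest_sub; first exact: smallest_sigma_algebra.
move=> _ [u [D [us mD ->]]]; apply: sub_sigma_algebra; exists [:: (u, D)]; split.
  by move=> p; rewrite inE => /eqP ->.
apply/seteqP; split => e /=.
  by move=> h p; rewrite inE => /eqP ->.
by move=> h; exact: (h (u, D) (mem_head _ _)).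
Qed.

End path_space.

(** * Independence and stationarity of the future increments *)

Section path_law.
Context d (Omega : measurableType d) (R : realType) (P : probability Omega R).
Variable B : R -> Omega -> R.
Hypothesis Pc : measure_is_complete P.
Hypothesis BM : brownian_motion P B.
Local Notation OF s := (g_sigma_algebraType (filtration_gen P B 0 s)).
Local Notation PE s := (g_sigma_algebraType (path_gen s)).

Definition shift t (w : Omega) : R -> R := fun u => B (t + u) w - B t w.

Lemma adapted_shift t s : 0 <= t -> 0 <= s -> measurable_fun [set: OF (t + s)] (shift t : _ -> PE s).
Proof.
move=> t0 s0; apply: measurable_to_path => u /andP[u0 us].
by apply: measurable_funB; apply: adapted_brownian; lra.
Qed.

Lemma shift_measurable t s : 0 <= t -> 0 <= s -> measurable_fun [set: Omega] (shift t : _ -> PE s).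
Proof. by move=> t0 s0; apply: (adapted_measurable Pc BM (s := t + s)); exact: adapted_shift. Qed.

(** The finite-dimensional law of the increments, computed backwards over the ordered times. [c] is
    the last time treated and [Y] the increment accumulated so far. [F] is chosen before [t], [G]
    and [Y]: this is where stationarity enters. Repeated times, for which the normal step would
    degenerate, form the case [u = c]. *)
Lemma cyl_integral (l : seq (R * set R)) c : 0 <= c ->
  path (fun p q : R * set R => p.1 <= q.1) (c, set0) l -> (forall p, p \in l -> measurable p.2) ->
  exists F : R -> \bar R, [/\ measurable_fun [set: R] F, forall y, (0 <= F y)%E &
    forall t (G Y : Omega -> R), 0 <= t -> measurable_fun [set: OF (t + c)] G ->
     measurable_fun [set: OF (t + c)] Y -> (forall w, 0 <= G w) ->
    (\int[P]_w (G w * \1_[set w | forall p, p \in l -> p.2 (Y w + (B (t + p.1) w - B (t + c) w))] w)%:E =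
     \int[P]_w ((G w)%:E * F (Y w)))%E].
Proof.
elim: l c => [|[u D] l IH] c c0.
  move=> _ _; exists (cst 1%E); split => // t G Y t0 mG mY G0.
  apply: eq_integral => w _; rewrite mule1 indicE mem_set ?mulr1//.
move=> /= /andP[cu pl] mD.
have u0 : 0 <= u := le_trans c0 cu.
have mD1 : measurable D by exact: (mD (u, D) (mem_head _ _)).
have [||F' [mF' F'0 hF']] := IH u u0; first by move: pl; case: (l).
  by move=> p pl'; apply: mD; rewrite inE pl' orbT.
have consE t (Y : Omega -> R) : [set w | forall p, p \in (u, D) :: l -> p.2 (Y w + (B (t + p.1) w - B (t + c) w))] =
    [set w | D (Y w + (B (t + u) w - B (t + c) w))] `&`
    [set w | forall p, p \in l -> p.2 (Y w + (B (t + u) w - B (t + c) w) + (B (t + p.1) w - B (t + u) w))].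
  apply/seteqP; split => w /=.
    move=> h; split; first exact: (h (u, D) (mem_head _ _)).
    move=> p pl'; have := h p; rewrite inE pl' orbT => /(_ isT).
    by congr (p.2 _); ring.
  move=> [h1 h2] p; rewrite inE => /predU1P[->//|/h2].
  by congr (p.2 _); ring.
have indM (A A' : set Omega) (w : Omega) : \1_(A `&` A') w = \1_A w * \1_A' w :> R by rewrite indicI.
have mInd d' (Om : measurableType d') (Y : Om -> R) : measurable_fun [set: Om] Y ->
    measurable_fun [set: Om] (fun w => \1_D (Y w) : R).
  by move=> mY; apply: (measurableT_comp (measurable_indic mD1)).
have [uc|lt] := leP u c.
  have {}uc : u = c by apply/eqP; rewrite eq_le uc.
  exists (fun y => (\1_D y)%:E * F' y)%E; split.
  - by apply: emeasurable_funM => //; apply/measurable_EFinP; exact: measurable_indic.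
  - by move=> y; rewrite mule_ge0// lee_fin indicE.
  move=> t G Y t0 mG mY G0; rewrite consE uc.
  have := hF' t (fun w => G w * \1_D (Y w)) Y t0; rewrite uc => /(_ _ mY) h.
  transitivity (\int[P]_w ((G w * \1_D (Y w))%:E * F' (Y w)))%E.
    rewrite -h; last 2 first.
    - by apply: measurable_funM => //; exact: mInd.
    - by move=> w; rewrite mulr_ge0// indicE.
    apply: eq_integral => w _; congr EFin; rewrite indM mulrA; congr (_ * _ * _).
      by rewrite !indicE; congr (_%:R); congr (nat_of_bool _); apply/idP/idP; rewrite !inE/= subrr addr0.
    rewrite !indicE; congr (_%:R); congr (nat_of_bool _).
    by apply/idP/idP; rewrite !inE/= subrr addr0.
  by apply: eq_integral => w _; rewrite EFinM muleA.
pose h2 (p : R * R) : \bar R := ((\1_D (p.1 + p.2)%R)%:E * F' (p.1 + p.2)%R)%E.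
have mh2 : measurable_fun [set: measurableTypeR R * measurableTypeR R] h2.
  have mp : measurable_fun [set: measurableTypeR R * measurableTypeR R] (fun p => p.1 + p.2 : R).
    by apply: measurable_funD; [exact: measurable_fst|exact: measurable_snd].
  apply: emeasurable_funM; last exact: (measurableT_comp mF' mp).
  by apply/measurable_EFinP; exact: mInd.
have h20 p : (0 <= h2 p)%E by rewrite /h2 mule_ge0// lee_fin indicE.
pose N := normal_prob 0 (Num.sqrt (u - c)) : probability (measurableTypeR R) R.
exists (fun y => \int[N]_z h2 (y, z))%E; split.
- exact: (@measurable_fun_fubini_tonelli_F _ _ _ _ R N h2 mh2 h20).
- by move=> y; apply: integral_ge0.
move=> t G Y t0 mG mY G0; rewrite consE.
have tu : 0 <= t + c < t + u by apply/andP; split; lra.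
have mB' : measurable_fun [set: OF (t + u)] (fun w => Y w + (B (t + u) w - B (t + c) w)).
  apply: measurable_funD; first by apply: (@adapted_le _ _ _ _ _ (t + c)) => //; lra.
  by apply: measurable_funB; apply: adapted_brownian; lra.
have mG' : measurable_fun [set: OF (t + u)] (fun w => G w * \1_D (Y w + (B (t + u) w - B (t + c) w))).
  apply: measurable_funM; last exact: mInd.
  by apply: (@adapted_le _ _ _ _ _ (t + c)) => //; lra.
transitivity (\int[P]_w ((G w * \1_D (Y w + (B (t + u) w - B (t + c) w)))%:E * F' (Y w + (B (t + u) w - B (t + c) w))%R))%E.
  rewrite -(hF' t _ _ t0 mG' mB'); last by move=> w; rewrite mulr_ge0// indicE.
  apply: eq_integral => w _; congr EFin; rewrite indM mulrA; congr (_ * _ * _).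
pose h (p : OF (t + c) * measurableTypeR R) : \bar R := ((G p.1)%:E * h2 (Y p.1, p.2))%E.
have mh : measurable_fun [set: OF (t + c) * measurableTypeR R] h.
  apply: emeasurable_funM.
    by apply/measurable_EFinP; exact: (measurableT_comp mG measurable_fst).
  have mj : measurable_fun [set: OF (t + c) * measurableTypeR R]
     ((fun p => (Y p.1, p.2)) : _ -> measurableTypeR R * measurableTypeR R).
    apply/measurable_fun_pairP; split; last exact: measurable_snd.
    exact: (measurableT_comp mY measurable_fst).
  exact: (measurableT_comp mh2 mj).
have h0 p : (0 <= h p)%E by rewrite /h mule_ge0// lee_fin.
have := brownian_incr_integral Pc BM tu mh h0.
rewrite (_ : t + u - (t + c) = u - c); last by ring.
move=> e; transitivity (\int[P]_w h ((w : OF (t + c)), (B (t + u) w - B (t + c) w)%R))%E.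
  by apply: eq_integral => w _; rewrite /h /h2 /= EFinM muleA.
rewrite e; apply: eq_integral => w _; rewrite /h /=.
rewrite ge0_integralZl//; last by rewrite lee_fin.
by apply: (measurableT_comp mh2 (measurable_fun_pair _ _)); [exact: measurable_cst|exact: measurable_id].
Qed.

Lemma shift_cyl s l : 0 <= s -> (forall p, p \in l -> 0 <= p.1 <= s /\ measurable p.2) ->
  exists q : \bar R, forall t A, 0 <= t -> filtration P B 0 t A -> P (A `&` shift t @^-1` cyl l) = (P A * q)%E.
Proof.
move=> s0 hl.
pose le1 := fun p q : R * set R => p.1 <= q.1.
pose l' := sort le1 l.
have srt : sorted le1 l' by apply: sort_sorted => p q; exact: le_total.
have pl' : path le1 (0, set0) l'.
  move: srt; have : forall p, p \in l' -> 0 <= p.1 by move=> p; rewrite mem_sort => /hl[/andP[]].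
  by case: (l') => //= p k hk ->; rewrite andbT; apply: hk; exact: mem_head.
have ml' p : p \in l' -> measurable p.2 by rewrite mem_sort => /hl[].
have [F [mF F0 hF]] := cyl_integral (lexx 0) pl' ml'.
exists (F 0) => t A t0 FA.
have mA : measurable A := filtration_measurable Pc BM FA.
have mA' : measurable (A : set (OF (t + 0))) by rewrite addr0.
have := hF t \1_A (cst 0) t0 (measurable_indic mA') (measurable_cst _) (fun w => ltac:(by rewrite indicE)).
have EE : [set w | forall p, p \in l' -> p.2 (cst 0 w + (B (t + p.1) w - B (t + 0) w))] = shift t @^-1` cyl l.
  apply/seteqP; split => w /= h p pl.
    by have := h p; rewrite mem_sort => /(_ pl); rewrite add0r addr0.
  by have := h p; rewrite -(mem_sort le1) => /(_ pl); rewrite /shift add0r addr0.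
have mE : measurable (shift t @^-1` cyl l).
  by rewrite -[X in measurable X]setTI; apply: (shift_measurable t0 s0) => //; exact: cyl_measurable.
rewrite EE.
under eq_integral do rewrite -[_ * _]/((\1_A \* \1_(shift t @^-1` cyl l)) _) -indicI.
rewrite integral_indic// ?setIT; last exact: measurableI.
move=> ->; transitivity (\int[P]_w (F 0%R * (\1_A w)%:E))%E.
  by apply: eq_integral => w _; rewrite muleC.
rewrite ge0_integralZl//; last by apply/measurable_EFinP; exact: measurable_indic.
by rewrite integral_indic// setIT muleC.
Qed.

(** A pi-lambda argument from cylinders, for which the conditional probability [q] of [shift_cyl] is
    the same after [t1] and after [t2]. *)
Lemma path_indep t1 t2 s A (D : set (PE s)) : 0 <= t1 -> 0 <= t2 -> 0 <= s ->
  filtration P B 0 t1 A -> measurable D ->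
  P (A `&` shift t1 @^-1` D) = (P A * P (shift t2 @^-1` D))%E.
Proof.
move=> t10 t20 s0 FA mD.
have mA : measurable A := filtration_measurable Pc BM FA.
have mS t (X : set (PE s)) : 0 <= t -> measurable X -> measurable (shift t @^-1` X).
  by move=> t0 mX; rewrite -[Y in measurable Y]setTI; apply: (shift_measurable t0 s0).
pose H : set (set (PE s)) := [set X : set (PE s) | measurable X /\ P (A `&` shift t1 @^-1` X) = (P A * P (shift t2 @^-1` X))%E].
suff : H D by case.
apply: (@lambda_system_subset _ (cyls s) (@cyls_setI R s) setT H) => //; last exact: path_gen_cyls.
- split => //.
  + by split; [exact: measurableT|rewrite !preimage_setT setIT probability_setT mule1].
  + move=> X Y YX [mX hX] [mY hY]; split; first exact: measurableD.
    have pD t : shift t @^-1` (X `\` Y) = shift t @^-1` X `\` shift t @^-1` Y by [].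
    have f1 t Z : 0 <= t -> measurable (Z : set (PE s)) -> P (shift t @^-1` Z) \is a fin_num.
      by move=> t0 mZ; rewrite fin_num_measure//; exact: mS.
    transitivity (P (A `&` shift t1 @^-1` X) - P (A `&` shift t1 @^-1` Y))%E.
      rewrite pD setIDA measureD//; last 3 first.
      * by apply: measurableI => //; exact: mS.
      * exact: mS.
      * by rewrite ltey_eq fin_num_measure//; apply: measurableI => //; exact: mS.
      congr (_ - P _)%E; rewrite -setIA; congr (_ `&` _); apply/setIidr; exact: preimage_subset.
    transitivity (P A * (P (shift t2 @^-1` X) - P (shift t2 @^-1` Y)))%E.
      rewrite hX hY muleBr//; first exact: fin_num_measure.
      by rewrite fin_num_adde_defr// f1.
    congr (_ * _)%E; rewrite pD measureD//; last 3 first.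
      * exact: mS.
      * exact: mS.
      * by rewrite ltey_eq f1.
    by congr (_ - P _)%E; apply/esym/setIidr; exact: preimage_subset.
  + move=> F ndF HF; have mF n : measurable (F n : set (PE s)) by have [] := HF n.
    split; first exact: bigcupT_measurable.
    rewrite !preimage_bigcup setI_bigcupr.
    have c1 : P (A `&` shift t1 @^-1` F n) @[n --> \oo] --> P (\bigcup_n (A `&` shift t1 @^-1` F n)).
      apply: nondecreasing_cvg_mu.
      * by move=> n; apply: measurableI => //; exact: mS.
      * by apply: bigcupT_measurable => n; apply: measurableI => //; exact: mS.
      * by move=> m n mn; apply/subsetPset; apply: setIS; apply: preimage_subset; apply/subsetPset; exact: ndF.
    have c2 : P (shift t2 @^-1` F n) @[n --> \oo] --> P (\bigcup_n (shift t2 @^-1` F n)).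
      apply: nondecreasing_cvg_mu.
      * by move=> n; exact: mS.
      * by apply: bigcupT_measurable => n; exact: mS.
      * by move=> m n mn; apply/subsetPset; apply: preimage_subset; apply/subsetPset; exact: ndF.
    have c3 : (P A * P (shift t2 @^-1` F n))%E @[n --> \oo] --> (P A * P (\bigcup_n (shift t2 @^-1` F n)))%E.
      by apply: cvgeZl => //; exact: fin_num_measure.
    have E : (fun n => P (A `&` shift t1 @^-1` F n)) = (fun n => (P A * P (shift t2 @^-1` F n))%E).
      by apply/funext => n; have [] := HF n.
    rewrite E in c1; exact: (cvg_unique _ c1 c3).
- move=> _ [l [hl ->]]; split; first exact: cyl_measurable.
  have [q hq] := shift_cyl s0 hl; rewrite (hq t1 A t10 FA).
  congr (_ * _)%E; have := hq t2 setT t20; rewrite setTI probability_setT mul1e => ->//.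
  by rewrite filtrationE; exact: (@measurableT _ (OF t2)).
Qed.

(** Independence and stationarity in one formula: the inner integral runs over the increments after
    [t2], so that a functional of the increments after [t1] can be replayed from another starting
    time with its past frozen. *)
Lemma path_law t1 t2 s (h : OF t1 * PE s -> \bar R) : 0 <= t1 -> 0 <= t2 -> 0 <= s ->
  measurable_fun [set: OF t1 * PE s] h -> (forall p, (0 <= h p)%E) ->
  (\int[P]_w h ((w : OF t1), (shift t1 w : PE s)) =
   \int[P]_w \int[P]_w' h ((w : OF t1), (shift t2 w' : PE s)))%E.
Proof.
move=> t10 t20 s0 mh h0.
have m2 := shift_measurable t20 s0.
pose jm : {mfun Omega >-> PE s} := HB.pack (shift t2 : Omega -> PE s) (isMeasurableFun.Build _ _ _ _ _ m2).
pose Q : probability (PE s) R := distribution P jm.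
have ind A (D : set (PE s)) : filtration P B 0 t1 A -> measurable D ->
  P (A `&` shift t1 @^-1` D) = (P A * Q D)%E by move=> FA mD; exact: (path_indep t10 t20).
rewrite (@indep_integral _ _ _ P _ (@brownian_gen_measurable _ _ _ _ _ Pc BM t1) _ (PE s) _ Q h (shift_measurable t10 s0) ind mh h0).
apply: eq_integral => w _.
rewrite (@ge0_integral_distribution _ _ _ _ _ P jm (fun e => h ((w : OF t1), e)))//.
apply: (measurableT_comp mh); apply/measurable_fun_pairP; split; [exact: measurable_cst|exact: measurable_id].
Qed.
End path_law.

(** * Translation of integrals in time *)

Section translation.
Context (R : realType).
Local Notation lam := (@lebesgue_measure R).

Let add c : measurableTypeR R -> measurableTypeR R := fun x => x + c.

Let measurable_add c : measurable_fun [set: measurableTypeR R] (add c).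
Proof. by apply: (@measurable_funD _ _ R setT (fun x => x) (cst c)) => //; exact: measurable_cst. Qed.

Lemma lebesgue_measure_shift (c : R) (A : set (measurableTypeR R)) : measurable A ->
  lam A = pushforward lam (add c) A.
Proof.
pose jm : {mfun measurableTypeR R >-> measurableTypeR R} := HB.pack (add c)
   (isMeasurableFun.Build _ _ _ _ _ (measurable_add c)).
move=> mA; rewrite -[RHS]/(pushforward lam jm A); apply: lebesgue_measure_unique => //= _ [[a b]] _ <-.
rewrite /pushforward (_ : jm @^-1` _ = `](a - c), (b - c)]%classic).
  rewrite !lebesgue_measure_itv/= !lte_fin ltrD2r; case: ifP => // _.
  by rewrite -!EFinB; congr EFin; ring.
by apply/seteqP; split => x /=; rewrite !in_itv/= lerBrDr ltrBlDr.
Qed.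

Lemma ge0_integral_shift (a b c : R) (f : R -> \bar R) :
  measurable_fun `[a + c, b + c] f -> (forall x, (0 <= f x)%E) ->
  (\int[lam]_(x in `[(a + c)%R, (b + c)%R]) f x = \int[lam]_(x in `[a, b]) f (x + c)%R)%E.
Proof.
move=> mf f0.
transitivity (\int[pushforward lam (add c)]_(x in `[(a + c)%R, (b + c)%R]) f x)%E.
  by apply: eq_measure_integral => A mA _; exact/lebesgue_measure_shift.
have mI : measurable (`[a + c, b + c]%classic : set (measurableTypeR R)) by exact: measurable_itv.
rewrite (ge0_integral_pushforward (measurable_add c) _ mI mf)//.
rewrite (_ : _ @^-1` _ = `[a, b]%classic)//.
by apply/seteqP; split => x /=; rewrite !in_itv/= !lerD2r.
Qed.

Lemma Rintegral_shift (a b c : R) (f : R -> R) : measurable_fun `[a + c, b + c] f ->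
  \int[lam]_(x in `[(a + c)%R, (b + c)%R]) f x = \int[lam]_(x in `[a, b]) f (x + c)%R.
Proof.
move=> mf; rewrite /Rintegral integralE [in RHS]integralE.
have mf' : measurable_fun `[a + c, b + c] (EFin \o f) by exact/measurable_EFinP.
congr (fine (_ - _)); rewrite ge0_integral_shift//; try exact: funepos_ge0; try exact: funeneg_ge0.
- by apply: eq_integral => x _; rewrite !funeposE.
- exact: measurable_funepos.
- by apply: eq_integral => x _; rewrite !funenegE.
- exact: measurable_funeneg.
Qed.
End translation.

(** * Convergence in probability through bounded expectations *)

Section convergence_in_probability.
Context d (Omega : measurableType d) (R : realType) (P : probability Omega R).

(** Convergence in probability to 0 amounts to E min(1, |Z|) tending to 0; as the expectation of a
    nonnegative function, this quantity passes through [path_law]. *)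
Definition min1 (x : \bar R) : \bar R := mine 1%E `|x|%E.

Lemma min1_ge0 x : (0 <= min1 x)%E.
Proof. by rewrite /min1 le_min lee01 abse_ge0. Qed.

Lemma min1_le1 x : (min1 x <= 1)%E.
Proof. by rewrite /min1 ge_min lexx. Qed.

Lemma measurable_min1 d' (Om : measurableType d') (Z : Om -> \bar R) : measurable_fun [set: Om] Z ->
  measurable_fun [set: Om] (fun w => min1 (Z w)).
Proof. by move=> mZ; apply: measurable_mine => //; exact: measurableT_comp. Qed.

Lemma measurable_lt_abse d' (Om : measurableType d') (Z : Om -> \bar R) (e : R) : measurable_fun [set: Om] Z ->
  measurable [set w | (e%:E < `|Z w|)%E].
Proof.
move=> mZ; have mA : measurable_fun [set: Om] (fun w => `|Z w|)%E by exact: measurableT_comp.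
by have := emeasurable_fun_o_infty measurableT mA e%:E; rewrite setTI.
Qed.

Lemma min1_markov (Z : Omega -> \bar R) (e del : R) : measurable_fun [set: Omega] Z -> 0 < e -> e <= 1 ->
  0 < del -> (\int[P]_w min1 (Z w) <= (e * del)%:E)%E -> (P [set w | (e%:E < `|Z w|)%E] <= del%:E)%E.
Proof.
move=> mZ e0 e1 d0 h.
have mA := measurable_lt_abse e mZ.
rewrite -(@lee_pmul2l _ e%:E)// ?lte_fin// -EFinM; apply: le_trans h.
have -> : P [set w | (e%:E < `|Z w|)%E] = (\int[P]_w (\1_[set w | (e%:E < `|Z w|)%E] w)%:E)%E.
  by rewrite integral_indic// setIT.
rewrite -ge0_integralZl//; first last.
- by rewrite lee_fin ltW.
- by apply/measurable_EFinP; exact: measurable_indic.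
apply: ge0_le_integral => //=.
- by move=> w _; rewrite mule_ge0// lee_fin ?indicE// ltW.
- by apply: emeasurable_funM => //; apply/measurable_EFinP; exact: measurable_indic.
- exact: measurable_min1.
move=> w _; rewrite indicE; case: (boolP (w \in _)).
  rewrite inE/= mule1 => h; rewrite /min1 le_min lee_fin e1; exact: ltW.
by move=> _; rewrite mule0 min1_ge0.
Qed.

Lemma cvg_in_prob_min1 (Z : nat -> Omega -> \bar R) (del : R) : (forall n, measurable_fun [set: Omega] (Z n)) ->
  cvg_in_prob P Z -> 0 < del -> exists N, forall n, (N <= n)%N -> (\int[P]_w min1 (Z n w) <= del%:E)%E.
Proof.
move=> mZ cZ d0; have d20 : 0 < del / 2 by lra.
have [N hN] := cvg_in_probP cZ d20 d20; exists N => n /hN hn.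
pose A := [set w | ((del / 2)%:E < `|Z n w|)%E].
have mA : measurable A by exact: measurable_lt_abse.
apply: (@le_trans _ _ (\int[P]_w ((\1_A w)%:E + (del / 2)%:E))%E).
  apply: ge0_le_integral => //=.
  - by move=> w _; exact: min1_ge0.
  - exact: measurable_min1.
  - by apply: emeasurable_funD => //; apply/measurable_EFinP; exact: measurable_indic.
  move=> w _; rewrite indicE; case: (boolP (w \in A)).
    by move=> _; apply: (le_trans (min1_le1 _)); rewrite -EFinD lee_fin lerDl ltW.
  move=> /negP nA; rewrite add0e /min1 ge_min; apply/orP; right.
  by rewrite leNgt; apply/negP => h; apply: nA; rewrite inE.
rewrite ge0_integralD//; last 2 first.
- by apply/measurable_EFinP; exact: measurable_indic.
- by move=> w _; rewrite lee_fin ltW.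
rewrite integral_indic// setIT integral_prob_cst.
by apply: (le_trans (leeD hn (lexx _))); rewrite -EFinD lee_fin; lra.
Qed.

Lemma min1_cvg_in_prob (Z : nat -> Omega -> \bar R) : (forall n, measurable_fun [set: Omega] (Z n)) ->
  (\int[P]_w min1 (Z n w))%E @[n --> \oo] --> 0%E -> cvg_in_prob P Z.
Proof.
move=> mZ cZ e e0.
apply/fine_cvgP; split; first by apply: nearW => n; rewrite fin_num_measure//; exact: measurable_lt_abse.
apply/cvgrPdist_le => del d0.
pose e1 := Num.min e 1.
have e10 : 0 < e1 by rewrite lt_min e0 ltr01.
have e11 : e1 <= 1 by rewrite ge_min lexx orbT.
have /fine_cvgP[fN /cvgrPdist_le/(_ _ (mulr_gt0 e10 d0))] := cZ.
apply: filterS2 fN => n fn; rewrite !sub0r !normrN => h.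
have mA := measurable_lt_abse e (mZ n); have mA1 := measurable_lt_abse e1 (mZ n).
have h1 : (\int[P]_w min1 (Z n w) <= (e1 * del)%:E)%E.
  by rewrite -(fineK fn) lee_fin; apply: le_trans (ler_norm _) h.
have := min1_markov (mZ n) e10 e11 d0 h1.
rewrite -(fineK (fin_num_measure P _ mA1)) lee_fin => h2.
rewrite ger0_norm ?fine_ge0//; apply: le_trans h2.
apply: fine_le; rewrite ?fin_num_measure//.
apply: le_measure; rewrite ?inE// => w /=; apply: le_lt_trans.
by rewrite lee_fin ge_min lexx.
Qed.

(* If E a_k,n -> 0 as n -> oo for every k, some subsequence converges almost
   surely to 0 for all k at once (summability along a diagonal). *)
Lemma ae_subsequence (a : nat -> nat -> Omega -> \bar R) :
  (forall k n, measurable_fun [set: Omega] (a k n)) -> (forall k n w, (0 <= a k n w)%E) ->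
  (forall k del, 0 < del -> exists N, forall n, (N <= n)%N -> (\int[P]_w a k n w <= del%:E)%E) ->
  exists f : nat -> nat, {ae P, forall w, forall k, a k (f n) w @[n --> \oo] --> 0%E}.
Proof.
move=> ma a0 ha.
have /choice[f hf] : forall j, exists n, forall k, (k <= j)%N -> (\int[P]_w a k n w <= ((2^-1) ^+ j)%:E)%E.
  move=> j; have [n hn] := @common_index (fun k n => (\int[P]_w a k n w <= ((2^-1) ^+ j)%:E)%E) j.+1
    (fun k _ => ha k _ (exprn_gt0 j (ltac:(by rewrite invr_gt0) : 0 < 2^-1))).
  by exists n => k kj; apply: hn.
exists f; apply: ae_foralln => k.
(* The shift by [k] guarantees [k <= j + k], so that the geometric bound [hf] applies to every term
   of the series. *)
pose g (j : nat) w : \bar R := a k (f (j + k)%N) w.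
have mg j : measurable_fun [set: Omega] (g j) by exact: ma.
have g0 j w : (0 <= g j w)%E by exact: a0.
have fin : (\int[P]_w (\sum_(j <oo) g j w) < +oo)%E.
  rewrite integral_nneseries//.
  apply: (@le_lt_trans _ _ (\sum_(j <oo) ((2^-1) ^+ j)%:E)%E).
    apply: lee_nneseries => [j _ _|j _].
      by apply: integral_ge0.
    apply: (le_trans (hf (j + k)%N k (leq_addl _ _))); rewrite lee_fin exprD ler_piMr ?exprn_ge0 ?invr_ge0//.
    by rewrite exprn_ile1 ?invr_ge0// invf_le1// ler1n.
  rewrite (_ : (\sum_(j <oo) ((2^-1) ^+ j)%:E)%E = 2%:E) ?ltry//.
  rewrite (_ : (fun j => _) = (fun j => \sum_(0 <= i < j) ((2^-1) ^+ i)%:E)%E)//.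
  apply/cvg_lim => //.
  rewrite (_ : (fun j => (\sum_(0 <= i < j) ((2^-1) ^+ i)%:E)%E) = EFin \o series (geometric 1 2^-1)); last first.
    by apply/funext => j /=; rewrite /series/= -sumEFin; apply: eq_bigr => i _; rewrite mul1r.
  apply: cvg_EFin; first exact: nearW.
  have := @cvg_geometric_series R 1 2^-1; rewrite gtr0_norm ?invr_gt0// invf_lt1// ltr1n => /(_ isT).
  by rewrite (_ : 1 / (1 - 2^-1) = 2)//; field.
have ms : measurable_fun [set: Omega] (fun w => \sum_(j <oo) g j w)%E.
  by apply: ge0_emeasurable_sum.
have := @integrable_ae _ _ _ P setT measurableT (fun w => \sum_(j <oo) g j w)%E.
have s0 w : (0 <= \sum_(j <oo) g j w)%E by apply: nneseries_ge0.
case.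
  apply/integrableP; split => //; under eq_integral do rewrite gee0_abs//.
  exact: fin.
move=> N [mN PN sN]; exists N; split => // w nw; apply: sN => /= h; apply: nw.
have {}h := h I.
change ((fun n => a k (f n) w) @ \oo --> (0%E : \bar R)); rewrite -(cvg_shiftn k).
have lt : (\sum_(j <oo) g j w < +oo)%E by move: h; rewrite fin_numElt => /andP[].
have := @nneseries_tail_cvg R (fun j => g j w) xpredT lt (fun j _ => g0 j w).
move=> tail; apply: (squeeze_cvge _ (cvg_cst (0%E : \bar R)) tail).
apply: nearW => n; rewrite a0 /= (@nneseries_split _ (fun j => g j w) n 1)// addn1 big_nat1.
by rewrite leeDl// nneseries_ge0.
Qed.
End convergence_in_probability.

(** * Random variables as functions of the past and of the later increments *)

Section representation.
Context d (Omega : measurableType d) (R : realType) (P : probability Omega R).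
Variable B : R -> Omega -> R.
Hypothesis Pc : measure_is_complete P.
Hypothesis BM : brownian_motion P B.
Local Notation OF s := (g_sigma_algebraType (filtration_gen P B 0 s)).
Local Notation PE s := (g_sigma_algebraType (path_gen s)).
Variable t1 : R.
Hypothesis t10 : 0 <= t1.
Local Notation psi w := ((w, shift B t1 w)).

Lemma measurable_path_le d' (E : measurableType d') (s s' : R) (f : OF t1 * PE s -> E) : s <= s' ->
  measurable_fun [set: OF t1 * PE s] f -> measurable_fun [set: OF t1 * PE s'] f.
Proof.
move=> ss' mf.
have mj : measurable_fun [set: OF t1 * PE s'] ((fun p => (p.1, p.2)) : _ -> OF t1 * PE s).
  apply/measurable_fun_pairP; split; first exact: measurable_fst.
  apply: (@measurable_to_path R _ _ (fun p : OF t1 * PE s' => p.2) s) => u /andP[u0 us].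
  apply: (measurableT_comp (@measurable_path_eval R s' u _) measurable_snd).
  by rewrite u0 (le_trans us).
have := measurableT_comp mf mj; by apply: eq_measurable_fun => -[].
Qed.

Lemma slice_adapted d' (E : measurableType d') t2 s (f : OF t1 * PE s -> E) w : 0 <= t2 -> 0 <= s ->
  measurable_fun [set: OF t1 * PE s] f ->
  measurable_fun [set: OF (t2 + s)] (fun w' => f (w, shift B t2 w')).
Proof.
move=> t20 s0 mf; apply: (measurableT_comp mf); apply/measurable_fun_pairP; split; first exact: measurable_cst.
exact: adapted_shift.
Qed.

Lemma slice_measurable_fun d' (E : measurableType d') t2 s (f : OF t1 * PE s -> E) w : 0 <= t2 -> 0 <= s ->
  measurable_fun [set: OF t1 * PE s] f ->
  measurable_fun [set: Omega] (fun w' => f (w, shift B t2 w')).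
Proof.
move=> t20 s0 mf; apply: (adapted_measurable Pc BM (s := t2 + s)).
exact: slice_adapted.
Qed.

Lemma psi_measurable d' (E : measurableType d') s (f : OF t1 * PE s -> E) : 0 <= s ->
  measurable_fun [set: OF t1 * PE s] f -> measurable_fun [set: Omega] (fun w => f (psi w)).
Proof.
move=> s0 mf; apply: (measurableT_comp mf); apply/measurable_fun_pairP; split.
  by apply: measurable_to_sub; exact: (brownian_gen_measurable Pc BM).
exact: (shift_measurable Pc BM t10 s0).
Qed.

Lemma measurable_slice_integral t2 s (h : OF t1 * PE s -> \bar R) : 0 <= t2 -> 0 <= s ->
  measurable_fun [set: OF t1 * PE s] h -> (forall p, (0 <= h p)%E) ->
  measurable_fun [set: OF t1] (fun w => \int[P]_w' h (w, shift B t2 w'))%E.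
Proof.
move=> t20 s0 mh h0.
have m2 := shift_measurable Pc BM t20 s0.
pose jm : {mfun Omega >-> PE s} := HB.pack (shift B t2 : Omega -> PE s) (isMeasurableFun.Build _ _ _ _ _ m2).
pose Q : probability (PE s) R := distribution P jm.
have := @measurable_fun_fubini_tonelli_F _ _ _ _ R Q h mh h0.
apply: eq_measurable_fun => w _; rewrite /fubini_F.
rewrite (@ge0_integral_distribution _ _ _ _ _ P jm (fun e => h ((w : OF t1), e)))//.
apply: (measurableT_comp mh); apply/measurable_fun_pairP; split; [exact: measurable_cst|exact: measurable_id].
Qed.

(** By [path_law] the double integral of the indicator of the complement of [D] vanishes, hence so
    do almost all inner integrals. This transfers each almost sure property of a solution to the
    process with frozen past. *)
Lemma slice_ae t2 s (D : set (Omega * (R -> R))) : 0 <= t2 -> 0 <= s -> measurable (D : set (OF t1 * PE s)) ->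
  {ae P, forall w, D (psi w)} -> {ae P, forall w, {ae P, forall w', D (w, shift B t2 w')}}.
Proof.
move=> t20 s0 mD hD.
pose h (p : OF t1 * PE s) : \bar R := (\1_(~` D) p)%:E.
have mh : measurable_fun [set: OF t1 * PE s] h.
  by apply/measurable_EFinP; apply: measurable_indic; exact: measurableC.
have h0 p : (0 <= h p)%E by rewrite /h lee_fin indicE.
have mI := measurable_slice_integral t20 s0 mh h0.
have e0 : (\int[P]_w \int[P]_w' h ((w : OF t1), (shift B t2 w' : PE s)) = 0)%E.
  rewrite -(path_law Pc BM t10 t20 s0 mh h0).
  rewrite (@ae_eq_integral _ _ _ P setT (cst 0%E))//; first by rewrite integral0.
  - exact: psi_measurable.
  - by apply: filterS hD => w Dw _; rewrite /h indicE memNset// => /(_ Dw).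
have mI' : measurable_fun [set: Omega] (fun w => \int[P]_w' h ((w : OF t1), (shift B t2 w' : PE s)))%E.
  exact: (adapted_measurable Pc BM mI).
have I0 w : (0 <= \int[P]_w' h ((w : OF t1), (shift B t2 w' : PE s)))%E by apply: integral_ge0.
have : ae_eq P setT (fun w => \int[P]_w' h ((w : OF t1), (shift B t2 w' : PE s)))%E (cst 0%E).
  apply/ae_eq_integral_abs => //; under eq_integral do rewrite gee0_abs//.
  exact: e0.
apply: filterS => w /(_ Logic.I) /= w0.
have mhw : measurable_fun [set: Omega] (fun w' => h ((w : OF t1), (shift B t2 w' : PE s))).
  exact: slice_measurable_fun.
have : ae_eq P setT (fun w' => h ((w : OF t1), (shift B t2 w' : PE s))) (cst 0%E).
  apply/ae_eq_integral_abs => //; under eq_integral do rewrite gee0_abs//.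
  exact: w0.
apply: filterS => w' /(_ Logic.I) /= h0'; apply: contrapT => nD.
by move: h0'; rewrite /h indicE mem_set//= => -[] /eqP; rewrite oner_eq0.
Qed.

(** The sets with this property form a sigma-algebra. Generators: negligible sets are represented by
    the empty set, and B u for u > t1 is B t1 plus an increment. *)
Lemma rep_set s (A : set (OF (t1 + s))) : 0 <= s -> measurable A ->
  exists D : set (OF t1 * PE s), measurable D /\ {ae P, forall w, A w <-> D (psi w)}.
Proof.
move=> s0; apply: (@smallest_sub _ _ (filtration_gen P B 0 (t1 + s))
  [set A : set Omega | exists D : set (OF t1 * PE s), measurable D /\ {ae P, forall w, A w <-> D (psi w)}]).
  split.
  - by exists set0; split => //; apply: aeW.
  - move=> X [D [mD hD]]; exists (~` D); split; first exact: measurableC.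
    by apply: filterS hD => w h; rewrite setTD; split => n /h.
  - move=> F hF; have /choice[D hD] := hF; exists (\bigcup_n D n); split.
      by apply: bigcupT_measurable => n; have [] := hD n.
    have : {ae P, forall w, forall n, F n w <-> D n (psi w)} by apply: ae_foralln => n; have [] := hD n.
    apply: filterS => w h; split => -[n _ hn]; exists n => //; exact/h.
move=> X [nX|[u [D [/andP[u0 us] mD ->]]]].
  exists set0; split => //; apply: filterS (_ : {ae P, forall w, ~ X w}) => [w nXw|]; first by split.
  by case: nX => N [mN PN sN]; exists N; split => // w /contrapT /sN.
have [ut|tu] := leP u t1.
  exists ((fun p : OF t1 * PE s => B u p.1) @^-1` D); split; last by apply: aeW.
  rewrite -[X in measurable X]setTI.
  have mb : measurable_fun [set: OF t1] (B u) by apply: adapted_brownian; rewrite u0.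
  have mf : measurable_fun [set: OF t1 * PE s] (fun p : OF t1 * PE s => B u p.1).
    exact: (measurableT_comp mb measurable_fst).
  exact: (mf measurableT D mD).
exists ((fun p : OF t1 * PE s => B t1 p.1 + p.2 (u - t1)) @^-1` D); split.
  rewrite -[X in measurable X]setTI.
  have mb : measurable_fun [set: OF t1] (B t1) by apply: adapted_brownian; rewrite t10 lexx.
  have us' : 0 <= u - t1 <= s by apply/andP; split; lra.
  have mf : measurable_fun [set: OF t1 * PE s] (fun p : OF t1 * PE s => B t1 p.1).
    exact: (measurableT_comp mb measurable_fst).
  have mg : measurable_fun [set: OF t1 * PE s] (fun p : OF t1 * PE s => p.2 (u - t1)).
    exact: (measurableT_comp (@measurable_path_eval R s (u - t1) us') measurable_snd).
  have ms : measurable_fun [set: OF t1 * PE s] (fun p : OF t1 * PE s => B t1 p.1 + p.2 (u - t1)).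
    exact: (measurable_funD mf mg).
  exact: (ms measurableT D mD).
apply: aeW => w /=; rewrite /shift; have -> : t1 + (u - t1) = u by ring.
by have -> : B t1 w + (B u w - B t1 w) = B u w by ring.
Qed.

(** Doob-Dynkin up to null sets: the function is rebuilt as the infimum of the rationals [q] for
    which the representative of the event [Z <= q] holds. *)
Lemma rep_fun s (Z : Omega -> R) : 0 <= s -> measurable_fun [set: OF (t1 + s)] Z ->
  exists f : OF t1 * PE s -> R, measurable_fun [set: OF t1 * PE s] f /\ {ae P, forall w, Z w = f (psi w)}.
Proof.
move=> s0 mZ.
have /choice[D hD] : forall n, exists D : set (OF t1 * PE s), measurable D /\
    {ae P, forall w, Z w <= rat_nth R n <-> D (psi w)}.
  move=> n; apply: (rep_set s0 (A := [set w | Z w <= rat_nth R n])).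
  by rewrite -[X in measurable X]setTI; exact: measurable_fun_ler.
pose g n p : \bar R := if `[< D n p >] then (rat_nth R n)%:E else +oo%E.
have mg n : measurable_fun [set: OF t1 * PE s] (g n).
  have [mD _] := hD n.
  rewrite (_ : g n = fun p => if p \in D n then (rat_nth R n)%:E else +oo%E); last first.
    by apply/funext => p; rewrite /g; congr (if _ then _ else _); apply/asboolP/idP; rewrite inE.
  apply: measurable_fun_ifT => //.
  apply: (measurable_fun_bool true); rewrite setTI; rewrite (_ : _ @^-1` _ = D n)//.
  by apply/seteqP; split => p /= h; [exact: set_mem h|exact: mem_set h].
exists (fun p => fine (einfs (g ^~ p) 0)); split.
  apply: (measurableT_comp (@fine_measurable R setT measurableT)).
  exact: measurable_fun_einfs.
have : {ae P, forall w, forall n, Z w <= rat_nth R n <-> D n (psi w)}.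
  by apply: ae_foralln => n; have [] := hD n.
apply: filterS => w h; rewrite (_ : einfs _ _ = (Z w)%:E)//.
apply/eqP; rewrite eq_le; apply/andP; split; last first.
  apply: le_ereal_inf_tmp => _ [n /= _ <-]; rewrite /g; case: asboolP => [/h|_]; last by rewrite leey.
  by rewrite lee_fin.
apply/lee_addgt0Pr => e e0.
have [n /andP[n1 n2]] := @rat_nthP R (Z w) (Z w + e) (ltac:(by rewrite ltrDl)).
apply: (@le_trans _ _ (g n (psi w))); first by apply: ereal_inf_lbound; exists n.
rewrite /g asboolT; first by rewrite -EFinD lee_fin ltW.
by apply/h; rewrite ltW.
Qed.
End representation.

(** * A representation with continuous paths at every point *)

Section regular_version.
Context d (Omega : measurableType d) (R : realType) (P : probability Omega R).
Variable B : R -> Omega -> R.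
Hypothesis Pc : measure_is_complete P.
Hypothesis BM : brownian_motion P B.
Local Notation OF s := (g_sigma_algebraType (filtration_gen P B 0 s)).
Local Notation PE s := (g_sigma_algebraType (path_gen s)).
Variables (t1 t2 Hz x0 : R) (K : set R) (X : R -> Omega -> R).
Hypothesis t10 : 0 <= t1.
Hypothesis t20 : 0 <= t2.
Hypothesis Hz0 : 0 <= Hz.
Hypothesis K_closed : closed K.
Hypothesis Kx0 : K x0.
Hypothesis X_cont : forall w, {within `[t1, t1 + Hz], continuous (X ^~ w)}.
Hypothesis X_in : forall s w, t1 <= s <= t1 + Hz -> K (X s w).
Local Notation psi w := ((w, shift B t1 w)).
Local Notation rk k := (dense_time 0 Hz k).
Variable z : nat -> Omega * (R -> R) -> R.
Hypothesis mz : forall k, measurable_fun [set: OF t1 * PE (rk k)] (z k).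
Hypothesis zX : forall k, {ae P, forall w, X (t1 + rk k) w = z k (psi w)}.

(** Where the values at dense times are uniformly continuous and lie in [K] they extend
    continuously; elsewhere the constant path [x0] is used. Thus every path is continuous with
    values in [K], not only almost every one. *)
Definition regular : set (Omega * (R -> R)) := [set p |
  (forall m : nat, exists l : nat, forall j k, `|rk j - rk k| < l.+1%:R^-1 -> `|z j p - z k p| <= m.+1%:R^-1) /\
  forall k, K (z k p)].

Let rkP k : 0 <= rk k <= Hz.
Proof. exact: dense_time_itv. Qed.

Let mzH k : measurable_fun [set: OF t1 * PE Hz] (z k).
Proof. by apply: (@measurable_path_le _ _ _ P B t1 _ _ (rk k)); have /andP[] := rkP k. Qed.

Lemma regular_measurable : measurable (regular : set (OF t1 * PE Hz)).
Proof.
pose A m l j k : set (OF t1 * PE Hz) := if `|rk j - rk k| < l.+1%:R^-1 then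
  [set p | `|z j p - z k p| <= m.+1%:R^-1] else setT.
rewrite (_ : regular = (\bigcap_m \bigcup_l \bigcap_j \bigcap_k A m l j k) `&` \bigcap_k (z k @^-1` K)); last first.
  apply/seteqP; split => p /=.
    move=> [h1 h2]; split; last by move=> k _; exact: h2.
    move=> m _; have [l hl] := h1 m; exists l => // j _ k _; rewrite /A; case: ifP => // jk.
    exact: hl.
  move=> [h1 h2]; split; last by move=> k; exact: h2.
  move=> m; have [l _ hl] := h1 m Logic.I; exists l => j k jk.
  by have := hl j Logic.I k Logic.I; rewrite /A jk.
apply: measurableI.
  apply: bigcapT_measurable => m; apply: bigcupT_measurable => l.
  apply: bigcapT_measurable => j; apply: bigcapT_measurable => k; rewrite /A.
  case: ifP => // _; apply: (@measurable_ler_set _ _ _ (fun p : OF t1 * PE Hz => `|z j p - z k p|)).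
  by apply: measurableT_comp => //; apply: measurable_funB; exact: mzH.
apply: bigcapT_measurable => k; rewrite -[X in measurable X]setTI; apply: mzH => //.
exact: closed_measurable.
Qed.

Lemma zX_all : {ae P, forall w, forall k, X (t1 + rk k) w = z k (psi w)}.
Proof. exact: ae_foralln. Qed.

Lemma regular_ae : {ae P, forall w, regular (psi w)}.
Proof.
apply: filterS zX_all => w h; split.
  move=> m; have m0 : 0 < m.+1%:R^-1 :> R by rewrite invr_gt0.
  have [r r0 hr] := segment_uniform_continuous (@X_cont w) m0.
  have [l hl] := nat_inv_lt r0; exists l => j k jk; rewrite -!h; apply: ltW; apply: hr.
  - by have /andP[? ?] := rkP j; apply/andP; split; lra.
  - by have /andP[? ?] := rkP k; apply/andP; split; lra.
  - by rewrite (_ : t1 + rk j - (t1 + rk k) = rk j - rk k); [exact: lt_trans hl|ring].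
by move=> k; rewrite -h; apply: X_in; have /andP[? ?] := rkP k; apply/andP; split; lra.
Qed.

Let z' k p := if `[< regular p >] then z k p else x0.

Let mz' k : measurable_fun [set: OF t1 * PE Hz] (z' k).
Proof.
rewrite (_ : z' k = fun p => if p \in regular then z k p else x0); last first.
  by apply/funext => p; rewrite /z'; congr (if _ then _ else _); apply/asboolP/idP; rewrite inE.
apply: measurable_fun_ifT => //.
apply: (measurable_fun_bool true); rewrite setTI; rewrite (_ : _ @^-1` _ = regular); first exact: regular_measurable.
  by apply/seteqP; split => p /= h; [exact: set_mem h|exact: mem_set h].
Qed.

(** A dense time within [n.+1%:R^-1] of [s] and not after it; the default index 0 is never relevant
    for [s] in [[0, Hz]]. *)
Let ks s n : nat := xget 0%N [set k | `|rk k - s| < n.+1%:R^-1 /\ rk k <= s].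

Let ksP s n : 0 <= s <= Hz -> `|rk (ks s n) - s| < n.+1%:R^-1 /\ rk (ks s n) <= s.
Proof.
move=> sH; have n0 : 0 < n.+1%:R^-1 :> R by rewrite invr_gt0.
have [k hk] := dense_timeP sH n0.
exact: (@xgetPex _ 0%N [set k | `|rk k - s| < n.+1%:R^-1 /\ rk k <= s] (ex_intro _ k hk)).
Qed.

Definition yreg s p := lim (z' (ks s n) p @[n --> \oo]).

Let unif p : regular p -> forall m : nat, exists2 r, 0 < r & forall j k, `|rk j - rk k| < r -> `|z j p - z k p| <= m.+1%:R^-1.
Proof. by move=> [h _] m; have [l hl] := h m; exists l.+1%:R^-1 => //; rewrite invr_gt0. Qed.

Let ks_near s r : 0 <= s <= Hz -> 0 < r -> \forall n \near \oo, `|rk (ks s n) - s| < r.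
Proof.
move=> sH r0; have [N hN] := nat_inv_lt r0; exists N => // n /= Nn.
apply: lt_trans (ksP n sH).1 _; apply: le_lt_trans hN.
by rewrite lef_pV2 ?posrE ?ltr0n// ler_nat.
Qed.

Lemma yreg_cvg s p : 0 <= s <= Hz -> z' (ks s n) p @[n --> \oo] --> yreg s p.
Proof.
move=> sH; have [Gp|nGp] := pselect (regular p); last first.
  apply/cvg_ex; exists x0; rewrite (_ : (fun n => _) = cst x0); first exact: cvg_cst.
  by apply/funext => n; rewrite /z' asboolF.
have E n : z' (ks s n) p = z (ks s n) p by rewrite /z' asboolT.
apply/cauchy_cvgP/cauchy_ballP => e e0.
have [m hm] := nat_inv_lt e0.
have [r r0 hr] := unif Gp m.
have h := ks_near sH (ltac:(by rewrite divr_gt0) : 0 < r / 2).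
exists ((fun n => z' (ks s n) p) @` [set n | `|rk (ks s n) - s| < r / 2],
        (fun n => z' (ks s n) p) @` [set n | `|rk (ks s n) - s| < r / 2]).
  split => /=.
  - by apply: filterS h => n hn; exists n.
  - by apply: filterS h => n hn; exists n.
move=> [_ _] /= [[n hn <-] [k hk <-]]; rewrite /ball/= !E; apply: le_lt_trans hm; apply: hr.
rewrite (_ : rk (ks s n) - rk (ks s k) = (rk (ks s n) - s) - (rk (ks s k) - s)); last by ring.
by apply: le_lt_trans (ler_normB _ _) _; lra.
Qed.

Lemma yreg_measurable s : 0 <= s <= Hz -> measurable_fun [set: OF t1 * PE Hz] (yreg s).
Proof.
move=> sH; apply: (@measurable_fun_cvg _ (OF t1 * PE Hz)%type _ setT (fun n => z' (ks s n))) => [n|p _]; first exact: mz'.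
exact: yreg_cvg.
Qed.

Lemma yreg_default s p : ~ regular p -> yreg s p = x0.
Proof.
move=> nG; rewrite /yreg (_ : (fun n => _) = cst x0); first by apply/cvg_lim => //; exact: cvg_cst.
by apply/funext => n; rewrite /z' asboolF.
Qed.

Let yreg_z s p m r : regular p -> 0 <= s <= Hz -> 0 < r ->
  (forall j k, `|rk j - rk k| < r -> `|z j p - z k p| <= m.+1%:R^-1) ->
  forall k, `|rk k - s| < r -> `|yreg s p - z k p| <= m.+1%:R^-1.
Proof.
move=> Gp sH r0 hr k ks'.
have c := @yreg_cvg s p sH.
have c2 : `|z' (ks s n) p - z k p| @[n --> \oo] --> `|yreg s p - z k p|.
  by apply: cvg_norm; apply: cvgB => //; exact: cvg_cst.
apply: (closed_cvg (fun y : R => y <= m.+1%:R^-1) _ _ _ c2); first exact: closed_le.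
have h := ks_near sH (ltac:(by rewrite subr_gt0) : 0 < r - `|rk k - s|).
apply: filterS h => n hn; rewrite /z' asboolT//; apply: hr.
rewrite (_ : rk (ks s n) - rk k = (rk (ks s n) - s) - (rk k - s)); last by ring.
by apply: le_lt_trans (ler_normB _ _) _; lra.
Qed.

Lemma yreg_continuous p : {within `[0, Hz], continuous (yreg ^~ p)}.
Proof.
have [Gp|nGp] := pselect (regular p); last first.
  rewrite (_ : yreg ^~ p = cst x0); last by apply/funext => s; exact: yreg_default.
  by apply: continuous_subspaceT => s; exact: cvg_cst.
rewrite subspace_continuousP => s; rewrite /= in_itv/= => sH; apply/cvgrPdist_le => e e0.
have [m hm] := nat_inv_lt (ltac:(by rewrite divr_gt0) : 0 < e / 2).
have [r r0 hr] := unif Gp m.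
rewrite near_withinE; apply/nbhs_ballP; exists (r / 2); first by rewrite /= divr_gt0.
move=> s' ss' s'H; rewrite /= in_itv/= in s'H; rewrite /ball/= in ss'.
have [k [hk _]] := dense_timeP s'H (ltac:(by rewrite divr_gt0) : 0 < r / 2).
have h1 : `|yreg s' p - z k p| <= m.+1%:R^-1 by apply: (yreg_z Gp s'H r0 hr); lra.
have h2 : `|yreg s p - z k p| <= m.+1%:R^-1.
  apply: (yreg_z Gp sH r0 hr); rewrite (_ : rk k - s = (rk k - s') - (s - s')); last by ring.
  by apply: le_lt_trans (ler_normB _ _) _; lra.
rewrite (_ : yreg s p - yreg s' p = (yreg s p - z k p) - (yreg s' p - z k p)); last by ring.
by apply: le_trans (ler_normB _ _) _; move: (m.+1%:R^-1) hm h1 h2 => q; lra.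
Qed.

Lemma yreg_in s p : 0 <= s <= Hz -> K (yreg s p).
Proof.
move=> sH; have [Gp|nGp] := pselect (regular p); last by rewrite yreg_default.
apply: (closed_cvg K K_closed _ _ (@yreg_cvg s p sH)); apply: nearW => n.
by rewrite /z' asboolT//; have [_] := Gp; apply.
Qed.

Lemma yreg_X : {ae P, forall w, forall s, 0 <= s <= Hz -> X (t1 + s) w = yreg s (psi w)}.
Proof.
apply: filterS2 zX_all regular_ae => w h Gw s sH; apply/eqP; rewrite -subr_eq0 -normr_le0.
apply/ler_addgt0Pr => e e0; rewrite add0r.
have [m hm] := nat_inv_lt (ltac:(by rewrite divr_gt0) : 0 < e / 2).
have [r r0 hr] := unif Gw m.
have sI : `[t1, t1 + Hz]%classic (t1 + s) by rewrite /= in_itv/=; lra.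
have [r' r0' hr'] := within_continuous_dist (@X_cont w) sI (ltac:(by rewrite divr_gt0) : 0 < e / 2).
have [k [hk _]] := dense_timeP sH (ltac:(by rewrite lt_min r0) : 0 < Num.min r r').
move: hk; rewrite lt_min => /andP[k1 k2].
have h1 := yreg_z Gw sH r0 hr k1.
have /andP[rk0 rkH] := rkP k.
have h2 : `|X (t1 + s) w - X (t1 + rk k) w| < e / 2.
  apply: hr'; first by rewrite /= in_itv/=; lra.
  by rewrite (_ : t1 + s - (t1 + rk k) = - (rk k - s)); [rewrite normrN|ring].
rewrite h in h2.
rewrite (_ : X (t1 + s) w - yreg s _ = (X (t1 + s) w - z k (psi w)) - (yreg s (psi w) - z k (psi w))); last by ring.
by apply: le_trans (ler_normB _ _) _; move: (m.+1%:R^-1) hm h1 h2 => q; lra.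
Qed.

(** The approximating dense times lie to the left of [s], so their values are known at [t2 + s]. The
    event of regularity looks ahead in time, but it has full measure and therefore belongs to the
    augmented filtration. *)
Lemma yreg_adapted s w : 0 <= s <= Hz -> {ae P, forall w', regular (w, shift B t2 w')} ->
  measurable_fun [set: OF (t2 + s)] (fun w' => yreg s (w, shift B t2 w')).
Proof.
move=> sH Gw.
apply: (@measurable_fun_cvg _ (OF (t2 + s)) _ setT (fun n w' => z' (ks s n) (w, shift B t2 w'))); last first.
  by move=> w' _; exact: yreg_cvg.
move=> n; set k := ks s n.
have mG : measurable ([set w' | regular (w, shift B t2 w')] : set (OF (t2 + s))).
  rewrite -[X in measurable X]setCK; apply: measurableC; apply: filtration_negligible.
  by have [N [mN PN sN]] := Gw; exists N; split.
rewrite (_ : (fun w' => _) = fun w' => if w' \in [set w' | regular (w, shift B t2 w')] then z k (w, shift B t2 w') else x0); last first.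
  by apply/funext => w'; rewrite /z'; congr (if _ then _ else _); apply/asboolP/idP; rewrite inE.
apply: measurable_fun_ifT => //.
  apply: (measurable_fun_bool true); rewrite setTI; rewrite (_ : _ @^-1` _ = [set w' | regular (w, shift B t2 w')])//.
  by apply/seteqP; split => p /= h; [exact: set_mem h|exact: mem_set h].
have /andP[rk0 rkH] := rkP k.
apply: (@adapted_le _ _ _ _ _ (t2 + rk k)); first by rewrite lerD2l; exact: (ksP n sH).2.
exact: slice_adapted.
Qed.
End regular_version.

Section helpers.
Context (R : realType).
Local Notation lam := (@lebesgue_measure R).

Lemma clip_id (C x : R) : `|x| <= C -> clip C x = x.
Proof. by rewrite ler_norml => /andP[h1 h2]; rewrite /clip; minmax_lra. Qed.

Lemma process_coef_measurable d (Om : measurableType d) (K : set R) (f : R -> R) (Y : R -> Om -> R) a b :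
  measurable K -> measurable_fun K f -> a <= b ->
  (forall w, {within `[a, b], continuous (Y ^~ w)}) ->
  (forall u, a <= u <= b -> measurable_fun [set: Om] (Y u)) ->
  (forall u w, a <= u <= b -> K (Y u w)) ->
  measurable_fun (`[a, b] `*` [set: Om]) (fun p : R * Om => f (Y p.1 p.2)).
Proof.
move=> mK mf ab cY mY YK.
apply: (@measurable_comp _ _ _ _ _ _ K f (`[a, b]%classic `*` [set: Om])
   (fun p : R * Om => Y p.1 p.2)) => //.
- by move=> _ [[u w] /= [+ _] <-]; rewrite in_itv/=; exact: YK.
- exact: continuous_process_measurable.
Qed.

Lemma Rintegral_split (f : R -> R) a b c : a <= b -> b <= c ->
  lam.-integrable `[a, c] (EFin \o f) ->
  \int[lam]_(u in `[a, c]) f u = \int[lam]_(u in `[a, b]) f u + \int[lam]_(u in `[b, c]) f u.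
Proof.
move=> ab bc fi.
have := @Rintegral_itvB R f (BLeft a) (BRight c) b fi.
rewrite !bnd_simp => /(_ ab bc).
rewrite Rintegral_itv_obnd_cbnd; first by lra.
apply: integrableS fi => //.
by move=> u /=; rewrite !in_itv/= => /andP[h1 ->]; rewrite andbT (le_trans ab)// ltW.
Qed.

Lemma integrable_sub (f : R -> R) a b a' b' : a <= a' -> b' <= b ->
  lam.-integrable `[a, b] (EFin \o f) -> lam.-integrable `[a', b'] (EFin \o f).
Proof.
move=> aa bb; apply: integrableS => //.
by move=> u /=; rewrite !in_itv/= => /andP[h1 h2]; rewrite (le_trans aa)// (le_trans h2).
Qed.

Lemma prob_vanishing_ae d (Omega : measurableType d) (P : probability Omega R) (U : nat -> set Omega) e :
  (forall n, measurable (U n)) ->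
  {ae P, forall w, exists N, forall n, (N <= n)%N -> ~ U n w} -> 0 < e ->
  exists N, forall n, (N <= n)%N -> fine (P (U n)) <= e.
Proof.
move=> mU [Z [mZ PZ sZ]] e0.
have mUZ n : measurable (U n `\` Z) by exact: measurableD.
have hUZ w : exists N, forall n, (N <= n)%N -> ~ (U n `\` Z) w.
  have [Zw|nZw] := pselect (Z w); first by exists 0%N => n _ [].
  have [N hN] : exists N, forall n, (N <= n)%N -> ~ U n w by apply: contrapT => h; apply: nZw; exact: sZ.
  by exists N => n /hN h [].
have [N hN] := prob_vanishing P mUZ hUZ e0; exists N => n /hN; apply: le_trans.
apply: fine_le; rewrite ?fin_num_measure//.
apply: (@le_trans _ _ (P (U n `\` Z) + P Z)%E).
  apply: (@le_trans _ _ (P ((U n `\` Z) `|` Z))).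
    apply: le_measure; rewrite ?inE//; first exact: measurableU.
    by move=> w Uw; have [Zw|nZw] := pselect (Z w); [right|left].
  exact: measureU2.
by rewrite PZ adde0.
Qed.
End helpers.

(** * Convergence of simple integrals at all times from dense times *)

Section ito_dense.
Context d (Omega : measurableType d) (R : realType) (P : probability Omega R).
Variable B : R -> Omega -> R.
Hypothesis Pc : measure_is_complete P.
Hypothesis BM : brownian_motion P B.
Local Notation lam := (@lebesgue_measure R).
Variables (t T : R) (H M : R -> Omega -> R) (Hn : nat -> simple_process Omega R).
Hypothesis t0 : 0 <= t.
Hypothesis tT : t <= T.
Hypothesis mH : measurable_fun (`[t, T] `*` [set: Omega]) (fun p : R * Omega => H p.1 p.2).
Hypothesis wf : forall n, sp_wf P B t T (Hn n).
Hypothesis cH : cvg_in_prob P (fun n w => \int[lam]_(u in `[t, T])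
              ((sp_val (Hn n) u w - H u w) ^+ 2)%:E)%E.
Hypothesis fH : {ae P, forall w, (\int[lam]_(u in `[t, T]) ((H u w) ^+ 2)%:E < +oo)%E}.
Hypothesis mM : forall s, t <= s <= T -> measurable_fun [set: Omega] (M s).
Hypothesis cM : {ae P, forall w, {within `[t, T], continuous (M ^~ w)}}.

Lemma cvg_in_prob_intro (Z : nat -> Omega -> \bar R) : (forall n, measurable_fun [set: Omega] (Z n)) ->
  (forall e del, 0 < e -> 0 < del -> exists N, forall n, (N <= n)%N ->
     (P [set w | (e%:E < `|Z n w|)%E] <= del%:E)%E) -> cvg_in_prob P Z.
Proof.
move=> mZ h e e0; apply/fine_cvgP; split.
  by apply: nearW => n; rewrite fin_num_measure//; exact: measurable_lt_abse.
apply/cvgrPdist_le => del d0; have [N hN] := h e del e0 d0.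
exists N => // n /= /hN; have mA := measurable_lt_abse e (mZ n) => hP.
have h1 : fine (P [set w | (e%:E < `|Z n w|)%E]) <= del.
  by rewrite -lee_fin fineK// fin_num_measure.
by rewrite sub0r normrN ger0_norm ?fine_ge0.
Qed.

Lemma sp_val_path_measurable (H0 : simple_process Omega R) w : measurable_fun [set: R] (fun u => sp_val H0 u w).
Proof.
apply: measurable_sum => i; apply: measurable_funM; first exact: measurable_cst.
by apply: measurable_indic; exact: measurable_itv.
Qed.

Lemma sp_qv_le_err n w r s : t <= r -> r <= s -> s <= T ->
  ((sp_qv (Hn n) r s w)%:E <= 2%:E * \int[lam]_(u in `[r, s]) (H u w ^+ 2)%:E + 2%:E * sp_err t T H Hn n w)%E.
Proof.
move=> tr rs sT; rewrite -(sp_val_integral w (wf n) tr rs sT).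
have sub : `[r, s] `<=` (`[t, T] : set R).
  by move=> u /=; rewrite !in_itv/= => /andP[h1 h2]; rewrite (le_trans tr)// (le_trans h2).
have mHT : measurable_fun `[t, T] (H ^~ w) := process_section_measurable mH w.
have mHs : measurable_fun `[r, s] (H ^~ w) by apply: measurable_funS mHT.
have mv := sp_val_path_measurable (Hn n) w.
have m1 : measurable_fun `[r, s] (fun u => (H u w ^+ 2)%:E) by apply/measurable_EFinP; exact: measurable_funX.
have m2 : measurable_fun `[t, T] (fun u => ((sp_val (Hn n) u w - H u w) ^+ 2)%:E).
  by apply/measurable_EFinP; apply: measurable_funX; apply: measurable_funB => //; exact: measurable_funTS.
have m2' : measurable_fun `[r, s] (fun u => ((sp_val (Hn n) u w - H u w) ^+ 2)%:E) by apply: measurable_funS m2.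
apply: (@le_trans _ _ (\int[lam]_(u in `[r, s]) (2%:E * (H u w ^+ 2)%:E + 2%:E * ((sp_val (Hn n) u w - H u w) ^+ 2)%:E))%E).
  apply: ge0_le_integral => //=.
  - by move=> u _; rewrite lee_fin sqr_ge0.
  - by apply/measurable_EFinP; apply: measurable_funX; exact: measurable_funTS.
  - by apply: emeasurable_funD; apply: emeasurable_funM.
  - move=> u _; rewrite -!EFinM -EFinD lee_fin.
    move: (sp_val _ u w) (H u w) => a b; have := sqr_ge0 (a - 2 * b).
    have -> : (a - 2 * b) ^+ 2 = a ^+ 2 - 4 * (a * b) + 4 * b ^+ 2 by ring.
    have -> : (a - b) ^+ 2 = a ^+ 2 - 2 * (a * b) + b ^+ 2 by ring.
    lra.
rewrite ge0_integralD//; last 4 first.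
- by move=> u _; rewrite mule_ge0// lee_fin ?sqr_ge0.
- exact: emeasurable_funM.
- by move=> u _; rewrite mule_ge0// lee_fin ?sqr_ge0.
- exact: emeasurable_funM.
rewrite !ge0_integralZl//; try by (move=> u _; rewrite lee_fin sqr_ge0).
apply: leeD => //; apply: lee_wpmul2l; first by rewrite lee_fin.
by apply: ge0_subset_integral => //= u _; rewrite lee_fin sqr_ge0.
Qed.

Lemma square_integral_tail w (r : nat -> R) s : (\int[lam]_(u in `[t, T]) ((H u w) ^+ 2)%:E < +oo)%E ->
  t <= s <= T -> (forall n, t <= r n <= s) -> r n @[n --> \oo] --> s ->
  forall e, 0 < e -> exists N, forall n, (N <= n)%N -> (\int[lam]_(u in `[r n, s]) (H u w ^+ 2)%:E <= e%:E)%E.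
Proof.
move=> fin /andP[ts sT] rs cr e e0.
have mHT : measurable_fun `[t, T] (H ^~ w) := process_section_measurable mH w.
have Hi : lam.-integrable `[t, T] (EFin \o (fun u => H u w ^+ 2)).
  apply/integrableP; split; first by apply/measurable_EFinP; exact: measurable_funX.
  by under eq_integral do rewrite /= ger0_norm ?sqr_ge0//.
have cF := parameterized_integral_continuous tT Hi.
have sI : `[t, T]%classic s by rewrite /= in_itv/= ts.
have [del d0 hd] := within_continuous_dist cF sI e0.
have /cvgrPdist_lt/(_ _ d0) [N _ hN] := cr.
exists N => n /hN /= h.
have /andP[tr rs'] := rs n.
have rI : `[t, T]%classic (r n) by rewrite /= in_itv/= tr (le_trans rs').
have := hd _ rI h; rewrite /parameterized_integral.
rewrite (Rintegral_split tr rs' (integrable_sub (lexx t) sT Hi)) addrAC subrr add0r => h2.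
have fi := integrable_sub tr sT Hi.
have ffin : (\int[lam]_(u in `[r n, s]) (H u w ^+ 2)%:E)%E \is a fin_num by exact: integrable_fin_num fi.
rewrite -(fineK ffin) lee_fin; apply: le_trans (ler_norm _) _; exact: ltW.
Qed.

(** A diagonal subsequence secures convergence at countably many times only. To reach [s], take a
    dense time r <= s close to it: the limit moves little by continuity, and the simple integrals
    move little over [r, s] by Lenglart, since their quadratic variation there is at most twice the
    integral of H^2 plus twice the approximation error. *)
Lemma ito_dense : (forall k, cvg_in_prob P (fun n w => (sp_integral B (Hn n) (dense_time t T k) w - M (dense_time t T k) w)%:E)) ->
  forall s, t <= s <= T -> cvg_in_prob P (fun n w => (sp_integral B (Hn n) s w - M s w)%:E).
Proof.
move=> cD s sT; have /andP[ts s_T] := sT.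
have mI u n : t <= u <= T -> measurable_fun [set: Omega] (sp_integral B (Hn n) u).
  by move=> uT; exact: (sp_integral_measurable Pc BM t0 uT (wf n)).
apply: cvg_in_prob_intro => [n|e del e0 del0].
  by apply/measurable_EFinP; apply: measurable_funB; [exact: mI|exact: mM].
have /choice[k hk] : forall m : nat, exists k, `|dense_time t T k - s| < m.+1%:R^-1 /\ dense_time t T k <= s.
  by move=> m; apply: dense_timeP => //; rewrite invr_gt0.
pose r m := dense_time t T (k m).
have rs m : t <= r m <= s by have /andP[-> _] := dense_time_itv (k m) tT; have [_] := hk m.
have rT m : t <= r m <= T by exact: dense_time_itv.
have cr : r m @[m --> \oo] --> s.
  apply/cvgrPdist_lt => z z0; have [N hN] := nat_inv_lt z0; exists N => // m /= Nm.
  rewrite distrC; apply: lt_trans (hk m).1 _; apply: le_lt_trans hN.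
  by rewrite lef_pV2 ?posrE ?ltr0n// ler_nat.
have e30 : 0 < e / 3 by rewrite divr_gt0.
have d40 : 0 < del / 5 by rewrite divr_gt0.
(* With this choice the Lenglart term is [del / 5]. Together with the two events behind the
   quadratic variation, the event at the dense time and the continuity event, five contributions of
   [del / 5] arise. *)
pose eta := (e / 3) ^+ 2 * (del / 5).
have eta0 : 0 < eta by rewrite mulr_gt0// exprn_gt0.
have eta40 : 0 < eta / 5 by rewrite divr_gt0.
pose U1 m := [set w | e / 3 < `|M s w - M (r m) w|].
pose U2 m := [set w | ((eta / 5)%:E < `|\int[lam]_(u in `[r m, s]) (H u w ^+ 2)%:E|)%E].
have mU1 m : measurable (U1 m) by apply: measurable_ltr_norm_set; apply: measurable_funB; exact: mM.
have mU2 m : measurable (U2 m).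
  apply: measurable_lt_abse.
  apply: (@measurable_param_integral _ _ _ (r m) s (fun p => H p.1 p.2 ^+ 2)); last by move=> p; exact: sqr_ge0.
  apply: measurable_funX; apply: measurable_funS mH.
  - by apply: measurableX => //; exact: measurable_itv.
  - move=> [u w] /= [+ _]; rewrite !in_itv/= => /andP[h1 h2]; split => //.
    by have /andP[h3 _] := rs m; rewrite (le_trans h3)// (le_trans h2).
have [N1 hN1] : exists N, forall m, (N <= m)%N -> fine (P (U1 m)) <= del / 5.
  apply: prob_vanishing_ae => //; apply: filterS cM => w cw.
  have sI : `[t, T]%classic s by rewrite /= in_itv/= ts.
  have [z z0 hz] := within_continuous_dist cw sI e30.
  have /cvgrPdist_lt/(_ _ z0) [N _ hN] := cr.
  exists N => m /hN /= h; rewrite /U1 /=; apply/negP; rewrite -leNgt; apply: ltW; apply: hz => //.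
  by rewrite /= in_itv/=.
have [N2 hN2] : exists N, forall m, (N <= m)%N -> fine (P (U2 m)) <= del / 5.
  apply: prob_vanishing_ae => //; apply: filterS fH => w fw.
  have [N hN] := square_integral_tail fw sT rs cr eta40.
  exists N => m /hN h; rewrite /U2 /=; apply/negP; rewrite -leNgt gee0_abs//.
  by apply: integral_ge0 => u _; rewrite lee_fin sqr_ge0.
pose m := maxn N1 N2.
have p1 : fine (P (U1 m)) <= del / 5 by apply: hN1; exact: leq_maxl.
have p2 : fine (P (U2 m)) <= del / 5 by apply: hN2; exact: leq_maxr.
have [N3 hN3] := cvg_in_probP (cD (k m)) e30 d40.
have [N4 hN4] := cvg_in_probP cH eta40 d40.
exists (maxn N3 N4) => n; rewrite geq_max => /andP[/hN3 h3 /hN4 h4].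
pose U3 := [set w | ((e / 3)%:E < `|(sp_integral B (Hn n) (r m) w - M (r m) w)%:E|)%E].
pose U4 := [set w | ((eta / 5)%:E < `|sp_err t T H Hn n w|)%E].
pose U5 := [set: Omega] `&` [set w | (e / 3 < `|sp_incr B (Hn n) (r m) s w|)%R].
have /andP[tr rs'] := rs m.
have mU3 : measurable U3.
  by apply: measurable_lt_abse; apply/measurable_EFinP; apply: measurable_funB; [exact: mI|exact: mM].
have merr := sp_err_measurable Pc BM mH wf n tT.
have mU4 : measurable U4 by exact: measurable_lt_abse.
have mincr : measurable_fun [set: Omega] (sp_incr B (Hn n) (r m) s).
  by apply: (adapted_measurable Pc BM (s := s)); exact: (adapted_sp_incr t0 (wf n) tr rs' s_T).
have mU5 : measurable U5 by apply: measurableI => //; exact: measurable_ltr_norm_set.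
have mqv : measurable_fun [set: Omega] (sp_qv (Hn n) (r m) s).
  by apply: (adapted_measurable Pc BM (s := s)); exact: (adapted_sp_qv (wf n) rs' s_T).
have len := sp_lenglart Pc BM t0 (wf n) tr rs' e30 (ltW eta0) (@measurableT _ Omega).
have e3 : eta / (e / 3) ^+ 2 = del / 5.
  by rewrite /eta mulrAC divff ?mul1r// expf_neq0// gt_eqF.
rewrite e3 in len.
have qvle : (P ([set: Omega] `&` [set w | (eta < sp_qv (Hn n) (r m) s w)%R]) <= P (U2 m) + P U4)%E.
  apply: (@le_trans _ _ (P (U2 m `|` U4))); last exact: measureU2.
  apply: le_measure; rewrite ?inE//.
  - by apply: measurableI => //; exact: measurable_ltr_set.
  - exact: measurableU.
  move=> w [_ /= qw]; have [h|h] := leP (`|\int[lam]_(u in `[r m, s]) (H u w ^+ 2)%:E|)%E (eta / 5)%:E; last by left.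
  right; rewrite /U4 /= ltNge; apply/negP => h'.
  move: h h'; rewrite !gee0_abs ?sp_err_ge0//; last by apply: integral_ge0 => u _; rewrite lee_fin sqr_ge0.
  move=> h h'; have := sp_qv_le_err n w tr rs' s_T.
  rewrite leNgt => /negP; apply.
  apply: (@le_lt_trans _ _ (2%:E * (eta / 5)%:E + 2%:E * (eta / 5)%:E)%E).
    by apply: leeD; apply: lee_wpmul2l.
  by rewrite -!EFinM -EFinD lte_fin; lra_only eta0 qw.
apply: (@le_trans _ _ (P (U3 `|` (U5 `|` U1 m)))).
  apply: le_measure; rewrite ?inE//.
  - by apply: measurable_lt_abse; apply/measurable_EFinP; apply: measurable_funB; [exact: mI|exact: mM].
  - by apply: measurableU => //; apply: measurableU.
  move=> w /=; rewrite lte_fin => ew.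
  have [h1|h1] := ltP (e / 3) `|M s w - M (r m) w|; first by right; right.
  have [h2|h2] := ltP (e / 3) `|sp_incr B (Hn n) (r m) s w|; first by right; left; split.
  left; rewrite /U3 /= lte_fin; move: h2; rewrite -sp_integralB// => h2.
  move: (sp_integral _ _ s w) (sp_integral _ _ (r m) w) (M s w) (M (r m) w) ew h1 h2 => a b c g ew h1 h2.
  have h5 := ler_normD (a - b) (b - g); have h6 := ler_normB ((a - b) + (b - g)) (c - g).
  move: h6; have -> : a - b + (b - g) - (c - g) = a - c by ring.
  by move=> h6; lra_only ew h1 h2 h5 h6.
have d5 x : measurable x -> fine (P x) <= del / 5 -> (P x <= (del / 5)%:E)%E.
  by move=> mx; rewrite -lee_fin fineK// fin_num_measure.
apply: (@le_trans _ _ ((del / 5)%:E + ((del / 5)%:E + (del / 5)%:E + (del / 5)%:E + (del / 5)%:E))%E); last first.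
  by rewrite -!EFinD lee_fin le_eqVlt; apply/orP; left; apply/eqP; field.
apply: (@le_trans _ _ (P U3 + P (U5 `|` U1 m))%E); first by apply: measureU2 => //; exact: measurableU.
apply: leeD; first exact: h3.
apply: (@le_trans _ _ (P U5 + P (U1 m))%E); first exact: measureU2.
apply: leeD; last exact: d5.
apply: (le_trans len); apply: leeD => //.
apply: (le_trans qvle); apply: leeD; [exact: d5|exact: h4].
Qed.
End ito_dense.

(** * Freezing the past of a solution gives a solution *)

Section slice_solution.
Context d (Omega : measurableType d) (R : realType) (P : probability Omega R).
Variable B : R -> Omega -> R.
Hypothesis Pc : measure_is_complete P.
Hypothesis BM : brownian_motion P B.
Local Notation OF s := (g_sigma_algebraType (filtration_gen P B 0 s)).
Local Notation PE s := (g_sigma_algebraType (path_gen s)).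
Local Notation lam := (@lebesgue_measure R).
Variables (I : set R) (mu sigma : R -> R).
Hypothesis mcl : measurable (closure I).
Hypothesis mmu : measurable_fun (closure I) mu.
Hypothesis msigma : measurable_fun (closure I) sigma.
Variables (t T x : R) (X : R -> Omega -> R).
Hypothesis t0 : 0 <= t.
Hypothesis Ix : I x.
Hypothesis solX : strong_solution P B I mu sigma T t x X.
Variables (t1 t2 Hz : R).
Hypothesis tt1 : t <= t1.
Hypothesis t12 : t1 <= t2.
Hypothesis Hz0 : 0 <= Hz.
Hypothesis t2H : t2 + Hz = T.
Local Notation psi w := ((w, shift B t1 w)).
Local Notation rk k := (dense_time 0 Hz k).
Local Notation Pr := (OF t1 * PE Hz)%type.

Let t10 : 0 <= t1. Proof. exact: le_trans tt1. Qed.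
Let t20 : 0 <= t2. Proof. exact: le_trans t12. Qed.
Let t1H : t1 + Hz <= T. Proof. by rewrite -t2H lerD2r. Qed.

Variable y : R -> Omega * (R -> R) -> R.
Hypothesis y_cont : forall p, {within `[0, Hz], continuous (y ^~ p)}.
Hypothesis y_in : forall s p, 0 <= s <= Hz -> closure I (y s p).
Hypothesis y_meas : forall s, 0 <= s <= Hz -> measurable_fun [set: Pr] (y s).
Hypothesis yX : {ae P, forall w, forall s, 0 <= s <= Hz -> X (t1 + s) w = y s (psi w)}.
Hypothesis y_adapted : {ae P, forall w, forall s, 0 <= s <= Hz ->
  measurable_fun [set: OF (t2 + s)] (fun w' => y s (w, shift B t2 w'))}.

Lemma y_coef_measurable (f : R -> R) b : measurable_fun (closure I) f -> 0 <= b -> b <= Hz ->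
  measurable_fun (`[0, b] `*` [set: Pr]) (fun q : R * Pr => f (y q.1 q.2)).
Proof.
move=> mf b0 bH; apply: (process_coef_measurable (Om := Pr) mcl mf b0).
- move=> p; apply: continuous_subspaceW (@y_cont p) => u /=; rewrite !in_itv/= => /andP[-> h].
  exact: le_trans bH.
- by move=> u /andP[u0 ub]; apply: y_meas; rewrite u0 (le_trans ub).
- by move=> u p /andP[u0 ub]; apply: y_in; rewrite u0 (le_trans ub).
Qed.

Let drift s p := \int[lam]_(u in `[0, s]) mu (y u p).
Let mart s p := y s p - y 0 p - drift s p.

Let mart_measurable s : 0 <= s <= Hz -> measurable_fun [set: Pr] (mart s).
Proof.
move=> /andP[s0 sH]; apply: measurable_funB; first apply: measurable_funB.
- by apply: y_meas; rewrite s0.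
- by apply: y_meas; rewrite lexx.
- exact: (@measurable_param_Rintegral _ Pr _ 0 s (fun q : R * Pr => mu (y q.1 q.2)) (y_coef_measurable mmu s0 sH)).
Qed.

Let int_mu p : \bar R := (\int[lam]_(u in `[0%R, Hz]) `|mu (y u p)|%:E)%E.
Let int_sg p : \bar R := (\int[lam]_(u in `[0%R, Hz]) (sigma (y u p) ^+ 2)%:E)%E.

Let int_mu_measurable : measurable_fun [set: Pr] int_mu.
Proof.
apply: (@measurable_param_integral _ Pr _ 0 Hz (fun q : R * Pr => `|mu (y q.1 q.2)|)).
  by apply: measurableT_comp => //; exact: y_coef_measurable.
by move=> q; exact: normr_ge0.
Qed.

Let int_sg_measurable : measurable_fun [set: Pr] int_sg.
Proof.
apply: (@measurable_param_integral _ Pr _ 0 Hz (fun q : R * Pr => sigma (y q.1 q.2) ^+ 2)).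
  by apply: measurable_funX; exact: y_coef_measurable.
by move=> q; exact: sqr_ge0.
Qed.

Let sub1 : `[t1, t1 + Hz] `<=` (`[t, T] : set R).
Proof. by move=> u /=; rewrite !in_itv/= => /andP[h1 h2]; rewrite (le_trans tt1)// (le_trans h2). Qed.

Let tT : t <= T. Proof. by move: tt1 t12 Hz0; rewrite -t2H; lra. Qed.
Let t1le : t1 <= t1 + Hz. Proof. by rewrite lerDl. Qed.

Let path_meas (f : R -> R) a b w : measurable_fun (closure I) f -> t <= a -> a <= b -> b <= T ->
  measurable_fun `[a, b] (fun u => f (X u w)).
Proof. by move=> *; exact: (sol_path_measurable Pc BM mcl solX). Qed.

Let shift_psi (F : R -> \bar R) (G : R -> R -> \bar R) w :
  (forall s, 0 <= s <= Hz -> X (t1 + s) w = y s (psi w)) ->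
  (forall u z, (0 <= G u z)%E) -> measurable_fun `[t1, t1 + Hz] (fun u => G u (X u w)) ->
  (\int[lam]_(u in `[t1, (t1 + Hz)%R]) G u (X u w) = \int[lam]_(s in `[0%R, Hz]) G (s + t1)%R (y s (psi w)))%E.
Proof.
move=> h G0 mG.
have := @ge0_integral_shift R 0 Hz t1 (fun u => G u (X u w)).
rewrite add0r addrC => -> //.
apply: eq_integral => s; rewrite inE/= in_itv/= => sH; by rewrite addrC h.
Qed.

Let int_mu_ae : {ae P, forall w, (int_mu (psi w) < +oo)%E}.
Proof.
have [_ _ _ _ [im _]] := solX; apply: filterS2 yX im => w h im.
rewrite /int_mu -(@shift_psi (cst 0%E) (fun _ z => `|mu z|%:E) w h)//; last first.
  apply/measurable_EFinP; apply: measurableT_comp => //.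
  by apply: path_meas.
apply: le_lt_trans (_ : (\int[lam]_(u in `[t, T]) `|(mu (X u w))%:E|)%E < +oo)%E; last by have /integrableP[] := im.
apply: ge0_subset_integral => //.
by apply/measurable_EFinP; apply: measurableT_comp => //; exact: path_meas.
Qed.

Let int_sg_ae : {ae P, forall w, (int_sg (psi w) < +oo)%E}.
Proof.
have [_ _ _ _ [_ [M [[mH _ fH _ _] _]]]] := solX; apply: filterS2 yX fH => w h fH.
rewrite /int_sg -(@shift_psi (cst 0%E) (fun _ z => (sigma z ^+ 2)%:E) w h)//; last 2 first.
- by move=> _ z; rewrite lee_fin sqr_ge0.
- by apply/measurable_EFinP; apply: measurable_funX; apply: path_meas.
apply: le_lt_trans fH; apply: ge0_subset_integral => //; last by move=> u _; rewrite lee_fin sqr_ge0.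
by apply/measurable_EFinP; apply: measurable_funX; apply: path_meas.
Qed.

Let start_ae : {ae P, forall w, {ae P, forall w', y 0 (w, shift B t2 w') = X t1 w}}.
Proof.
pose D : set (Omega * (R -> R)) := [set p | y 0 p - X t1 p.1 = 0].
have mD : measurable (D : set Pr).
  have mf : measurable_fun [set: Pr] (fun p : Pr => y 0 p - X t1 p.1).
    apply: measurable_funB; first by apply: y_meas; rewrite lexx.
    have mX : measurable_fun [set: OF t1] (X t1).
      by apply: (sol_adapted solX) => //; rewrite (le_trans t1le).
    exact: (measurableT_comp mX measurable_fst).
  rewrite (_ : D = (fun p : Pr => y 0 p - X t1 p.1) @^-1` [set 0])//.
  by rewrite -[X in measurable X]setTI; exact: (mf measurableT [set 0] (measurable_set1 _)).
have hD : {ae P, forall w, D (psi w)}.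
  apply: filterS yX => w /(_ 0); rewrite lexx Hz0 addr0 => /(_ isT) h.
  by rewrite /D /= h subrr.
have h := slice_ae Pc BM t10 t20 Hz0 mD hD.
apply: filterS h => w hw; apply: filterS hw => w' /eqP.
by rewrite subr_eq0 => /eqP.
Qed.

Let slice_mu_ae : {ae P, forall w, {ae P, forall w', (int_mu (w, shift B t2 w') < +oo)%E}}.
Proof.
apply: (slice_ae Pc BM t10 t20 Hz0 (D := [set p | (int_mu p < +oo)%E])) => //.
by have := emeasurable_fun_infty_o measurableT int_mu_measurable +oo%E; rewrite setTI.
Qed.

Let slice_sg_ae : {ae P, forall w, {ae P, forall w', (int_sg (w, shift B t2 w') < +oo)%E}}.
Proof.
apply: (slice_ae Pc BM t10 t20 Hz0 (D := [set p | (int_sg p < +oo)%E])) => //.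
by have := emeasurable_fun_infty_o measurableT int_sg_measurable +oo%E; rewrite setTI.
Qed.

Variable Hn : nat -> simple_process Omega R.
Hypothesis wf : forall n, sp_wf P B t T (Hn n).
Hypothesis cH : cvg_in_prob P (fun n w => \int[lam]_(u in `[t, T])
              ((sp_val (Hn n) u w - sigma (X u w)) ^+ 2)%:E)%E.
Hypothesis cM : forall s, t <= s <= T ->
        cvg_in_prob P (fun n w => (sp_integral B (Hn n) s w - sol_mart mu t x X s w)%:E).
Let tau n i := sp_time (Hn n) i.
Let sg n i := clamp t1 (t1 + Hz) (tau n i) - t1.
Variable c : nat -> nat -> Omega * (R -> R) -> R.
Variable Cb : nat -> R.
Hypothesis mc : forall n i, measurable_fun [set: OF t1 * PE (sg n i)] (c n i).
Hypothesis c_bound : forall n i p, `|c n i p| <= Cb n.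
Hypothesis c_late : forall n i p, t1 + Hz <= tau n i -> c n i p = 0.
Hypothesis c_ae : {ae P, forall w, forall n i, (i < sp_size (Hn n))%N -> tau n i < t1 + Hz ->
   sp_coef (Hn n) i w = c n i (psi w)}.

Let sg_itv n i : 0 <= sg n i <= Hz.
Proof. by have /andP[? ?] := clamp_bounds (tau n i) t1le; rewrite /sg; apply/andP; split; lra. Qed.

Definition slice_sp n w : simple_process Omega R :=
  SimpleProcess (sp_size (Hn n)) (fun i => sg n i + t2) (fun i w' => c n i (w, shift B t2 w')).

Let slice_wf n w : sp_wf P B t2 T (slice_sp n w).
Proof.
have [h0 hN hm _ _] := wf n; split => /=.
- by rewrite /sg /tau h0 clamp_left// subrr add0r.
- by rewrite /sg /tau hN clamp_right//; move: t2H; lra.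
- by move=> i iN; rewrite /sg !lerD2r; apply: clamp_le; exact: hm.
- move=> i iN; apply/measurable_wrtP; rewrite addrC; apply: slice_adapted => //.
  by have /andP[] := sg_itv n i.
- by exists (Cb n) => i w' _; exact: c_bound.
Qed.

Let ind n i (s : R) : R := \1_(`]sg n i, sg n i.+1]%classic) s.
Let V n p s := \sum_(i < sp_size (Hn n)) c n i p * ind n i s.
Let Err n p : \bar R := (\int[lam]_(s in `[0%R, Hz]) ((V n p s - sigma (y s p)) ^+ 2)%:E)%E.
(** The integral of the n-th simple process over the first [s] units of time after [t1], as a
    functional of the past and of the increments, so that it can be evaluated along the path and on
    slices alike. *)
Let In n s p := \sum_(i < sp_size (Hn n)) c n i p * (p.2 (Num.min (sg n i.+1) s) - p.2 (Num.min (sg n i) s)).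

Let mcH n i : measurable_fun [set: Pr] (c n i).
Proof. by apply: (@measurable_path_le _ _ _ P B t1 _ _ (sg n i)) => //; have /andP[] := sg_itv n i. Qed.

Let Err_measurable n : measurable_fun [set: Pr] (Err n).
Proof.
apply: (@measurable_param_integral _ Pr _ 0 Hz (fun q : R * Pr => (V n q.2 q.1 - sigma (y q.1 q.2)) ^+ 2)); last first.
  by move=> q; exact: sqr_ge0.
apply: measurable_funX; apply: measurable_funB; last exact: y_coef_measurable.
apply: measurable_funTS; apply: measurable_sum => i; apply: measurable_funM.
  exact: (measurableT_comp (mcH n i) measurable_snd).
by apply: (measurableT_comp (measurable_indic _) measurable_fst); exact: measurable_itv.
Qed.

Let In_measurable n s : 0 <= s <= Hz -> measurable_fun [set: Pr] (In n s).
Proof.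
move=> /andP[s0 sH]; apply: measurable_sum => i; apply: measurable_funM; first exact: mcH.
have m j : measurable_fun [set: Pr] (fun p : Pr => p.2 (Num.min (sg n j) s)).
  apply: (measurableT_comp (@measurable_path_eval R Hz (Num.min (sg n j) s) _) measurable_snd).
  by have /andP[sg0 _] := sg_itv n j; rewrite le_min sg0 s0 /= (le_trans _ sH)// ge_min lexx orbT.
by apply: measurable_funB.
Qed.

Let slice_val n w u w' : sp_val (slice_sp n w) u w' = V n (w, shift B t2 w') (u - t2).
Proof.
apply: eq_bigr => i _; congr (_ * _); rewrite /ind !indicE; congr (_%:R); congr nat_of_bool.
by apply/idP/idP; rewrite !inE/= !in_itv/= ltrBrDr lerBlDr.
Qed.

Let slice_integral n w s w' : 0 <= s -> sp_integral B (slice_sp n w) (t2 + s) w' = In n s (w, shift B t2 w').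
Proof.
move=> s0; apply: eq_bigr => i _; congr (_ * _); rewrite /shift /=.
have E j : Num.min (sg n j + t2) (t2 + s) = t2 + Num.min (sg n j) s by rewrite [t2 + s]addrC -addr_minl addrC.
by rewrite !E; ring.
Qed.

Let In_psi : {ae P, forall w, forall n s, 0 <= s <= Hz -> In n s (psi w) = sp_incr B (Hn n) t1 (t1 + s) w}.
Proof.
apply: filterS c_ae => w hc n s /andP[s0 sH]; apply: eq_bigr => i _; rewrite /shift /=.
have E j : t1 + Num.min (sg n j) s = clamp t1 (t1 + s) (tau n j).
  by rewrite clamp_shift_min// s0.
rewrite !E -!/(tau n _).
have [lt|le] := ltP (tau n i) (t1 + Hz).
  by rewrite -hc//; congr (_ * _); ring.
rewrite c_late// mul0r.
have [_ _ mono _ _] := wf n.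
have le' : t1 + Hz <= tau n i.+1 by apply: le_trans le _; exact: mono.
rewrite (_ : clamp t1 (t1 + s) (sp_time (Hn n) i.+1) = clamp t1 (t1 + s) (sp_time (Hn n) i)) ?subrr ?mulr0//.
have st : t1 + s <= t1 + Hz by rewrite lerD2l.
by rewrite !clamp_right ?lerDl// (le_trans st).
Qed.

Let mart_psi : {ae P, forall w, forall s, 0 <= s <= Hz ->
  mart s (psi w) = sol_mart mu t x X (t1 + s) w - sol_mart mu t x X t1 w}.
Proof.
have [_ _ _ _ [im _]] := solX; apply: filterS2 yX im => w h im s /andP[s0 sH].
have st : t1 <= t1 + s by rewrite lerDl.
have sT : t1 + s <= T by apply: le_trans t1H; rewrite lerD2l.
rewrite /mart /sol_mart -!h ?s0 ?lexx// addr0.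
rewrite (Rintegral_split tt1 st (integrable_sub (lexx t) sT im)).
have -> : drift s (psi w) = \int[lam]_(u in `[t1, (t1 + s)%R]) mu (X u w).
  have := @Rintegral_shift R 0 s t1 (fun u => mu (X u w)).
  rewrite add0r (addrC s) => ->; last by apply: path_meas.
  apply: eq_Rintegral => u; rewrite inE/= in_itv/= => /andP[u0 us].
  by rewrite addrC h// u0 (le_trans us).
by ring.
Qed.

Let Err_psi : {ae P, forall w, forall n, (Err n (psi w) <= sp_err t T (fun u w => sigma (X u w)) Hn n w)%E}.
Proof.
apply: filterS2 yX c_ae => w h hc n.
have mV : measurable_fun [set: R] (V n (psi w)).
  apply: measurable_sum => i; apply: measurable_funM; first exact: measurable_cst.
  by apply: measurable_indic; exact: measurable_itv.
have mVt : measurable_fun [set: R] (fun u => V n (psi w) (u - t1)).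
  by apply: (measurableT_comp mV); apply: measurable_funB.
have mX1 : measurable_fun `[t1, t1 + Hz] (fun u => sigma (X u w)) by exact: path_meas.
have -> : Err n (psi w) = (\int[lam]_(u in `[t1, (t1 + Hz)%R]) ((V n (psi w) (u - t1) - sigma (X u w)) ^+ 2)%:E)%E.
  rewrite (@shift_psi (cst 0%E) (fun u z => ((V n (psi w) (u - t1) - sigma z) ^+ 2)%:E) w h)//.
  - by apply: eq_integral => s _; rewrite addrK.
  - by move=> u z; rewrite lee_fin sqr_ge0.
  - apply/measurable_EFinP; apply: measurable_funX; apply: measurable_funB => //.
    exact: measurable_funTS.
have mXT : measurable_fun `[t, T] (fun u => sigma (X u w)) by exact: path_meas.
have mE : measurable_fun `[t, T] (fun u => ((sp_val (Hn n) u w - sigma (X u w)) ^+ 2)%:E).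
  apply/measurable_EFinP; apply: measurable_funX; apply: measurable_funB => //.
  by apply: measurable_funTS; exact: sp_val_path_measurable.
apply: (@le_trans _ _ (\int[lam]_(u in `[t1, (t1 + Hz)%R]) ((sp_val (Hn n) u w - sigma (X u w)) ^+ 2)%:E)%E); last first.
  by apply: ge0_subset_integral => // u _; rewrite lee_fin sqr_ge0.
rewrite le_eqVlt; apply/orP; left; apply/eqP.
have sub2 : `]t1, (t1 + Hz)] `<=` (`[t1, t1 + Hz] : set R).
  by move=> u /=; rewrite !in_itv/= => /andP[/ltW -> ->].
rewrite -integral_itv_obnd_cbnd; last first.
  apply/measurable_EFinP; apply: measurable_funX; apply: measurable_funB; first exact: measurable_funTS.
  by apply: measurable_funS mX1.
rewrite -[RHS]integral_itv_obnd_cbnd; last by apply: measurable_funS mE => //; exact: subset_trans sub1.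
apply: eq_integral => u; rewrite inE/= in_itv/= => /andP[u1 u2].
congr (((_ - _) ^+ 2)%:E); apply: eq_bigr => i _.
have -> : ind n i (u - t1) = \1_(`]sp_time (Hn n) i, sp_time (Hn n) i.+1]%classic) u.
  rewrite /ind !indicE; congr (_%:R); congr nat_of_bool.
  have := @clamp_itv R t1 (t1 + Hz) (tau n i) (tau n i.+1) u; rewrite u1 u2 => /(_ isT) E.
  apply/idP/idP; rewrite !inE/= !in_itv/= /sg ltrD2r lerD2r E//.
have [lt|le] := ltP (tau n i) (t1 + Hz); first by rewrite -hc.
rewrite indicE memNset ?mulr0// /= in_itv/= => /andP[h1 _].
by move: le; rewrite leNgt => /negP; apply; exact: lt_le_trans u2.
Qed.

(** Index 0 carries the error of the integrand and index [k.+1] the integral at the k-th dense time,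
    so that one diagonal subsequence serves all conditions. *)
Let Z j n p : \bar R := if j is k.+1 then (In n (rk k) p - mart (rk k) p)%:E else Err n p.

Let Z_measurable j n : measurable_fun [set: Pr] (Z j n).
Proof.
case: j => [|k]; first exact: Err_measurable.
have h := dense_time_itv k Hz0.
by apply/measurable_EFinP; apply: measurable_funB; [exact: In_measurable|exact: mart_measurable].
Qed.

Let Z_psi j : cvg_in_prob P (fun n w => Z j n (psi w)).
Proof.
have mZp n : measurable_fun [set: Omega] (fun w => Z j n (psi w)).
  exact: (psi_measurable Pc BM t10 Hz0 (Z_measurable j n)).
have merr n := @sp_err_measurable _ _ _ P B Pc BM t T (fun u w => sigma (X u w)) Hn
  (sol_coef_measurable Pc BM mcl solX msigma (lexx t) tT (lexx T)) wf n tT.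
case: j mZp => [|k] mZp.
  apply: cvg_in_prob_intro => // e del e0 del0.
  have [N hN] := cvg_in_probP cH e0 del0; exists N => n /hN h.
  have mA := measurable_lt_abse e (mZp n).
  have mA' := measurable_lt_abse e (merr n).
  have [E0 [mE0 PE0 sE0]] := Err_psi.
  apply: le_trans h; apply: (@le_trans _ _ (P [set w | (e%:E < `|sp_err t T (fun u w => sigma (X u w)) Hn n w|)%E] + P E0)%E).
    apply: (@le_trans _ _ (P ([set w | (e%:E < `|sp_err t T (fun u w => sigma (X u w)) Hn n w|)%E] `|` E0))); last exact: measureU2.
    apply: le_measure; rewrite ?inE//; first exact: measurableU.
    move=> w /= hw; have [E0w|nE0w] := pselect (E0 w); [by right|left].
    have le : (Err n (psi w) <= sp_err t T (fun u w => sigma (X u w)) Hn n w)%E.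
      by apply: contrapT => h'; apply: nE0w; apply: sE0 => /= hh; exact: h'.
    have Err0 : (0 <= Err n (psi w))%E by apply: integral_ge0 => s _; rewrite lee_fin sqr_ge0.
    apply: (lt_le_trans hw); rewrite (gee0_abs Err0); apply: (le_trans le); exact: lee_abs.
  by rewrite PE0 adde0.
have kH := dense_time_itv k Hz0; have /andP[k0 kHz] := kH.
have := tt1 => tt1'.
have k1 : t <= t1 + rk k <= T by apply/andP; split; [apply: le_trans tt1 _; rewrite lerDl|apply: le_trans t1H; rewrite lerD2l].
have k2 : t <= t1 <= T by rewrite tt1; apply: le_trans t1H; rewrite lerDl.
pose Z1 s n w : \bar R := (sp_integral B (Hn n) s w - sol_mart mu t x X s w)%:E.
have mZ1 s n : t <= s <= T -> measurable_fun [set: Omega] (Z1 s n).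
  move=> sT; apply/measurable_EFinP; apply: measurable_funB.
    exact: (sp_integral_measurable Pc BM t0 sT (wf n)).
  exact: (sol_mart_measurable Pc BM mcl mmu solX sT).
apply: cvg_in_prob_intro => // e del e0 del0.
have e20 : 0 < e / 2 by rewrite divr_gt0.
have d20 : 0 < del / 2 by rewrite divr_gt0.
have [N1 h1] := cvg_in_probP (cM k1) e20 d20.
have [N2 h2] := cvg_in_probP (cM k2) e20 d20.
exists (maxn N1 N2) => n; rewrite geq_max => /andP[/h1 {}h1 /h2 {}h2].
have mA1 := measurable_lt_abse (e / 2) (mZ1 _ n k1).
have mA2 := measurable_lt_abse (e / 2) (mZ1 _ n k2).
have [E0 [mE0 PE0 sE0]] : {ae P, forall w, In n (rk k) (psi w) - mart (rk k) (psi w) =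
   (sp_integral B (Hn n) (t1 + rk k) w - sol_mart mu t x X (t1 + rk k) w) -
   (sp_integral B (Hn n) t1 w - sol_mart mu t x X t1 w)}.
  apply: filterS2 In_psi mart_psi => w e1 e2; rewrite (e1 n _ kH) (e2 _ kH) -sp_integralB; last by rewrite lerDl; exact: k0.
  move: (sp_integral _ _ _ _) (sp_integral _ _ _ _) (sol_mart _ _ _ _ _ _) (sol_mart _ _ _ _ _ _) => a1 a2 a3 a4; ring.
pose A1 : set Omega := [set w | ((e / 2)%:E < `|Z1 (t1 + rk k)%R n w|)%E].
pose A2 : set Omega := [set w | ((e / 2)%:E < `|Z1 t1 n w|)%E].
have mU : measurable (A2 `|` E0) by exact: measurableU.
have inc : (P [set w | (e%:E < `|Z k.+1 n (psi w)|)%E] <= P (A1 `|` (A2 `|` E0)))%E.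
  apply: le_measure; rewrite ?inE//.
  - by apply: measurable_lt_abse; exact: mZp.
  - exact: measurableU.
  move=> w /=; rewrite !lte_fin => hw; have [E0w|nE0w] := pselect (E0 w); first by right; right.
  have E : In n (rk k) (psi w) - mart (rk k) (psi w) =
   (sp_integral B (Hn n) (t1 + rk k) w - sol_mart mu t x X (t1 + rk k) w) -
   (sp_integral B (Hn n) t1 w - sol_mart mu t x X t1 w).
    by apply: contrapT => h; apply: nE0w; exact: sE0.
  rewrite E in hw.
  have [l1|l1] := ltP (e / 2) `|sp_integral B (Hn n) (t1 + rk k) w - sol_mart mu t x X (t1 + rk k) w|; first by left.
  right; left; rewrite /A2 /Z1 /= lte_fin ltNge; apply/negP => l2.
  have := le_trans (ler_normB _ _) (lerD l1 l2).
  by rewrite -splitr leNgt hw.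
apply: (le_trans inc).
apply: (@le_trans _ _ ((del / 2)%:E + ((del / 2)%:E + 0))%E); last by rewrite adde0 -EFinD -splitr.
apply: (@le_trans _ _ (P A1 + P (A2 `|` E0))%E); first exact: measureU2.
apply: leeD; first exact: h1.
apply: (@le_trans _ _ (P A2 + P E0)%E); first exact: measureU2.
by rewrite PE0; apply: leeD => //; exact: h2.
Qed.

Lemma within_continuous_intro (A : set R) (f : R -> R) :
  (forall u e, A u -> 0 < e -> exists2 r, 0 < r & forall v, A v -> `|u - v| < r -> `|f u - f v| < e) ->
  {within A, continuous f}.
Proof.
move=> h; rewrite subspace_continuousP => u Au; apply/cvgrPdist_lt => e e0.
have [r r0 hr] := h u e Au e0.
rewrite near_withinE; apply/nbhs_ballP; exists r => // v uv Av; exact: hr.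
Qed.

Lemma within_continuous_shift (f : R -> R) : {within `[0, Hz], continuous f} ->
  {within `[t2, T], continuous (fun u => f (u - t2))}.
Proof.
move=> cf; apply: within_continuous_intro => u e; rewrite /= in_itv/= => uT e0.
have uI : `[0, Hz]%classic (u - t2) by move: t2H; rewrite /= in_itv/=; lra.
have [r r0 hr] := within_continuous_dist cf uI e0; exists r => // v; rewrite /= in_itv/= => vT uv.
apply: hr; first by move: t2H; rewrite /= in_itv/=; lra.
by rewrite (_ : u - t2 - (v - t2) = u - v)//; ring.
Qed.

Let Ysl w u w' := y (u - t2) (w, shift B t2 w').

Let Ysl_cont w w' : {within `[t2, T], continuous (Ysl w ^~ w')}.
Proof. exact: (within_continuous_shift (@y_cont (w, shift B t2 w'))). Qed.

Let itvE u : t2 <= u <= T -> 0 <= u - t2 <= Hz.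
Proof. by move: t2H; lra. Qed.

Let Ysl_meas w u : t2 <= u <= T -> measurable_fun [set: Omega] (Ysl w u).
Proof.
move=> uT; apply: (slice_measurable_fun Pc BM w t20 Hz0).
by apply: y_meas; exact: itvE.
Qed.

Let Ysl_coef (f : R -> R) w : measurable_fun (closure I) f ->
  measurable_fun (`[t2, T] `*` [set: Omega]) (fun q : R * Omega => f (Ysl w q.1 q.2)).
Proof.
move=> mf; apply: (process_coef_measurable mcl mf) => //; first by rewrite -t2H lerDl.
- by move=> u uT; exact: Ysl_meas.
- by move=> u w' uT; apply: y_in; exact: itvE.
Qed.

Let Ysl_path (f : R -> R) w w' : measurable_fun (closure I) f ->
  measurable_fun `[t2, T] (fun u => f (Ysl w u w')).
Proof.
move=> mf; exact: (@process_section_measurable _ _ _ t2 T (fun u w' => f (Ysl w u w')) (Ysl_coef w mf) w').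
Qed.

Let ge0_slice_shift (G : R -> \bar R) w w' : (forall z, (0 <= G z)%E) ->
  measurable_fun `[t2, T] (fun u => G (Ysl w u w')) ->
  (\int[lam]_(u in `[t2, T]) G (Ysl w u w') = \int[lam]_(s in `[0%R, Hz]) G (y s (w, shift B t2 w')))%E.
Proof.
move=> G0 mG; have := @ge0_integral_shift R 0 Hz t2 (fun u => G (Ysl w u w')).
rewrite add0r addrC t2H => -> //.
by apply: eq_integral => s _; rewrite /Ysl addrK.
Qed.

Let slice_err n w w' : (\int[lam]_(u in `[t2, T]) ((sp_val (slice_sp n w) u w' - sigma (Ysl w u w')) ^+ 2)%:E)%E =
  Err n (w, shift B t2 w').
Proof.
have := @ge0_integral_shift R 0 Hz t2 (fun u => ((sp_val (slice_sp n w) u w' - sigma (Ysl w u w')) ^+ 2)%:E).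
rewrite add0r (addrC Hz) t2H => ->.
- by apply: eq_integral => s _; rewrite slice_val /Ysl addrK.
- apply/measurable_EFinP; apply: measurable_funX; apply: measurable_funB; last exact: Ysl_path.
  by apply: measurable_funTS; exact: sp_val_path_measurable.
- by move=> u; rewrite lee_fin sqr_ge0.
Qed.

(** The initial value and the integrability of the coefficients pass to almost every slice by
    [slice_ae]. Convergence of the simple integrals passes through the expectations of [min1] and
    [path_law], which gives convergence in mean over the past; a subsequence gives it for almost
    every past, at dense times, and [ito_dense] completes it. *)
Lemma slice_solution_ae : {ae P, forall w, strong_solution P B I mu sigma T t2 (X t1 w) (Ysl w)}.
Proof.
have t2T : t2 <= T by rewrite -t2H lerDl.
pose a j n w := (\int[P]_w' min1 (Z j n (w, shift B t2 w')))%E.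
have mZ1 j n : measurable_fun [set: Pr] (fun p : Pr => min1 (Z j n p)) by exact: measurable_min1.
have ma j n : measurable_fun [set: Omega] (a j n).
  apply: (adapted_measurable Pc BM (s := t1)).
  exact: (measurable_slice_integral Pc BM t20 Hz0 (mZ1 j n) (fun p => min1_ge0 _)).
have a0 j n w : (0 <= a j n w)%E by apply: integral_ge0 => w' _; exact: min1_ge0.
have ha j del : 0 < del -> exists N, forall n, (N <= n)%N -> (\int[P]_w a j n w <= del%:E)%E.
  move=> d0; have [N hN] := cvg_in_prob_min1
    (fun n => psi_measurable Pc BM t10 Hz0 (Z_measurable j n)) (Z_psi j) d0.
  exists N => n /hN; apply: le_trans.
  by rewrite -(path_law Pc BM t10 t20 Hz0 (mZ1 j n) (fun p => min1_ge0 _)).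
have [f hf] := ae_subsequence ma a0 ha.
apply: filterS (filterI (filterI hf start_ae) (filterI (filterI slice_mu_ae slice_sg_ae) y_adapted)).
move=> w [[cw st] [[imu isg] ad]].
have mZw j n : measurable_fun [set: Omega] (fun w' => Z j n (w, shift B t2 w')).
  exact: (slice_measurable_fun Pc BM w t20 Hz0 (Z_measurable j n)).
have cZ j : cvg_in_prob P (fun n w' => Z j (f n) (w, shift B t2 w')).
  by apply: min1_cvg_in_prob => //; exact: cw.
pose M u w' := mart (u - t2) (w, shift B t2 w').
have mM u : t2 <= u <= T -> measurable_fun [set: Omega] (M u).
  move=> uT; apply: (slice_measurable_fun Pc BM w t20 Hz0).
  by apply: mart_measurable; exact: itvE.
have mmuw w' := @Ysl_path mu w w' mmu; have msgw w' := @Ysl_path sigma w w' msigma.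
have imuT : {ae P, forall w', lam.-integrable `[t2, T] (fun u => (mu (Ysl w u w'))%:E)}.
  apply: filterS imu => w' h; apply/integrableP; split; first by apply/measurable_EFinP; exact: mmuw.
  apply: le_lt_trans h; rewrite le_eqVlt; apply/orP; left; apply/eqP.
  apply: (@ge0_slice_shift (fun z => `|mu z|%:E)) => //.
  by apply/measurable_EFinP; apply: measurableT_comp => //; exact: mmuw.
have isgT : {ae P, forall w', (\int[lam]_(u in `[t2, T]) (sigma (Ysl w u w') ^+ 2)%:E < +oo)%E}.
  apply: filterS isg => w' h; rewrite (@ge0_slice_shift (fun z => (sigma z ^+ 2)%:E))//.
    by move=> z; rewrite lee_fin sqr_ge0.
  by apply/measurable_EFinP; exact: measurable_funX.
have adY u : t2 <= u <= T -> measurable_fun [set: OF u] (Ysl w u).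
  by move=> uT; have := ad (u - t2) (itvE uT); rewrite addrC subrK.
have cMae : {ae P, forall w', {within `[t2, T], continuous (M ^~ w')}}.
  apply: filterS imu => w' h; apply: (@within_continuous_shift (fun s => mart s (w, shift B t2 w'))).
  have imu0 : lam.-integrable `[0, Hz] (EFin \o (fun u => mu (y u (w, shift B t2 w')))).
    apply/integrableP; split; last by [].
    apply/measurable_EFinP.
    exact: (@process_section_measurable _ Pr _ 0 Hz (fun u p => mu (y u p)) (y_coef_measurable mmu Hz0 (lexx Hz)) (w, shift B t2 w')).
  have cI := parameterized_integral_continuous Hz0 imu0.
  move=> s; apply: cvgB; last exact: cI.
  by apply: cvgB; [exact: y_cont|exact: cvg_cst].
have drE u w' : t2 <= u <= T -> \int[lam]_(v in `[t2, u]) mu (Ysl w v w') = drift (u - t2) (w, shift B t2 w').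
  move=> /andP[tu uT]; have := @Rintegral_shift R 0 (u - t2) t2 (fun v => mu (Ysl w v w')).
  rewrite add0r subrK => ->; last first.
    apply: measurable_funS (mmuw w') => // v /=; rewrite !in_itv/= => /andP[-> h]; exact: le_trans uT.
  by apply: eq_Rintegral => v _; rewrite /Ysl addrK.
split.
- by move=> w'; exact: Ysl_cont.
- by move=> u w' uT; apply: y_in; exact: itvE.
- by move=> u uT; apply/measurable_wrtP; exact: adY.
- by apply: filterS st => w' h; rewrite /Ysl subrr.
split => //.
exists M; split; last first.
  apply: filterS st => w' h u uT; rewrite drE// /M /mart -h /Ysl; by ring.
split.
- exact: Ysl_coef.
- move=> u uT; apply/measurable_wrtP.
  apply: (measurable_comp (F := closure I)) => //; last exact: adY.
  by move=> _ [w' _ <-]; apply: y_in; exact: itvE.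
- exact: isgT.
- exact: cMae.
exists (fun n => slice_sp (f n) w); split.
- by move=> n; exact: slice_wf.
- rewrite (_ : (fun n w' => _) = fun n w' => Z 0 (f n) (w, shift B t2 w')); first exact: cZ.
  by apply/funext => n; apply/funext => w'; exact: slice_err.
apply: (@ito_dense _ _ _ P B Pc BM t2 T (fun u w' => sigma (Ysl w u w')) M (fun n => slice_sp (f n) w)) => //.
- exact: Ysl_coef.
- rewrite (_ : (fun n w' => _) = fun n w' => Z 0 (f n) (w, shift B t2 w')); first exact: cZ.
  by apply/funext => n; apply/funext => w'; exact: slice_err.
move=> k; rewrite (_ : (fun n w' => _) = fun n w' => Z k.+1 (f n) (w, shift B t2 w')); first exact: cZ.
apply/funext => n; apply/funext => w' /=.
have -> : dense_time t2 T k = t2 + rk k by rewrite /dense_time -t2H; ring.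
have /andP[k0 _] := dense_time_itv k Hz0.
by rewrite slice_integral// /M (_ : t2 + rk k - t2 = rk k)//; ring.
Qed.
End slice_solution.

(** * Measurability of hitting times and payoffs *)

Section path_functionals.
Context d (Om : measurableType d) (R : realType).
Local Notation lam := (@lebesgue_measure R).

(** By compactness a continuous function without a point where it is [<= 0] is bounded below by some
    [m.+1%:R^-1], so the complement is a countable union of measurable events. *)
Lemma measurable_exists_le (F : R -> Om -> R) a c : a <= c ->
  (forall w, {within `[a, c], continuous (F ^~ w)}) ->
  (forall u, a <= u <= c -> measurable_fun [set: Om] (F u)) ->
  measurable [set w | exists2 u, a <= u <= c & F u w <= 0].
Proof.
move=> ac cF mF.
rewrite (_ : [set w | _] = ~` \bigcup_m [set w | forall u, a <= u <= c -> - F u w <= - m.+1%:R^-1]).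
  apply: measurableC; apply: bigcupT_measurable => m.
  apply: (@measurable_forall_le _ _ _ (fun u w => - F u w)) => //.
  - by move=> w u; apply: cvgN; exact: cF.
  - by move=> u uac; apply: measurableT_comp => //; exact: mF.
apply/seteqP; split => w /=.
  move=> [u uac Fu] [m _ /= h]; have := h u uac.
  have : 0 < m.+1%:R^-1 :> R by rewrite invr_gt0.
  by move: (m.+1%:R^-1) => q; lra.
move=> h; apply: contrapT => no; apply: h.
have [c0 c0I hc0] := EVT_min ac (@cF w).
have Fc0 : 0 < F c0 w.
  by rewrite ltNge; apply/negP => le; apply: no; exists c0 => //; move: c0I; rewrite in_itv.
have [m hm] := nat_inv_lt Fc0; exists m => // u uac; rewrite lerN2.
by apply: le_trans (ltW hm) _; apply: hc0; rewrite in_itv.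
Qed.

Variables (Y : R -> Om -> R) (b g r : R -> R) (t T : R).
Hypothesis tT : t <= T.
Hypothesis cY : forall w, {within `[t, T], continuous (Y ^~ w)}.
Hypothesis cb : {within `[t, T], continuous b}.

Lemma tau_star_bounds w : 0 <= tau_star b Y T t w <= T - t.
Proof.
have i : has_lbound ([set s | 0 <= s < T - t /\ Y (t + s) w <= b (t + s)] `|` [set T - t]).
  by exists 0 => s [[/andP[? _] _]//|->]; rewrite subr_ge0.
apply/andP; split; last by apply: ge_inf => //; right.
apply: lb_le_inf; first by exists (T - t); right.
by move=> s [[/andP[? _] _]//|->]; rewrite subr_ge0.
Qed.

Let cYb w : {within `[t, T], continuous (fun u => Y u w - b u)}.
Proof. by move=> u; apply: cvgB; [exact: cY|exact: cb]. Qed.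

(** The infimum is attained: if [Y - b] is positive on [[t, t + s]] then by continuity it stays
    positive a little longer, and [tau_star] exceeds [s]. The case [s = T - t] is excluded because
    the horizon is adjoined to the set. *)
Lemma tau_star_le w s : 0 <= s -> s < T - t ->
  (tau_star b Y T t w <= s) <-> exists2 u, t <= u <= t + s & Y u w - b u <= 0.
Proof.
move=> s0 sT.
set S := ([set s | 0 <= s < T - t /\ Y (t + s) w <= b (t + s)] `|` [set T - t]).
have lbS : has_lbound S by exists 0 => z [[/andP[? _] _]//|->]; rewrite subr_ge0; exact: tT.
split; last first.
  move=> [u /andP[tu us] Yu]; apply: le_trans (_ : u - t <= s); last by rewrite lerBlDl.
  apply: ge_inf => //; left; split; first by rewrite subr_ge0 tu ltrD2r (le_lt_trans us)// -ltrBrDl.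
  by rewrite addrC subrK -subr_le0.
move=> le; apply: contrapT => no.
have ts : t <= t + s by rewrite lerDl.
have sub : `[t, t + s] `<=` (`[t, T] : set R).
  by move=> u /=; rewrite !in_itv/= => /andP[-> h]; lra_only h sT.
have [c cI hc] := EVT_min ts (continuous_subspaceW sub (@cYb w)).
have c1 : 0 < Y c w - b c.
  by rewrite ltNge; apply/negP => h; apply: no; exists c => //; move: cI; rewrite in_itv.
have sI : `[t, T]%classic (t + s) by rewrite /= in_itv/= ts; lra_only sT.
have Ys : 0 < Y (t + s) w - b (t + s).
  by apply: lt_le_trans c1 _; apply: hc; rewrite in_itv/= ts lexx.
have [e e0 he] := within_continuous_dist (@cYb w) sI Ys.
pose e' := Num.min e (T - t - s).
have e'0 : 0 < e' by rewrite lt_min e0 subr_gt0.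
have : s + e' <= inf S.
  apply: lb_le_inf; first by exists (T - t); right.
  move=> z [[/andP[z0 zT] Yz]|->]; last by rewrite /e'; minmax_lra.
  have [zs|sz] := leP z s.
    have := hc (t + z); rewrite in_itv/= => /(_ (ltac:(apply/andP; split; [lra_only z0|lra_only zs]))) => h; lra_only c1 h Yz.
  rewrite leNgt; apply/negP => ze.
  have zI : `[t, T]%classic (t + z) by rewrite /= in_itv/=; apply/andP; split; [lra_only z0|lra_only zT].
  have dist : `|t + s - (t + z)| < e.
    rewrite (_ : t + s - (t + z) = - (z - s)); last by ring.
    rewrite normrN ger0_norm; last by rewrite subr_ge0 ltW.
    by move: ze; rewrite /e'; minmax_lra.
  by have := he _ zI dist; rewrite ltr_norml => /andP[_ h]; lra_only h Yz.
by move=> /le_trans/(_ le); rewrite gerDl leNgt e'0.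
Qed.

Lemma tau_star_set_measurable s : 0 <= s <= T - t ->
  (forall u, t <= u <= t + s -> measurable_fun [set: Om] (Y u)) -> measurable [set w | tau_star b Y T t w <= s].
Proof.
move=> /andP[s0]; rewrite le_eqVlt => /predU1P[->|sT] mYs.
  rewrite (_ : [set w | _] = setT) //; apply/seteqP; split => // w _ /=.
  by have /andP[] := tau_star_bounds w.
rewrite (_ : [set w | _] = [set w | exists2 u, t <= u <= t + s & Y u w - b u <= 0]); last first.
  by apply/seteqP; split => w /= /(tau_star_le w s0 sT).
have sub u : t <= u <= t + s -> t <= u <= T by lra.
apply: (@measurable_exists_le (fun u w => Y u w - b u)); first by lra.
- move=> w; apply: continuous_subspaceW (@cYb w) => u /=; rewrite !in_itv/=; exact: sub.
- by move=> u uT; apply: measurable_funB => //; exact: mYs.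
Qed.

Hypothesis mY : forall u, t <= u <= T -> measurable_fun [set: Om] (Y u).

Lemma measurable_of_le_sets (tau : Om -> R) D : (forall w, 0 <= tau w <= D) ->
  (forall s, 0 <= s <= D -> measurable [set w | tau w <= s]) -> measurable_fun [set: Om] tau.
Proof.
move=> tD h; apply: (measurability (@RGenOInfty.G R)) => [|_ /= [_ [c ->] <-]]; first exact: RGenOInfty.measurableE.
rewrite setTI (_ : _ @^-1` _ = ~` [set w | tau w <= c]); last first.
  by apply/seteqP; split => w /=; rewrite in_itv/= andbT ltNge => /negP.
apply: measurableC; have [c0|c0] := ltP c 0.
  rewrite (_ : [set w | _] = set0)//; apply/seteqP; split => // w /=.
  by have /andP[] := tD w; lra.
have [cD|cD] := leP c D; first by apply: h; rewrite c0.
rewrite (_ : [set w | _] = setT)//; apply/seteqP; split => // w _ /=.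
by have /andP[] := tD w; lra.
Qed.

Lemma tau_star_measurable : measurable_fun [set: Om] (tau_star b Y T t).
Proof.
apply: (@measurable_of_le_sets _ (T - t)); first exact: tau_star_bounds.
move=> s sT; apply: tau_star_set_measurable => // u /andP[tu us]; apply: mY.
by have /andP[_ ?] := sT; apply/andP; split; lra.
Qed.

Variable tau : Om -> R.
Hypothesis tau_bounds : forall w, 0 <= tau w <= T - t.
Hypothesis mtau : measurable_fun [set: Om] tau.
Hypothesis cg : continuous g.
Hypothesis cr : continuous r.

Lemma stopped_measurable (f : R -> R) : continuous f -> measurable_fun [set: Om] (fun w => f (Y (t + tau w) w)).
Proof.
move=> cf.
have mf : measurable_fun [set: R] f by exact: continuous_measurable_fun.
apply: (measurableT_comp mf).
apply: (@measurable_comp _ _ _ _ _ _ (`[t, T] `*` [set: Om]) (fun p : R * Om => Y p.1 p.2) setT (fun w => (t + tau w, w))).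
- by apply: measurableX => //; exact: measurable_itv.
- move=> _ [w _ <-]; split => //=; rewrite in_itv/=.
  by move: tT => ?; have /andP[? ?] := tau_bounds w; apply/andP; split; lra.
- exact: continuous_process_measurable.
- have m1 : measurable_fun [set: Om] (fun w => t + tau w).
    by apply: measurable_funD => //; exact: measurable_cst.
  by apply: measurable_fun_pair => //; exact: measurable_id.
Qed.

(** The random upper limit is turned into an indicator on a fixed interval, which brings the
    integral within the reach of Fubini. *)
Lemma discount_measurable : measurable_fun [set: Om] (fun w => \int[lam]_(s in `[0, tau w]) r (Y (t + s) w)).
Proof.
have mr : measurable_fun [set: R] r by exact: continuous_measurable_fun.
have E w : \int[lam]_(s in `[0, tau w]) r (Y (t + s) w) =
   \int[lam]_(s in `[0, T - t]) (\1_[set p : R * Om | p.1 <= tau p.2] (s, w) * r (Y (t + s) w)).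
  rewrite Rintegral_mkcond [RHS]Rintegral_mkcond; congr (fine _); apply: eq_integral => s _.
  have /andP[t0 t1] := tau_bounds w; rewrite !patchE !mem_setE.
  have -> : (s \in `[0, tau w]) = (0 <= s <= tau w) by rewrite in_itv.
  have -> : (s \in `[0, T - t]) = (0 <= s <= T - t) by rewrite in_itv.
  have [s0|s0] //= := leP 0 s; have [st|st] := leP s (tau w).
    by rewrite (le_trans st t1) indicE mem_set// mul1r.
  rewrite indicE memNset; first by rewrite mul0r; case: ifP.
  by apply/negP; rewrite /= -ltNge.
rewrite (_ : (fun w => _) = fun w => \int[lam]_(s in `[0, T - t]) (\1_[set p : R * Om | p.1 <= tau p.2] (s, w) * r (Y (t + s) w))); last exact/funext.
apply: (@measurable_param_Rintegral _ _ _ 0 (T - t) (fun p : R * Om => \1_[set p : R * Om | p.1 <= tau p.2] p * r (Y (t + p.1) p.2))).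
apply: measurable_funM.
  apply: measurable_funTS; apply: measurable_indic.
  have m1 : measurable_fun [set: R * Om] (fun p : R * Om => tau p.2 - p.1).
    by apply: measurable_funB; [exact: (measurableT_comp mtau measurable_snd)|exact: measurable_fst].
  rewrite (_ : [set p | _] = [set p : R * Om | 0 <= tau p.2 - p.1]); last first.
    by apply/seteqP; split => p /=; rewrite subr_ge0.
  by rewrite -[X in measurable X]setTI; exact: measurable_fun_ler.
apply: (@measurable_comp _ _ _ _ _ _ setT r) => //.
apply: (@measurable_comp _ _ _ _ _ _ (`[t, T] `*` [set: Om]) (fun p : R * Om => Y p.1 p.2) _ (fun p : R * Om => (t + p.1, p.2))).
- by apply: measurableX => //; exact: measurable_itv.
- move=> _ [[s w] /= [+ _] <-]; rewrite !in_itv/= => /andP[? ?]; split => //.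
  by apply/andP; split; lra.
- exact: continuous_process_measurable.
- apply: measurable_funTS; apply/measurable_fun_pairP; split; last exact: measurable_snd.
  by apply: measurable_funD => //; exact: measurable_fst.
Qed.

Lemma payoff_measurable : measurable_fun [set: Om] (payoff g r Y t tau).
Proof.
apply: measurable_funM; last exact: stopped_measurable.
apply: (measurableT_comp (@measurable_expR R)); apply: measurableT_comp => //.
exact: discount_measurable.
Qed.
End path_functionals.

Section extensionality.
Context d (Om : measurableType d) d' (Om' : measurableType d') (R : realType).
Variables (b g r : R -> R) (t T : R).
Hypothesis tT : t <= T.

(** The two processes may live on different spaces: a process on [Omega] is compared with its
    representation on pairs of a past and a path of increments. *)
Lemma tau_star_ext (X : R -> Om -> R) (Y : R -> Om' -> R) w w' :
  (forall s, t <= s <= T -> X s w = Y s w') -> tau_star b X T t w = tau_star b Y T t w'.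
Proof.
move=> h; congr (inf (_ `|` _)); apply/seteqP; split => s /= [/andP[s0 sT]];
  (rewrite h || rewrite -h); try (by split => //; apply/andP; split); lra.
Qed.

Lemma payoff_ext (X : R -> Om -> R) (Y : R -> Om' -> R) (tau : Om -> R) (tau' : Om' -> R) w w' :
  (forall s, t <= s <= T -> X s w = Y s w') -> tau w = tau' w' -> 0 <= tau w <= T - t ->
  payoff g r X t tau w = payoff g r Y t tau' w'.
Proof.
move=> h e /andP[t0 t1]; rewrite /payoff -e; congr (expR (- _) * g _); last by apply: h; lra.
apply: eq_Rintegral => s; rewrite inE/= in_itv/= => /andP[s0 s1]; rewrite h//; lra.
Qed.
End extensionality.

(** * Existence of the family of slices *)

Section slices.
Context d (Omega : measurableType d) (R : realType) (P : probability Omega R).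
Variable B : R -> Omega -> R.
Hypothesis Pc : measure_is_complete P.
Hypothesis BM : brownian_motion P B.
Local Notation OF s := (g_sigma_algebraType (filtration_gen P B 0 s)).
Local Notation PE s := (g_sigma_algebraType (path_gen s)).
Local Notation lam := (@lebesgue_measure R).
Variables (I : set R) (mu sigma : R -> R).
Hypothesis mcl : measurable (closure I).
Hypothesis mmu : measurable_fun (closure I) mu.
Hypothesis msigma : measurable_fun (closure I) sigma.
Variables (t T x : R) (X : R -> Omega -> R).
Hypothesis t0 : 0 <= t.
Hypothesis Ix : I x.
Hypothesis solX : strong_solution P B I mu sigma T t x X.
Variables (t1 t2 Hz : R).
Hypothesis tt1 : t <= t1.
Hypothesis t12 : t1 <= t2.
Hypothesis Hz0 : 0 <= Hz.
Hypothesis t2H : t2 + Hz = T.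
Local Notation psi w := ((w, shift B t1 w)).
Local Notation Pr := (OF t1 * PE Hz)%type.

(** Assembly of the preceding constructions: the values of [X] at dense times are represented
    through [rep_fun], regularized, and fed to [slice_solution_ae] together with representatives of
    the simple coefficients. *)
Lemma slice_family : exists y : R -> Omega * (R -> R) -> R,
  [/\ forall p, {within `[0, Hz], continuous (y ^~ p)},
      forall s p, 0 <= s <= Hz -> closure I (y s p),
      forall s, 0 <= s <= Hz -> measurable_fun [set: Pr] (y s),
      {ae P, forall w, forall s, 0 <= s <= Hz -> X (t1 + s) w = y s (psi w)} &
      {ae P, forall w, strong_solution P B I mu sigma T t2 (X t1 w)
         (fun u w' => y (u - t2) (w, shift B t2 w'))}].
Proof.
have tt1' := tt1; have t12' := t12; have t2H' := t2H; have t0' := t0; have Hz0' := Hz0.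
have t10 : 0 <= t1 by lra.
have t20 : 0 <= t2 by lra.
have t1H : t1 + Hz <= T by lra.
have [X_cont X_in _ _ _] := solX.
have /choice[z hz] : forall k, exists z : Omega * (R -> R) -> R,
   measurable_fun [set: OF t1 * PE (dense_time 0 Hz k)] z /\
   {ae P, forall w, X (t1 + dense_time 0 Hz k) w = z (psi w)}.
  move=> k; have /andP[k0 kH] := dense_time_itv k Hz0.
  by apply: rep_fun => //; apply: (sol_adapted solX) => //; lra.
have mz k := (hz k).1; have zX k := (hz k).2.
have Xc w : {within `[t1, t1 + Hz], continuous (X ^~ w)}.
  by apply: continuous_subspaceW (X_cont w) => u /=; rewrite !in_itv/= => /andP[? ?]; lra.
have Xi s w : t1 <= s <= t1 + Hz -> closure I (X s w).
  by move=> /andP[? ?]; apply: X_in; lra.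
have Kx : closure I x by exact: subset_closure.
have cK : closed (closure I) by exact: closed_closure.
pose y := yreg Hz x (closure I) z.
exists y.
have yc p : {within `[0, Hz], continuous (y ^~ p)} by exact: yreg_continuous.
have yi s p : 0 <= s <= Hz -> closure I (y s p) by exact: yreg_in.
have ym s : 0 <= s <= Hz -> measurable_fun [set: Pr] (y s) by exact: yreg_measurable.
have yX : {ae P, forall w, forall s, 0 <= s <= Hz -> X (t1 + s) w = y s (psi w)} by exact: yreg_X.
split => //.
have ya : {ae P, forall w, forall s, 0 <= s <= Hz ->
  measurable_fun [set: OF (t2 + s)] (fun w' => y s (w, shift B t2 w'))}.
  have mreg := regular_measurable Hz0 cK mz.
  have := slice_ae Pc BM t10 t20 Hz0 mreg (regular_ae Hz0 Xc Xi zX).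
  by apply: filterS => w h s sH; exact: yreg_adapted.
have [Hn [wf cH cM]] := sol_approx Pc BM mcl mmu t0 solX.
pose tau n i := sp_time (Hn n) i.
pose sg n i := clamp t1 (t1 + Hz) (tau n i) - t1.
have t1le : t1 <= t1 + Hz by rewrite lerDl.
have sg_itv n i : 0 <= sg n i <= Hz.
  by have /andP[? ?] := clamp_bounds (tau n i) t1le; rewrite /sg lerBlDl subr_ge0; apply/andP.
have /choice[Cb hCb] : forall n, exists C : R, 0 <= C /\ forall i w, (i < sp_size (Hn n))%N -> `|sp_coef (Hn n) i w| <= C.
  move=> n; have [_ _ _ _ [K hK]] := wf n; exists (Num.max 0 K); split; first by rewrite le_max lexx.
  by move=> i w iN; rewrite le_max hK// orbT.
have claim n i : exists c : Omega * (R -> R) -> R,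
  [/\ measurable_fun [set: OF t1 * PE (sg n i)] c, forall p, `|c p| <= Cb n,
      forall p, t1 + Hz <= tau n i -> c p = 0 &
      {ae P, forall w, (i < sp_size (Hn n))%N -> tau n i < t1 + Hz ->
          sp_coef (Hn n) i w = c (psi w)}].
  have [C0 hC] := hCb n.
  have [no|] := boolP (~~ ((i < sp_size (Hn n))%N && (tau n i < t1 + Hz))).
    exists (cst 0); split => //; first by move=> p; rewrite normr0.
    by apply: aeW => w i1 i2; move: no; rewrite i1 i2.
  rewrite negbK => /andP[iN early].
  have mc : measurable_fun [set: OF (t1 + sg n i)] (sp_coef (Hn n) i).
    apply: (@adapted_le _ _ _ _ _ (tau n i)).
      by rewrite /sg addrC subrK clamp_ge_self// ltW.
    by apply/measurable_wrtP; have [_ _ _ + _] := wf n; exact.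
  have /andP[sg0 sgH] := sg_itv n i.
  have [f [mf ef]] := rep_fun t10 sg0 mc.
  (* The representative agrees with the bounded coefficient only almost surely; clipping makes the
     bound hold at every point, as a well-formed simple process requires. *)
  exists (fun p => clip (Cb n) (f p)); split.
  - by apply: (measurableT_comp _ mf); exact: measurable_clip.
  - by move=> p; exact: clip_bound.
  - by move=> p; rewrite leNgt early.
  - by apply: filterS ef => w <- _ _; rewrite clip_id//; exact: hC.
have /choice[c hc] : forall ni : nat * nat, exists c : Omega * (R -> R) -> R,
  [/\ measurable_fun [set: OF t1 * PE (sg ni.1 ni.2)] c, forall p, `|c p| <= Cb ni.1,
      forall p, t1 + Hz <= tau ni.1 ni.2 -> c p = 0 &
      {ae P, forall w, (ni.2 < sp_size (Hn ni.1))%N -> tau ni.1 ni.2 < t1 + Hz ->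
          sp_coef (Hn ni.1) ni.2 w = c (psi w)}] by move=> [n i]; exact: claim.
apply: (slice_solution_ae Pc BM mcl mmu msigma t0 solX tt1 t12 Hz0 t2H yc yi ym yX ya wf cH cM
  (c := fun n i => c (n, i)) (Cb := Cb)).
- by move=> n i; have [] := hc (n, i).
- by move=> n i; have [] := hc (n, i).
- by move=> n i p; have [_ _ + _] := hc (n, i); exact.
- apply: ae_foralln => n; apply: ae_foralln => i; by have [] := hc (n, i).
Qed.
End slices.

(** * The Markov property and homogeneity in time *)

Section markov.
Context d (Omega : measurableType d) (R : realType) (P : probability Omega R).
Variable B : R -> Omega -> R.
Hypothesis Pc : measure_is_complete P.
Hypothesis BM : brownian_motion P B.
Local Notation OF s := (g_sigma_algebraType (filtration_gen P B 0 s)).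
Local Notation PE s := (g_sigma_algebraType (path_gen s)).

Lemma mean_is_posneg (f : Omega -> R) m : mean_is P f m -> exists a c,
  [/\ mean_is P (fun w => Num.max (f w) 0) a, mean_is P (fun w => Num.max (- f w) 0) c & m = a - c].
Proof.
move=> hf; have mf : measurable_fun [set: Omega] f by apply/measurable_EFinP; have [/integrableP[]] := hf.
have [w||a ha] := @mean_is_le_norm _ _ _ P f (fun w => Num.max (f w) 0) m _ _ hf.
- by apply: measurable_maxr.
- move=> w; rewrite ger0_norm; last by rewrite le_max lexx orbT.
  by rewrite ge_max ler_norm normr_ge0.
have [||c hc] := @mean_is_le_norm _ _ _ P f (fun w => Num.max (- f w) 0) m _ _ hf.
- by apply: measurable_maxr => //; exact: measurableT_comp.
- move=> w; rewrite ger0_norm; last by rewrite le_max lexx orbT.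
  by rewrite ge_max normr_ge0 -normrN ler_norm.
exists a, c; split => //; apply: (mean_is_uniq hf).
have -> : a - c = a + -1 * c by ring.
have := mean_is_add ha (mean_is_scale (-1) hc); congr (mean_is P _ _); apply/funext => w.
by rewrite mulN1r /Num.max; case: ifP; case: ifP; lra.
Qed.

Lemma complete_ae_measurable d' (E : measurableType d') (f h : Omega -> E) :
  measurable_fun [set: Omega] f -> {ae P, forall w, h w = f w} -> measurable_fun [set: Omega] h.
Proof.
move=> mf fh _ D mD; rewrite setTI.
have [] // := @ae_eq_measure _ _ _ P Pc (h @^-1` D) (f @^-1` D).
  by rewrite -[X in measurable X]setTI; exact: mf.
by apply: filterS fh => w e; rewrite /preimage /= e.
Qed.

Lemma mean_is_ae (f h : Omega -> R) m : {ae P, forall w, h w = f w} -> mean_is P f m -> mean_is P h m.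
Proof.
move=> fh [fi fm]; have /integrableP[mf ff] := fi.
have mh : measurable_fun [set: Omega] (EFin \o h).
  by apply: (complete_ae_measurable mf); apply: filterS fh => w /= ->.
have e : (\int[P]_w (h w)%:E = \int[P]_w (f w)%:E)%E.
  by apply: ae_eq_integral => //; apply: filterS fh => w -> _.
split; last by rewrite e.
apply/integrableP; split => //; apply: le_lt_trans ff; rewrite le_eqVlt; apply/orP; left; apply/eqP.
apply: ae_eq_integral => //; [exact: measurableT_comp|exact: measurableT_comp|].
by apply: filterS fh => w /= -> _.
Qed.

Lemma mean_is_fine (f : Omega -> \bar R) m : measurable_fun [set: Omega] f -> (forall w, (0 <= f w)%E) ->
  (\int[P]_w f w = m%:E)%E -> {ae P, forall w, f w \is a fin_num} /\ mean_is P (fun w => fine (f w)) m.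
Proof.
move=> mf f0 fm.
have fi : P.-integrable setT f.
  by apply/integrableP; split => //; under eq_integral do rewrite gee0_abs//; rewrite fm ltry.
have fn : {ae P, forall w, f w \is a fin_num}.
  by have := integrable_ae measurableT fi; apply: filterS => w; exact.
split => //.
have mff : measurable_fun [set: Omega] (EFin \o (fun w => fine (f w))).
  by apply/measurable_EFinP; apply: (measurableT_comp (@fine_measurable R setT measurableT)).
have e : ae_eq P setT (EFin \o (fun w => fine (f w))) f.
  by apply: filterS fn => w fw _ /=; rewrite fineK.
split; last by rewrite -fm; exact: ae_eq_integral.
apply/integrableP; split => //.
under eq_integral do rewrite /= ger0_norm ?fine_ge0//.
by rewrite (ae_eq_integral f)// fm ltry.
Qed.

Variables (T : R) (I : set R) (mu sigma g r b : R -> R) (X : R -> R -> Omega -> R) (v : R -> R).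
Hypothesis mcl : measurable (closure I).
Hypothesis mmu : measurable_fun (closure I) mu.
Hypothesis msigma : measurable_fun (closure I) sigma.
Hypothesis g_cont : continuous g.
Hypothesis r_cont : continuous r.
Hypothesis b_cont : {within `[0, T], continuous b}.
Variables (t x : R) (Y : R -> Omega -> R) (t1 t2 : R).
Hypothesis t0 : 0 <= t.
Hypothesis Ix : I x.
Hypothesis solY : strong_solution P B I mu sigma T t x Y.
Hypothesis tt1 : t <= t1.
Hypothesis t12 : t1 <= t2.
Hypothesis t2T : t2 <= T.
Hypothesis X_sol : forall x : R, I x -> unique_strong_solution P B I mu sigma T t2 x (X x).
Hypothesis v_mean : forall x, I x -> mean_is P (payoff g r (X x) t2 (tau_star b (X x) T t2)) (v x).

(** The path of [Y] after [t1], retimed to start at [t2] and stopped by the boundary rule. The case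
    [t1 = t2] is the Markov property; [t1 < t2] adds homogeneity in time. *)
Definition hit_payoff w := payoff g r (fun u w => Y (u - t2 + t1) w) t2 (tau_star b (fun u w => Y (u - t2 + t1) w) T t2) w.

(** For a frozen past the slice solves the equation started from [Y t1 w] at time [t2], so by
    uniqueness it is the given solution and its mean payoff is [v (Y t1 w)]. Positive and negative
    parts are treated separately because [path_law] is for nonnegative functions. The weight must
    vanish where [Y t1] is outside [I], since solutions are given only for starting points in
    [I]. *)
Lemma markov (W : Omega -> R) m : measurable_fun [set: OF t1] W -> (forall w, 0 <= W w) -> (forall w, W w != 0 -> I (Y t1 w)) ->
  mean_is P (fun w => W w * hit_payoff w) m -> mean_is P (fun w => W w * v (Y t1 w)) m.
Proof.
move=> mW W0 WI [Hi Hm].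
have tt1' := tt1; have t12' := t12; have t0' := t0; have t2T' := t2T.
have t10 : 0 <= t1 by lra.
have t20 : 0 <= t2 by lra.
pose Hz := T - t2.
have Hz0 : 0 <= Hz by rewrite /Hz; lra.
have t2H : t2 + Hz = T by rewrite /Hz; lra.
have [y [yc yi ym yY ys]] := slice_family Pc BM mcl mmu msigma t0 Ix solY tt1 t12 Hz0 t2H.
pose Pr := (OF t1 * PE Hz)%type.
pose Z (u : R) (p : Omega * (R -> R)) := y (u - t2) p.
have cZ p : {within `[t2, T], continuous (Z ^~ p)}.
  have := within_continuous_shift t2H (yc p); exact.
have uH u : t2 <= u <= T -> 0 <= u - t2 <= Hz by rewrite /Hz => /andP[? ?]; lra.
have mZ u : t2 <= u <= T -> measurable_fun [set: Pr] (Z u) by move=> /uH; exact: ym.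
have cb : {within `[t2, T], continuous b}.
  by apply: continuous_subspaceW b_cont => u /=; rewrite !in_itv/= => /andP[? ?]; lra.
pose tau := tau_star (Omega := Pr) b Z T t2.
have mtau : measurable_fun [set: Pr] tau by exact: tau_star_measurable.
have tauT p : 0 <= tau p <= T - t2 by exact: tau_star_bounds.
pose Psi := payoff (Omega := Pr) g r Z t2 tau.
have mPsi : measurable_fun [set: Pr] Psi by apply: (@payoff_measurable _ Pr _ Z g r t2 T t2T cZ mZ tau tauT mtau g_cont r_cont).
pose Hp (p : Pr) : \bar R := (W p.1 * Num.max (Psi p) 0)%:E.
pose Hm' (p : Pr) : \bar R := (W p.1 * Num.max (- Psi p) 0)%:E.
have mW1 : measurable_fun [set: Pr] (fun p : Pr => W p.1) by exact: (measurableT_comp mW measurable_fst).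
have mHp : measurable_fun [set: Pr] Hp.
  by apply/measurable_EFinP; apply: measurable_funM => //; apply: measurable_maxr.
have mHm : measurable_fun [set: Pr] Hm'.
  apply/measurable_EFinP; apply: measurable_funM => //; apply: measurable_maxr => //.
  exact: measurableT_comp.
have Hp0 p : (0 <= Hp p)%E by rewrite lee_fin mulr_ge0// le_max lexx orbT.
have Hm0 p : (0 <= Hm' p)%E by rewrite lee_fin mulr_ge0// le_max lexx orbT.
have ePsi : {ae P, forall w, hit_payoff w = Psi (w, shift B t1 w)}.
  apply: filterS yY => w h.
  have e s : t2 <= s <= T -> Y (s - t2 + t1) w = Z s (w, shift B t1 w).
    by move=> /uH sH; rewrite addrC h.
  have et := @tau_star_ext _ Omega _ Pr _ b t2 T (fun u w => Y (u - t2 + t1) w) Z w (w, shift B t1 w) e.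
  have bt : 0 <= tau_star b (fun u w => Y (u - t2 + t1) w) T t2 w <= T - t2 by rewrite et; exact: tauT.
  exact: (@payoff_ext _ Omega _ Pr _ g r t2 T (fun u w => Y (u - t2 + t1) w) Z
    (tau_star b (fun u w => Y (u - t2 + t1) w) T t2) tau w (w, shift B t1 w) e et bt).
pose Jp (w : Omega) : \bar R := (\int[P]_w' Hp ((w : OF t1), (shift B t2 w' : PE Hz)))%E.
pose Jm (w : Omega) : \bar R := (\int[P]_w' Hm' ((w : OF t1), (shift B t2 w' : PE Hz)))%E.
have lawp := path_law Pc BM t10 t20 Hz0 mHp Hp0.
have lawm := path_law Pc BM t10 t20 Hz0 mHm Hm0.
have mJp : measurable_fun [set: Omega] Jp.
  by apply: (adapted_measurable Pc BM (s := t1)); exact: measurable_slice_integral.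
have mJm : measurable_fun [set: Omega] Jm.
  by apply: (adapted_measurable Pc BM (s := t1)); exact: measurable_slice_integral.
have Jp0 w : (0 <= Jp w)%E by apply: integral_ge0.
have Jm0 w : (0 <= Jm w)%E by apply: integral_ge0.
pose h w := W w * Psi (w, shift B t1 w).
have hm : mean_is P h m.
  by apply: mean_is_ae (conj Hi Hm); apply: filterS ePsi => w ->.
have maxM (a c : R) : 0 <= a -> Num.max (a * c) 0 = a * Num.max c 0.
  by move=> a0; rewrite maxr_pMr// mulr0.
have [mp [mm [hp hn em]]] := mean_is_posneg hm.
have [Jpf Jpm] : {ae P, forall w, Jp w \is a fin_num} /\ mean_is P (fun w => fine (Jp w)) mp.
  apply: (mean_is_fine mJp Jp0); rewrite -lawp; have [_ <-] := hp.
  by apply: eq_integral => w _; rewrite /Hp /h /= maxM.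
have [Jmf Jmm] : {ae P, forall w, Jm w \is a fin_num} /\ mean_is P (fun w => fine (Jm w)) mm.
  apply: (mean_is_fine mJm Jm0); rewrite -lawm; have [_ <-] := hn.
  by apply: eq_integral => w _; rewrite /Hm' /h /= -(mulrN (W w)) maxM.
rewrite em (_ : mp - mm = mp + -1 * mm); last by ring.
apply: mean_is_ae (mean_is_add Jpm (mean_is_scale (-1) Jmm)).
apply: filterS ys => w ysw.
have [W0'|Wn0] := eqVneq (W w) 0.
  rewrite /Jp /Jm /Hp /Hm' /= W0'; under eq_integral do rewrite mul0r.
  rewrite integral0; under eq_integral do rewrite mul0r.
  by rewrite integral0/= mul0r; ring.
have Iw := WI w Wn0; have [_ uniq] := X_sol Iw.
have hPsi : mean_is P (fun w' => Psi (w, shift B t2 w')) (v (Y t1 w)).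
  apply: mean_is_ae (v_mean Iw); apply: filterS (uniq _ ysw) => w' e.
  have e' s : t2 <= s <= T -> Z s (w, shift B t2 w') = X (Y t1 w) s w' by move=> sT; rewrite e.
  have et := @tau_star_ext _ Pr _ Omega _ b t2 T Z (X (Y t1 w)) (w, shift B t2 w') w' e'.
  exact: (@payoff_ext _ Pr _ Omega _ g r t2 T Z (X (Y t1 w)) tau (tau_star b (X (Y t1 w)) T t2) (w, shift B t2 w') w' e' et (tauT _)).
have [a [c [ha hc ->]]] := mean_is_posneg hPsi.
have -> : Jp w = (W w * a)%:E by have [_ <-] := mean_is_scale (W w) ha.
have -> : Jm w = (W w * c)%:E by have [_ <-] := mean_is_scale (W w) hc.
by rewrite /=; ring.
Qed.
End markov.

(** * Restarting hitting times and payoffs at a later time *)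

Section paths.
Context d (Om : measurableType d) (R : realType).
Local Notation lam := (@lebesgue_measure R).
Variables (Y : R -> Om -> R) (b g r : R -> R) (t T : R).
Hypothesis tT : t <= T.
Hypothesis cY : forall w, {within `[t, T], continuous (Y ^~ w)}.
Hypothesis cb : {within `[t, T], continuous b}.
Hypothesis cr : continuous r.

Lemma tau_star_gt w s : 0 <= s -> s < tau_star b Y T t w -> b (t + s) < Y (t + s) w.
Proof.
move=> s0 st; rewrite ltNge; apply/negP => le.
have /andP[_ tD] := tau_star_bounds Y b tT w.
have sT : s < T - t by exact: lt_le_trans tD.
have : tau_star b Y T t w <= s.
  apply/(tau_star_le tT cY cb w s0 sT); exists (t + s); first by rewrite lerDl s0 lexx.
  by rewrite subr_le0.
by rewrite leNgt st.
Qed.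

Lemma tau_star_ge w : b t <= Y t w -> b (t + tau_star b Y T t w) <= Y (t + tau_star b Y T t w) w.
Proof.
move=> bY; set tau := tau_star b Y T t w.
have /andP[t0 tD] := tau_star_bounds Y b tT w; rewrite -/tau in t0 tD.
move: t0; rewrite le_eqVlt => /predU1P[<-|t0]; first by rewrite addr0.
rewrite leNgt; apply/negP => lt.
have cYb : {within `[t, T], continuous (fun u => Y u w - b u)}.
  by move=> u; apply: cvgB; [exact: cY|exact: cb].
have tI : `[t, T]%classic (t + tau) by rewrite /= in_itv/=; apply/andP; split; lra.
have e0 : 0 < b (t + tau) - Y (t + tau) w by rewrite subr_gt0.
have [e e0' he] := within_continuous_dist cYb tI e0.
pose s := tau - Num.min (tau / 2) (e / 2).
have s0 : 0 <= s by rewrite /s; minmax_lra.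
have st : s < tau by rewrite /s; minmax_lra.
have sI : `[t, T]%classic (t + s) by rewrite /= in_itv/=; apply/andP; split; lra.
have ds : `|t + tau - (t + s)| < e.
  rewrite (_ : t + tau - (t + s) = Num.min (tau / 2) (e / 2)); last by rewrite /s; ring.
  by rewrite ger0_norm; minmax_lra.
have := he _ sI ds; have := tau_star_gt s0 st; rewrite ltr_norml => h /andP[]; lra.
Qed.

Lemma tau_star_shift w t1 : t <= t1 -> t1 <= T -> (forall u, t <= u -> u < t1 -> b u < Y u w) ->
  tau_star b Y T t w = (t1 - t) + tau_star b Y T t1 w.
Proof.
move=> tt1 t1T h.
have lb (t' : R) : t' <= T -> has_lbound ([set s | 0 <= s < T - t' /\ Y (t' + s) w <= b (t' + s)] `|` [set T - t']).
  by move=> ?; exists 0 => s [[/andP[? _] _]//|->]; rewrite subr_ge0.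
apply/eqP; rewrite eq_le; apply/andP; split.
  rewrite -lerBlDl; apply: lb_le_inf; first by exists (T - t1); right.
  move=> s [[/andP[s0 sT] le]|->].
    rewrite lerBlDl; apply: ge_inf; first exact: lb.
    left; split; first by apply/andP; split; lra.
    by rewrite (_ : t + (t1 - t + s) = t1 + s)//; ring.
  by rewrite (_ : T - t1 = (T - t) - (t1 - t)); [rewrite lerD2r; apply: ge_inf; [exact: lb|right]|ring].
apply: lb_le_inf; first by exists (T - t); right.
move=> s [[/andP[s0 sT] le]|->]; last first.
  rewrite -lerBrDl (_ : T - t - (t1 - t) = T - t1); last by ring.
  by apply: ge_inf; [exact: lb|right].
have st : t1 <= t + s.
  by rewrite leNgt; apply/negP => lt; have := h (t + s) (ltac:(lra)) lt; lra.
rewrite -lerBrDl; apply: ge_inf; first exact: lb.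
left; split; first by apply/andP; split; lra.
by rewrite (_ : t1 + (s - (t1 - t)) = t + s)//; ring.
Qed.

Definition discount t1 w := expR (- \int[lam]_(s in `[0, (t1 - t)%R]) r (Y (t + s) w)).

Let shifted_continuous w : {within `[0, T - t], continuous (fun s => r (Y (t + s) w))}.
Proof.
apply: within_continuous_intro => u e; rewrite /= in_itv/= => /andP[u0 uT] e0.
have uI : `[t, T]%classic (t + u) by rewrite /= in_itv/=; apply/andP; split; lra.
have crY : {within `[t, T], continuous (fun u => r (Y u w))}.
  by move=> z; apply: (@cvg_comp _ _ _ _ r _ _ _ (@cY w z)); exact: cr.
have [q q0 hq] := within_continuous_dist crY uI e0; exists q => // z; rewrite /= in_itv/= => /andP[z0 zT] uz.
apply: hq; first by rewrite /= in_itv/=; apply/andP; split; lra.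
by rewrite (_ : t + u - (t + z) = u - z)//; ring.
Qed.

Lemma payoff_shift (tau : Om -> R) w t1 : t <= t1 -> t1 <= T -> 0 <= tau w <= T - t1 ->
  payoff g r Y t (fun w => (t1 - t) + tau w) w = discount t1 w * payoff g r Y t1 tau w.
Proof.
move=> tt1 t1T /andP[u0 uT]; rewrite /payoff /discount [RHS]mulrA.
have -> : t + (t1 - t + tau w) = t1 + tau w by rewrite addrA subrKC.
congr (_ * _); rewrite -expRD; congr expR.
have ci : lam.-integrable `[0, T - t] (EFin \o (fun s => r (Y (t + s) w))).
  by apply: continuous_compact_integrable => //; exact: segment_compact.
have ci' : lam.-integrable `[0, t1 - t + tau w] (EFin \o (fun s => r (Y (t + s) w))).
  by apply: integrable_sub ci => //; lra.
have d0 : 0 <= t1 - t by lra.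
have d1 : t1 - t <= t1 - t + tau w by lra.
rewrite (Rintegral_split d0 d1 ci') opprD; congr (_ - _).
have mf : measurable_fun `[t1 - t, t1 - t + tau w] (fun s => r (Y (t + s) w)).
  have mf0 : measurable_fun `[0, t1 - t + tau w] (fun s => r (Y (t + s) w)).
    by apply/measurable_EFinP; have /integrableP[] := ci'.
  by apply: measurable_funS mf0 => // u /=; rewrite !in_itv/= => /andP[? ->]; rewrite andbT; lra.
have := @Rintegral_shift R 0 (tau w) (t1 - t) (fun s => r (Y (t + s) w)).
rewrite (_ : 0 + (t1 - t) = t1 - t); last by ring.
rewrite (_ : tau w + (t1 - t) = t1 - t + tau w); last by ring.
move=> /(_ mf) ->.
apply: eq_Rintegral => s _; congr (r (Y _ w)); ring.
Qed.
End paths.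

(** * Monotonicity of the value in time *)

Section value_function.
Context d (Omega : measurableType d) (R : realType) (P : probability Omega R).
Variable B : R -> Omega -> R.
Hypothesis Pc : measure_is_complete P.
Hypothesis BM : brownian_motion P B.
Local Notation OF s := (g_sigma_algebraType (filtration_gen P B 0 s)).
Local Notation lam := (@lebesgue_measure R).
Variables (T : R) (I : set R) (mu sigma g r b : R -> R) (X : R -> R -> R -> Omega -> R) (v : R -> R -> R).
Hypothesis mcl : measurable (closure I).
Hypothesis mmu : measurable_fun (closure I) mu.
Hypothesis msigma : measurable_fun (closure I) sigma.
Hypothesis g_cont : continuous g.
Hypothesis r_cont : continuous r.
Hypothesis r_ge0 : forall x, 0 <= r x.
Hypothesis X_sol : forall t x : R, 0 <= t <= T -> I x -> unique_strong_solution P B I mu sigma T t x (X t x).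
Hypothesis payoff_integrable : forall (t x : R) (tau : Omega -> R), 0 <= t <= T -> I x ->
       stopping_time P (X t x) T t tau ->
       P.-integrable [set: Omega] (EFin \o payoff g r (X t x) t tau).
Hypothesis v_value : forall t x : R, 0 <= t <= T -> I x -> (v t x)%:E = value P g r T t (X t x).
Hypothesis b_cont : {within `[0, T], continuous b}.
Hypothesis tau_star_optimal : forall t x : R, 0 <= t <= T -> I x ->
       optimal P g r T t (X t x) (tau_star b (X t x) T t).

Lemma v_mean t x : 0 <= t <= T -> I x ->
  mean_is P (payoff g r (X t x) t (tau_star b (X t x) T t)) (v t x).
Proof.
move=> tT Ix; have [st op] := tau_star_optimal tT Ix.
split; first exact: payoff_integrable.
by rewrite v_value// -op unlock.
Qed.

Lemma payoff_mean_le t x tau m : 0 <= t <= T -> I x -> stopping_time P (X t x) T t tau ->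
  mean_is P (payoff g r (X t x) t tau) m -> m <= v t x.
Proof.
move=> tT Ix st [_ hm]; rewrite -lee_fin v_value// -hm.
apply: ereal_sup_ubound; exists tau => //; by rewrite unlock.
Qed.

Lemma filtration_measurable_self (Y : R -> Omega -> R) t s u : t <= u <= s ->
  measurable_fun [set: g_sigma_algebraType (filtration_gen P Y t s)] (Y u).
Proof. by move=> us; apply/measurable_wrtP; exact: filtration_coord. Qed.

Let b_sub t : 0 <= t -> {within `[t, T], continuous b}.
Proof.
by move=> t0; apply: continuous_subspaceW b_cont => u /=; rewrite !in_itv/= => /andP[? ->]; rewrite andbT; lra.
Qed.

(** The rule that is optimal from [t + s], retimed to start at [t], is admissible because more time
    remains; by [markov] its mean payoff is exactly [v (t + s) x]. *)
Lemma value_nonincreasing t s x : 0 <= t -> 0 <= s -> t + s <= T -> I x -> v (t + s) x <= v t x.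
Proof.
move=> t0 s0 tsT Ix.
have tT : 0 <= t <= T by apply/andP; split; lra.
have tsT' : 0 <= t + s <= T by apply/andP; split; lra.
have [solY _] := X_sol tT Ix; set Y := X t x in solY *.
have [Y_cont _ _ Y_x _] := solY.
pose Z := fun u w => Y (u - (t + s) + t) w.
pose tau := tau_star b Z T (t + s).
have cZ w : {within `[t + s, T], continuous (Z ^~ w)}.
  apply: within_continuous_intro => u e; rewrite /= in_itv/= => /andP[u0 uT] e0.
  have uI : `[t, T]%classic (u - (t + s) + t) by rewrite /= in_itv/=; apply/andP; split; lra.
  have [q q0 hq] := within_continuous_dist (Y_cont w) uI e0; exists q => // z; rewrite /= in_itv/= => /andP[z0 zT] uz.
  apply: hq; first by rewrite /= in_itv/=; apply/andP; split; lra.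
  by rewrite (_ : u - (t + s) + t - (z - (t + s) + t) = u - z)//; ring.
have tsT2 : t + s <= T by lra.
have cb : {within `[t + s, T], continuous b} by apply: b_sub; lra.
have tauB w : 0 <= tau w <= T - (t + s) by exact: tau_star_bounds.
have st : stopping_time P Y T t tau.
  split=> [w|u /andP[u0 uT]]; first by have /andP[? ?] := tauB w; apply/andP; split; lra.
  have [uS|Su] := leP u (T - (t + s)); last first.
    rewrite (_ : [set w | _] = setT); first exact: (@measurableT _ (g_sigma_algebraType (filtration_gen P Y t (t + u)))).
    by apply/seteqP; split => // w _ /=; have /andP[? ?] := tauB w; lra.
  have uS' : 0 <= u <= T - (t + s) by rewrite u0.
  apply: (@tau_star_set_measurable _ (g_sigma_algebraType (filtration_gen P Y t (t + u))) R Z b (t + s) T tsT2 cZ cb u uS') => z /andP[z0 zu].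
  by apply: filtration_measurable_self; apply/andP; split; lra.
have hm := mean_isP (payoff_integrable tT Ix st).
apply: le_trans (payoff_mean_le tT Ix st hm); rewrite le_eqVlt; apply/orP; left; apply/eqP.
(* The path starts at [x] only almost surely, whereas [markov] requires a start in [I] wherever the
   weight is nonzero. *)
pose W : Omega -> R := \1_(Y t @^-1` [set x]).
have W1 : {ae P, forall w, W w = 1}.
  by apply: filterS Y_x => w Yw; rewrite /W indicE mem_set.
have mW : measurable_fun [set: OF t] W.
  apply: measurable_indic; rewrite -[X in measurable X]setTI.
  have mY : measurable_fun [set: OF t] (Y t) by apply: (sol_adapted solY) => //; lra.
  by apply: mY => //; exact: measurable_set1.
have hmk : mean_is P (fun w => W w * v (t + s) (Y t w)) (fine (\int[P]_w (payoff g r (X t x) t tau w)%:E)).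
  apply: (markov Pc BM mcl mmu msigma g_cont r_cont b_cont t0 Ix solY (lexx t) _ tsT2 (X := X (t + s))) => //.
  - by rewrite lerDl.
  - by move=> y Iy; exact: X_sol.
  - by move=> y Iy; exact: v_mean.
  - by move=> w; rewrite /W; have [[/= -> _]|[_ ->]] := @indicEb _ _ R (Y t @^-1` [set x]) w => //; rewrite eqxx.
  apply: mean_is_ae hm => //; apply: filterS W1 => w ->; rewrite mul1r.
  rewrite /hit_payoff /payoff -/tau /Z; congr (expR (- _) * g (Y _ w)); last by rewrite /tau /Z; ring.
  by apply: eq_Rintegral => z _; congr (r (Y _ w)); ring.
apply: (mean_is_uniq (mean_is_cst P (v (t + s) x))).
apply: (mean_is_ae Pc _ hmk); apply: filterS2 W1 Y_x => w -> ->; by rewrite mul1r.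
Qed.
End value_function.

(** * The two halves of dynamic programming over a short time *)

Section dynamic_programming.
Context d (Omega : measurableType d) (R : realType) (P : probability Omega R).
Variable B : R -> Omega -> R.
Hypothesis Pc : measure_is_complete P.
Hypothesis BM : brownian_motion P B.
Local Notation OF s := (g_sigma_algebraType (filtration_gen P B 0 s)).
Local Notation lam := (@lebesgue_measure R).
Variables (T : R) (I : set R) (mu sigma g r b : R -> R) (X : R -> R -> R -> Omega -> R) (v : R -> R -> R).
Hypothesis mcl : measurable (closure I).
Hypothesis mmu : measurable_fun (closure I) mu.
Hypothesis msigma : measurable_fun (closure I) sigma.
Hypothesis g_cont : continuous g.
Hypothesis r_cont : continuous r.
Hypothesis r_ge0 : forall x, 0 <= r x.
Hypothesis X_sol : forall t x : R, 0 <= t <= T -> I x -> unique_strong_solution P B I mu sigma T t x (X t x).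
Hypothesis payoff_integrable : forall (t x : R) (tau : Omega -> R), 0 <= t <= T -> I x ->
       stopping_time P (X t x) T t tau ->
       P.-integrable [set: Omega] (EFin \o payoff g r (X t x) t tau).
Hypothesis v_value : forall t x : R, 0 <= t <= T -> I x -> (v t x)%:E = value P g r T t (X t x).
Hypothesis b_cont : {within `[0, T], continuous b}.
Hypothesis tau_star_optimal : forall t x : R, 0 <= t <= T -> I x ->
       optimal P g r T t (X t x) (tau_star b (X t x) T t).
Variables (t x : R).
Hypothesis t0 : 0 <= t.
Hypothesis tT : t <= T.
Hypothesis Ix : I x.
Local Notation Y := (X t x).

Let tT' : 0 <= t <= T. Proof. by rewrite t0. Qed.
Let solY : strong_solution P B I mu sigma T t x Y. Proof. by have [] := X_sol tT' Ix. Qed.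
Let Y_cont w : {within `[t, T], continuous (Y ^~ w)}. Proof. by have [] := solY. Qed.
Let Y_x : {ae P, forall w, Y t w = x}. Proof. by have [] := solY. Qed.
Let b_sub u : 0 <= u -> {within `[u, T], continuous b}.
Proof.
by move=> u0; apply: continuous_subspaceW b_cont => z /=; rewrite !in_itv/= => /andP[? ->]; rewrite andbT; lra.
Qed.
Let Y_sub t1 w : t <= t1 -> {within `[t1, T], continuous (Y ^~ w)}.
Proof.
by move=> h; apply: continuous_subspaceW (@Y_cont w) => z /=; rewrite !in_itv/= => /andP[? ->]; rewrite andbT; lra.
Qed.
Lemma discount_bounds t1 w : 0 <= discount Y r t t1 w <= 1.
Proof.
rewrite /discount expR_ge0 /= -expR0 ler_expR oppr_le0.
by apply: Rintegral_ge0 => u _; exact: r_ge0.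
Qed.

Lemma discount_adapted t1 : t <= t1 <= T -> measurable_fun [set: OF t1] (discount Y r t t1).
Proof.
move=> /andP[tt1 t1T].
apply: (measurableT_comp (@measurable_expR R)); apply: measurableT_comp => //.
apply: (@discount_measurable _ (OF t1) _ Y r t t1 tt1 _ _ (fun=> t1 - t) _ _ r_cont).
- move=> w; apply: continuous_subspaceW (@Y_cont w) => z /=; rewrite !in_itv/= => /andP[-> h].
  exact: le_trans t1T.
- by move=> u /andP[tu ut]; apply: (sol_adapted solY).
- by move=> w; rewrite lexx andbT subr_ge0.
- exact: measurable_cst.
Qed.

(** Conditional form: on an event known at [t1] on which the payoff factors through the boundary
    rule from [t1], the payoff may be replaced by the discounted value. *)
Lemma restart t1 (G : set Omega) (p : Omega -> R) k : t <= t1 <= T ->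
  measurable (G : set (OF t1)) -> (forall w, G w -> I (Y t1 w)) ->
  (forall w, G w -> p w = discount Y r t t1 w * payoff g r Y t1 (tau_star b Y T t1) w) ->
  mean_is P (fun w => \1_G w * p w) k ->
  mean_is P (fun w => \1_G w * (discount Y r t t1 w * v t1 (Y t1 w))) k.
Proof.
move=> /andP[tt1 t1T] mG GI Gp hk; have t10 : 0 <= t1 by exact: le_trans tt1.
have t1T' : 0 <= t1 <= T by rewrite t10.
have mW : measurable_fun [set: OF t1] (fun w => \1_G w * discount Y r t t1 w : R).
  apply: measurable_funM; first exact: measurable_indic.
  by apply: discount_adapted; rewrite tt1.
under eq_fun do rewrite mulrA.
apply: (markov Pc BM mcl mmu msigma g_cont r_cont b_cont t0 Ix solY tt1 (lexx t1) t1T (X := X t1) (v := v t1) (g := g) (r := r) (b := b)) => //.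
- by move=> y Iy; exact: X_sol.
- by move=> y Iy; apply: (v_mean payoff_integrable v_value tau_star_optimal).
- by move=> w; rewrite mulr_ge0//; have /andP[] := discount_bounds t1 w.
- move=> w; have [[Gw ->] _|[_ ->]] := @indicEb _ _ R G w; first exact: GI.
  by rewrite mul0r eqxx.
have hitE w : hit_payoff T g r b Y t1 t1 w = payoff g r Y t1 (tau_star b Y T t1) w.
  rewrite /hit_payoff (_ : (fun u w => Y (u - t1 + t1) w) = Y)//.
  by apply/funext => u; apply/funext => w'; rewrite subrK.
rewrite (_ : (fun w => _) = fun w => \1_G w * p w)//; apply/funext => w; rewrite hitE.
have [[Gw ->]|[_ ->]] := @indicEb _ _ R G w; last by rewrite !mul0r.
by rewrite !mul1r Gp.
Qed.

Lemma indic_setC (A : set Omega) w : \1_(~` A) w = 1 - \1_A w :> R.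
Proof.
have [[h ->]|[h ->]] := @indicEb _ _ R A w; rewrite indicE.
  by rewrite memNset ?subrr//; apply.
by rewrite mem_set// subr0.
Qed.

Lemma mean_is_indicC (f : Omega -> R) m k l (A : set Omega) : mean_is P f m ->
  mean_is P (fun w => \1_A w * f w) k -> mean_is P (fun w => \1_(~` A) w * f w) l -> m = k + l.
Proof.
move=> hf h1 h2; apply: (mean_is_uniq hf).
have := mean_is_add h1 h2; congr (mean_is P _ _); apply/funext => w.
by rewrite indic_setC; ring.
Qed.

Variables (D rho C : R).
Hypothesis D0 : 0 < D.
Hypothesis tD : t + D < T.
Hypothesis rho0 : 0 < rho.
Hypothesis C0 : 0 <= C.
Hypothesis ballI : forall y, `|y - x| <= rho -> I y.

Let tDT : t <= t + D <= T. Proof. by move: D0 tD => ? ?; apply/andP; split; lra. Qed.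

(** Tests the rule that stops on leaving the ball of radius [rho] before [t + D] and otherwise
    follows the boundary rule from [t + D]. The smaller radius [rho1] guarantees that paths counted
    by [stay] have not triggered the exit. All other paths cost at most [2 * C], since payoff and
    value are bounded on the ball. *)
Lemma value_ge_stay rho1 : 0 < rho1 < rho ->
  (forall y, `|y - x| <= rho -> `|g y| <= C /\ `|v (t + D) y| <= C) ->
  exists2 m, mean_is P (fun w => \1_(stay t x Y rho1 (t + D)) w * (discount Y r t (t + D) w * v (t + D) (Y (t + D) w))) m &
    m <= v t x + 2 * C * fine (P (~` stay t x Y rho1 (t + D))).
Proof.
move=> /andP[rho10 rho1r] bd.
have [tsD sDT] := andP tDT; have D0' := D0; have tD' := tD; have t0' := t0.
pose Z (u : R) (w : Omega) := rho - `|Y u w - x|.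
have cZ w : {within `[t, T], continuous (Z ^~ w)}.
  by move=> u; apply: cvgB; [exact: cvg_cst|apply: cvg_norm; apply: cvgB; [exact: Y_cont|exact: cvg_cst]].
have c0 : {within `[t, T], continuous (fun=> 0 : R)} by move=> u; exact: cvg_cst.
(* The exit time is itself an instance of [tau_star], for the process [rho - |Y - x|] and the
   boundary 0, so the facts on hitting times apply. *)
pose th := tau_star (fun=> 0) Z T t.
have thB w : 0 <= th w <= T - t by exact: tau_star_bounds.
have DT : D < T - t by lra_only tD'.
pose S := [set w | D < th w].
have thD w : th w <= D <-> exists2 u, t <= u <= t + D & Z u w - 0 <= 0.
  by apply: (tau_star_le tT cZ c0) => //; exact: ltW.
have stayS w : stay t x Y rho1 (t + D) w -> S w.
  move=> h; rewrite /S /= ltNge; apply/negP => /thD[u uD]; rewrite /Z.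
  by have := h u uD; lra_only rho1r.
pose t2 := tau_star b Y T (t + D).
have t2B w : 0 <= t2 w <= T - (t + D) by exact: tau_star_bounds.
have cYD w : {within `[t + D, T], continuous (Y ^~ w)} by exact: Y_sub.
have cbD : {within `[t + D, T], continuous b} by apply: b_sub; lra_only tsD t0'.
pose tau w := if th w <= D then th w else D + t2 w.
have st : stopping_time P Y T t tau.
  split=> [w|s /andP[s0 sT]].
    rewrite /tau; have /andP[q0 q1] := t2B w; case: ifP => // _; apply/andP; split; [lra_only q0 D0'|lra_only q1].
  pose FY := g_sigma_algebraType (filtration_gen P Y t (t + s)).
  have mY u : t <= u <= t + s -> measurable_fun [set: FY] (Y u) by exact: filtration_measurable_self.
  have mthle e : 0 <= e -> e <= s -> measurable ([set w | th w <= e] : set FY).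
    move=> e0 es; apply: (@tau_star_set_measurable _ FY R Z _ t T tT cZ c0 e).
      by rewrite e0 (le_trans es).
    move=> u /andP[tu ue]; apply: measurable_funB => //; apply: measurableT_comp => //.
    apply: measurable_funB => //; apply: mY; apply/andP; split => //; lra_only ue es.
  have [sD|Ds] := ltP s D.
    rewrite (_ : [set w | _] = [set w | th w <= s]); first exact: mthle.
    apply/seteqP; split => w /=; rewrite /tau; have /andP[q0 _] := t2B w.
      by case: ifP => // _ le; lra_only q0 sD le.
    by move=> h; rewrite ifT//; lra_only h sD.
  rewrite (_ : [set w | _] = [set w | th w <= D] `|` (~` [set w | th w <= D] `&` [set w | t2 w <= s - D])).
    apply: (@measurableU _ FY); first by apply: mthle => //; exact: ltW.
    apply: (@measurableI _ FY); first by apply: measurableC; apply: mthle => //; exact: ltW.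
    have sD' : 0 <= s - D <= T - (t + D) by apply/andP; split; [lra_only Ds|lra_only sT].
    apply: (@tau_star_set_measurable _ FY R Y b (t + D) T sDT cYD cbD (s - D) sD') => u /andP[u0 u1].
    by apply: mY; apply/andP; split; [lra_only u0 tsD|lra_only u1].
  apply/seteqP; split => w /=; rewrite /tau.
    case: ifP => h; first by left.
    by move=> le; right; split => //; lra_only le.
  move=> [h|[/negP h le]]; first by rewrite h (le_trans h).
  by rewrite (negbTE h); lra_only le.
have hp := mean_isP (payoff_integrable tT' Ix st).
set k := fine _ in hp; set p := payoff g r Y t tau in hp.
have kv : k <= v t x by exact: (payoff_mean_le v_value tT' Ix st hp).
have mSD : measurable (S : set (OF (t + D))).
  rewrite (_ : S = ~` [set w | th w <= D]); last by apply/seteqP; split => w; rewrite /S /= ltNge => /negP.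
  apply: (@measurableC _ (OF (t + D))); apply: (@tau_star_set_measurable _ (OF (t + D)) R Z _ t T tT cZ c0 D).
    by apply/andP; split; [lra_only D0'|lra_only tD'].
  move=> u /andP[tu ue]; apply: measurable_funB => //; apply: measurableT_comp => //.
  by apply: measurable_funB => //; apply: (sol_adapted solY).
have mS : measurable S.
  exact: (filtration_measurable Pc BM mSD).
have [k1 hk1] := mean_is_indicM hp mS.
have [k2 hk2] := mean_is_indicM hp (measurableC mS).
have kE : k = k1 + k2 := mean_is_indicC hp hk1 hk2.
have SI w : S w -> `|Y (t + D) w - x| <= rho.
  by move=> Sw; have := tau_star_gt tT cZ c0 (ltW D0) Sw; rewrite /Z => h; lra_only h.
have hv := restart (t1 := t + D) (G := S) (p := p) (k := k1) tDT mSD (fun w h => ballI (SI w h)).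
have {}hv := hv _ hk1.
have pS w : S w -> p w = discount Y r t (t + D) w * payoff g r Y (t + D) (tau_star b Y T (t + D)) w.
  move=> Sw; rewrite -(payoff_shift g Y_cont r_cont tsD sDT (t2B w)).
  rewrite /p /payoff (_ : tau w = t + D - t + t2 w)//.
  by rewrite /tau ifN ?(addrC t) ?addrK// -ltNge.
have {}hv := hv pS.
have mst : measurable (stay t x Y rho1 (t + D)) by exact: (stay_measurable Pc BM solY).
have [m hm] := mean_is_indicM hv mst.
have iE w : \1_(stay t x Y rho1 (t + D)) w * (\1_S w * (discount Y r t (t + D) w * v (t + D) (Y (t + D) w))) =
  \1_(stay t x Y rho1 (t + D)) w * (discount Y r t (t + D) w * v (t + D) (Y (t + D) w)).
  have [[h ->]|[_ ->]] := @indicEb _ _ R (stay t x Y rho1 (t + D)) w; last by rewrite !mul0r.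
  by rewrite !mul1r indicE mem_set ?mul1r//; exact: stayS.
exists m; first by move: hm; under eq_fun do rewrite iE.
have dv w : S w -> `|discount Y r t (t + D) w * v (t + D) (Y (t + D) w)| <= C.
  move=> Sw; have /andP[d0 d1] := discount_bounds (t + D) w; rewrite normrM (ger0_norm d0) -[leRHS]mul1r.
  by apply: ler_pM => //; have [_] := bd _ (SI w Sw).
have pw1 w : \1_(stay t x Y rho1 (t + D)) w * (\1_S w * (discount Y r t (t + D) w * v (t + D) (Y (t + D) w))) <=
   \1_S w * (discount Y r t (t + D) w * v (t + D) (Y (t + D) w)) + C * \1_(~` stay t x Y rho1 (t + D)) w.
  rewrite indic_setC; have [[h ->]|[nh ->]] := @indicEb _ _ R (stay t x Y rho1 (t + D)) w.
    by rewrite mul1r subrr mulr0 addr0.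
  rewrite mul0r subr0 mulr1; have [[Sw ->]|[_ ->]] := @indicEb _ _ R S w; last by rewrite mul0r add0r.
  by have := dv w Sw; rewrite mul1r ler_norml => /andP[h1 h2]; lra_only h1.
have m1 := mean_is_le pw1 hm (mean_is_add hv (mean_is_scale C (mean_is_indic P (measurableC mst)))).
have hk2' : mean_is P (fun w => if `[< Y t w = x >] then \1_(~` S) w * p w else 0) k2.
  by apply: (mean_is_ae Pc _ hk2); apply: filterS Y_x => w h; rewrite asboolT.
(* The bound on the payoff at the exit uses the starting point, so the payoff was replaced by 0 on
   the null set where the path does not start at [x]. *)
have pw2 w : - C * \1_(~` stay t x Y rho1 (t + D)) w <= if `[< Y t w = x >] then \1_(~` S) w * p w else 0.
  have i0 : 0 <= \1_(~` stay t x Y rho1 (t + D)) w :> R by rewrite indicE.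
  have neg : - C * \1_(~` stay t x Y rho1 (t + D)) w <= 0 by rewrite mulNr oppr_le0 mulr_ge0.
  case: asboolP => // Yt; have [[nS ->]|[_ ->]] := @indicEb _ _ R (~` S) w; last by rewrite mul0r.
  rewrite indicE mem_set; last by move=> /stayS.
  rewrite mulr1 mul1r /p /payoff.
  have thle : th w <= D by rewrite leNgt; apply/negP.
  have -> : tau w = th w by rewrite /tau thle.
  have Yth : `|Y (t + th w) w - x| <= rho.
    have := @tau_star_ge _ _ R Z (fun=> 0) t T tT cZ c0 w; rewrite -/th /Z Yt subrr normr0 subr0.
    by move=> /(_ (ltW rho0)) h; lra_only h.
  have [gC _] := bd _ Yth; have := expR_ge0 (- \int[lam]_(s in `[0, th w]) r (Y (t + s) w)).
  have : expR (- \int[lam]_(s in `[0, th w]) r (Y (t + s) w)) <= 1.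
    rewrite -[X in _ <= X]expR0 ler_expR oppr_le0.
    by apply: Rintegral_ge0 => u _; exact: r_ge0.
  move: gC; rewrite ler_norml; move: (expR _) (g _) => e gy /andP[h1 h2] e1 e0.
  have e1' : 0 <= (1 - e) * C by rewrite mulr_ge0// subr_ge0.
  have e0' : 0 <= e * (gy + C) by rewrite mulr_ge0//; lra_only h1.
  by move: e1' e0' => h3 h4; lra_only h3 h4.
have m2 := mean_is_le pw2 (mean_is_scale (- C) (mean_is_indic P (measurableC mst))) hk2'.
by move: (fine _) m1 m2 kE kv => q m1 m2 kE kv; lra_only m1 m2 kE kv.
Qed.

(** The payoff is only integrable, so its mean over an exit event is not directly controlled by the
    probability of that event. It is restarted at the first mesh time far from [x], where the path
    is still in the ball, has not met the boundary, and the value is bounded by [C]. The oscillation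
    events contribute nothing in the limit, by integrability of the payoff. *)
Lemma value_le_stay pf :
  (forall u y, t <= u <= t + D -> `|y - x| <= rho -> b u < y /\ `|v u y| <= C) ->
  (forall n, fine (P (far t x Y rho D n)) <= pf) ->
  exists2 m, mean_is P (fun w => \1_(stay t x Y rho (t + D)) w * (discount Y r t (t + D) w * v (t + D) (Y (t + D) w))) m &
    v t x <= m + 2 * C * pf.
Proof.
move=> bd fp.
have [tsD sDT] := andP tDT; have D0' := D0; have tD' := tD; have t0' := t0.
have hp := v_mean payoff_integrable v_value tau_star_optimal tT' Ix.
set p := payoff g r Y t (tau_star b Y T t) in hp.
have itv t1 : t <= t1 <= t + D -> t <= t1 <= T by move=> /andP[? ?]; apply/andP; split; lra.
have step t1 (G : set Omega) k : t <= t1 <= t + D -> measurable (G : set (OF t1)) ->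
    (forall w, G w -> stay t x Y rho t1 w) -> mean_is P (fun w => \1_G w * p w) k ->
    mean_is P (fun w => \1_G w * (discount Y r t t1 w * v t1 (Y t1 w))) k.
  move=> t1D mG Gs hk; have [tt1 t1D'] := andP t1D; have t1T : t1 <= T by lra.
  apply: (restart (p := p)) => //; first exact: itv.
    by move=> w /Gs h; apply: ballI; apply: h; rewrite tt1 lexx.
  move=> w /Gs h.
  have t2B := tau_star_bounds Y b t1T w.
  rewrite -(payoff_shift g Y_cont r_cont tt1 t1T t2B) /p /payoff.
  rewrite (tau_star_shift tT tt1 t1T)// => u tu ut.
  have uD : t <= u <= t + D by apply/andP; split; lra.
  by have [] := bd u (Y u w) uD (h u (ltac:(by rewrite tu ltW))).
have dv t1 w : t <= t1 <= t + D -> `|Y t1 w - x| <= rho -> `|discount Y r t t1 w * v t1 (Y t1 w)| <= C.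
  move=> t1D Yt; have /andP[d0 d1] := discount_bounds t1 w; rewrite normrM (ger0_norm d0) -[leRHS]mul1r.
  by apply: ler_pM => //; have [_] := bd _ _ t1D Yt.
set S := stay t x Y rho (t + D).
have mSD : measurable (S : set (OF (t + D))) by exact: (stay_adapted solY).
have mS : measurable S by exact: (filtration_measurable Pc BM mSD).
have [m0 hm0] := mean_is_indicM hp mS.
have hm := step (t + D) S m0 (ltac:(by rewrite tsD lexx)) mSD (fun w h => h) hm0.
exists m0 => //.
apply/ler_addgt0Pr => e e0.
have mosc n : measurable (osc t Y rho D n) by exact: (osc_measurable Pc BM solY).
have [N hN] := integral_vanishing hp.1 mosc (osc_vanish solY rho0 D0 sDT) e0.
have [q hq qe] := hN N (leqnn N); set O := osc t Y rho D N in hq.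
pose F := far t x Y rho D N.
have mF : measurable F by exact: (far_measurable Pc BM solY).
have [kF hkF] := mean_is_indicM hp mF.
have gr j : (j < N.+1)%N -> t <= grid t D N.+1 j <= t + D by move=> jN; apply: grid_itv => //; exact: ltnW.
have mj j : (j < N.+1)%N -> measurable (first_far t x Y rho D N j : set (OF (grid t D N.+1 j))).
  by move=> jN; apply: (first_far_adapted solY) => //; exact: ltnW.
have mj' j : (j < N.+1)%N -> measurable (first_far t x Y rho D N j).
  by move=> jN; exact: (filtration_measurable Pc BM (mj j jN)).
have kFC : kF <= C * fine (P F).
  have /choice[k hk] : forall j : nat, exists k, (j < N.+1)%N ->
     mean_is P (fun w => \1_(first_far t x Y rho D N j) w * p w) k.
    move=> j; have [jN|] := boolP (j < N.+1)%N; last by exists 0.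
    by have [k hk] := mean_is_indicM hp (mj' j jN); exists k.
  have FE w : \1_F w = \sum_(j < N.+1) \1_(first_far t x Y rho D N j) w :> R.
    have [[[j jN Fj] ->]|[nF ->]] := @indicEb _ _ R F w; last first.
      rewrite big1// => j _; rewrite indicE memNset// => Fj; apply: nF; exists j => //=; exact: ltn_ord.
    rewrite (bigD1 (Ordinal jN))//= indicE mem_set// big1 ?addr0// => i /negP ij.
    rewrite indicE memNset// => Fi; apply: ij; apply/eqP/val_inj; exact: (first_far_disjoint Fi Fj).
  have -> : kF = \sum_(j < N.+1) k j.
    apply: (mean_is_uniq hkF); have := mean_is_sum hk; congr (mean_is P _ _); apply/funext => w.
    by rewrite FE mulr_suml.
  have -> : fine (P F) = \sum_(j < N.+1) fine (P (first_far t x Y rho D N j)).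
    apply: (mean_is_uniq (mean_is_indic P mF)).
    have := @mean_is_sum _ _ _ P N.+1 (fun j => \1_(first_far t x Y rho D N j)) _ (fun j jN => mean_is_indic P (mj' j jN)).
    by congr (mean_is P _ _); apply/funext => w; rewrite FE.
  rewrite mulr_sumr; apply: ler_sum => j _; have jN := ltn_ord j.
  have hj := step _ _ _ (gr j jN) (mj j jN) (fun w h => h.1) (hk j jN).
  apply: (mean_is_le _ hj (mean_is_scale C (mean_is_indic P (mj' j jN)))) => w.
  have [[Fw ->]|[_ ->]] := @indicEb _ _ R (first_far t x Y rho D N j) w; last by rewrite mul0r mulr0.
  rewrite mul1r mulr1; apply: le_trans (ler_norm _) _; apply: dv; first exact: gr.
  by apply: Fw.1; have /andP[-> _] := gr j jN; rewrite lexx.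
have mFD : measurable (F : set (OF (t + D))).
  apply: (@bigcup_measurable _ (OF (t + D))) => j jN.
  by apply: (filtration_le _ (mj j jN)); have /andP[] := gr j jN.
(* A path may be far at a mesh time and still stay in the ball. Such paths are charged to [F], at
   the cost of a second term [C * fine (P F)]; this is the factor 2 in the statement. *)
have mSF : measurable (S `\` F) by exact: measurableD.
have mSFD : measurable (S `\` F : set (OF (t + D))) by exact: (@measurableD _ (OF (t + D))).
have [kS hkS] := mean_is_indicM hp mSF.
have hmS := step (t + D) (S `\` F) kS (ltac:(by rewrite tsD lexx)) mSFD (fun w h => h.1) hkS.
have kSm : kS <= m0 + C * fine (P F).
  apply: (mean_is_le _ hmS (mean_is_add hm (mean_is_scale C (mean_is_indic P mF)))) => w.
  have [[Fw ->]|[nF ->]] := @indicEb _ _ R F w.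
    rewrite [X in X * _ <= _]indicE memNset; last by move=> [].
    rewrite mul0r mulr1; have [[Sw ->]|[_ ->]] := @indicEb _ _ R S w; last by rewrite mul0r add0r.
    have tDD : t <= t + D <= t + D by rewrite tsD lexx.
    have := dv (t + D) w tDD (Sw (t + D) tDD).
    by rewrite mul1r ler_norml => /andP[]; lra.
  rewrite mulr0 addr0 (_ : \1_(S `\` F) w = \1_S w)//.
  have [[Sw ->]|[nS ->]] := @indicEb _ _ R S w; first by rewrite indicE mem_set.
  by rewrite indicE memNset// => -[].
have hp' : mean_is P (fun w => if `[< Y t w = x >] then p w else \1_F w * p w + (\1_(S `\` F) w * p w + `|p w| * \1_O w)) (v t x).
  by apply: (mean_is_ae Pc _ hp); apply: filterS Y_x => w h; rewrite asboolT.
have pw w : (if `[< Y t w = x >] then p w else \1_F w * p w + (\1_(S `\` F) w * p w + `|p w| * \1_O w)) <=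
   \1_F w * p w + (\1_(S `\` F) w * p w + `|p w| * \1_O w).
  case: asboolP => // Yt.
  have [[Fw ->]|[nF ->]] := @indicEb _ _ R F w.
    rewrite [\1_(S `\` F) w]indicE memNset; last by move=> [].
    by rewrite mul1r mul0r add0r lerDl mulr_ge0// indicE.
  have [Sw|nS] := pselect (S w).
    rewrite [\1_(S `\` F) w]indicE mem_set//.
    by rewrite mul1r mul0r add0r lerDl mulr_ge0// indicE.
  rewrite [\1_(S `\` F) w]indicE memNset; last by move=> [].
  have -> : \1_O w = 1 :> R.
    by have [Ow|[/nF//|/=]] := far_cover rho0 N nS; [rewrite indicE mem_set|rewrite Yt eqxx].
  by rewrite !mul0r !add0r mulr1 ler_norm.
have vle := mean_is_le pw hp' (mean_is_add hkF (mean_is_add hkS hq)).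
have FC : C * fine (P F) <= C * pf by rewrite ler_wpM2l//; exact: fp.
by move: (fine (P F)) kFC kSm FC => z kFC kSm FC; lra.
Qed.
End dynamic_programming.

Lemma expR_neg_bounds (R : realType) (z : R) : 0 <= z -> `|expR (- z) - (1 - z)| <= z ^+ 2.
Proof.
move=> z0; have e1 := expR_ge1Dx (- z); have e2 := expR_ge1Dx z.
have ez : expR (- z) * expR z = 1 by rewrite -expRD addNr expR0.
have e0 := expR_ge0 (- z).
have h : expR (- z) * (1 + z) <= 1 by rewrite -[leRHS]ez ler_wpM2l.
rewrite ler_norml; apply/andP; split; first by have := sqr_ge0 z; lra.
have h2 : expR (- z) * (1 + z) <= (1 - z + z ^+ 2) * (1 + z).
  apply: le_trans h _; rewrite (_ : (1 - z + z ^+ 2) * (1 + z) = 1 + z ^+ 3); last by ring.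
  by rewrite lerDl exprn_ge0.
have h3 : expR (- z) <= 1 - z + z ^+ 2 by rewrite -(ler_pM2r (_ : 0 < 1 + z))//; lra.
lra.
Qed.

(** * Algebra of the second-order expansion *)

Section taylor.
Variables (R : realFieldType) (w0 m a p rx eps D : R).
Hypotheses (rx0 : 0 <= rx).

Lemma taylor_pointwise (y dd ww : R) : 0 <= eps -> eps <= 1 -> 0 < D ->
  w0 + m * y + a / 2 * y ^+ 2 + (p - eps) * D <= ww -> `|ww - w0| <= eps ->
  `|dd - (1 - rx * D)| <= eps * D ->
  w0 + (p - rx * w0 - eps * (`|w0| + rx + 3)) * D + (m * y + a / 2 * y ^+ 2) <= dd * ww.
Proof.
move=> eps0 eps1 D0 f3 f4 f5; have rx0' := rx0.
have e5 : (dd - 1) * ww = - (rx * w0) * D + ((dd - (1 - rx * D)) * w0 + (dd - 1) * (ww - w0)) by ring.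
have g1 : `|(dd - (1 - rx * D)) * w0| <= eps * D * `|w0| by rewrite normrM ler_wpM2r.
have rD0 : 0 <= rx * D by rewrite mulr_ge0// ltW.
have eD : 0 <= eps * D by rewrite mulr_ge0// ltW.
have eD1 : eps * D <= D by rewrite -[leRHS]mul1r ler_wpM2r// ltW.
have dd1 : `|dd - 1| <= (rx + 1) * D.
  by move: f5; rewrite !ler_norml mulrDl mul1r => /andP[? ?]; apply/andP; split; lra.
have g2 : `|(dd - 1) * (ww - w0)| <= (rx + 1) * D * eps by rewrite normrM ler_pM.
have -> : dd * ww = ww + (dd - 1) * ww by ring.
rewrite e5; move: g1 g2; rewrite !ler_norml => /andP[g1 _] /andP[g2 _].
move: (`|w0|) ((dd - (1 - rx * D)) * w0) ((dd - 1) * (ww - w0)) g1 g2 => n u1 u2 g1 g2.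
have -> : (p - rx * w0 - eps * (n + rx + 3)) * D =
  (p - eps) * D - rx * w0 * D - (eps * D * n + (rx + 1) * D * eps) - eps * D by ring.
by clear -f3 g1 g2 eD; lra.
Qed.

(** Division by [D] of the averaged expansion. The factor of [eps] in the conclusion depends neither
    on [eps] nor on [D], so [eps] can be sent to 0 afterwards. *)
Lemma taylor_mean (mux s2 q e1 e2 : R) : 0 < eps -> eps <= 1 -> 0 < D -> D <= 1 ->
  0 <= q -> q <= eps * D -> `|e1 - mux * D| <= eps * D -> `|e2 - s2 * D| <= eps * D ->
  (w0 + (p - rx * w0 - eps * (`|w0| + rx + 3)) * D) * (1 - q) + (m * e1 + a / 2 * e2) <= w0 + eps * D ->
  p + mux * m + 2^-1 * s2 * a - rx * w0 <=
  eps * (1 + (`|w0| + rx + 3) + (`|w0| + `|p - rx * w0| + (`|w0| + rx + 3)) + `|m| + `|a|).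
Proof.
move=> eps0 eps1 D0 n0 q1 pS b1 b2; have rx0' := rx0.
have w00 := normr_ge0 w0; have m0 := normr_ge0 m; have a0 := normr_ge0 a.
set L := `|w0| + rx + 3; set c0 := w0 + _; set M := `|w0| + `|p - rx * w0| + L => main.
have L0 : 0 <= L by rewrite /L !addr_ge0.
have cM : `|c0| <= M.
  rewrite /c0; apply: le_trans (ler_normD _ _) _; have -> : M = `|w0| + (`|p - rx * w0| + L) by rewrite /M; ring.
  rewrite lerD2l normrM (ger0_norm (ltW D0)).
  have h : `|p - rx * w0 - eps * L| <= `|p - rx * w0| + L.
    apply: le_trans (ler_normB _ _) _; rewrite lerD2l ger0_norm; last by rewrite mulr_ge0// ltW.
    by rewrite -[leRHS]mul1r ler_wpM2r.
  by apply: le_trans h; rewrite -[leRHS]mulr1 ler_wpM2l.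
have c0q : c0 * q <= M * (eps * D).
  by apply: le_trans (ler_norm _) _; rewrite normrM (ger0_norm q1) ler_pM.
have mE : m * (mux * D) - `|m| * (eps * D) <= m * e1.
  have : `|m * (e1 - mux * D)| <= `|m| * (eps * D) by rewrite normrM ler_wpM2l.
  rewrite ler_norml mulrBr => /andP[h _]; lra.
have aE : a / 2 * (s2 * D) - `|a| * (eps * D) <= a / 2 * e2.
  have : `|a / 2 * (e2 - s2 * D)| <= `|a| * (eps * D).
    rewrite normrM; apply: ler_pM => //; rewrite normrM -[leRHS]mulr1 ler_wpM2l//.
    by rewrite ger0_norm; [rewrite invf_le1// ler1n|rewrite invr_ge0].
  rewrite ler_norml mulrBr => /andP[h _]; lra.
rewrite -(ler_pM2r D0).
have -> : eps * (1 + L + M + `|m| + `|a|) * D = eps * D + eps * L * D + M * (eps * D) + `|m| * (eps * D) + `|a| * (eps * D) by ring.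
have -> : (p + mux * m + 2^-1 * s2 * a - rx * w0) * D =
   (p - rx * w0) * D + m * (mux * D) + a / 2 * (s2 * D) by ring.
have c0E : c0 = w0 + (p - rx * w0) * D - eps * L * D by rewrite /c0; ring.
have mainE : c0 * (1 - q) = c0 - c0 * q by ring.
rewrite mainE c0E in main; rewrite c0E in c0q.
by move: main c0q; move: ((w0 + _ - _) * q) => u main c0q; lra.
Qed.
End taylor.

(** * From dynamic programming to the generator *)

Section generator.
Context d (Omega : measurableType d) (R : realType) (P : probability Omega R).
Variable B : R -> Omega -> R.
Hypothesis Pc : measure_is_complete P.
Hypothesis BM : brownian_motion P B.
Local Notation lam := (@lebesgue_measure R).
Variables (T : R) (I : set R) (mu sigma r : R -> R).
Hypothesis mcl : measurable (closure I).
Hypothesis mmu : measurable_fun (closure I) mu.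
Hypothesis msigma : measurable_fun (closure I) sigma.
Hypothesis r_cont : continuous r.
Hypothesis r_ge0 : forall x, 0 <= r x.
Variables (t x : R) (Y : R -> Omega -> R).
Hypothesis t0 : 0 <= t.
Hypothesis tT : t < T.
Hypothesis solY : strong_solution P B I mu sigma T t x Y.

Lemma discount_near eps : 0 < eps -> exists2 rho0, 0 < rho0 & exists2 D0, 0 < D0 &
  forall rho D w, rho <= rho0 -> 0 < D <= D0 -> t + D <= T -> stay t x Y rho (t + D) w ->
  `|discount Y r t (t + D) w - (1 - r x * D)| <= eps * D.
Proof.
move=> eps0; have [q q0 hq] : exists2 q, 0 < q & forall y, `|y - x| < q -> `|r y - r x| < eps / 2.
  have /cvgrPdist_lt/(_ _ (divr_gt0 eps0 (ltr0n _ 2))) := @r_cont x.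
  move=> /nbhs_ballP[q q0 hq]; exists q => // y yx; rewrite distrC; apply: hq.
  by rewrite /ball/= distrC.
pose K := r x + eps / 2.
have K0 : 0 < K by rewrite ltr_wpDl// divr_gt0.
exists (q / 2); first by rewrite divr_gt0.
exists (eps / (2 * K ^+ 2)); first by rewrite divr_gt0// mulr_gt0// exprn_gt0.
move=> rho D w rq /andP[D0 Dle] tDT st.
have [Y_cont _ _ _ _] := solY.
have cf : {within `[0, D], continuous (fun s => r (Y (t + s) w))}.
  apply: within_continuous_intro => u e; rewrite /= in_itv/= => /andP[u0 uT] e0.
  have uI : `[t, T]%classic (t + u) by rewrite /= in_itv/=; apply/andP; split; [lra_only u0|lra_only uT tDT].
  have crY : {within `[t, T], continuous (fun u => r (Y u w))}.
    by move=> z; apply: (@cvg_comp _ _ _ _ r _ _ _ (@Y_cont w z)); exact: r_cont.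
  have [l l0 hl] := within_continuous_dist crY uI e0; exists l => // z; rewrite /= in_itv/= => /andP[z0 zT] uz.
  apply: hl; first by rewrite /= in_itv/=; apply/andP; split; [lra_only z0|lra_only zT tDT].
  by rewrite (_ : t + u - (t + z) = u - z)//; ring.
have mf : measurable_fun `[0, D] (fun s => r (Y (t + s) w)).
  by apply: subspace_continuous_measurable_fun => //; exact: measurable_itv.
have near_ u : 0 <= u <= D -> `|r (Y (t + u) w) - r x| <= eps / 2.
  move=> /andP[u0 uD]; apply: ltW; apply: hq; apply: (@le_lt_trans _ _ rho); last by lra_only q0 rq.
  by apply: st; apply/andP; split; [lra_only u0|lra_only uD].
have := Rintegral_near (ltW D0) mf near_; rewrite subr0.
rewrite /discount (_ : t + D - t = D); last by ring.
set z := \int[lam]_(s in `[0, D]) _ => zD.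
have z0 : 0 <= z by apply: Rintegral_ge0 => u _; exact: r_ge0.
have zK : z <= K * D by move: zD; rewrite ler_norml => /andP[_ h]; rewrite /K; lra_only h.
have z2 : z ^+ 2 <= eps / 2 * D.
  apply: (@le_trans _ _ ((K * D) ^+ 2)); first by rewrite lerXn2r ?nnegrE// mulr_ge0// ltW.
  have : D * (2 * K ^+ 2) <= eps by rewrite -ler_pdivlMr// mulr_gt0// exprn_gt0.
  by move=> /(ler_wpM2r (ltW D0)) h; rewrite exprMn expr2 [D ^+ 2]expr2; lra_only h.
have := expR_neg_bounds z0; move: zD z2; rewrite !ler_norml; move: (expR _) => ee.
by move=> /andP[h1 h2] h3 /andP[h4 h5]; apply/andP; split; lra_only h1 h2 h3 h4 h5.
Qed.

Hypothesis mu_cont : {for x, continuous mu}.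
Hypothesis sigma_cont : {for x, continuous sigma}.
Variables (w : R -> R -> R) (w0 m a p : R).
Hypothesis dynamic : forall eps, 0 < eps -> exists2 rho0, 0 < rho0 & forall rho, 0 < rho <= rho0 ->
  exists2 D0, 0 < D0 & forall D, 0 < D <= D0 ->
  exists2 k, mean_is P (fun om => \1_(stay t x Y rho (t + D)) om * (discount Y r t (t + D) om * w D (Y (t + D) om))) k &
   k <= w0 + eps * D.
Hypothesis minorant : forall eps, 0 < eps -> exists2 rho0, 0 < rho0 & exists2 D0, 0 < D0 &
  forall D y, 0 < D <= D0 -> `|y - x| <= rho0 ->
  w0 + m * (y - x) + a / 2 * (y - x) ^+ 2 + (p - eps) * D <= w D y.
Hypothesis w_near : forall eps, 0 < eps -> exists2 rho0, 0 < rho0 & exists2 D0, 0 < D0 &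
  forall D y, 0 < D <= D0 -> `|y - x| <= rho0 -> `|w D y - w0| <= eps.

(** [w D y] stands for the value at time [t + D], or for its negative, so that one argument gives
    both viscosity inequalities. The moments of [local_moments] are inserted in the quadratic
    minorant, and [dynamic] bounds the result from above. *)
Lemma generator_bound : p + mu x * m + 2^-1 * sigma x ^+ 2 * a - r x * w0 <= 0.
Proof.
apply/ler_addgt0Pr => e e0; rewrite add0r.
have rx0 := r_ge0 x; have w00 := normr_ge0 w0; have m0 := normr_ge0 m; have a0 := normr_ge0 a.
pose L := `|w0| + r x + 3.
pose M := `|w0| + `|p - r x * w0| + L.
pose N := 1 + L + M + `|m| + `|a|.
have q0 := normr_ge0 (p - r x * w0).
have L0 : 0 < L by rewrite /L; lra.
have M0 : 0 < M by rewrite /M; lra.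
have N0 : 0 < N by rewrite /N; lra.
pose eps := Num.min 1 (e / N).
have eps0 : 0 < eps by rewrite lt_min ltr01 divr_gt0.
have eps1 : eps <= 1 by rewrite ge_min lexx.
have epsN : eps * N <= e by rewrite -ler_pdivlMr// ge_min lexx orbT.
have [r1 r10 h1] := local_moments Pc BM mcl mmu msigma t0 tT solY mu_cont sigma_cont eps0.
have [r2 r20 h2] := dynamic eps0.
have [r3 r30 [D3 D30 h3]] := minorant eps0.
have [r4 r40 [D4 D40 h4]] := w_near eps0.
have [r5 r50 [D5 D50 h5]] := discount_near eps0.
pose rho := Num.min r1 (Num.min r2 (Num.min r3 (Num.min r4 r5))).
have rho0 : 0 < rho by rewrite !lt_min r10 r20 r30 r40 r50.
have [l1 l2 l3 l4 l5] : [/\ rho <= r1, rho <= r2, rho <= r3, rho <= r4 & rho <= r5].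
  by rewrite /rho !ge_min !lexx !orbT.
have [D1 D10 k1] := h1 rho (ltac:(by rewrite rho0)).
have [D2 D20 k2] := h2 rho (ltac:(by rewrite rho0)).
pose D := Num.min 1 (Num.min D1 (Num.min D2 (Num.min D3 (Num.min D4 D5)))).
have D0 : 0 < D by rewrite !lt_min ltr01 D10 D20 D30 D40 D50.
have [n1 n2 n3 n4 n5] : [/\ D <= D1, D <= D2, D <= D3, D <= D4 & D <= D5].
  by rewrite /D !ge_min !lexx !orbT.
have n0 : D <= 1 by rewrite /D ge_min lexx.
have [tDT [pS _ [e1 he1 b1] [e2 he2 b2]]] := k1 D (ltac:(by rewrite D0)).
have [k hk kw] := k2 D (ltac:(by rewrite D0)).
have tDT' : t <= t + D <= T by rewrite tDT lerDl ltW.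
have mS : measurable (stay t x Y rho (t + D)) by exact: (stay_measurable Pc BM solY).
pose c0 := w0 + (p - r x * w0 - eps * L) * D.
have pw om : c0 * \1_(stay t x Y rho (t + D)) om + (m * ((Y (t + D) om - x) * \1_(stay t x Y rho (t + D)) om) +
   a / 2 * ((Y (t + D) om - x) ^+ 2 * \1_(stay t x Y rho (t + D)) om)) <=
   \1_(stay t x Y rho (t + D)) om * (discount Y r t (t + D) om * w D (Y (t + D) om)).
  have [[st ->]|[_ ->]] := @indicEb _ _ R (stay t x Y rho (t + D)) om; last by rewrite !mulr0 mul0r !addr0.
  rewrite !mulr1 mul1r.
  have yx : `|Y (t + D) om - x| <= rho by apply: st; rewrite lexx; case/andP: tDT' => ->.
  have f3 := h3 D _ (ltac:(by rewrite D0)) (le_trans yx l3).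
  have f4 := h4 D _ (ltac:(by rewrite D0)) (le_trans yx l4).
  have f5 := h5 rho D om l5 (ltac:(by rewrite D0)) tDT st.
  move: f3 f4 f5; set y := Y (t + D) om - x; set dd := discount _ _ _ _ _; set ww := w D _ => f3 f4 f5.
  rewrite /c0 /L; exact: (taylor_pointwise (r_ge0 x) (ltW eps0) eps1 D0 f3 f4 f5).
have mS1 : mean_is P \1_(stay t x Y rho (t + D)) (1 - fine (P (~` stay t x Y rho (t + D)))).
  have := mean_is_add (mean_is_cst P 1) (mean_is_scale (-1) (mean_is_indic P (measurableC mS))).
  rewrite mulN1r; congr (mean_is P _ _); apply/funext => om.
  by rewrite indic_setC; ring.
have main := mean_is_le pw (mean_is_add (mean_is_scale c0 mS1) (mean_is_add (mean_is_scale m he1) (mean_is_scale (a / 2) he2))) hk.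
have q1 : 0 <= fine (P (~` stay t x Y rho (t + D))) by exact: fine_ge0.
apply: le_trans epsN; rewrite /N /M /L.
exact: (taylor_mean (r_ge0 x) eps0 eps1 D0 n0 q1 pS b1 b2 (le_trans main kw)).
Qed.
End generator.

(** * Viscosity inequalities for the value function *)

Section viscosity.
Context d (Omega : measurableType d) (R : realType) (P : probability Omega R).
Variable B : R -> Omega -> R.
Hypothesis Pc : measure_is_complete P.
Hypothesis BM : brownian_motion P B.
Variables (T : R) (I : set R) (mu sigma g r b : R -> R) (X : R -> R -> R -> Omega -> R) (v : R -> R -> R).
Hypothesis I_open : open I.
Hypothesis mcl : measurable (closure I).
Hypothesis mmu : measurable_fun (closure I) mu.
Hypothesis msigma : measurable_fun (closure I) sigma.
Hypothesis g_cont : continuous g.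
Hypothesis r_cont : continuous r.
Hypothesis r_ge0 : forall x, 0 <= r x.
Hypothesis X_sol : forall t x : R, 0 <= t <= T -> I x -> unique_strong_solution P B I mu sigma T t x (X t x).
Hypothesis payoff_integrable : forall (t x : R) (tau : Omega -> R), 0 <= t <= T -> I x ->
       stopping_time P (X t x) T t tau ->
       P.-integrable [set: Omega] (EFin \o payoff g r (X t x) t tau).
Hypothesis v_value : forall t x : R, 0 <= t <= T -> I x -> (v t x)%:E = value P g r T t (X t x).
Hypothesis v_cont : {within `[0, T] `*` I, continuous (fun p : R * R => v p.1 p.2)}.
Hypothesis b_cont : {within `[0, T], continuous b}.
Hypothesis tau_star_optimal : forall t x : R, 0 <= t <= T -> I x ->
       optimal P g r T t (X t x) (tau_star b (X t x) T t).
Variables (t x : R).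
Hypothesis t0 : 0 <= t.
Hypothesis tT : t < T.
Hypothesis Ix : I x.

Lemma value_near eps : 0 < eps -> exists2 q, 0 < q & forall u y, 0 <= u <= T -> `|u - t| < q -> `|y - x| < q ->
  [/\ I y, `|v u y - v t x| < eps & `|g y - g x| < eps].
Proof.
move=> eps0.
have [q1 q10 h1] : exists2 q, 0 < q & forall y, `|y - x| < q -> I y.
  have /nbhs_ballP[q q0 hq] := open_nbhs_nbhs (conj I_open Ix).
  by exists q => // y yx; apply: hq; rewrite /ball/= distrC.
have [q2 q20 h2] : exists2 q, 0 < q & forall y, `|y - x| < q -> `|g y - g x| < eps.
  have /cvgrPdist_lt/(_ _ eps0) := @g_cont x.
  move=> /nbhs_ballP[q q0 hq]; exists q => // y yx; rewrite distrC; apply: hq.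
  by rewrite /ball/= distrC.
have Atx : (`[0, T] `*` I) (t, x) by split => //=; rewrite in_itv/= t0 ltW.
have := v_cont; rewrite subspace_continuousP => /(_ (t, x) Atx) /cvgrPdist_lt /(_ _ eps0).
rewrite near_withinE => /nbhs_ballP[q3 q30 h3].
exists (Num.min q1 (Num.min q2 q3)); first by rewrite !lt_min q10 q20.
move=> u y uT; rewrite !lt_min => /andP[_ /andP[_ u3]] /andP[y1 /andP[y2 y3]].
split; [exact: h1| |exact: h2].
rewrite distrC; apply: (h3 (u, y)); last by split; [rewrite /= in_itv|exact: h1].
by split; rewrite /ball/= distrC.
Qed.

Hypothesis mu_cont : {for x, continuous mu}.
Hypothesis sigma_cont : {for x, continuous sigma}.
Variables (m a p : R).

Let solY : strong_solution P B I mu sigma T t x (X t x).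
Proof. by have [] := @X_sol t x (ltac:(by rewrite t0 ltW)) Ix. Qed.

Let bounded_near : exists2 q, 0 < q & [/\ t + q <= T, forall y, `|y - x| <= q -> I y,
   forall u y, t <= u <= t + q -> `|y - x| <= q -> `|v u y| <= `|v t x| + `|g x| + 1 &
   forall y, `|y - x| <= q -> `|g y| <= `|v t x| + `|g x| + 1].
Proof.
have [q q0 hq] := value_near ltr01.
have tT' := tT; have t0' := t0.
pose q' := Num.min (q / 2) ((T - t) / 2).
have q'q : q' <= q / 2 by rewrite ge_min lexx.
have q'T : q' <= (T - t) / 2 by rewrite ge_min lexx orbT.
have q'0 : 0 < q' by rewrite lt_min !divr_gt0// subr_gt0.
have tt : `|t - t| < q by rewrite subrr normr0.
have yq y : `|y - x| <= q' -> `|y - x| < q by lra.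
have tI : 0 <= t <= T by apply/andP; split; lra.
exists q' => //; split; first by lra.
- by move=> y /yq yx; have [] := hq t y tI tt yx.
- move=> u y /andP[tu uq] /yq yx.
  have uI : 0 <= u <= T by apply/andP; split; lra.
  have ut : `|u - t| < q by rewrite ger0_norm; lra.
  have [_ h _] := hq u y uI ut yx; rewrite -(subrK (v t x) (v u y)).
  by apply: le_trans (ler_normD _ _) _; have := normr_ge0 (g x); lra.
- move=> y /yq yx; have [_ _ h] := hq t y tI tt yx; rewrite -(subrK (g x) (g y)).
  by apply: le_trans (ler_normD _ _) _; have := normr_ge0 (v t x); lra.
Qed.

(** The hypothesis says that [(p, m, a)] is a parabolic subjet of [v] at [(t, x)], tested forward in
    time only. The one-sidedness in time is used when a maximum sits at the initial time of a
    cylinder. *)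
Lemma superharmonic :
  (forall eps, 0 < eps -> exists2 rho0, 0 < rho0 & exists2 D0, 0 < D0 &
    forall D y, 0 < D <= D0 -> `|y - x| <= rho0 ->
    v t x + m * (y - x) + a / 2 * (y - x) ^+ 2 + (p - eps) * D <= v (t + D) y) ->
  p + mu x * m + 2^-1 * sigma x ^+ 2 * a - r x * v t x <= 0.
Proof.
move=> minor; have tT' := tT; have t0' := t0.
have [q q0 [tq qI qv qg]] := bounded_near; set C := _ + 1 in qv qg.
have C0 : 0 <= C by rewrite /C !addr_ge0.
apply: (generator_bound Pc BM mcl mmu msigma r_cont r_ge0 t0 tT solY mu_cont sigma_cont
  (w := fun D y => v (t + D) y) (w0 := v t x)) => //.
(* With exits of probability at most [e1 * D], their cost [2 * C * e1 * D] stays below [eps * D]. *)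
- move=> eps eps0; have e1 : 0 < eps / (2 * C + 1) by rewrite divr_gt0//; lra.
  have [r1 r10 h1] := local_moments Pc BM mcl mmu msigma t0 tT solY mu_cont sigma_cont e1.
  exists (Num.min (q / 2) r1); first by rewrite lt_min r10 divr_gt0.
  move=> rho /andP[rho0]; rewrite le_min => /andP[rq rr].
  have [D1 D10 k1] := h1 rho (ltac:(by rewrite rho0)).
  exists (Num.min D1 (q / 2)); first by rewrite lt_min D10 divr_gt0.
  move=> D /andP[D0]; rewrite le_min => /andP[DD1 Dq].
  have [_ [pS _ _ _]] := k1 D (ltac:(by rewrite D0)).
  have tDT : t + D < T by lra_only Dq tq q0.
  have bd y : `|y - x| <= q -> `|g y| <= C /\ `|v (t + D) y| <= C.
    by move=> yx; split; [exact: qg|apply: qv => //; rewrite lerDl ltW//=; lra_only Dq q0].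
  have [k hk kle] := value_ge_stay Pc BM mcl mmu msigma g_cont r_cont r_ge0 X_sol payoff_integrable
    v_value b_cont tau_star_optimal t0 (ltW tT) Ix D0 tDT q0 C0 qI (rho1 := rho) (ltac:(rewrite rho0; lra)) bd.
  exists k => //; apply: le_trans kle _; rewrite lerD2l.
  apply: (@le_trans _ _ ((2 * C + 1) * fine (P (~` stay t x (X t x) rho (t + D))))).
    by rewrite ler_wpM2r ?fine_ge0// lerDl.
  apply: le_trans (ler_wpM2l _ pS) _; first by rewrite addr_ge0// mulr_ge0.
  by rewrite mulrA [_ * (eps / _)]mulrC divfK// gt_eqF// ltr_wpDl// mulr_ge0.
- move=> eps eps0; have [q1 q10 h1] := value_near eps0.
  exists (q1 / 2); first by rewrite divr_gt0.
  exists (Num.min (q1 / 2) (T - t)); first by rewrite lt_min divr_gt0// subr_gt0.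
  move=> D y /andP[D0]; rewrite le_min => /andP[Dq DT] yx; apply: ltW.
  have uI : 0 <= t + D <= T by apply/andP; split; [lra_only t0' D0|lra_only DT].
  have ut : `|t + D - t| < q1 by rewrite addrAC subrr add0r gtr0_norm//; lra_only Dq q10.
  by have [] := h1 (t + D) y uI ut (ltac:(lra)).
Qed.

(** [generator_bound] applied to [- v]. By continuity of [b], [b t < x] persists on a small ball and
    a short time, so that no stopping occurs there and [value_le_stay] applies. *)
Lemma subharmonic : b t < x ->
  (forall eps, 0 < eps -> exists2 rho0, 0 < rho0 & exists2 D0, 0 < D0 &
    forall D y, 0 < D <= D0 -> `|y - x| <= rho0 ->
    v (t + D) y <= v t x + m * (y - x) + a / 2 * (y - x) ^+ 2 + (p + eps) * D) ->
  0 <= p + mu x * m + 2^-1 * sigma x ^+ 2 * a - r x * v t x.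
Proof.
move=> bx major; have tT' := tT; have t0' := t0.
have [q q0 [tq qI qv qg]] := bounded_near; set C := _ + 1 in qv qg.
have C0 : 0 <= C by rewrite /C !addr_ge0.
have [q2 q20 hb] : exists2 q2, 0 < q2 & forall u, t <= u <= T -> `|u - t| < q2 -> b u < (b t + x) / 2.
  have tI : `[0, T]%classic t by rewrite /= in_itv/= t0 ltW.
  have [q2 q20 h2] := within_continuous_dist b_cont tI (ltac:(by rewrite divr_gt0// subr_gt0) : 0 < (x - b t) / 2).
  exists q2 => // u /andP[tu uT] ut.
  have uI : `[0, T]%classic u by rewrite /= in_itv/=; apply/andP; split; lra.
  by have := h2 u uI (ltac:(by rewrite distrC)); rewrite ltr_norml => /andP[]; lra.
have gen : - p + mu x * - m + 2^-1 * sigma x ^+ 2 * - a - r x * - v t x <= 0; last by lra.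
apply: (generator_bound Pc BM mcl mmu msigma r_cont r_ge0 t0 tT solY mu_cont sigma_cont
  (w := fun D y => - v (t + D) y) (w0 := - v t x)) => //.
- move=> eps eps0; have e1 : 0 < eps / (2 * C + 1) by rewrite divr_gt0//; lra.
  have [r1 r10 h1] := local_moments Pc BM mcl mmu msigma t0 tT solY mu_cont sigma_cont e1.
  exists (Num.min (Num.min (q / 2) ((x - b t) / 4)) r1); first by rewrite !lt_min r10 !divr_gt0// subr_gt0.
  move=> rho /andP[rho0]; rewrite !le_min => /andP[/andP[rq rb] rr].
  have [D1 D10 k1] := h1 rho (ltac:(by rewrite rho0)).
  exists (Num.min D1 (Num.min (q / 2) (q2 / 2))); first by rewrite !lt_min D10 !divr_gt0.
  move=> D /andP[D0]; rewrite !le_min => /andP[DD1 /andP[Dq Dq2]].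
  have [_ [_ pF _ _]] := k1 D (ltac:(by rewrite D0)).
  have tDT : t + D < T by lra_only Dq tq q0.
  have qI' y : `|y - x| <= rho -> I y by move=> yx; apply: qI; lra_only yx rq q0.
  have bd u y : t <= u <= t + D -> `|y - x| <= rho -> b u < y /\ `|v u y| <= C.
    move=> /andP[tu uD] yx; split; last by apply: qv; [rewrite tu/=; lra_only uD Dq q0|lra_only yx rq q0].
    have uT : t <= u <= T by rewrite tu (le_trans uD)// ltW.
    have ut : `|u - t| < q2 by rewrite ger0_norm ?subr_ge0//; lra_only uD Dq2 q20.
    by have := hb u uT ut; move: yx; rewrite ler_norml => /andP[h1' h2'] h3'; lra_only rb h1' h3' bx.
  have [k hk kle] := value_le_stay Pc BM mcl mmu msigma g_cont r_cont r_ge0 X_sol payoff_integrable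
    v_value b_cont tau_star_optimal t0 (ltW tT) Ix D0 tDT rho0 C0 qI' bd pF.
  exists (-1 * k).
    have := mean_is_scale (-1) hk; congr (mean_is P _ _); apply/funext => om; ring.
  have : 2 * C * (eps / (2 * C + 1) * D) <= eps * D.
    rewrite mulrA ler_wpM2r ?(ltW D0)// mulrCA -[leRHS]mulr1 ler_wpM2l ?(ltW eps0)//.
    by rewrite ler_pdivrMr ?mul1r ?lerDl// ltr_wpDl// mulr_ge0.
  by move=> pf; lra_only pf kle.
- move=> eps eps0; have [r1 r10 [D1 D10 h1]] := major _ eps0.
  exists r1 => //; exists D1 => // D y D0 yx; have := h1 D y D0 yx; lra.
- move=> eps eps0; have [q1 q10 h1] := value_near eps0.
  exists (q1 / 2); first by rewrite divr_gt0.
  exists (Num.min (q1 / 2) (T - t)); first by rewrite lt_min divr_gt0// subr_gt0.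
  move=> D y /andP[D0]; rewrite le_min => /andP[Dq DT] yx; apply: ltW.
  have uI : 0 <= t + D <= T by apply/andP; split; [lra_only t0' D0|lra_only DT].
  have ut : `|t + D - t| < q1 by rewrite addrAC subrr add0r gtr0_norm//; lra_only Dq q10.
  have [_ h _] := h1 (t + D) y uI ut (ltac:(lra)).
  by rewrite (_ : - v (t + D) y - - v t x = - (v (t + D) y - v t x)); [rewrite normrN|ring].
Qed.
End viscosity.

(** * Maximum principle for functions without affine contact from above *)

Section touching.
Variable R : realType.

(* Maximum principle in one variable: a function which no affine function
   touches from above lies above its one-sided tangents. *)
Lemma no_touch_right (w : R -> R) (p q k : R) : p < q -> {within `[p, q], continuous w} ->
  (forall e, 0 < e -> exists2 del, 0 < del & forall y, p < y < p + del -> (k - e) * (y - p) <= w y - w p) ->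
  (forall z l del, p < z < q -> 0 < del -> (forall y, `|y - z| < del -> w y <= w z + l * (y - z)) -> False) ->
  forall z, p <= z <= q -> w p + k * (z - p) <= w z.
Proof.
move=> pq cw hk no z /andP[]; rewrite le_eqVlt => /predU1P[<- _|pz zq]; first by rewrite subrr mulr0 addr0.
rewrite leNgt; apply/negP => lt; have zp : 0 < z - p by rewrite subr_gt0.
(* [l] is the slope of the chord. The function [u] vanishes at [p] and [z] and is positive just
   right of [p] because [l < k]; at its interior maximum an affine function of slope [l] touches [w]
   from above. *)
pose l := (w z - w p) / (z - p).
have lE : l * (z - p) = w z - w p by rewrite /l divfK// gt_eqF.
have lk : l < k by rewrite -(ltr_pM2r zp) lE; lra_only lt.
pose u y := w y - w p - l * (y - p).
have cu : {within `[p, z], continuous u}.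
  have sub : `[p, z] `<=` (`[p, q] : set R).
    by move=> y /=; rewrite !in_itv/= => /andP[-> yz]; rewrite (le_trans yz).
  move=> y; apply: cvgB; first by apply: cvgB; [exact: (continuous_subspaceW sub cw)|exact: cvg_cst].
  have : {within `[p, z], continuous (fun y : R => l * (y - p))}.
    apply: continuous_subspaceT => a; apply: cvgM; first exact: cvg_cst.
    by apply: cvgB; [exact: cvg_id|exact: cvg_cst].
  exact.
have [c cI hc] := EVT_max (ltW pz) cu.
have [del del0 hdel] := hk ((k - l) / 2) (ltac:(by rewrite divr_gt0// subr_gt0)).
pose y0 := p + Num.min (del / 2) ((z - p) / 2).
have m0 : 0 < Num.min (del / 2) ((z - p) / 2) by rewrite lt_min !divr_gt0.
have m1 : Num.min (del / 2) ((z - p) / 2) <= del / 2 by rewrite ge_min lexx.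
have m2 : Num.min (del / 2) ((z - p) / 2) <= (z - p) / 2 by rewrite ge_min lexx orbT.
have y0d : p < y0 < p + del by rewrite /y0; apply/andP; split; [lra_only m0|lra_only m1 del0].
have u0 : 0 < u y0.
  have := hdel y0 y0d; rewrite /u (_ : y0 - p = Num.min (del / 2) ((z - p) / 2)); last by rewrite /y0; ring.
  move: m0; set mm := Num.min _ _ => m0 h1.
  have h2 : 0 < (k - l) / 2 * mm by rewrite mulr_gt0// divr_gt0// subr_gt0.
  by lra_only h1 h2.
have ucpos : 0 < u c.
  by apply: lt_le_trans u0 _; apply: hc; rewrite in_itv/= /y0; apply/andP; split; [lra_only m0|lra_only m2 zp].
have up : u p = 0 by rewrite /u; ring.
have uz : u z = 0 by rewrite /u lE; ring.
move: cI; rewrite in_itv/= => /andP[pc cz].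
have pc' : p < c by rewrite lt_neqAle pc andbT; apply/eqP => e; move: ucpos; rewrite -e up ltxx.
have cz' : c < z by rewrite lt_neqAle cz andbT; apply/eqP => e; move: ucpos; rewrite e uz ltxx.
apply: (no c l (Num.min (c - p) (z - c))).
- by rewrite pc' (lt_le_trans cz').
- by rewrite lt_min !subr_gt0 pc'.
- move=> y; rewrite lt_min !ltr_norml => /andP[/andP[h1 h2] /andP[h3 h4]].
  have yI : y \in `[p, z] by rewrite in_itv/=; apply/andP; split; [lra_only h1|lra_only h4].
  by have := hc y yI; rewrite /u => h; lra_only h.
Qed.

(** Two-sided version, obtained on the left by the reflection y -> 2 p - y. *)
Lemma no_touch (w : R -> R) (p del k : R) : 0 < del ->
  {within `[p - del, p + del], continuous w} ->
  (forall e, 0 < e -> exists2 r, 0 < r & forall y, `|y - p| < r -> `|w y - w p - k * (y - p)| <= e * `|y - p|) ->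
  (forall z l r, `|z - p| < del -> 0 < r -> (forall y, `|y - z| < r -> w y <= w z + l * (y - z)) -> False) ->
  forall z, `|z - p| <= del -> w p + k * (z - p) <= w z.
Proof.
move=> del0 cw hk no z zp.
have [pz|zp'] := leP p z.
  apply: (@no_touch_right w p (p + del) k); first by rewrite ltrDl.
  - by apply: continuous_subspaceW cw => y /=; rewrite !in_itv/= => /andP[py ->]; rewrite andbT; lra_only py del0.
  - move=> e e0; have [r r0 hr] := hk e e0; exists r => // y /andP[py yr].
    have yp : 0 <= y - p by lra_only py.
    have := hr y; rewrite (ger0_norm yp) => /(_ ltac:(lra_only yr)).
    by rewrite ler_norml => /andP[h1 _]; lra_only h1.
  - by move=> x l r /andP[px xq]; apply: no; rewrite ger0_norm; [lra_only xq|lra_only px].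
  - by move: zp; rewrite ler_norml => /andP[_ h1]; apply/andP; split => //; lra_only h1.
have := @no_touch_right (fun y => w (2 * p - y)) p (p + del) (- k).
have e1 : 2 * p - p = p by ring.
have e2 : 2 * p - (2 * p - z) = z by ring.
move=> /(_ _ _ _ _ (2 * p - z)); rewrite e1 e2.
have -> : w p + - k * (2 * p - z - p) = w p + k * (z - p) by ring.
apply.
- by rewrite ltrDl.
- apply: within_continuous_intro => y e; rewrite /= in_itv/= => /andP[y1 y2] e0.
  have yI : `[p - del, p + del]%classic (2 * p - y) by rewrite /= in_itv/=; lra_only y1 y2 del0.
  have [r r0 hr] := within_continuous_dist cw yI e0; exists r => // y'; rewrite /= in_itv/= => /andP[y1' y2'] yy.
  apply: hr; first by rewrite /= in_itv/=; lra_only y1' y2' del0.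
  by rewrite (_ : 2 * p - y - (2 * p - y') = - (y - y')); [rewrite normrN|ring].
- move=> e e0; have [r r0 hr] := hk e e0; exists r => // y /andP[py yr].
  have := hr (2 * p - y); rewrite (_ : 2 * p - y - p = - (y - p)); last by ring.
  rewrite normrN (ger0_norm (_ : 0 <= y - p)); last by lra_only py.
  by move=> /(_ (ltac:(lra_only yr))); rewrite ler_norml => /andP[h1 _]; lra_only h1.
- move=> x l r /andP[px xq] r0 h; apply: (no (2 * p - x) (- l) r) => //.
    by rewrite (_ : 2 * p - x - p = - (x - p)); [rewrite normrN ger0_norm; [lra_only xq|lra_only px]|ring].
  move=> y yx; have := h (2 * p - y); rewrite (_ : 2 * p - (2 * p - y) = y); last by ring.
  rewrite (_ : 2 * p - y - x = - (y - (2 * p - x))); last by ring.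
  by rewrite normrN => /(_ yx); rewrite mulrN mulNr.
- by move: zp zp'; rewrite ler_norml => /andP[h1 _] h2; apply/andP; split; [lra_only h2|lra_only h1].
Qed.

(** A parabola below a differentiable function with contact at [z] is tangent to it; the sign [s]
    selects the side from which [z] is approached. *)
Lemma touch_slope (w : R -> R) (z l m K del : R) : 0 < del ->
  (forall e, 0 < e -> exists2 r, 0 < r & forall y, `|y - z| < r -> `|w y - w z - l * (y - z)| <= e * `|y - z|) ->
  (forall y, `|y - z| < del -> w z + m * (y - z) + K * (y - z) ^+ 2 <= w y) -> m = l.
Proof.
move=> del0 hw h.
have K1 : 0 < `|K| + 1 by rewrite ltr_wpDl.
have key s : s = 1 \/ s = -1 -> s * (m - l) <= 0.
  move=> hs; have s2 : s * s = 1 by case: hs => ->; ring.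
  have sn : `|s| = 1 by case: hs => ->; rewrite ?normrN normr1.
  apply/ler_addgt0Pr => e e0; rewrite add0r.
  have [r r0 hr] := hw _ (divr_gt0 e0 (ltr0n _ 2)).
  pose t := Num.min (Num.min (r / 2) (del / 2)) (e / (2 * (`|K| + 1))).
  have t0 : 0 < t by rewrite !lt_min !divr_gt0// mulr_gt0.
  have t1 : t <= r / 2 by rewrite !ge_min lexx.
  have t2 : t <= del / 2 by rewrite !ge_min lexx orbT.
  have t3 : t * (`|K| + 1) <= e / 2.
    have : t <= e / (2 * (`|K| + 1)) by rewrite !ge_min lexx orbT.
    by rewrite ler_pdivlMr ?mulr_gt0//; lra.
  have yE : z + s * t - z = s * t by ring.
  have yn : `|s * t| = t by rewrite normrM sn mul1r ger0_norm// ltW.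
  have := hr (z + s * t); rewrite yE yn => /(_ (ltac:(lra))) h1.
  have := h (z + s * t); rewrite yE yn => /(_ (ltac:(lra))) h2.
  have sq : (s * t) ^+ 2 = t * t by rewrite expr2 (_ : s * t * (s * t) = s * s * (t * t)); [rewrite s2 mul1r|ring].
  have Kt : - (`|K| * (t * t)) <= K * (s * t) ^+ 2.
    by rewrite sq -mulNr ler_wpM2r ?mulr_ge0 ?(ltW t0)// lerNl -normrN ler_norm.
  move: h1; rewrite ler_norml => /andP[_ h1].
  have h3 : s * (m - l) * t <= (e / 2 + `|K| * t) * t by lra.
  have := h3; rewrite ler_pM2r// => h4; have : `|K| * t <= t * (`|K| + 1) by lra.
  by lra.
by have := key 1 (or_introl erefl); have := key (-1) (or_intror erefl); lra.
Qed.
End touching.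

(** [G] solves the equation with the value [v'], so the terms in [vt] and [vx] cancel. Of the
    barrier, [sg ^+ 2 * B >= M + 1] beats the drift by at least [s * A], and [A >= N + 1] absorbs
    [s * N] and the curvature slack, at most [s / 2]. The remaining term r (v' - v) has the right
    sign. *)
Lemma barrier_contradiction (R : realFieldType) (vt vx G mu sg r v v' M cc A B N s y : R) :
  0 < s -> 0 < cc -> 0 <= r -> v' <= v -> `|mu| <= M -> `|sg| <= M -> cc <= sg ->
  B = (M + 1) / cc ^+ 2 -> 0 < A -> N + 1 <= A -> 0 <= B * y <= 2^-1 ->
  G = 2 * (r * v' - mu * vx - vt) / sg ^+ 2 ->
  0 <= (vt + s * N) + mu * (vx + s * A * (1 - 2 * (B * y))) +
    2^-1 * sg ^+ 2 * (G + s / (M ^+ 2 + 1) - 2 * (s * A * B)) - r * v -> False.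
Proof.
move=> s0 cc0 r0 vv muM sgM sgc BE A0 NA /andP[By0 By1] GE.
have M0 : 0 <= M by exact: le_trans muM.
have sg0 : 0 < sg by exact: lt_le_trans sgc.
have M1 : 0 < M ^+ 2 + 1 by rewrite ltr_wpDl// sqr_ge0.
have sM : sg ^+ 2 <= M ^+ 2 + 1.
  rewrite -(real_normK (num_real sg)).
  have : `|sg| ^+ 2 <= M ^+ 2 by rewrite lerXn2r ?nnegrE.
  lra.
have gE : 2^-1 * sg ^+ 2 * G = r * v' - mu * vx - vt by rewrite GE; field; rewrite gt_eqF.
have eE : 2^-1 * sg ^+ 2 * (s / (M ^+ 2 + 1)) <= s / 2.
  rewrite (_ : 2^-1 * sg ^+ 2 * (s / (M ^+ 2 + 1)) = s / 2 * (sg ^+ 2 / (M ^+ 2 + 1))); last by field; rewrite gt_eqF.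
  by rewrite -[leRHS]mulr1 ler_wpM2l ?ler_pdivrMr ?mul1r// divr_ge0// ltW.
have sB : M + 1 <= sg ^+ 2 * B.
  rewrite BE mulrCA -[leLHS]mulr1 ler_wpM2l ?addr_ge0// ler_pdivlMr ?exprn_gt0// mul1r.
  by rewrite lerXn2r ?nnegrE// ltW.
have mB : mu * (1 - 2 * (B * y)) <= M.
  apply: le_trans (ler_norm _) _; rewrite normrM -[leRHS]mulr1 ler_pM//.
  by rewrite ler_norml; apply/andP; split; lra.
have sA : 0 < s * A by rewrite mulr_gt0.
have h1 : s * A * (mu * (1 - 2 * (B * y))) <= s * A * M by rewrite ler_wpM2l// ltW.
have h2 : s * A * (M + 1) <= s * A * (sg ^+ 2 * B) by rewrite ler_wpM2l// ltW.
have h3 : s * N + s <= s * A by rewrite -[X in _ + X <= _]mulr1 -mulrDr ler_wpM2l// ltW.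
have h4 : r * v' <= r * v by rewrite ler_wpM2l.
rewrite (_ : vt + s * N + _ + _ - r * v = vt + s * N + mu * vx + s * A * (mu * (1 - 2 * (B * y))) +
  2^-1 * sg ^+ 2 * G + 2^-1 * sg ^+ 2 * (s / (M ^+ 2 + 1)) - s * A * (sg ^+ 2 * B) - r * v); last first.
  by field; rewrite gt_eqF.
rewrite gE.
rewrite mulrDr mulr1 in h2.
by move=> h; lra.
Qed.

Lemma barrier_majorant (R : realFieldType) (v1 v2 v3 v4 v5 P1 P2 A B N s y z D vt vx G e eps : R) :
  v1 - v2 - s * P1 <= v3 - v4 - s * P2 ->
  P1 = P2 + A * (1 - 2 * (B * y)) * z - A * B * z ^+ 2 + N * D ->
  v2 <= v5 + (vt + eps) * D -> v5 <= v4 + vx * z + (G + e) / 2 * z ^+ 2 ->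
  v1 <= v3 + (vx + s * A * (1 - 2 * (B * y))) * z + (G + e - 2 * (s * A * B)) / 2 * z ^+ 2 + (vt + s * N + eps) * D.
Proof.
move=> h1 hP h2 h3; rewrite hP in h1.
have -> : (vx + s * A * (1 - 2 * (B * y))) * z = vx * z + s * (A * (1 - 2 * (B * y)) * z) by ring.
have -> : (G + e - 2 * (s * A * B)) / 2 * z ^+ 2 = (G + e) / 2 * z ^+ 2 - s * (A * B * z ^+ 2) by field.
have -> : (vt + s * N + eps) * D = (vt + eps) * D + s * (N * D) by ring.
lra.
Qed.

Section order_facts.
Variable R : realDomainType.
Implicit Types a b c e p w x y : R.

Lemma between_norm a b x y : `|y - x| <= x - a -> `|y - x| <= b - x -> a <= y <= b.
Proof. by rewrite !ler_norml => /andP[? ?] /andP[? ?]; apply/andP; split; lra. Qed.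

Lemma norm_step_le a b c e x : `|a - b - c * x| <= e * x -> a <= b + (c + e) * x.
Proof. by rewrite ler_norml => /andP[_ ?]; lra. Qed.

Lemma norm_step_ge a b c e x : `|a - b - c * x| <= e * x -> b + (c - e) * x <= a.
Proof. by rewrite ler_norml => /andP[? _]; lra. Qed.

Lemma sum_lt_absurd a b p w : a + b <= p -> p < w -> w <= a -> 0 <= b -> False.
Proof. lra. Qed.
End order_facts.

(** * Local Lipschitz estimate for the boundary, from analytic data only *)

Section boundary.
Variables (R : realType) (T q tb W M cc eta : R) (I : set R).
Variables (mu sigma g g1 g2 r b : R -> R) (v vt vx : R -> R -> R).
Local Notation near_b t x := ([/\ 0 <= t, `|t - tb| < q & `|x - b tb| < q]).
Hypothesis q0 : 0 < q.
Hypothesis cc0 : 0 < cc.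
Hypothesis eta0 : 0 < eta.
Hypothesis domain : forall t x, near_b t x -> t < T /\ I x.
Hypothesis b_cont : {within `[0, T], continuous b}.
Hypothesis v_cont : {within `[0, T] `*` I, continuous (fun p : R * R => v p.1 p.2)}.
Hypothesis r_ge0 : forall x, 0 <= r x.
Hypothesis v_ge : forall t x, near_b t x -> g x <= v t x.
Hypothesis contin : forall t x, near_b t x -> g x < v t x <-> b t < x.
Hypothesis v_mono : forall t s x, near_b t x -> 0 <= s -> near_b (t + s) x ->
  v (t + s) x <= v t x <= v (t + s) x + W * s.
Hypothesis superh : forall t x m a p, near_b t x ->
  (forall eps, 0 < eps -> exists2 rho0, 0 < rho0 & exists2 D0, 0 < D0 &
    forall D y, 0 < D <= D0 -> `|y - x| <= rho0 ->
    v t x + m * (y - x) + a / 2 * (y - x) ^+ 2 + (p - eps) * D <= v (t + D) y) ->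
  p + mu x * m + 2^-1 * sigma x ^+ 2 * a - r x * v t x <= 0.
Hypothesis subh : forall t x m a p, near_b t x -> b t < x ->
  (forall eps, 0 < eps -> exists2 rho0, 0 < rho0 & exists2 D0, 0 < D0 &
    forall D y, 0 < D <= D0 -> `|y - x| <= rho0 ->
    v (t + D) y <= v t x + m * (y - x) + a / 2 * (y - x) ^+ 2 + (p + eps) * D) ->
  0 <= p + mu x * m + 2^-1 * sigma x ^+ 2 * a - r x * v t x.
Hypothesis vt_exp : forall t x eps, near_b t x -> 0 < eps -> exists2 rho0, 0 < rho0 & exists2 D0, 0 < D0 &
    forall D y, 0 < D <= D0 -> `|y - x| <= rho0 -> `|v (t + D) y - v t y - vt t x * D| <= eps * D.
Hypothesis vx_exp : forall t x eps, near_b t x -> 0 < eps -> exists2 del, 0 < del &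
    forall y, `|y - x| < del -> `|v t y - v t x - vx t x * (y - x)| <= eps * `|y - x|.
Hypothesis g_exp : forall x eps, `|x - b tb| < q -> 0 < eps -> exists2 del, 0 < del &
    forall y, `|y - x| < del -> g y - g x - g1 x * (y - x) - g2 x / 2 * (y - x) ^+ 2 <= eps * (y - x) ^+ 2.
Hypothesis continuity : forall t x, near_b t x ->
  [/\ {for x, continuous (v t)}, {for x, continuous (vt t)} & {for x, continuous (vx t)}].
Hypothesis coef_continuity : forall x, `|x - b tb| < q ->
  [/\ {for x, continuous mu}, {for x, continuous sigma}, {for x, continuous r} & {for x, continuous g}].
Hypothesis coef_bounds : forall x, `|x - b tb| < q -> [/\ `|mu x| <= M, `|sigma x| <= M & cc <= sigma x].
Hypothesis strict : forall t x, near_b t x ->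
  mu x * vx t x + 2^-1 * sigma x ^+ 2 * g2 x - r x * v t x <= - eta.

Let near_x t x : near_b t x -> exists2 del, 0 < del & forall y, `|y - x| < del -> near_b t y.
Proof.
move=> [t0 tq xq]; exists (q - `|x - b tb|); first by rewrite subr_gt0.
move=> y yx; split => //; rewrite -(subrK x y) -addrA.
by apply: le_lt_trans (ler_normD _ _) _; rewrite -ltrBrDr.
Qed.

Let near_t t x : near_b t x -> exists2 del, 0 < del & forall D y, 0 <= D < del -> `|y - x| < del -> near_b (t + D) y.
Proof.
move=> tx; have [del del0 h] := near_x tx; have [t0 tq _] := tx.
exists (Num.min del (q - `|t - tb|)); first by rewrite lt_min del0 subr_gt0.
move=> D y; rewrite !lt_min => /andP[D0 /andP[_ Dq]] /andP[yd _].
have [_ _ yq] := h y yd; split => //; first by rewrite addr_ge0.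
rewrite (_ : t + D - tb = (t - tb) + D); last by ring.
by apply: le_lt_trans (ler_normD _ _) _; rewrite (ger0_norm D0) -ltrBrDl.
Qed.

Lemma boundary_nondecreasing t s : near_b t (b t) -> 0 <= s -> near_b (t + s) (b t) -> b t <= b (t + s).
Proof.
move=> h1 s0 h2; rewrite leNgt; apply/negP => /(contin h2) lt.
have /andP[le _] := v_mono h1 s0 h2.
by have /(contin h1) := lt_le_trans lt le; rewrite ltxx.
Qed.

(** The second space derivative that vt + mu vx + sigma^2 / 2 vxx - r v = 0 would prescribe. *)
Let curv t x := 2 * (r x * v t x - mu x * vx t x - vt t x) / sigma x ^+ 2.

(** With curvature raised by [eps], the supersolution inequality fails strictly for parabolas
    touching [v] from below near [x]: this is [E > 0]. Hence no affine function touches the parabola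
    minus [v] from above, and [no_touch] places that difference above its tangent. *)
Lemma upper_quadratic t x eps : near_b t x -> 0 < eps -> exists2 del, 0 < del & forall y, `|y - x| <= del ->
  v t y <= v t x + vx t x * (y - x) + (curv t x + eps) / 2 * (y - x) ^+ 2.
Proof.
move=> tx eps0; have [t0 tq xq] := tx.
set a := curv t x + eps.
have [cmu csg cr _] := coef_continuity xq; have [cv cvt cvx] := continuity tx.
pose E z := vt t z + mu z * vx t z + 2^-1 * sigma z ^+ 2 * a - r z * v t z.
have s0 : 0 < sigma x by have [_ _] := coef_bounds xq; exact: lt_le_trans.
have Ex : 0 < E x.
  rewrite (_ : E x = 2^-1 * sigma x ^+ 2 * eps); first by rewrite !mulr_gt0// exprn_gt0.
  by rewrite /E /a /curv; field; rewrite gt_eqF.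
have cE : {for x, continuous E}.
  apply: cvgB; last exact: cvgM.
  apply: cvgD; first by apply: cvgD; [exact: cvt|exact: cvgM].
  by apply: cvgM; [apply: cvgM; [exact: cvg_cst|exact: cvgM]|exact: cvg_cst].
have [d1 d10 h1] : exists2 d1, 0 < d1 & forall y, `|y - x| < d1 -> 0 < E y.
  have /cvgrPdist_lt/(_ _ Ex)/nbhs_ballP[d1 d10 h1] := cE; exists d1 => // y yx.
  by have := h1 y (ltac:(by rewrite /ball/= distrC)); rewrite /= ltr_norml => /andP[_ h2]; lra_only h2.
have [d2 d20 h2] := near_x tx.
pose del := Num.min (d1 / 2) (d2 / 2).
have del0 : 0 < del by rewrite lt_min !divr_gt0.
have del1 : del <= d1 / 2 by rewrite ge_min lexx.
have del2 : del <= d2 / 2 by rewrite ge_min lexx orbT.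
exists del => // y yd.
have main : - v t x + a / 2 * (x - x) ^+ 2 + - vx t x * (y - x) <= - v t y + a / 2 * (y - x) ^+ 2; last first.
  by move: main; rewrite subrr expr0n/= mulr0 => h; lra_only h.
apply: (@no_touch _ (fun y => - v t y + a / 2 * (y - x) ^+ 2) x del (- vx t x)) => //.
- apply: continuous_in_subspaceT => z; rewrite inE/= in_itv/= => /andP[z1 z2].
  have zx : `|z - x| < d2 by rewrite ltr_norml; apply/andP; split; [lra_only z1 del2 d20|lra_only z2 del2 d20].
  have [cz _ _] := continuity (h2 z zx).
  apply: cvgD; first exact: cvgN.
  apply: cvgM; first exact: cvg_cst.
  by under eq_fun do rewrite expr2; apply: cvgM; (apply: cvgB; [exact: cvg_id|exact: cvg_cst]).
- move=> e e0; have [r1 r10 k1] := vx_exp tx (divr_gt0 e0 (ltr0n _ 2)).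
  have a1 : 0 < `|a| + 1 by rewrite ltr_wpDl.
  exists (Num.min r1 (e / (`|a| + 1))); first by rewrite lt_min r10 divr_gt0.
  move=> z; rewrite lt_min => /andP[z1 z2].
  rewrite subrr expr0n/= mulr0 addr0.
  rewrite (_ : - v t z + _ - _ - _ = - (v t z - v t x - vx t x * (z - x)) + a / 2 * (z - x) ^+ 2); last by ring.
  apply: le_trans (ler_normD _ _) _; rewrite normrN.
  have q1 := k1 z z1.
  have q2 : `|a / 2 * (z - x) ^+ 2| <= e / 2 * `|z - x|.
    rewrite normrM normrX expr2 mulrA ler_wpM2r// normrM (ger0_norm (_ : 0 <= 2^-1)) ?invr_ge0//.
    by move: z2; rewrite ltr_pdivlMr//; have h3 := normr_ge0 (z - x) => h4; lra_only h3 h4.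
  by lra_only q1 q2.
- move=> z l r1 zx r10 touch.
  have zn : near_b t z by apply: h2; lra_only zx del2 d20.
  have Ez : 0 < E z by apply: h1; lra_only zx del1 d10.
  (* Affine contact from above for the difference is parabolic contact from below for [v], with this
     slope; differentiability of [v] forces it to be [vx t z]. *)
  pose m := a * (z - x) - l.
  have low y' : `|y' - z| < r1 -> v t z + m * (y' - z) + a / 2 * (y' - z) ^+ 2 <= v t y'.
    move=> yz; have := touch y' yz.
    rewrite (_ : a / 2 * (y' - x) ^+ 2 = a / 2 * (z - x) ^+ 2 + a * (z - x) * (y' - z) + a / 2 * (y' - z) ^+ 2); last by field.
    by rewrite /m => h; lra_only h.
  have mE : m = vx t z by apply: (touch_slope r10 _ low) => e e0; exact: vx_exp.
  have : vt t z + mu z * m + 2^-1 * sigma z ^+ 2 * a - r z * v t z <= 0.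
    apply: superh => // e e0; have [r2 r20 [D0 D00 k2]] := vt_exp zn e0.
    exists (Num.min r2 (r1 / 2)); first by rewrite lt_min r20 divr_gt0.
    exists D0 => // D y' D1; rewrite le_min => /andP[y1 y2].
    apply: le_trans (norm_step_ge (k2 D y' D1 y1)); rewrite lerD2r; apply: low.
    by apply: le_lt_trans y2 _; rewrite ltr_pdivrMr// mulr2n mulrDr mulr1 ltrDl.
  by rewrite mE; move: Ez; rewrite /E => h3 h4; lra_only h3 h4.
Qed.

(** Chosen so that [sigma z ^+ 2 * c <= eta / 2]: adding c/2 (x - b t)^2 to [g] spends only half of
    the strict negativity [eta]. *)
Let c := eta / (2 * (M ^+ 2 + 1)).
Let c0 : 0 < c. Proof. by rewrite divr_gt0// mulr_gt0// ltr_wpDl// sqr_ge0. Qed.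

(** The one-dimensional principle applies at the fixed time [t] to v - g - c/2 (x - b t)^2, with
    right slope at least 0 at the boundary point because [v >= g]. Affine contact from above would,
    by the subsolution property, contradict [strict]. *)
Lemma nondegenerate t x : near_b t (b t) -> b t <= x -> `|x - b tb| < q ->
  c / 2 * (x - b t) ^+ 2 <= v t x - g x.
Proof.
move=> tn; rewrite le_eqVlt => /predU1P[<- _|bx xq].
  by rewrite subrr expr0n mulr0 subr_ge0; exact: v_ge.
have [t0 tq bq] := tn; set be := b t in bx bq tn *.
have tz z : be <= z <= x -> near_b t z.
  move=> /andP[h1 h2]; split => //; rewrite ltr_norml.
  by move: bq xq; rewrite !ltr_norml => /andP[h3 _] /andP[_ h4]; apply/andP; split; [lra_only h1 h3|lra_only h2 h4].
have vbe : v t be = g be.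
  apply/eqP; rewrite eq_le v_ge// andbT leNgt; apply/negP => /(contin tn).
  by rewrite ltxx.
pose w y := v t y - g y - c / 2 * (y - be) ^+ 2.
have wbe : w be = 0 by rewrite /w vbe; ring.
suff : w be + 0 * (x - be) <= w x by rewrite wbe /w => h; lra_only h.
apply: (@no_touch_right _ w be x 0) => //; last by rewrite lexx ltW.
- apply: continuous_in_subspaceT => z; rewrite inE/= in_itv/= => zI.
  have zn := tz z zI; have [_ _ zq] := zn.
  have [cz _ _] := continuity zn; have [_ _ _ cg] := coef_continuity zq.
  apply: cvgB; first exact: cvgB.
  apply: cvgM; first exact: cvg_cst.
  by under eq_fun do rewrite expr2; apply: cvgM; (apply: cvgB; [exact: cvg_id|exact: cvg_cst]).
- move=> e e0; exists (Num.min (2 * e / c) (x - be)).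
    by rewrite lt_min subr_gt0 bx andbT divr_gt0// mulr_gt0.
  move=> y /andP[by1 by2].
  have [ye1 ye2] : y - be < 2 * e / c /\ y < x.
    have := ge_min (2 * e / c) (2 * e / c) (x - be); have := ge_min (x - be) (2 * e / c) (x - be).
    by rewrite !lexx orbT /= => h1 h2; split; lra_only h1 h2 by2.
  have yn : near_b t y by apply: tz; apply/andP; split; [lra_only by1|lra_only ye2].
  have := v_ge yn; rewrite wbe subr0 /w sub0r mulNr.
  have yb0 : 0 <= y - be by lra_only by1.
  have : c / 2 * (y - be) ^+ 2 <= e * (y - be).
    rewrite expr2 mulrA ler_wpM2r//.
    by move: ye1; rewrite ltr_pdivlMr// => h; lra_only h.
  by move=> h1 h2; lra_only h1 h2.
- move=> z l r1 /andP[bz zx] r10 touch.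
  have zn : near_b t z by apply: tz; apply/andP; split; [lra_only bz|lra_only zx].
  have [_ _ zq] := zn; have [muM sgM sgc] := coef_bounds zq.
  have [r2 r20 k2] := g_exp zq (divr_gt0 c0 (ltr0n _ 2)).
  have [r3 r30 k3] := near_t zn.
  pose m := g1 z + c * (z - be) + l.
  pose a := g2 z + 2 * c.
  have up y : `|y - z| < r1 -> `|y - z| < r2 -> v t y <= v t z + m * (y - z) + a / 2 * (y - z) ^+ 2.
    move=> y1 y2; have := touch y y1; have := k2 y y2; rewrite /w.
    rewrite (_ : c / 2 * (y - be) ^+ 2 = c / 2 * (z - be) ^+ 2 + c * (z - be) * (y - z) + c / 2 * (y - z) ^+ 2); last by field.
    have -> : m * (y - z) = g1 z * (y - z) + c * (z - be) * (y - z) + l * (y - z) by rewrite /m; ring.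
    have -> : a / 2 * (y - z) ^+ 2 = g2 z / 2 * (y - z) ^+ 2 + c * (y - z) ^+ 2 by rewrite /a; field.
    have -> : c / 2 * (y - z) ^+ 2 = 2^-1 * (c * (y - z) ^+ 2) by field.
    by move=> h1 h2; lra_only h1 h2.
  have mE : - m = - vx t z.
    apply: (@touch_slope _ (fun y => - v t y) z (- vx t z) (- m) (- (a / 2)) (Num.min r1 r2)); first by rewrite lt_min r10.
      move=> e e0; have [r4 r40 k4] := vx_exp zn e0; exists r4 => // y /k4.
      by rewrite (_ : - v t y - - v t z - - vx t z * (y - z) = - (v t y - v t z - vx t z * (y - z))); [rewrite normrN|ring].
    move=> y; rewrite lt_min => /andP[y1 y2]; have h := up y y1 y2; lra_only h.
  (* The time slope can be taken to be 0 because [v] is nonincreasing in time, which reduces the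
     parabolic test to one in space. *)
  have : 0 <= 0 + mu z * m + 2^-1 * sigma z ^+ 2 * a - r z * v t z.
    apply: subh => // e e0; exists (Num.min (Num.min r1 r2) r3 / 2); first by rewrite divr_gt0// !lt_min r10 r20.
    exists (r3 / 2); first by rewrite divr_gt0.
    move=> D y /andP[D0 D1] yz.
    have h0 : 0 < Num.min (Num.min r1 r2) r3 by rewrite !lt_min r10 r20.
    have : `|y - z| < Num.min (Num.min r1 r2) r3 by lra_only h0 yz.
    rewrite !lt_min => /andP[/andP[y1 y2] y3].
    have n1 : near_b t y by rewrite -[t]addr0; apply: k3 => //; rewrite lexx.
    have n2 : near_b (t + D) y.
      by apply: k3 => //; rewrite ltW//= (le_lt_trans D1)// ltr_pdivrMr// mulr2n mulrDr mulr1 ltrDl.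
    have /andP[le _] := v_mono n1 (ltW D0) n2.
    have h1 := up y y1 y2; have h2 : 0 <= e * D by rewrite mulr_ge0// ltW.
    by rewrite add0r; lra_only le h1 h2.
  have mE' : m = vx t z by apply: oppr_inj.
  rewrite mE' /a; move: (strict zn) eta0 => h1 h2.
  have h3 : sigma z ^+ 2 * c <= eta / 2.
    have s2 : sigma z ^+ 2 <= M ^+ 2 + 1.
      rewrite -(real_normK (num_real (sigma z))).
      have M0 : 0 <= M by exact: le_trans muM.
      have : `|sigma z| ^+ 2 <= M ^+ 2 by rewrite lerXn2r ?nnegrE.
      by move=> h; lra_only h.
    apply: le_trans (ler_wpM2r (ltW c0) s2) _.
    by rewrite /c mulrC invfM mulrA mulfVK// gt_eqF// ltr_wpDl// sqr_ge0.
  by move: h1 h2 h3 => h4 h5 h6 h7; lra_only h4 h5 h6 h7.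
Qed.

(** A positive maximum of v(t) - v(t + s) - s Phi over the square lies in the continuation set,
    since v(t) > v(t + s) >= g there, and off the left, right and final sides. The initial side is
    harmless as tests look forward in time. At the maximum, [upper_quadratic] for the shifted copy
    and maximality give a test function for the other copy, and [barrier_contradiction] applies. *)
Lemma comparison t1 rho s A B N : 0 <= t1 -> `|t1 - tb| <= q / 4 -> `|b t1 - b tb| <= q / 4 ->
  0 < rho <= q / 4 -> 0 < s <= q / 4 -> 0 <= W -> B = (M + 1) / cc ^+ 2 -> B * rho <= 2^-1 ->
  N = W / rho -> N + 1 <= A -> W <= A * (rho / 2) ->
  forall x, b t1 <= x <= b t1 + rho -> v t1 x - v (t1 + s) x <= s * (A * (x - b t1)).
Proof.
move=> t10 tq bq /andP[rho0 rq] /andP[s0 sq] W0 BE Br NE NA WA.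
have q0' := q0; have cc0' := cc0.
set b1 := b t1 in bq *.
have N0 : 0 <= N by rewrite NE divr_ge0// ltW.
have A0 : 0 < A by apply: lt_le_trans NA; rewrite ltr_wpDl.
have M0 : 0 <= M.
  have [h _ _] := @coef_bounds (b tb) (ltac:(by rewrite subrr normr0)); exact: le_trans h.
have B0 : 0 <= B by rewrite BE divr_ge0 ?addr_ge0// exprn_ge0// ltW.
have nb t x : t1 <= t <= t1 + rho + s -> b1 <= x <= b1 + rho -> near_b t x.
  move: tq bq; rewrite !ler_norml !ltr_norml => /andP[h1 h2] /andP[h3 h4] /andP[h5 h6] /andP[h7 h8].
  by split; [lra_only t10 h5|apply/andP; split; lra_only h1 h2 h5 h6 rq sq q0'|apply/andP; split; lra_only h3 h4 h7 h8 rq q0'].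
pose Phi t x := A * ((x - b1) - B * (x - b1) ^+ 2) + N * (t - t1).
have By x : b1 <= x <= b1 + rho -> 0 <= B * (x - b1) <= 2^-1.
  move=> /andP[x1 x2]; rewrite mulr_ge0 ?subr_ge0//=; apply: le_trans Br; rewrite ler_wpM2l//; lra_only x2.
have Phi_ge t x : b1 <= x <= b1 + rho -> A * ((x - b1) / 2) + N * (t - t1) <= Phi t x.
  move=> xI; have /andP[_ h] := By x xI; rewrite lerD2r ler_wpM2l ?(ltW A0)//.
  have : B * (x - b1) ^+ 2 <= 2^-1 * (x - b1) by rewrite expr2 mulrA ler_wpM2r// subr_ge0; case/andP: xI.
  by move=> h1; lra_only h1.
pose u (p : R * R) := v p.1 p.2 - v (p.1 + s) p.2 - s * Phi p.1 p.2.
pose K : set (R * R) := `[t1, t1 + rho]%classic `*` `[b1, b1 + rho]%classic.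
have inK t x : t1 <= t <= t1 + rho -> b1 <= x <= b1 + rho -> K (t, x) by split; rewrite /= in_itv.
have Kin p : K p -> t1 <= p.1 <= t1 + rho /\ b1 <= p.2 <= b1 + rho by case; rewrite /= !in_itv.
have cK : compact K by apply: compact_setX; exact: segment_compact.
have cv (e : R) : 0 <= e <= s -> {within K, continuous (fun p : R * R => v (p.1 + e) p.2)}.
  move=> /andP[e0 es]; rewrite subspace_continuousP => p Kp.
  have KA z : K z -> (`[0, T]%classic `*` I) (z.1 + e, z.2).
    move=> /Kin[/andP[h1 h2] zK].
    have zn : near_b (z.1 + e) z.2 by apply: nb => //; apply/andP; split; [lra_only h1 e0|lra_only h2 es].
    have [z0 zT] := @domain _ _ zn.
    by split => //=; rewrite in_itv/=; apply/andP; split; [lra_only t10 h1 e0|exact: ltW].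
  have := v_cont; rewrite subspace_continuousP => /(_ _ (KA p Kp)) h.
  apply/cvgrPdist_lt => eps eps0; move/cvgrPdist_lt: h => /(_ eps eps0).
  rewrite !near_withinE => /nbhs_ballP[l l0 hl]; apply/nbhs_ballP; exists l => // z [z1 z2] Kz.
  apply: (hl (z.1 + e, z.2)); last exact: KA.
  split; last exact: z2.
  by rewrite /ball/= (_ : p.1 + e - (z.1 + e) = p.1 - z.1)//; ring.
have cu : {within K, continuous u}.
  have c1 := cv 0 (ltac:(by rewrite lexx ltW)).
  have c2 := cv s (ltac:(by rewrite lexx ltW)).
  have cx : {within K, continuous (fun p : R * R => s * Phi p.1 p.2)}.
    apply: continuous_subspaceT => p; apply: cvgM; first exact: cvg_cst.
    have cy : {for p, continuous (fun p : R * R => p.2 - b1)} by apply: cvgB; [exact: cvg_snd|exact: cvg_cst].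
    apply: cvgD; apply: cvgM; try exact: cvg_cst.
      apply: cvgB; first exact: cy.
      by apply: cvgM; [exact: cvg_cst|under eq_fun do rewrite expr2; apply: cvgM; exact: cy].
    by apply: cvgB; [exact: cvg_fst|exact: cvg_cst].
  move=> p; apply: cvgB; last exact: cx.
  apply: cvgB; last exact: c2.
  by move: (c1 p); under eq_fun do rewrite addr0.
move=> x xI; rewrite leNgt; apply/negP => lt.
have ux : 0 < u (t1, x).
  rewrite /u/= /Phi subrr mulr0 addr0.
  have : s * (A * (x - b1 - B * (x - b1) ^+ 2)) <= s * (A * (x - b1)).
    by rewrite ler_wpM2l ?(ltW s0)// ler_wpM2l ?(ltW A0)// gerBl mulr_ge0// sqr_ge0.
  by move=> h1; lra_only h1 lt.
have Kx : K (t1, x) by apply: inK => //; rewrite lexx lerDl ltW.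
have [[ts xs] Ks hmax] := compact_EVT_max (ex_intro _ _ Kx) cK cu.
have {Ks}[/= tI yI] := Kin _ (set_mem Ks).
have umax t y : t1 <= t <= t1 + rho -> b1 <= y <= b1 + rho -> u (t, y) <= u (ts, xs).
  by move=> h1 h2; apply: hmax; apply: mem_set; exact: inK.
have us : 0 < u (ts, xs) by apply: lt_le_trans ux _; apply: umax => //; rewrite lexx lerDl ltW.
have [ts1 ts2] := andP tI; have [xs1 xs2] := andP yI.
have n0 : near_b ts xs by apply: nb => //; rewrite ts1 (le_trans ts2)// lerDl ltW.
have ns : near_b (ts + s) xs by apply: nb => //; rewrite lerD2r ts2 andbT (le_trans ts1)// lerDl ltW.
have /andP[m1 m2] := v_mono n0 (ltW s0) ns.
have Pg := Phi_ge ts xs yI.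
have pp1 : 0 <= A * ((xs - b1) / 2) by rewrite mulr_ge0 ?(ltW A0)// divr_ge0// subr_ge0.
have pp2 : 0 <= N * (ts - t1) by rewrite mulr_ge0// subr_ge0.
have Phi0 : 0 <= s * Phi ts xs by rewrite mulr_ge0 ?(ltW s0)//; apply: le_trans Pg; exact: addr_ge0.
have Dpos : v (ts + s) xs < v ts xs.
  by move: us; rewrite /u/= subr_gt0 => /(le_lt_trans Phi0); rewrite subr_gt0.
have gs : b ts < xs by apply/(contin n0); apply: le_lt_trans Dpos; exact: v_ge.
have WPhi : s * Phi ts xs < W * s.
  by move: us; rewrite /u/= subr_gt0 => h; apply: lt_le_trans h _; rewrite lerBlDr addrC.
have PhiW : Phi ts xs < W by rewrite -(ltr_pM2l s0) (mulrC s W).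
(* On the left side [xs = b t1], but [b] is nondecreasing and [b ts < xs]. *)
have xs1' : b1 < xs.
  rewrite lt_neqAle xs1 andbT; apply/eqP => e.
  have nb1 : near_b t1 b1 by apply: nb; rewrite lexx ?lerDl ?(ltW rho0)// -addrA lerDl addr_ge0// ltW.
  have := @boundary_nondecreasing t1 (ts - t1) nb1 (ltac:(by rewrite subr_ge0)).
  rewrite addrC subrK => /(_ (ltac:(by rewrite -/b1 e))).
  by rewrite -/b1 e leNgt gs.
(* At the right end the barrier is at least [A * (rho / 2) >= W], more than the time difference
   quotient allows; at the final time, below, [N * rho = W] plays the same part. *)
have xs2' : xs < b1 + rho.
  rewrite lt_neqAle xs2 andbT; apply/eqP => e.
  have xr : (xs - b1) / 2 = rho / 2 by rewrite e; field.
  by move: Pg; rewrite xr => Pg; exact: (sum_lt_absurd Pg PhiW WA pp2).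
have ts2' : ts < t1 + rho.
  rewrite lt_neqAle ts2 andbT; apply/eqP => e.
  have tr : N * (ts - t1) = W by rewrite e NE; field; rewrite gt_eqF.
  by move: Pg; rewrite tr addrC => Pg; exact: (sum_lt_absurd Pg PhiW (lexx W) pp1).
have [_ _ xq] := n0; have [muM sgM sgc] := coef_bounds xq.
(* The slack in the curvature is proportional to [s], so that after multiplication by half of
   sigma^2 it is at most [s / 2]. *)
pose e := s / (M ^+ 2 + 1).
have e0 : 0 < e by rewrite divr_gt0// ltr_wpDl// sqr_ge0.
have [d1 d10 k1] := upper_quadratic ns e0.
apply: (@barrier_contradiction R (vt (ts + s) xs) (vx (ts + s) xs) (curv (ts + s) xs) (mu xs) (sigma xs) (r xs)
  (v ts xs) (v (ts + s) xs) M cc A B N s (xs - b1)) => //; first exact: By.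
apply: subh => // eps eps0.
have [d2 d20 [D2 D20 k2]] := vt_exp ns eps0.
exists (Num.min (Num.min d1 d2) (Num.min (xs - b1) (b1 + rho - xs))).
  by rewrite !lt_min d10 d20 !subr_gt0 xs1' xs2'.
exists (Num.min D2 (t1 + rho - ts)); first by rewrite lt_min D20 subr_gt0.
move=> D y /andP[D0]; rewrite !le_min => /andP[DD2 Dt] /andP[/andP[y1 y2] /andP[y3 y4]].
have yK : b1 <= y <= b1 + rho by exact: between_norm y3 y4.
have tK : t1 <= ts + D <= t1 + rho by rewrite -lerBrDl Dt andbT (le_trans ts1)// lerDl ltW.
have h1 := umax _ _ tK yK; rewrite /u /= in h1.
have h2 := k2 D y (ltac:(by rewrite D0)) y2.
apply: (barrier_majorant h1 _ (v5 := v (ts + s) y)).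
- by rewrite /Phi; ring.
- by apply: norm_step_le; rewrite (addrAC ts D s).
- exact: k1.
Qed.

Lemma locally_lipschitz : 0 <= tb -> 0 <= W -> exists2 L, 0 <= L & exists2 del, 0 < del &
  forall t1 s, 0 <= t1 -> `|t1 - tb| < del -> 0 < s < del -> b (t1 + s) <= b t1 + L * s.
Proof.
move=> tb0 W0.
have nbb : near_b tb (b tb) by rewrite !subrr !normr0.
have M0 : 0 <= M.
  have [h _ _] := @coef_bounds (b tb) (ltac:(by rewrite subrr normr0)); exact: le_trans h.
pose B := (M + 1) / cc ^+ 2.
have B0 : 0 < B by rewrite divr_gt0 ?exprn_gt0// ltr_wpDl.
(* The bound [(2 * B)^-1] keeps the concave correction of the barrier below half of its linear
   part. *)
pose rho := Num.min (q / 4) (2 * B)^-1.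
have rho0 : 0 < rho by rewrite lt_min divr_gt0//= invr_gt0 mulr_gt0.
have rq : rho <= q / 4 by rewrite ge_min lexx.
have Br : B * rho <= 2^-1.
  have : rho <= (2 * B)^-1 by rewrite ge_min lexx orbT.
  by rewrite -(ler_pM2l B0) invfM mulrCA divff ?mulr1// gt_eqF.
pose N := W / rho.
have N0 : 0 <= N by rewrite divr_ge0// ltW.
(* [N + 1] serves the barrier inequality, and the extra [2 * N] gives
   [A * (rho / 2) >= N * rho = W]. *)
pose A := N + 1 + 2 * N.
have NA : N + 1 <= A by rewrite lerDl mulr_ge0.
have WA : W <= A * (rho / 2).
  rewrite (_ : A * (rho / 2) = W + (N + 1) * (rho / 2)); last by rewrite /A /N; field; rewrite gt_eqF.
  by rewrite lerDl mulr_ge0 ?addr_ge0// divr_ge0// ltW.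
have A0 : 0 <= A by rewrite !addr_ge0// mulr_ge0.
exists (A / (c / 2)); first by rewrite divr_ge0// divr_ge0// ltW.
have [tbT _] := domain nbb.
have tI : `[0, T]%classic tb by rewrite /= in_itv/= tb0 ltW.
have [d1 d10 h1] := within_continuous_dist b_cont tI (ltac:(by rewrite divr_gt0) : 0 < rho / 2).
pose del := Num.min (d1 / 2) (q / 4).
have del0 : 0 < del by rewrite lt_min !divr_gt0.
have del1 : del <= d1 / 2 by rewrite ge_min lexx.
have del2 : del <= q / 4 by rewrite ge_min lexx orbT.
exists del => // t1 s t10 t1d /andP[s0 sd].
have t1q : `|t1 - tb| <= q / 4 by exact: le_trans (ltW t1d) del2.
have sq : s <= q / 4 by exact: le_trans (ltW sd) del2.
have q4 : q / 4 < q by rewrite ltr_pdivrMr// ltr_pMr// ltr1n.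
have q2 : q / 4 + q / 4 < q.
  by have q0' := q0; lra.
have tsd : `|t1 + s - tb| < d1 /\ `|t1 + s - tb| < q.
  have le : `|t1 + s - tb| <= `|t1 - tb| + s.
    by rewrite addrAC; apply: le_trans (ler_normD _ _) _; rewrite (ger0_norm (ltW s0)).
  split; apply: le_lt_trans le _.
    by rewrite [ltRHS]splitr ltrD//; [exact: lt_le_trans del1|exact: lt_le_trans del1].
  by apply: le_lt_trans q2; rewrite lerD.
have nt1 : near_b t1 (b tb) by rewrite subrr normr0; split => //; exact: le_lt_trans q4.
have nts : near_b (t1 + s) (b tb).
  by rewrite subrr normr0; split; [rewrite addr_ge0// ltW|exact: tsd.2|].
have bnear t : near_b t (b tb) -> `|t - tb| < d1 -> `|b t - b tb| < rho / 2.
  move=> nt td; have [tT _] := domain nt; have [t0 _ _] := nt.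
  by rewrite distrC; apply: h1; [rewrite /= in_itv/= t0 ltW|rewrite distrC].
have b1n := bnear _ nt1 (ltac:(apply: lt_le_trans t1d (le_trans del1 _); rewrite ler_pdivrMr// mulr2n mulrDr mulr1 lerDl ltW//)).
have b2n := bnear _ nts tsd.1.
have r2 : rho / 2 <= q / 4 by apply: le_trans rq; rewrite ler_pdivrMr// mulr2n mulrDr mulr1 lerDl ltW.
set x := b (t1 + s) in b2n *.
have [xb|bx] := leP x (b t1).
  by apply: le_trans xb _; rewrite lerDl mulr_ge0 ?(ltW s0)// divr_ge0// divr_ge0// ltW.
have xr : x <= b t1 + rho.
  rewrite -lerBlDl; apply: le_trans (ler_norm _) _; rewrite (_ : x - b t1 = (x - b tb) - (b t1 - b tb)); last by ring.
  by apply: le_trans (ler_normB _ _) _; rewrite [leRHS]splitr lerD// ltW.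
have b1q : `|b t1 - b tb| <= q / 4 by exact: le_trans (ltW b1n) r2.
have nb1 : near_b t1 (b t1) by split => //; [exact: le_lt_trans q4|exact: le_lt_trans q4].
have xq : `|x - b tb| < q by apply: lt_le_trans b2n (le_trans r2 (ltW q4)).
have nx : near_b (t1 + s) x by split => //; [rewrite addr_ge0// ltW|exact: tsd.2].
have nd := nondegenerate nb1 (ltW bx) xq.
have cmp := @comparison t1 rho s A B N t10 t1q b1q (ltac:(by rewrite rho0)) (ltac:(by rewrite s0)) W0
  erefl Br erefl NA WA x (ltac:(by rewrite (ltW bx))).
have gx : v (t1 + s) x <= g x.
  by rewrite leNgt; apply/negP => /(contin nx); rewrite /x ltxx.
have y0 : 0 < x - b t1 by rewrite subr_gt0.
have le : c / 2 * (x - b t1) ^+ 2 <= s * (A * (x - b t1)).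
  by apply: le_trans nd (le_trans _ cmp); rewrite lerD2l lerN2.
have c20 : 0 < c / 2 by rewrite divr_gt0.
have le' : (x - b t1) * (c / 2) <= A * s.
  rewrite -(ler_pM2r y0) (_ : (x - b t1) * (c / 2) * _ = c / 2 * (x - b t1) ^+ 2); last by ring.
  by rewrite (_ : A * s * _ = s * (A * (x - b t1)))//; ring.
by rewrite -lerBlDl mulrAC ler_pdivlMr.
Qed.
End boundary.

(** * Derivatives in epsilon-delta form and the Taylor-Peano bound *)

Section derivatives.
Variable R : realType.
Implicit Types (f : R -> R) (S : set R).

Definition expands f x l := forall eps : R, 0 < eps -> exists2 del, 0 < del &
  forall y, `|y - x| < del -> `|f y - f x - l * (y - x)| <= eps * `|y - x|.

Lemma derivative_within_dist S f x l eps : derivative_within S f x l -> 0 < eps ->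
  exists2 del, 0 < del & forall y, S y -> `|y - x| < del -> `|f y - f x - l * (y - x)| <= eps * `|y - x|.
Proof.
move=> /cvgrPdist_lt h eps0; have := h _ eps0.
rewrite near_withinE => /nbhs_ballP[del del0 hd]; exists del => // y Sy yx.
have [->|ne] := eqVneq y x; first by rewrite !subrr mulr0 subr0 normr0 mulr0.
have := hd y (ltac:(by rewrite /ball/= distrC)) ne Sy => /ltW le.
rewrite (_ : f y - f x - l * (y - x) = - (l - (f y - f x) / (y - x)) * (y - x)).
  by rewrite normrM normrN ler_wpM2r.
by field; rewrite subr_eq0.
Qed.

Lemma derivative_expands S f x l q : 0 < q -> (forall y, `|y - x| < q -> S y) ->
  derivative_within S f x l -> expands f x l.
Proof.
move=> q0 qS df eps eps0; have [del del0 h] := derivative_within_dist df eps0.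
exists (Num.min del q); first by rewrite lt_min del0.
by move=> y; rewrite lt_min => /andP[y1 y2]; apply: h => //; exact: qS.
Qed.

Lemma expands_continuous f x l : expands f x l -> {for x, continuous f}.
Proof.
move=> h; apply/cvgrPdist_lt => eps eps0; have [del del0 hd] := h 1 ltr01.
have l1 : 0 < `|l| + 1 by rewrite ltr_wpDl.
apply/nbhs_ballP; exists (Num.min del (eps / (`|l| + 1))); first by rewrite /= lt_min del0 divr_gt0.
move=> y; rewrite /ball/= distrC lt_min => /andP[y1 y2]; rewrite distrC.
rewrite (_ : f y - f x = (f y - f x - l * (y - x)) + l * (y - x)); last by ring.
apply: le_lt_trans (ler_normD _ _) _; rewrite normrM.
apply: le_lt_trans (_ : (`|l| + 1) * `|y - x| < eps).
  by rewrite mulrDl addrC lerD2l; exact: hd.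
by rewrite mulrC -ltr_pdivlMr.
Qed.

Lemma expands_is_derive f x l : expands f x l -> is_derive x 1 f l.
Proof.
move=> h.
have lim_ : (fun e : R => e^-1 *: (f (e *: (1 : R) + x) - f x)) @ 0^' --> l.
  apply/cvgrPdist_lt => eps eps0; have [del del0 hd] := h _ (divr_gt0 eps0 (ltr0n _ 2)).
  apply/nbhs_ballP; exists del => // e; rewrite /ball/= sub0r normrN => ed e0.
  have := hd (e + x); rewrite (_ : e + x - x = e); last by ring.
  move=> /(_ ed) le; rewrite -[e *: 1]/(e * 1) mulr1 -[_ *: _]/(_ * _).
  rewrite (_ : l - _ = - (e^-1 * (f (e + x) - f x - l * e))); last by field.
  rewrite normrN normrM normfV -(ltr_pM2l (_ : 0 < `|e|)) ?normr_gt0//.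
  rewrite mulrA divff ?normr_eq0// mul1r; apply: le_lt_trans le _.
  by rewrite mulrC ltr_pM2l ?normr_gt0// ltr_pdivrMr// ltr_pMr// ltr1n.
by apply: DeriveDef; [apply/cvg_ex; exists l|exact: cvg_lim].
Qed.

Lemma expands_mvt f (f1 : R -> R) a c : a < c -> (forall x, a < x < c -> expands f x (f1 x)) ->
  {within `[a, c], continuous f} -> exists2 z, a < z < c & f c - f a = f1 z * (c - a).
Proof.
move=> ac df cf; have [||z zI e] := @MVT R f f1 a c ac.
- by move=> x; rewrite in_itv/= => xI; apply: expands_is_derive; exact: df.
- exact: cf.
- by exists z => //; move: zI; rewrite in_itv.
Qed.

(** Only differentiability of [f1] at the single point [x] is available, so the mean value theorem
    is applied to the remainder [k], whose derivative [k1] is o(|y - x|). *)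
Lemma taylor2 f (f1 : R -> R) (f2 x q : R) : 0 < q -> (forall y, `|y - x| < q -> expands f y (f1 y)) -> expands f1 x f2 ->
  forall eps, 0 < eps -> exists2 del, 0 < del & forall y, `|y - x| < del ->
  f y - f x - f1 x * (y - x) - f2 / 2 * (y - x) ^+ 2 <= eps * (y - x) ^+ 2.
Proof.
move=> q0 df df1 eps eps0; have [d1 d10 h1] := df1 eps eps0.
pose k y := f y - f x - f1 x * (y - x) - f2 / 2 * (y - x) ^+ 2.
pose k1 y := f1 y - f1 x - f2 * (y - x).
exists (Num.min d1 q); first by rewrite lt_min d10.
move=> y; rewrite lt_min => /andP[y1 y2].
have kx : k x = 0 by rewrite /k; ring.
have dk z : `|z - x| < q -> expands k z (k1 z).
  move=> zq e e0; have [r r0 hr] := df z zq _ (divr_gt0 e0 (ltr0n _ 2)).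
  have f21 : 0 < `|f2| + 1 by rewrite ltr_wpDl.
  exists (Num.min r (e / (`|f2| + 1))); first by rewrite lt_min r0 divr_gt0.
  move=> z'; rewrite lt_min => /andP[z1 z2].
  rewrite (_ : k z' - k z - k1 z * (z' - z) = (f z' - f z - f1 z * (z' - z)) - f2 / 2 * (z' - z) ^+ 2); last by rewrite /k /k1; field.
  apply: le_trans (ler_normB _ _) _.
  rewrite (_ : e * `|z' - z| = e / 2 * `|z' - z| + e / 2 * `|z' - z|); last by field.
  apply: lerD; first exact: hr.
  rewrite normrM normrX expr2 mulrA ler_wpM2r// normrM (ger0_norm (_ : 0 <= 2^-1)) ?invr_ge0//.
  by move: z2; rewrite ltr_pdivlMr//; have := normr_ge0 (z' - z); lra.
have kc u w : x - q < u -> w < x + q -> {within `[u, w], continuous k}.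
  move=> u1 w1; apply: continuous_in_subspaceT => z; rewrite inE/= in_itv/= => /andP[z1 z2].
  apply: (@expands_continuous _ _ (k1 z)); apply: dk; rewrite ltr_norml; apply/andP; split; lra.
have kb z : `|z - x| <= `|y - x| -> `|k1 z| <= eps * `|y - x|.
  by move=> zy; apply: le_trans (h1 z (le_lt_trans zy y1)) _; rewrite ler_wpM2l// ltW.
have main z : `|z - x| <= `|y - x| -> k y = k1 z * (y - x) -> k y <= eps * (y - x) ^+ 2.
  move=> zy ->; apply: le_trans (ler_norm _) _; rewrite normrM.
  by rewrite -(real_normK (num_real (y - x))) expr2 mulrA ler_wpM2r//; exact: kb.
have [xy|yx|xy] := ltgtP x y; last by rewrite -xy !subrr expr0n/= !mulr0 !subr0.
  have yq : y - x < q by apply: le_lt_trans y2; exact: ler_norm.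
  have [||z /andP[z1 z2] e] := @expands_mvt k k1 x y xy.
  - by move=> z /andP[z1 z2]; apply: dk; rewrite ger0_norm; lra.
  - by apply: kc; lra.
  apply: (main z); last by rewrite -e kx subr0.
  by rewrite !ger0_norm; lra.
have yq : x - y < q by apply: le_lt_trans y2; rewrite distrC; exact: ler_norm.
have [||z /andP[z1 z2] e] := @expands_mvt k k1 y x yx.
- by move=> z /andP[z1 z2]; apply: dk; rewrite ltr0_norm; lra.
- by apply: kc; lra.
apply: (main z); first by rewrite !ltr0_norm; lra.
by move: e; rewrite kx; lra.
Qed.

Lemma within2_dist (S : set (R * R)) (F : R -> R -> R) t x eps :
  {within S, continuous (fun p : R * R => F p.1 p.2)} -> S (t, x) -> 0 < eps ->
  exists2 q, 0 < q & forall u y, S (u, y) -> `|u - t| < q -> `|y - x| < q -> `|F u y - F t x| < eps.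
Proof.
rewrite subspace_continuousP => h Sx eps0; have /cvgrPdist_lt/(_ _ eps0) := h _ Sx.
rewrite near_withinE => /nbhs_ballP[q q0 hq]; exists q => // u y Suy u1 y1.
by rewrite distrC; apply: (hq (u, y)) => //; split; rewrite /ball/= distrC.
Qed.
End derivatives.

Lemma norm_between (R : realDomainType) (a e l u z : R) :
  `|l - a| < e -> `|u - a| < e -> l <= z <= u -> `|z - a| < e.
Proof.
rewrite !ltr_norml => /andP[la _] /andP[_ ua] /andP[lz zu]; apply/andP; split.
  by apply: lt_le_trans la _; rewrite lerD2r.
by apply: le_lt_trans ua; rewrite lerD2r.
Qed.

(** * Local data around a boundary point from Assumption (A) *)

Section local_data.
Variables (R : realType) (T : R) (I : set R) (mu sigma g r b : R -> R) (v : R -> R -> R).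
Hypothesis I_open : open I.
Hypothesis g_cont : continuous g.
Hypothesis r_cont : continuous r.
Hypothesis r_ge0 : forall x, 0 <= r x.
Hypothesis v_cont : {within `[0, T] `*` I, continuous (fun p : R * R => v p.1 p.2)}.
Hypothesis b_in : forall t : R, 0 <= t <= T -> I (b t).
Hypothesis b_cont : {within `[0, T], continuous b}.
Hypothesis continuation_set : forall t x : R, 0 <= t < T -> I x -> g x < v t x <-> b t < x.
Hypothesis assumpA : assumption_A T I mu sigma g r b v.
Hypothesis v_ge : forall t x, 0 <= t < T -> I x -> g x <= v t x.
Hypothesis v_mono : forall t s x, 0 <= t -> 0 <= s -> t + s <= T -> I x -> v (t + s) x <= v t x.
Hypothesis superh : forall t x m a p, 0 <= t -> t < T -> I x ->
  {for x, continuous mu} -> {for x, continuous sigma} ->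
  (forall eps, 0 < eps -> exists2 rho0, 0 < rho0 & exists2 D0, 0 < D0 &
    forall D y, 0 < D <= D0 -> `|y - x| <= rho0 ->
    v t x + m * (y - x) + a / 2 * (y - x) ^+ 2 + (p - eps) * D <= v (t + D) y) ->
  p + mu x * m + 2^-1 * sigma x ^+ 2 * a - r x * v t x <= 0.
Hypothesis subh : forall t x m a p, 0 <= t -> t < T -> I x ->
  {for x, continuous mu} -> {for x, continuous sigma} -> b t < x ->
  (forall eps, 0 < eps -> exists2 rho0, 0 < rho0 & exists2 D0, 0 < D0 &
    forall D y, 0 < D <= D0 -> `|y - x| <= rho0 ->
    v (t + D) y <= v t x + m * (y - x) + a / 2 * (y - x) ^+ 2 + (p + eps) * D) ->
  0 <= p + mu x * m + 2^-1 * sigma x ^+ 2 * a - r x * v t x.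

Let continuous_dist (f : R -> R) x eps : {for x, continuous f} -> 0 < eps ->
  exists2 q, 0 < q & forall y, `|y - x| < q -> `|f y - f x| < eps.
Proof.
move=> /cvgrPdist_lt h eps0; have /nbhs_ballP[q q0 hq] := h _ eps0.
by exists q => // y yx; rewrite distrC; apply: hq; rewrite /ball/= distrC.
Qed.

Lemma boundary_locally_lipschitz tb : 0 <= tb < T -> exists2 L, 0 <= L & exists2 del, 0 < del &
  forall t1 s, 0 <= t1 -> `|t1 - tb| < del -> 0 < s < del -> b (t1 + s) <= b t1 + L * s.
Proof.
move=> tbT; have [tb0 tbT'] := andP tbT.
have [Q /= [[[_ [Op oO QE]] Qdom Qtb] [vt [vx [dvt dvx cvt cvx]]] [g1 [g2 [[dg _] [dg1 cg2] h0]]]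
  [mu1 [r1 [_ [[dmu _] _ _ _ _]]]] [sigma1 [cc [[dsg _] _ cc0 sgcc]]]]] := assumpA tbT.
set Qb := rel_closure T I Q in Qdom dvt dvx cvt cvx dg dg1 cg2 h0 dmu dsg sgcc.
set S := [set x | exists t, Qb (t, x)] in dg dg1 cg2 h0 dmu dsg sgcc.
set bb := b tb.
have Ibb : I bb by apply: b_in; rewrite tb0 ltW.
have [q1 q10 h1] : exists2 q1, 0 < q1 & forall t x, 0 <= t -> `|t - tb| < q1 -> `|x - bb| < q1 -> [/\ t < T, I x & Qb (t, x)].
  have : nbhs (tb, bb) Op by apply: open_nbhs_nbhs; split => //; move: Qtb; rewrite QE => -[].
  move=> /nbhs_ballP[p1 p10 hp1].
  have /nbhs_ballP[p2 p20 hp2] := open_nbhs_nbhs (conj I_open Ibb).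
  exists (Num.min p1 (Num.min p2 (T - tb))); first by rewrite !lt_min p10 p20 subr_gt0.
  move=> t x t0; rewrite !lt_min => /andP[t1 /andP[_ t2]] /andP[x1 /andP[x2 _]].
  have tT : t < T by move: t2; rewrite ltr_norml => /andP[_ h]; lra_only h.
  have Ix : I x by apply: hp2; rewrite /ball/= distrC.
  split => //; split; last by split => //=; rewrite in_itv/= t0 ltW.
  apply: subset_closure; rewrite QE; split; last by split => //=; rewrite in_itv/= t0.
  by apply: hp1; split; rewrite /ball/= distrC.
have bbn : `|bb - bb| < q1 by rewrite subrr normr0.
have tbn : `|tb - tb| < q1 by rewrite subrr normr0.
have [_ _ Qbb] := h1 tb bb tb0 tbn bbn.
have Sn x : `|x - bb| < q1 -> S x.
  by move=> xq; exists tb; have [] := h1 tb x tb0 tbn xq.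
have inner x : `|x - bb| < q1 -> exists2 e, 0 < e & forall y, `|y - x| < e -> `|y - bb| < q1.
  move=> xq; exists (q1 - `|x - bb|); first by rewrite subr_gt0.
  by move=> y yx; apply: le_lt_trans (ler_distD x _ _) _; rewrite -ltrBrDr.
have exp_S (f f1 : R -> R) x : (forall x, S x -> derivative_within S f x (f1 x)) -> `|x - bb| < q1 -> expands f x (f1 x).
  move=> df xq; have [e e0 he] := inner x xq.
  by apply: (derivative_expands e0 _ (df x (Sn x xq))) => y /he; exact: Sn.
have cmu x : `|x - bb| < q1 -> {for x, continuous mu} by move=> /(exp_S _ _ _ dmu) /expands_continuous.
have csg x : `|x - bb| < q1 -> {for x, continuous sigma} by move=> /(exp_S _ _ _ dsg) /expands_continuous.
have tinner t x : 0 <= t -> `|t - tb| < q1 -> `|x - bb| < q1 -> exists2 e, 0 < e &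
    forall u y, `|u - t| < e -> `|y - x| < e -> `|u - tb| < q1 /\ `|y - bb| < q1.
  move=> t0 tq xq; have [e e0 he] := inner x xq.
  exists (Num.min e (q1 - `|t - tb|)); first by rewrite lt_min e0 subr_gt0.
  move=> u y; rewrite !lt_min => /andP[_ u2] /andP[y1 _]; split; last exact: he.
  by apply: le_lt_trans (ler_distD t _ _) _; rewrite -ltrBrDr.
have vx_exp t x : 0 <= t -> `|t - tb| < q1 -> `|x - bb| < q1 -> expands (v t) x (vx t x).
  move=> t0 tq xq; have [e e0 he] := inner x xq; have [_ _ Qtx] := h1 t x t0 tq xq.
  by apply: (derivative_expands e0 _ (dvx t x Qtx)) => y /he yq; have [] := h1 t y t0 tq yq.
(* The time [t] may be 0, where the derivative is one-sided; the mean value theorem needs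
   derivatives only at intermediate times. *)
have vt_mvt t s x : 0 <= t -> 0 < s -> `|t - tb| < q1 -> `|t + s - tb| < q1 -> `|x - bb| < q1 ->
    exists2 z, t < z < t + s & v (t + s) x - v t x = vt z x * s.
  move=> t0 s0 tq tsq xq; have ts : t < t + s by rewrite ltrDl.
  have btw u : t <= u <= t + s -> `|u - tb| < q1.
    exact: norm_between.
  have [||z zI e] := @expands_mvt R (v ^~ x) (vt ^~ x) t (t + s) ts; last by exists z => //; rewrite e addrAC subrr add0r.
  - move=> u /andP[u1 u2]; have u0 : 0 <= u by apply: le_trans t0 (ltW u1).
    have [_ _ Qux] := h1 u x u0 (btw u (ltac:(by rewrite !ltW))) xq.
    apply: (@derivative_expands _ _ _ _ _ (Num.min (u - t) (t + s - u)) _ _ (dvt u x Qux)).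
      by rewrite lt_min !subr_gt0 u1.
    move=> y; rewrite lt_min !ltr_norml => /andP[/andP[y1 _] /andP[_ y2]].
    have ty : t <= y <= t + s by apply/andP; split; [lra_only y1|lra_only y2].
    have y0 : 0 <= y by apply: le_trans t0 _; case/andP: ty.
    by have [] := h1 y x y0 (btw y ty) xq.
  - apply: within_continuous_intro => u e; rewrite /= in_itv/= => uI e0.
    have u0 : 0 <= u by apply: le_trans t0 _; case/andP: uI.
    have [uT Ix _] := h1 u x u0 (btw u uI) xq.
    have uA : (`[0, T]%classic `*` I) (u, x) by split => //=; rewrite in_itv/= u0 ltW.
    have [p p0 hp] := within2_dist v_cont uA e0; exists p => // u'; rewrite /= in_itv/= => uI' uu.
    have u0' : 0 <= u' by apply: le_trans t0 _; case/andP: uI'.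
    have [uT' _ _] := h1 u' x u0' (btw u' uI') xq.
    rewrite distrC; apply: hp; first by split => //=; rewrite in_itv/= u0' ltW.
      by rewrite distrC.
    by rewrite subrr normr0.
have vle y : `|y - bb| < q1 -> y <= bb -> v tb y = g y.
  move=> yq yb; have [_ Iy _] := h1 tb y tb0 tbn yq; apply/eqP; rewrite eq_le v_ge// andbT leNgt.
  by apply/negP => /(continuation_set tbT Iy); rewrite ltNge yb.
(* Smooth fit: at time [tb] the value equals [g] on the left of the boundary, so the two derivatives
   at [bb] agree when tested from the left. *)
have fit : vx tb bb = g1 bb.
  apply/eqP; rewrite -subr_eq0 -normr_le0; apply/ler_addgt0Pr => e e0; rewrite add0r.
  have [p1 p10 k1] := vx_exp tb bb tb0 tbn bbn _ (divr_gt0 e0 (ltr0n _ 2)).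
  have [p2 p20 k2] := exp_S g g1 bb dg bbn _ (divr_gt0 e0 (ltr0n _ 2)).
  pose h := Num.min p1 (Num.min p2 q1) / 2.
  have m0 : 0 < Num.min p1 (Num.min p2 q1) by rewrite !lt_min p10 p20.
  have hm : h < Num.min p1 (Num.min p2 q1) by rewrite /h ltr_pdivrMr// ltr_pMr// ltr1n.
  have h0' : 0 < h by rewrite divr_gt0.
  move: hm; rewrite !lt_min => /andP[hp1 /andP[hp2 hq]].
  have yE : bb - h - bb = - h by ring.
  have yn : `|bb - h - bb| = h by rewrite yE normrN gtr0_norm.
  have := k1 (bb - h); have := k2 (bb - h); rewrite yn => /(_ hp2) a2 /(_ hp1) a1.
  have yb : bb - h <= bb by rewrite gerBl ltW.
  have e1 : v tb (bb - h) = g (bb - h) by apply: vle => //; rewrite yn.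
  have e2 : v tb bb = g bb by apply: vle.
  rewrite -(ler_pM2r h0') -[X in _ * X <= _]yn -normrM.
  rewrite (_ : (vx tb bb - g1 bb) * (bb - h - bb) =
    (g (bb - h) - g bb - g1 bb * (bb - h - bb)) - (v tb (bb - h) - v tb bb - vx tb bb * (bb - h - bb))); last first.
    by rewrite e1 e2; ring.
  by apply: le_trans (ler_normB _ _) _; rewrite [e]splitr mulrDl lerD.
(* Half of -h at the boundary point. By smooth fit [F] equals [- (2 * eta)] there, and continuity
   keeps it below [- eta] nearby; this is [strict]. *)
pose eta := - (generator mu sigma g1 g2 bb - r bb * g bb) / 2.
have eta0 : 0 < eta by rewrite /eta divr_gt0// oppr_gt0; apply: h0; exact: Sn.
pose F (p : R * R) := mu p.2 * vx p.1 p.2 + 2^-1 * sigma p.2 ^+ 2 * g2 p.2 - r p.2 * v p.1 p.2.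
have Fbb : F (tb, bb) = - (2 * eta).
  by rewrite /F/= fit (vle bb)// /eta /generator; field.
have cF : F p @[p --> within Qb (nbhs (tb, bb))] --> F (tb, bb).
  have sn (f : R -> R) : {for bb, continuous f} -> f p.2 @[p --> within Qb (nbhs (tb, bb))] --> f bb.
    move=> cf; apply: cvg_within_filter; apply: (@cvg_comp _ _ _ (fun p : R * R => p.2) f _ (nbhs bb)) => //.
    exact: cvg_snd.
  have cv : v p.1 p.2 @[p --> within Qb (nbhs (tb, bb))] --> v tb bb.
    apply/cvgrPdist_lt => e e0.
    have Abb : (`[0, T]%classic `*` I) (tb, bb) by split => //=; rewrite in_itv/= tb0 ltW.
    have [p p0 hp] := within2_dist v_cont Abb e0.
    rewrite near_withinE; apply/nbhs_ballP; exists p => // -[u y] [u1 y1] Quy; rewrite distrC.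
    apply: hp; [|by rewrite distrC|by rewrite distrC].
    by have [] := Qdom _ Quy; rewrite /= !in_itv/= => /andP[-> /ltW ->].
  have cg2' : g2 p.2 @[p --> within Qb (nbhs (tb, bb))] --> g2 bb.
    apply/cvgrPdist_lt => e e0.
    have [p p0 hp] := within_continuous_dist cg2 (Sn bb bbn) e0.
    rewrite near_withinE; apply/nbhs_ballP; exists p => // -[u y] [u1 y1] Quy.
    by apply: hp => //; exists u.
  have cvx' : vx p.1 p.2 @[p --> within Qb (nbhs (tb, bb))] --> vx tb bb.
    by move: cvx; rewrite subspace_continuousP => /(_ _ Qbb).
  apply: cvgB; last by apply: cvgM => //; apply: sn; exact: r_cont.
  apply: cvgD; first by apply: cvgM => //; apply: sn; exact: cmu.
  apply: cvgM => //; apply: cvgM; first exact: cvg_cst.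
  by rewrite expr2; under eq_fun do rewrite expr2; apply: cvgM; apply: sn; exact: csg.
have [q2 q20 h2] : exists2 q2, 0 < q2 & forall t x, Qb (t, x) -> `|t - tb| < q2 -> `|x - bb| < q2 -> F (t, x) <= - eta.
  have /cvgrPdist_lt/(_ _ eta0) := cF; rewrite near_withinE => /nbhs_ballP[q2 q20 hq2].
  exists q2 => // t x Qtx t1 x1; have := hq2 (t, x) (ltac:(by split; rewrite /ball/= distrC)) Qtx.
  by rewrite Fbb /= ltr_norml => /andP[h _]; lra_only h.
have [q3 q30 h3] := within2_dist cvt Qbb ltr01.
have [q4 q40 h4] := continuous_dist (cmu bb bbn) ltr01.
have [q5 q50 h5] := continuous_dist (csg bb bbn) ltr01.
pose q := Num.min q1 (Num.min q2 (Num.min q3 (Num.min q4 q5))).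
have q0 : 0 < q by rewrite !lt_min q10 q20 q30 q40.
have qle z : z < q -> [/\ z < q1, z < q2, z < q3, z < q4 & z < q5].
  by rewrite !lt_min => /andP[-> /andP[-> /andP[-> /andP[-> ->]]]].
pose W := `|vt tb bb| + 1.
pose M := `|mu bb| + `|sigma bb| + 1.
have normle (x y : R) : `|x - y| < 1 -> `|x| <= `|y| + 1.
  by move=> h; rewrite -(subrK y x) addrC; apply: le_trans (ler_normD _ _) _; rewrite lerD2l ltW.
have vtW t x : 0 <= t -> `|t - tb| < q -> `|x - bb| < q -> `|vt t x| <= W.
  move=> t0 /qle[t1 _ t3 _ _] /qle[x1 _ x3 _ _]; apply: normle; apply: h3 => //.
  by have [] := h1 t x t0 t1 x1.
apply: (@locally_lipschitz R T q tb W M cc eta I mu sigma g g1 g2 r b v vt vx) => //.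
- by move=> t x [t0 /qle[t1 _ _ _ _] /qle[x1 _ _ _ _]]; have [] := h1 t x t0 t1 x1.
- move=> t x [t0 /qle[t1 _ _ _ _] /qle[x1 _ _ _ _]]; have [tT Ix _] := h1 t x t0 t1 x1.
  by apply: v_ge => //; rewrite t0.
- move=> t x [t0 /qle[t1 _ _ _ _] /qle[x1 _ _ _ _]]; have [tT Ix _] := h1 t x t0 t1 x1.
  by apply: continuation_set => //; rewrite t0.
- move=> t s x [t0 tq xq] s0 [_ tsq _].
  have [t1 _ _ _ _] := qle _ tq; have [x1 _ _ _ _] := qle _ xq; have [ts1 _ _ _ _] := qle _ tsq.
  have [tT Ix _] := h1 t x t0 t1 x1; have [tsT _ _] := h1 (t + s) x (addr_ge0 t0 s0) ts1 x1.
  rewrite v_mono ?(ltW tsT)//=.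
  move: s0; rewrite le_eqVlt => /predU1P[<-|s0]; first by rewrite addr0 mulr0 addr0.
  have [z /andP[z1 z2] e] := vt_mvt t s x t0 s0 t1 ts1 x1.
  have zq : `|z - tb| < q.
    by apply: norm_between tq tsq _; rewrite !ltW.
  have := vtW z x (le_trans t0 (ltW z1)) zq xq; rewrite ler_norml => /andP[w1 _].
  have : - W * s <= vt z x * s by rewrite ler_wpM2r// ltW.
  by rewrite -e => h; lra_only h.
- move=> t x m a p [t0 /qle[t1 _ _ _ _] /qle[x1 _ _ _ _]]; have [tT Ix _] := h1 t x t0 t1 x1.
  by apply: superh => //; [exact: cmu|exact: csg].
- move=> t x m a p [t0 /qle[t1 _ _ _ _] /qle[x1 _ _ _ _]]; have [tT Ix _] := h1 t x t0 t1 x1.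
  by apply: subh => //; [exact: cmu|exact: csg].
- move=> t x eps [t0 /qle[t1 _ _ _ _] /qle[x1 _ _ _ _]] eps0; have [tT Ix Qtx] := h1 t x t0 t1 x1.
  have [e e0 he] := tinner t x t0 t1 x1.
  have [p p0 hp] := within2_dist cvt Qtx eps0.
  exists (Num.min e p / 2); first by rewrite divr_gt0// lt_min e0.
  exists (Num.min e p / 2); first by rewrite divr_gt0// lt_min e0.
  have half z : z <= Num.min e p / 2 -> z < e /\ z < p.
    have m0 : 0 < Num.min e p by rewrite lt_min e0.
    move=> zm; have : z < Num.min e p by apply: le_lt_trans zm _; rewrite ltr_pdivrMr// ltr_pMr// ltr1n.
    by rewrite lt_min => /andP[].
  move=> D y /andP[D0 /half[De Dp]] /half[ye yp].
  have [tDq yq] := he (t + D) y (ltac:(by rewrite addrAC subrr add0r gtr0_norm)) ye.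
  have [z /andP[z1 z2] ->] := vt_mvt t D y t0 D0 t1 tDq yq.
  have zt : `|z - t| < D by rewrite gtr0_norm ?subr_gt0// ltrBlDl.
  have [zq _] := he z y (lt_trans zt De) ye.
  have [_ _ Qzy] := h1 z y (le_trans t0 (ltW z1)) zq yq.
  rewrite -mulrBl normrM (gtr0_norm D0) ler_wpM2r ?(ltW D0)//; apply: ltW.
  by apply: hp => //; exact: lt_trans Dp.
- move=> t x eps [t0 /qle[t1 _ _ _ _] /qle[x1 _ _ _ _]] eps0; exact: vx_exp.
- move=> x eps /qle[x1 _ _ _ _] eps0; have [e e0 he] := inner x x1.
  apply: (taylor2 e0) => //; last exact: exp_S.
  by move=> y /he yq; exact: exp_S.
- move=> t x [t0 /qle[t1 _ _ _ _] /qle[x1 _ _ _ _]]; have [tT Ix Qtx] := h1 t x t0 t1 x1.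
  have [e e0 he] := inner x x1.
  have slice (f : R -> R -> R) : {within Qb, continuous (fun p : R * R => f p.1 p.2)} -> {for x, continuous (f t)}.
    move=> cf; apply/cvgrPdist_lt => eps eps0; have [p p0 hp] := within2_dist cf Qtx eps0.
    apply/nbhs_ballP; exists (Num.min p e); first by rewrite /= lt_min p0.
    move=> y; rewrite /ball/= distrC lt_min => /andP[y1 y2]; rewrite distrC; apply: hp => //; last by rewrite subrr normr0.
    by have [] := h1 t y t0 t1 (he y y2).
  by split; [exact: expands_continuous (vx_exp t x t0 t1 x1)|exact: slice|exact: slice].
- move=> x /qle[x1 _ _ _ _]; split; [exact: cmu|exact: csg|exact: r_cont|exact: g_cont].
- move=> x /qle[x1 _ _ x4 x5]; split; last by apply: sgcc; exact: Sn.
    by apply: le_trans (normle _ _ (h4 x x4)) _; rewrite /M addrAC lerDl.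
  by apply: le_trans (normle _ _ (h5 x x5)) _; rewrite /M -addrA lerDr.
- move=> t x [t0 /qle[t1 t2 _ _ _] /qle[x1 x2 _ _ _]]; have [_ _ Qtx] := h1 t x t0 t1 x1.
  exact: (h2 t x Qtx).
- by rewrite addr_ge0.
Qed.
End local_data.

(** * Globalization and conclusion *)

(** Continuous induction: the supremum of the times up to which some constant works can be passed by
    the local estimate there, with the larger of the two constants. Intervals straddling [tau] are
    split, and the two linear bounds add up. *)
Lemma increments_le_of_local (R : realType) (b : R -> R) T1 : 0 <= T1 ->
  (forall tb, 0 <= tb <= T1 -> exists2 L, 0 <= L & exists2 del, 0 < del &
     forall t1 s, 0 <= t1 -> `|t1 - tb| < del -> 0 < s < del -> b (t1 + s) <= b t1 + L * s) ->
  exists2 L, 0 <= L & forall t t', 0 <= t -> t <= t' -> t' <= T1 -> b t' <= b t + L * (t' - t).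
Proof.
move=> T10 loc.
pose E := [set tau | 0 <= tau <= T1 /\ exists2 L, 0 <= L &
  forall t t', 0 <= t -> t <= t' -> t' <= tau -> b t' <= b t + L * (t' - t)].
have E0 : E 0.
  split; first by rewrite lexx.
  exists 0 => // t t' t0 tt t'0; have -> : t' = t by lra_only tt t'0 t0.
  by rewrite mul0r addr0.
have ubE : ubound E T1 by move=> tau [/andP[]].
have hs : has_sup E by split; [exists 0|exists T1].
set sg := sup E.
have sg1 : sg <= T1 by apply: ge_sup; [exists 0|].
have sg0 : 0 <= sg by apply: ub_le_sup => //; exists T1.
have [L0 L00 [del del0 hd]] := loc sg (ltac:(by rewrite sg0)).
have [tau [/andP[tau0 tau1] [L L0' hL]] taus] := sup_adherent (ltac:(by rewrite divr_gt0) : 0 < del / 2) hs.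
rewrite -/sg in taus.
have tau_sg : tau <= sg.
  apply: ub_le_sup; first by exists T1.
  by split; [rewrite tau0|exists L].
pose new := Num.min T1 (sg + del / 4).
have new1 : new <= T1 by rewrite ge_min lexx.
have new2 : new <= sg + del / 4 by rewrite ge_min lexx orbT.
pose K := Num.max L L0.
have KL : L <= K by rewrite le_max lexx.
have KL0 : L0 <= K by rewrite le_max lexx orbT.
have K0 : 0 <= K by exact: le_trans KL.
have locK t t' : 0 <= t -> tau <= t -> t <= t' -> t' <= new -> b t' <= b t + K * (t' - t).
  move=> t0 taut; rewrite le_eqVlt => /predU1P[<- _|tt t'n]; first by rewrite subrr mulr0 addr0.
  have td : `|t - sg| < del by rewrite ltr_norml; apply/andP; split; [lra_only taut taus del0|lra_only tt t'n new2 del0].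
  have sd : 0 < t' - t < del by rewrite subr_gt0 tt; lra_only taut taus t'n new2 del0.
  have := hd t (t' - t) t0 td sd.
  rewrite (_ : t + (t' - t) = t'); last by ring.
  have : L0 * (t' - t) <= K * (t' - t) by rewrite ler_wpM2r// subr_ge0 ltW.
  by move=> h1 h2; lra_only h1 h2.
have locL t t' : 0 <= t -> t <= t' -> t' <= tau -> b t' <= b t + K * (t' - t).
  move=> t0 tt t'n; apply: le_trans (hL t t' t0 tt t'n) _.
  by rewrite lerD2l ler_wpM2r// subr_ge0.
have hK t t' : 0 <= t -> t <= t' -> t' <= new -> b t' <= b t + K * (t' - t).
  move=> t0 tt t'n; have [t't|tt'] := leP t' tau; first exact: locL.
  have [taut|ttau] := leP tau t; first exact: locK.
  apply: le_trans (locK tau t' tau0 (lexx _) (ltW tt') t'n) _.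
  have := locL t tau t0 (ltW ttau) (lexx _).
  rewrite (_ : K * (t' - t) = K * (tau - t) + K * (t' - tau)); last by ring.
  by move=> h; lra_only h.
have newE : E new.
  split; last by exists K.
  by rewrite new1 andbT le_min T10 addr_ge0// divr_ge0// ltW.
have nsg : new <= sg by apply: ub_le_sup => //; exists T1.
exists K => // t t' t0 tt t'T; apply: hK => //; rewrite le_min t'T.
move: nsg; rewrite ge_min => /orP[h|h]; last by exfalso; lra_only h del0.
by apply: le_trans t'T (le_trans h _); rewrite lerDl divr_ge0// ltW.
Qed.

(** Immediate stopping is admissible, and its payoff is almost surely [g x]. *)
Lemma stop_now_le_value d (Omega : measurableType d) (R : realType) (P : probability Omega R)
    (B : R -> Omega -> R) (T : R) (I : set R) (mu sigma g r : R -> R)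
    (X : R -> Omega -> R) (t x : R) (v : R) :
  measure_is_complete P -> t <= T -> strong_solution P B I mu sigma T t x X ->
  (forall tau, stopping_time P X T t tau -> P.-integrable [set: Omega] (EFin \o payoff g r X t tau)) ->
  v%:E = value P g r T t X -> g x <= v.
Proof.
move=> P_complete tT [_ _ _ X_x _] int vE.
have st : stopping_time P X T t (fun=> 0).
  split=> [w|s /andP[s0 _]]; first by rewrite lexx subr_ge0.
  rewrite (_ : [set w | _] = setT); last by apply/seteqP; split => // w _ /=.
  exact: (@measurableT _ (g_sigma_algebraType (filtration_gen P X t (t + s)))).
have hp := mean_isP (int _ st); set k := fine _ in hp.
have gk : g x = k.
  apply: (mean_is_uniq (mean_is_cst P (g x))); apply: (mean_is_ae P_complete _ hp).
  apply: filterS X_x => w h; rewrite /payoff set_itv1 Rintegral_set1 oppr0 expR0 mul1r addr0.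
  by rewrite h.
rewrite gk -lee_fin vE; have [_ <-] := hp.
by apply: ereal_sup_ubound; exists (fun=> 0) => //; rewrite unlock.
Qed.

(* X t x is the solution started from x at time t; v, b and X are only
   constrained on the domains on which they are meaningful. *)
Theorem proposition2p7 (d : measure_display) (Omega : measurableType d)
    (R : realType) (P : probability Omega R) (B : R -> Omega -> R)
    (T : R) (I : set R) (mu sigma g r : R -> R)
    (X : R -> R -> R -> Omega -> R) (v : R -> R -> R) (b : R -> R)
    (P_complete : measure_is_complete P)
    (B_brownian : brownian_motion P B)
    (T_gt0 : 0 < T)
    (I_open : open I) (I_itv : is_interval I)
    (sigma_gt0 : forall x, I x -> 0 < sigma x)
    (g_cont : continuous g)
    (r_cont : continuous r) (r_ge0 : forall x, 0 <= r x)
    (X_sol : forall t x : R, 0 <= t <= T -> I x ->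
       unique_strong_solution P B I mu sigma T t x (X t x))
    (payoff_integrable : forall (t x : R) (tau : Omega -> R), 0 <= t <= T -> I x ->
       stopping_time P (X t x) T t tau ->
       P.-integrable [set: Omega] (EFin \o payoff g r (X t x) t tau))
    (v_value : forall t x : R, 0 <= t <= T -> I x ->
       (v t x)%:E = value P g r T t (X t x))
    (v_cont : {within `[0, T] `*` I, continuous (fun p : R * R => v p.1 p.2)})
    (b_in : forall t : R, 0 <= t <= T -> I (b t))
    (b_cont : {within `[0, T], continuous b})
    (tau_star_optimal : forall t x : R, 0 <= t <= T -> I x ->
       optimal P g r T t (X t x) (tau_star b (X t x) T t))
    (continuation_set : forall t x : R, 0 <= t < T -> I x ->
       g x < v t x <-> b t < x)
    (assumpA : assumption_A T I mu sigma g r b v) :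
  forall T1 : R, 0 <= T1 < T -> [lipschitz b t | t in `[0, T1]].
Proof.
move=> T1 /andP[T10 T1T].
have [mcl mmu msigma] : [/\ measurable (closure I), measurable_fun (closure I) mu & measurable_fun (closure I) sigma].
  apply: (borel_coefficients P_complete B_brownian I_itv sigma_gt0 (X := X 0) T_gt0) => x Ix.
  by have [] := @X_sol 0 x (ltac:(by rewrite lexx ltW)) Ix.
have le t : 0 <= t < T -> 0 <= t <= T by move=> /andP[-> /ltW].
have v_ge t x : 0 <= t < T -> I x -> g x <= v t x.
  move=> tT Ix; have [sol _] := X_sol t x (le t tT) Ix; have [t0 tT'] := andP (le t tT).
  by apply: (stop_now_le_value P_complete tT' sol _ (v_value t x (le t tT) Ix)) => tau; apply: payoff_integrable; rewrite ?t0.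
have v_mono t s x : 0 <= t -> 0 <= s -> t + s <= T -> I x -> v (t + s) x <= v t x.
  exact: (value_nonincreasing P_complete B_brownian mcl mmu msigma g_cont r_cont X_sol payoff_integrable v_value b_cont tau_star_optimal).
have loc tb : 0 <= tb <= T1 -> exists2 L, 0 <= L & exists2 del, 0 < del &
     forall t1 s, 0 <= t1 -> `|t1 - tb| < del -> 0 < s < del -> b (t1 + s) <= b t1 + L * s.
  move=> /andP[tb0 tbT1].
  apply: (boundary_locally_lipschitz I_open g_cont r_cont r_ge0 v_cont b_in b_cont continuation_set assumpA v_ge v_mono).
  - move=> t x m a p t0 tT Ix cmu csg; apply: (superharmonic P_complete B_brownian I_open mcl mmu msigma
      g_cont r_cont r_ge0 X_sol payoff_integrable v_value v_cont b_cont tau_star_optimal) => //.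
  - move=> t x m a p t0 tT Ix cmu csg; apply: (subharmonic P_complete B_brownian I_open mcl mmu msigma
      g_cont r_cont r_ge0 X_sol payoff_integrable v_value v_cont b_cont tau_star_optimal) => //.
  - by rewrite tb0 (le_lt_trans tbT1).
have [L L0 hL] := increments_le_of_local T10 loc.
(* If [b t' < b t], the point [b t] would be in the continuation set at time [t'], hence, since [v]
   is nonincreasing, also at time [t]. *)
have mono t t' : 0 <= t -> t <= t' -> t' <= T1 -> b t <= b t'.
  move=> t0 tt t'T; have t'0 : 0 <= t' by exact: le_trans tt.
  have tT : 0 <= t < T by rewrite t0 (le_lt_trans tt)// (le_lt_trans t'T).
  have t'T' : 0 <= t' < T by rewrite t'0 (le_lt_trans t'T).
  have Ib := b_in t (le t tT).
  rewrite leNgt; apply/negP => /(continuation_set t' (b t) t'T' Ib) lt.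
  have := v_mono t (t' - t) (b t) t0; rewrite subrKC subr_ge0 => /(_ tt (ltW (andP t'T').2) Ib) vle.
  by have := lt_le_trans lt vle => /(continuation_set t (b t) tT Ib); rewrite ltxx.
have bound t t' : 0 <= t -> t <= t' -> t' <= T1 -> `|b t' - b t| <= L * `|t' - t|.
  move=> t0 tt t'T; rewrite !ger0_norm ?subr_ge0//; last exact: mono.
  by rewrite lerBlDl; exact: hL.
(* The Lipschitz predicate asks for the estimate with all sufficiently large constants; every
   constant above [L] qualifies. *)
exists L; split; first exact: num_real.
move=> M LM [t t'] [/= + +]; rewrite !in_itv/= => /andP[t0 tT] /andP[t'0 t'T].
apply: (@le_trans _ _ (L * `|t - t'|)); last by rewrite ler_wpM2r// ltW.
have [tt|/ltW tt] := leP t t'; last exact: bound.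
by rewrite distrC (distrC t); exact: bound.
Qed.
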